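(* Let $(T_1,T_2)$ be a cyclic commuting pair of analytic $2$-isometries on a complex Hilbert space $\mathcal H$, with a unit cyclic vector $x_0\in\ker T_1^*\cap\ker T_2^*$. Then $(T_1,T_2)$ on $\mathcal H$ is unitarily equivalent to $(M_{z_1},M_{z_2})$ on $\mathcal D^2(\boldsymbol\mu)$ for some $\boldsymbol\mu\in\mathcal{PM}_+(\mathbb T^2)$ if and only if $L_1T_2=T_2L_1$, $L_2T_1=T_1L_2$, and for all integers $m,n\ge1$, $$\langle T_1^mT_2^nx_0,\,T_1T_2x_0\rangle=\langle T_1^mx_0,T_1x_0\rangle\,\langle T_2^nx_0,T_2x_0\rangle,$$ $$\langle T_1^mT_2x_0,\,T_1T_2^nx_0\rangle=\langle T_1^mx_0,T_1x_0\rangle\,\langle T_2x_0,T_2^nx_0\rangle.$$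
   Context: Operators are bounded and linear. $T$ is a $2$-isometry if $\|T^2h\|^2-2\|Th\|^2+\|h\|^2=0$ for all $h\in\mathcal H$; it is analytic if $\bigcap_{k\ge0}T^k\mathcal H=\{0\}$. The pair $(T_1,T_2)$ is cyclic with cyclic vector $x_0$ if $\mathcal H=\overline{\mathrm{span}}\{T_1^{k_1}T_2^{k_2}x_0:k_1,k_2\ge0\}$. $L_i:=(T_i^*T_i)^{-1}T_i^*$ (a $2$-isometry is left invertible). Two pairs are unitarily equivalent if a single unitary intertwines both coordinates. $\mathcal M_+(\mathbb T)$ is the set of finite positive Borel measures on the unit circle $\mathbb T$ (parametrized by $t\in[0,2\pi)$); $\mathcal{PM}_+(\mathbb T^2)$ is the set of measures $\boldsymbol\mu=\mu_1\times\mu_2$ on $\mathbb T^2$ with $\mu_1,\mu_2\in\mathcal M_+(\mathbb T)$. For $\nu\in\mathcal M_+(\mathbb T)$, $P_\nu(z)=\frac1{2\pi}\int_0^{2\pi}\frac{1-|z|^2}{|e^{it}-z|^2}\,d\nu(t)$, $z\in\mathbb D$. $dA$ is normalized area measure on $\mathbb D$. For $f$ holomorphic on $\mathbb D^2$ put $D^{(2)}_{\boldsymbol\mu,1}(f)=\lim_{r\to1^-}\frac1{2\pi}\int_{\mathbb D}\int_0^{2\pi}|\partial_1f(z_1,re^{it})|^2P_{\mu_1}(z_1)\,dt\,dA(z_1)$, $D^{(2)}_{\boldsymbol\mu,2}(f)=\lim_{r\to1^-}\frac1{2\pi}\int_{\mathbb D}\int_0^{2\pi}|\partial_2f(re^{it},z_2)|^2P_{\mu_2}(z_2)\,dt\,dA(z_2)$,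 $D^{(2)}_{\boldsymbol\mu,3}(f)=\int_{\mathbb D}\int_{\mathbb D}|\partial_1\partial_2f(z_1,z_2)|^2P_{\mu_1}(z_1)P_{\mu_2}(z_2)\,dA(z_1)dA(z_2)$, and $D^{(2)}_{\boldsymbol\mu}(f)=\sum_{j=1}^3D^{(2)}_{\boldsymbol\mu,j}(f)$. For non-zero $\boldsymbol\mu$, $\mathcal D^2(\boldsymbol\mu)$ is the set of holomorphic $f$ on $\mathbb D^2$ with $D^{(2)}_{\boldsymbol\mu}(f)<\infty$ (such $f$ lie in the Hardy space $H^2(\mathbb D^2)$); for $\boldsymbol\mu=0$, $\mathcal D^2(\boldsymbol\mu)=H^2(\mathbb D^2)$. The norm is given by $\|f\|_{\boldsymbol\mu}^2=\|f\|^2_{H^2(\mathbb D^2)}+D^{(2)}_{\boldsymbol\mu}(f)$. $M_{z_i}$ is multiplication by the coordinate function $z_i$ on $\mathcal D^2(\boldsymbol\mu)$.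
   Formalization: μ is given by its pair of factors (μ1, μ2); if exactly one factor is zero, D²(μ) means the f in H²(D²) with D_μ(f) finite, because taking D²(μ)=H²(D²) there (as μ1×μ2=0) would make the ''if'' direction false. *)

(* Defs.v *)
From HB Require Import structures.
From mathcomp Require Import all_boot all_order all_algebra.
From mathcomp Require Import all_classical all_reals all_analysis.
From mathcomp.real_closed Require Import complex.

Set Implicit Arguments.
Unset Strict Implicit.
Unset Printing Implicit Defensive.

Import Order.TTheory GRing.Theory Num.Theory.
Import numFieldNormedType.Exports.

Local Open Scope classical_set_scope.
Local Open Scope ring_scope.

Section Operators.
Variables (R : realType) (H : completeNormedModType R[i]).

(* [dot] is linear in its first argument; the last clause says that the norm
   of the Banach space [H] is the one induced by [dot]. *)
Definition hilbert_inner (dot : {dot H for Num.conj}) : Prop :=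
  forall x, dot x x = `|x| ^+ 2.

Definition bounded_op (T : H -> H) : Prop :=
  exists M : R[i], forall x, `|T x| <= M * `|x|.

(* The Hilbert adjoint: for bounded linear [T] the set below is a singleton by
   Riesz representation, so the default value 0 is never taken. *)
Definition adjoint (dot : {dot H for Num.conj}) (T : H -> H) : H -> H :=
  fun y => xget 0 [set z | forall x, dot (T x) y = dot x z].

Definition ker (T : H -> H) : set H := [set x | T x = 0].

(* (T^* T)^-1 T^*; [pinv] on the whole space is the two-sided inverse of a
   bijection. *)
Definition left_inv (dot : {dot H for Num.conj}) (T : H -> H) : H -> H :=
  'pinv_(fun=> 0) [set: H] (adjoint dot T \o T) \o adjoint dot T.

Definition two_isometry (T : H -> H) : Prop :=
  forall h, `|T (T h)| ^+ 2 - 2 * `|T h| ^+ 2 + `|h| ^+ 2 = 0.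

Definition analytic (T : H -> H) : Prop :=
  \bigcap_k range (iter k T) = [set 0].

Definition linear_span (S : set H) : set H :=
  [set x | exists n (c : 'I_n -> R[i]) (v : 'I_n -> H),
     (forall i, S (v i)) /\ x = \sum_(i < n) c i *: v i].

Definition cyclic_vector (T1 T2 : H -> H) (x0 : H) : Prop :=
  closure (linear_span
    [set iter k.1 T1 (iter k.2 T2 x0) | k in [set: nat * nat]]) = [set: H].

End Operators.

Section DirichletType.
Variable R : realType.
Local Notation C := R[i].

Definition modulus (z : C) : R := complex.Re `|z|.

(* r e^{it} *)
Definition polar (r t : R) : C := Complex (r * cos t) (r * sin t).

Definition bidisc : set (C * C) := [set z | `|z.1| < 1 /\ `|z.2| < 1].

(* Finite positive Borel measures on the unit circle, transported to [0, 2 pi)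
   along t |-> e^{it}. *)
Record circle_measure := CircleMeasure {
  circle_measure_val :> {finite_measure set (measurableTypeR R) -> \bar R} ;
  circle_measure_supp : circle_measure_val (~` `[0, 2 * pi[) = 0%E }.

Definition poisson (nu : circle_measure) (z : C) : \bar R :=
  (((2 * pi)^-1)%R%:E * \int[nu]_(t in `[0%R, (2 * pi)%R[)
     ((1 - modulus z ^+ 2) / modulus (polar 1 t - z) ^+ 2)%R%:E)%E.

Definition int_angle (g : R -> \bar R) : \bar R :=
  (\int[@lebesgue_measure R]_(t in `[0%R, (2 * pi)%R]) g t)%E.

(* integral over the unit disc against normalized area measure dA *)
Definition int_disc (g : C -> \bar R) : \bar R :=
  ((pi^-1)%R%:E *
   \int[(@lebesgue_measure R \x @lebesgue_measure R)]_(p in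
          [set p : R * R | (p.1 ^+ 2 + p.2 ^+ 2 < 1)%R])
     g (Complex p.1 p.2))%E.

(* Complex (Frechet) differentiability at every point of the bidisc; values of
   [f] outside the bidisc play no role. *)
Definition holomorphic_bidisc (f : C * C -> C) : Prop :=
  forall z, bidisc z -> differentiable (f : C^o * C^o -> C^o) (z : (C^o * C^o)%type).

Definition partial1 (f : C * C -> C) : C * C -> C :=
  fun z => derive1 (fun w : C => (f (w, z.2) : C^o)) z.1.

Definition partial2 (f : C * C -> C) : C * C -> C :=
  fun z => derive1 (fun w : C => (f (z.1, w) : C^o)) z.2.

(* Squared norm of the Hardy space H^2(D^2): supremum over 0 < r < 1 of the mean
   of |f|^2 on the torus of radius r; +oo if [f] is not in the space. *)
Definition hardy_normsq (f : C * C -> C) : \bar R :=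
  ereal_sup [set (((2 * pi) ^- 2)%R%:E * int_angle (fun s => int_angle (fun t =>
      (modulus (f (polar r s, polar r t)) ^+ 2)%R%:E)))%E
    | r in `]0%R, 1%R[].

Definition in_hardy (f : C * C -> C) : Prop :=
  holomorphic_bidisc f /\ (hardy_normsq f < +oo)%E.

Definition dirichlet1 (mu1 : circle_measure) (f : C * C -> C) : \bar R :=
  lim ((((2 * pi)^-1)%R%:E * int_disc (fun z1 => int_angle (fun t =>
      (modulus (partial1 f (z1, polar r t)) ^+ 2)%R%:E * poisson mu1 z1)))%E
    @[r --> (1 : R)^'-]).

Definition dirichlet2 (mu2 : circle_measure) (f : C * C -> C) : \bar R :=
  lim ((((2 * pi)^-1)%R%:E * int_disc (fun z2 => int_angle (fun t =>
      (modulus (partial2 f (polar r t, z2)) ^+ 2)%R%:E * poisson mu2 z2)))%E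
    @[r --> (1 : R)^'-]).

Definition dirichlet3 (mu1 mu2 : circle_measure) (f : C * C -> C) : \bar R :=
  int_disc (fun z2 => int_disc (fun z1 =>
    (modulus (partial1 (partial2 f) (z1, z2)) ^+ 2)%R%:E
      * poisson mu1 z1 * poisson mu2 z2)%E).

(* A product measure mu1 x mu2 is given by its two factors: the integrals
   depend on each factor, and the product determines these only up to
   reciprocal scalings (not at all if it vanishes). *)
Definition dirichlet (mu1 mu2 : circle_measure) (f : C * C -> C) : \bar R :=
  (dirichlet1 mu1 f + dirichlet2 mu2 f + dirichlet3 mu1 mu2 f)%E.

(* If mu1 x mu2 is non-zero, finiteness of the integral forces [f] into the
   Hardy space; if mu1 x mu2 = 0 it does not, and membership is required.
   For mu1 = mu2 = 0 the set is the Hardy space. *)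
Definition dirichlet_space (mu1 mu2 : circle_measure) : set (C * C -> C) :=
  [set f | [/\ holomorphic_bidisc f,
               (dirichlet mu1 mu2 f < +oo)%E
             & (mu1 \x mu2)%E [set: R * R] = 0%E -> in_hardy f]].

Definition dirichlet_normsq (mu1 mu2 : circle_measure) (f : C * C -> C)
  : \bar R := (hardy_normsq f + dirichlet mu1 mu2 f)%E.

(* A unitary from [H] onto the Dirichlet-type space (a surjective linear map
   preserving the norm, hence the inner product) that intertwines [T1], [T2]
   with multiplication by the coordinates.  Elements of the space are compared
   on the bidisc only. *)
Definition unitarily_equivalent_to_Mz (H : completeNormedModType R[i])
    (T1 T2 : H -> H) (mu1 mu2 : circle_measure) : Prop :=
  exists U : H -> C * C -> C,
    [/\ forall h, dirichlet_space mu1 mu2 (U h),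
        forall f, dirichlet_space mu1 mu2 f ->
          exists h, forall z, bidisc z -> U h z = f z,
        forall (a : C) h k z, bidisc z -> U (a *: h + k) z = a * U h z + U k z,
        forall h, dirichlet_normsq mu1 mu2 (U h) = (complex.Re (`|h| ^+ 2))%:E
      & forall h z, bidisc z ->
          U (T1 h) z = z.1 * U h z /\ U (T2 h) z = z.2 * U h z].

End DirichletType.

(* Main.v *)
(**
  Expand [f = sum a_mn z1^m z2^n].  The disc integrals against the Poisson kernel
  of [mu] turn the norm of the Dirichlet-type space into a sum over [k, l] of
  integrals of squares of finite partial sums of [a]; for polynomials, Abel
  summation collapses it to [sum a_mn (a_pq)^* G1(m,p) G2(n,q)], where
  [G_i(m,p) = delta_mp + min(m,p) mu_i^(m-p)] and [mu_i^] are the trigonometric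
  moments.  These are exactly the Gram matrices of the orbits of [x0] under a
  2-isometry: [<T^(m+1)x0, T^(p+1)x0> - <T^m x0, T^p x0>] is a positive semidefinite
  Toeplitz matrix, hence the moment matrix of a measure by Herglotz's theorem.

  If the pair is modelled on the space, the vector representing the constant [1]
  is orthogonal to both ranges, hence a unimodular multiple of [x0].  So the Gram
  matrix of the vectors [T1^m T2^n x0] is a product, which yields the two
  identities, and shows that [T2] preserves the closed span [ker T1^*] of the
  [T2^n x0], that is [L1 T2 = T2 L1].

  Conversely, the commutation relations make [T1^(m+1) T2^n x0] orthogonal to
  [T2^q x0], and a 2-isometric Gram matrix is affine along its diagonals, so it is
  determined by the entries with [min(m,p) <= 1] and [min(n,q) <= 1]; there it is
  the product by the two identities.  The model sends [h] to the power series with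
  coefficients [<L1^m L2^n h, x0>].  It is isometric on the orbit span, contractive
  by lower semicontinuity, and isometric by the parallelogram law.  It is onto
  because any [a] of finite norm agrees up to any order with polynomials of
  bounded norm, and a weak limit of their preimages has coefficients [a].
*)
From HB Require Import structures.
Require Import Defs.
From mathcomp Require Import all_boot all_order all_algebra.
From mathcomp Require Import all_classical all_reals all_analysis.
From mathcomp.real_closed Require Import complex.
From mathcomp Require Import measurable_realfun ring lra.
Import Order.TTheory GRing.Theory Num.Theory.
Import numFieldNormedType.Exports.
Local Open Scope classical_set_scope.
Local Open Scope ring_scope.
Set Implicit Arguments.
Unset Strict Implicit.
Unset Printing Implicit Defensive.

(** The one-variable norm is a sum of squares of linear functionals (coefficients, and partial sums
    of the derivative), and the norm in two variables is its tensor square; hence the product in the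
    Gram matrix. The partial sums come from [|f|^2 P = (1 - |z|^2) |f / (1 - e^(-it) z)|^2]: the
    division turns Taylor coefficients into partial sums, and an area integral with radial weight is
    diagonal in the coefficients.

    Two features of the space shape the argument. Its elements are arbitrary holomorphic functions,
    so their double power series is first derived from Goursat's lemma. And cutting off a series may
    enlarge its norm: the partial sum of order [n], once frozen, receives the weight of the whole
    tail, [n + 2] times its own. Because the harmonic series diverges, arbitrarily large orders
    exist at which this costs only a bounded factor. This is weaker than density of polynomials, but
    together with weak compactness in [H] it gives surjectivity. *)

Local Notation Re := complex.Re.
Local Notation Im := complex.Im.

(** * Complex numbers *)

Section ComplexModulus.
Variable R : realType.
Local Notation C := R[i].
Implicit Types z w : C.

Lemma modulusE z : (modulus z)%:C%C = `|z|.
Proof. by rewrite /modulus normc_def. Qed.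

Lemma modulus_def z : modulus z = Num.sqrt (Re z ^+ 2 + Im z ^+ 2).
Proof. by rewrite /modulus normc_def. Qed.

Lemma modulus_ge0 z : 0 <= modulus z.
Proof. by rewrite modulus_def sqrtr_ge0. Qed.

Lemma sqr_modulus z : modulus z ^+ 2 = Re z ^+ 2 + Im z ^+ 2.
Proof. by rewrite modulus_def sqr_sqrtr ?addr_ge0 ?sqr_ge0. Qed.

Lemma modulus0 : modulus (0 : C) = 0.
Proof. by rewrite modulus_def /= expr0n /= addr0 sqrtr0. Qed.

Lemma modulusM z w : modulus (z * w) = modulus z * modulus w.
Proof. by apply: (@complexI R); rewrite rmorphM /= !modulusE normrM. Qed.

Lemma modulusN z : modulus (- z) = modulus z.
Proof. by rewrite /modulus normrN. Qed.

Lemma modulusB z w : modulus (z - w) = modulus (w - z).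
Proof. by rewrite /modulus distrC. Qed.

Lemma modulusX z n : modulus (z ^+ n) = modulus z ^+ n.
Proof. by apply: (@complexI R); rewrite rmorphXn /= !modulusE normrX. Qed.

Lemma modulusV z : modulus z^-1 = (modulus z)^-1.
Proof. by apply: (@complexI R); rewrite fmorphV /= !modulusE normfV. Qed.

Lemma modulusJ z : modulus z^*%C = modulus z.
Proof. by rewrite /modulus normcJ. Qed.

Lemma modulus_real (x : R) : modulus x%:C%C = `|x|.
Proof. by rewrite modulus_def /= expr0n /= addr0 sqrtr_sqr. Qed.

Lemma modulus_nat n : modulus (n%:R : C) = n%:R.
Proof. by rewrite -[n%:R](rmorph_nat (real_complex R)) modulus_real normr_nat. Qed.

Lemma modulus1 : modulus (1 : C) = 1.
Proof. exact: (modulus_nat 1). Qed.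

Lemma ler_modulusD z w : modulus (z + w) <= modulus z + modulus w.
Proof. by rewrite -lecR rmorphD /= !modulusE ler_normD. Qed.

Lemma ler_modulusB z w : modulus (z - w) <= modulus z + modulus w.
Proof. by rewrite -[modulus w]modulusN ler_modulusD. Qed.

Lemma ler_modulus_sum (I : Type) (r : seq I) (P : pred I) (F : I -> C) :
  modulus (\sum_(i <- r | P i) F i) <= \sum_(i <- r | P i) modulus (F i).
Proof.
rewrite -lecR modulusE rmorph_sum /=.
by under [leRHS]eq_bigr do rewrite modulusE; exact: ler_norm_sum.
Qed.

Lemma modulus_eq0 z : (modulus z == 0) = (z == 0).
Proof. by rewrite -(inj_eq (@complexI R)) modulusE normr_eq0. Qed.

Lemma modulus_gt0 z : (0 < modulus z) = (z != 0).
Proof. by rewrite lt_def modulus_eq0 modulus_ge0 andbT. Qed.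

Lemma ler_Re_modulus z : `|Re z| <= modulus z.
Proof. by rewrite -lecR modulusE normc_ge_Re. Qed.

Lemma ler_Im_modulus z : `|Im z| <= modulus z.
Proof.
by rewrite modulus_def -sqrtr_sqr ler_wsqrtr // lerDr sqr_ge0.
Qed.

Lemma ler_modulus_ReIm z : modulus z <= `|Re z| + `|Im z|.
Proof.
rewrite -(@ler_pXn2r _ 2) ?nnegrE ?modulus_ge0 ?addr_ge0 //.
by rewrite sqr_modulus sqrrD !real_normK ?num_real // lerD2r lerDl mulrn_wge0 ?mulr_ge0.
Qed.

Lemma mulcJ z : z * z^*%C = (modulus z ^+ 2)%:C%C.
Proof. by rewrite -sqr_normc rmorphXn /= modulusE. Qed.

Lemma sqr_modulusE z : modulus z ^+ 2 = Re (z * z^*%C).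
Proof. by rewrite mulcJ. Qed.

Lemma ltc_modulus z (e : R) : (`|z| < e%:C%C) = (modulus z < e).
Proof. by rewrite -modulusE ltcR. Qed.

Lemma lec_modulus z (e : R) : (`|z| <= e%:C%C) = (modulus z <= e).
Proof. by rewrite -modulusE lecR. Qed.

Lemma gt0_complex z : 0 < z -> exists2 e : R, 0 < e & z = e%:C%C.
Proof.
rewrite ltcE /= => /andP[/eqP z0 z1]; exists (Re z) => //.
by apply/eqP; rewrite eq_complex /= z0 !eqxx.
Qed.

Lemma ReD z w : Re (z + w) = Re z + Re w. Proof. by case: z; case: w. Qed.
Lemma ImD z w : Im (z + w) = Im z + Im w. Proof. by case: z; case: w. Qed.
Lemma ReN z : Re (- z) = - Re z. Proof. by case: z. Qed.
Lemma ReB z w : Re (z - w) = Re z - Re w. Proof. by case: z; case: w. Qed.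
Lemma ImB z w : Im (z - w) = Im z - Im w. Proof. by case: z; case: w. Qed.
Lemma ReMc z w : Re (z * w) = Re z * Re w - Im z * Im w.
Proof. by case: z; case: w. Qed.
Lemma ImMc z w : Im (z * w) = Re z * Im w + Im z * Re w.
Proof. by case: z; case: w. Qed.
Lemma ReJ z : Re z^*%C = Re z. Proof. by case: z. Qed.
Lemma ImJ z : Im z^*%C = - Im z. Proof. by case: z. Qed.
Lemma conjcM z w : (z * w)^*%C = z^*%C * w^*%C.
Proof. exact: rmorphM. Qed.
Lemma conjcD z w : (z + w)^*%C = z^*%C + w^*%C.
Proof. exact: rmorphD. Qed.
Lemma conjc_sum (I : Type) (r : seq I) (P : pred I) (F : I -> C) :
  (\sum_(i <- r | P i) F i)^*%C = \sum_(i <- r | P i) (F i)^*%C.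
Proof. exact: rmorph_sum. Qed.
Lemma ReZ (x : R) z : Re (x%:C%C * z) = x * Re z.
Proof. by rewrite ReMc /= mul0r subr0. Qed.
Lemma ImZ (x : R) z : Im (x%:C%C * z) = x * Im z.
Proof. by rewrite ImMc /= mul0r addr0. Qed.

Lemma Re_sum (I : Type) (r : seq I) (P : pred I) (F : I -> C) :
  Re (\sum_(i <- r | P i) F i) = \sum_(i <- r | P i) Re (F i).
Proof. by apply: big_morph => //; exact: ReD. Qed.

Lemma Im_sum (I : Type) (r : seq I) (P : pred I) (F : I -> C) :
  Im (\sum_(i <- r | P i) F i) = \sum_(i <- r | P i) Im (F i).
Proof. by apply: big_morph => //; exact: ImD. Qed.

Lemma complex_eqP z w : Re z = Re w -> Im z = Im w -> z = w.
Proof. by move=> h k; apply/eqP; rewrite eq_complex h k !eqxx. Qed.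

Definition expi (t : R) : C := Complex (cos t) (sin t).

Lemma expiD s t : expi (s + t) = expi s * expi t.
Proof.
apply: complex_eqP; rewrite ?ReMc ?ImMc /= ?cosD ?sinD //.
by rewrite addrC; congr (_ + _); exact: mulrC.
Qed.

Lemma expi0 : expi 0 = 1.
Proof. by rewrite /expi cos0 sin0. Qed.

Lemma conj_expi t : (expi t)^*%C = expi (- t).
Proof. by rewrite /expi cosN sinN. Qed.

Lemma modulus_expi t : modulus (expi t) = 1.
Proof. by rewrite modulus_def /= cos2Dsin2 sqrtr1. Qed.

Lemma expi_neq0 t : expi t != 0.
Proof. by rewrite -modulus_eq0 modulus_expi oner_eq0. Qed.

Lemma expiX t n : expi t ^+ n = expi (n%:R * t).
Proof.
elim: n => [|n IH]; first by rewrite mul0r expi0.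
by rewrite exprS IH -expiD mulrSr mulrDl mul1r addrC.
Qed.

Lemma expiV t : (expi t)^-1 = expi (- t).
Proof.
apply: (mulfI (expi_neq0 t)).
by rewrite mulfV ?expi_neq0 // -expiD subrr expi0.
Qed.

Lemma expi2pi t : expi (t + 2 * pi) = expi t.
Proof. by rewrite /expi mulr_natl cosD2pi sinD2pi. Qed.

Lemma polarE r t : polar r t = r%:C%C * expi t.
Proof. by apply: complex_eqP; rewrite ?ReZ ?ImZ. Qed.

Lemma modulus_polar (r t : R) : 0 <= r -> modulus (polar r t) = r.
Proof.
by move=> r0; rewrite polarE modulusM modulus_expi mulr1 modulus_real ger0_norm.
Qed.

End ComplexModulus.

(** * Power series in one and two variables *)

Section GeometricConvergence.
Variable R : realType.
Local Notation C := R[i].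
Implicit Types (u v : nat -> C) (s t z w : C) (x y M K : R).

(* All series below converge geometrically, which makes interchanges of sums elementary. *)
Definition gconv u s := exists K x, [/\ 0 <= K, 0 <= x < 1 &
  forall n, modulus (s - \sum_(k < n) u k) <= K * x ^+ n].

Lemma geometric_le0 x K a : 0 <= x < 1 ->
  (forall n, a <= K * x ^+ n) -> a <= 0.
Proof.
move=> /andP[x0 x1] h.
have /cvgrPdist_le : (fun n => K * x ^+ n) @ \oo --> (0 : R).
  by apply: cvg_geometric; rewrite ger0_norm.
move=> c; apply/ler_addgt0Pl => e e0; rewrite addr0.
have [N _ /(_ N (leqnn N))] := c e e0; rewrite sub0r normrN => hN.
exact: le_trans (h N) (le_trans (ler_norm _) hN).
Qed.

Lemma geometric_le_add x K a b : 0 <= x < 1 ->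
  (forall n, a <= b + K * x ^+ n) -> a <= b.
Proof.
move=> x01 h; rewrite -subr_le0; apply: (geometric_le0 (K := K) x01) => n.
by rewrite lerBlDl.
Qed.

Lemma gconv_unique u s t : gconv u s -> gconv u t -> s = t.
Proof.
move=> [K [x [K0 /andP[x0 x1] h]]] [L [y [L0 /andP[y0 y1] k]]].
apply/eqP; rewrite -subr_eq0 -modulus_eq0 eq_le modulus_ge0 andbT.
have m01 : 0 <= Num.max x y < 1 by rewrite le_max x0 /= gt_max x1 y1.
apply: (geometric_le0 (K := K + L) m01) => n.
rewrite (_ : s - t = (s - \sum_(k < n) u k) - (t - \sum_(k < n) u k)); last first.
  by rewrite opprB addrA subrK.
apply: le_trans (ler_modulusB _ _) _; rewrite mulrDl lerD //.
  apply: le_trans (h n) _; rewrite ler_wpM2l // lerXn2r ?nnegrE ?le_max ?x0 ?lexx //.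
apply: le_trans (k n) _; rewrite ler_wpM2l // lerXn2r ?nnegrE ?le_max ?x0 ?y0 ?lexx ?orbT //.
Qed.

Lemma gconvD u v s t : gconv u s -> gconv v t ->
  gconv (fun k => u k + v k) (s + t).
Proof.
move=> [K [x [K0 /andP[x0 x1] h]]] [L [y [L0 /andP[y0 y1] k]]].
exists (K + L), (Num.max x y); split; first exact: addr_ge0.
  by rewrite le_max x0 /= gt_max x1 y1.
move=> n; rewrite big_split /= opprD addrACA.
apply: le_trans (ler_modulusD _ _) _; rewrite mulrDl lerD //.
  apply: le_trans (h n) _; rewrite ler_wpM2l // lerXn2r ?nnegrE ?le_max ?x0 ?lexx //.
apply: le_trans (k n) _; rewrite ler_wpM2l // lerXn2r ?nnegrE ?le_max ?x0 ?y0 ?lexx ?orbT //.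
Qed.

Lemma gconvZ (c : C) u s : gconv u s -> gconv (fun k => c * u k) (c * s).
Proof.
move=> [K [x [K0 x01 h]]]; exists (modulus c * K), x; split=> //.
  by rewrite mulr_ge0 ?modulus_ge0.
by move=> n; rewrite -mulr_sumr -mulrBr modulusM -mulrA ler_wpM2l ?modulus_ge0.
Qed.

Lemma gconvN u s : gconv u s -> gconv (fun k => - u k) (- s).
Proof.
move=> /(gconvZ (-1)); rewrite mulN1r.
by congr gconv; apply/funext => k; rewrite mulN1r.
Qed.

Lemma gconvB u v s t : gconv u s -> gconv v t ->
  gconv (fun k => u k - v k) (s - t).
Proof. by move=> hu /gconvN; exact: gconvD. Qed.

Lemma gconv_shift u s : gconv (fun k => u k.+1) s -> gconv u (u 0%N + s).
Proof.
move=> [K [x [K0 /andP[x0 x1] h]]].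
(* [x] may be 0, so the ratio is enlarged to a positive [y]: dividing the constant by [y] absorbs
   the index shift, and the extra summand covers the empty partial sum. *)
pose y := (1 + x) / 2; have xy : x <= y by rewrite /y; lra.
have y0 : 0 < y by rewrite /y; lra.
exists ((K + modulus (u 0%N + s)) / y), y; split.
- by rewrite divr_ge0 ?addr_ge0 ?modulus_ge0 // ltW.
- by rewrite /y; apply/andP; lra.
case=> [|n].
  rewrite big_ord0 subr0 expr0 mulr1 ler_pdivlMr //.
  apply: (@le_trans _ _ (modulus (u 0%N + s))); last by rewrite lerDr.
  by rewrite ler_piMr ?modulus_ge0 // /y; lra.
rewrite big_ord_recl /= opprD addrACA subrr add0r.
apply: le_trans (h n) _.
rewrite exprS mulrA divfK ?gt_eqF //.
apply: ler_pM => //; first exact: exprn_ge0.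
  by rewrite lerDl modulus_ge0.
by rewrite lerXn2r ?nnegrE // ltW.
Qed.

Lemma gconv_fin u N : (forall k, (N <= k)%N -> u k = 0) -> gconv u (\sum_(k < N) u k).
Proof.
elim: N u => [|N IH] u h.
  rewrite big_ord0; exists 0, 0; split; rewrite ?lexx ?ltr01 // => n.
  by rewrite big1 ?subr0 ?modulus0 ?mul0r // => k _; exact: h.
rewrite big_ord_recl /=; apply: gconv_shift; apply: IH => k Nk; exact: h.
Qed.

Lemma ler_sum_geometric x M u n m : 0 <= x < 1 -> 0 <= M ->
  (forall k, modulus (u k) <= M * x ^+ k) ->
  modulus (\sum_(n <= k < m) u k) <= M * x ^+ n / (1 - x).
Proof.
move=> /andP[x0 x1] M0 h.
apply: le_trans (ler_modulus_sum _ _ _) _.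
apply: (@le_trans _ _ (\sum_(n <= k < m) M * x ^+ k)).
  by apply: ler_sum => k _; exact: h.
rewrite -mulr_sumr -mulrA ler_wpM2l // ler_pdivlMr ?subr_gt0 //.
have [mn|/ltnW nm] := leqP m n.
  by rewrite big_geq // mul0r exprn_ge0.
have -> : (\sum_(n <= k < m) x ^+ k) * (1 - x) = x ^+ n - x ^+ m.
  rewrite mulr_suml (eq_big_nat _ _ (F2 := fun k => - (x ^+ k.+1 - x ^+ k))).
    by rewrite sumrN telescope_sumr // opprB.
  by move=> k _; rewrite exprS; ring.
by rewrite gerBl exprn_ge0.
Qed.

Lemma bound_ge0 x M u : (forall k, modulus (u k) <= M * x ^+ k) -> 0 <= M.
Proof. by move=> /(_ 0%N); rewrite expr0 mulr1; apply: le_trans; exact: modulus_ge0. Qed.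

(** The rate hidden in [gconv] is existential; a bound on the terms replaces it by an explicit one.
    Compare with a later partial sum and let its index grow. *)
Lemma gconv_tail x M u s n : 0 <= x < 1 -> gconv u s ->
  (forall k, modulus (u k) <= M * x ^+ k) ->
  modulus (s - \sum_(k < n) u k) <= M * x ^+ n / (1 - x).
Proof.
move=> x01 [K [y [K0 /andP[y0 y1] h]]] b; have M0 := bound_ge0 b.
have y01 : 0 <= y < 1 by rewrite y0.
apply: (geometric_le_add (K := K) y01) => m.
have [mn|/ltnW nm] := leqP m n.
  have ? : 0 <= M * x ^+ n / (1 - x).
    by case/andP: x01 => ? ?; rewrite divr_ge0 ?mulr_ge0 ?exprn_ge0 ?subr_ge0 // ltW.
  apply: (@le_trans _ _ (M * x ^+ n / (1 - x) + K * y ^+ n)); last first.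
    rewrite lerD2l ler_wpM2l //; apply: ler_wiXn2l => //; exact: ltW.
  by apply: le_trans (h n) _; rewrite lerDr.
rewrite (_ : s - _ = (s - \sum_(k < m) u k) + \sum_(n <= k < m) u k); last first.
  by rewrite -!(big_mkord xpredT u) (big_cat_nat (leq0n n) nm) /= opprD addrA subrK.
apply: le_trans (ler_modulusD _ _) _; rewrite addrC lerD //.
exact: ler_sum_geometric.
Qed.

Lemma gconv_le x M u s : 0 <= x < 1 -> gconv u s ->
  (forall k, modulus (u k) <= M * x ^+ k) -> modulus s <= M / (1 - x).
Proof.
move=> x01 us b; have := gconv_tail 0 x01 us b.
by rewrite big_ord0 subr0 expr0 mulr1.
Qed.

Lemma real_geometric_cvg x M (v : nat -> R) : 0 <= x < 1 ->
  (forall k, `|v k| <= M * x ^+ k) -> cvgn (series v).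
Proof.
move=> /andP[x0 x1] h; apply: normed_cvg.
apply: (@series_le_cvg _ _ (fun k => M * x ^+ k)) => //.
- by move=> k; exact: normr_ge0.
- by move=> k; exact: le_trans (normr_ge0 _) (h k).
- by apply: is_cvg_geometric_series; rewrite ger0_norm.
Qed.

Lemma real_geometric_tail x M (v : nat -> R) n : 0 <= x < 1 ->
  (forall k, `|v k| <= M * x ^+ k) ->
  `|limn (series v) - \sum_(k < n) v k| <= M * x ^+ n / (1 - x).
Proof.
move=> x01 h; have /cvgrPdist_le c := real_geometric_cvg x01 h.
have hb k : modulus (v k)%:C%C <= M * x ^+ k by rewrite modulus_real.
apply/ler_addgt0Pl => e e0.
have [N _ /(_ (maxn n N) (leq_maxr _ _))] := c e e0.
set L := limn _; rewrite /series /= => hN.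
rewrite (_ : L - _ = (L - \sum_(0 <= k < maxn n N) v k) + \sum_(n <= k < maxn n N) v k); last first.
  by rewrite -!(big_mkord xpredT v) (big_cat_nat (leq0n n) (leq_maxl n N)) /= opprD addrA subrK.
apply: le_trans (ler_normD _ _) _; apply: lerD => //.
have := ler_sum_geometric n (maxn n N) x01 (bound_ge0 hb) hb.
by rewrite -(rmorph_sum (real_complex R)) modulus_real.
Qed.

Lemma gconv_exists x M u : 0 <= x < 1 ->
  (forall k, modulus (u k) <= M * x ^+ k) -> exists s, gconv u s.
Proof.
move=> x01 h; have M0 := bound_ge0 h.
have hR k : `|Re (u k)| <= M * x ^+ k := le_trans (ler_Re_modulus _) (h k).
have hI k : `|Im (u k)| <= M * x ^+ k := le_trans (ler_Im_modulus _) (h k).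
exists (Complex (limn (series (fun k => Re (u k)))) (limn (series (fun k => Im (u k))))).
exists (2 * (M / (1 - x))), x; split=> //.
  by case/andP: x01 => ? ?; rewrite mulr_ge0 ?divr_ge0 // subr_ge0 ltW.
move=> n; apply: le_trans (ler_modulus_ReIm _) _.
rewrite ReB ImB Re_sum Im_sum /=.
have := real_geometric_tail n x01 hR; have := real_geometric_tail n x01 hI.
move=> h1 h2; apply: le_trans (lerD h2 h1) _.
by rewrite mulrAC -mulr2n -mulr_natl; lra.
Qed.

Definition csum u : C := xget 0 [set s | gconv u s].

Lemma gconv_csum u s : gconv u s -> csum u = s.
Proof.
move=> us; rewrite /csum; case: xgetP => [t -> /= ut|/(_ s)//].
exact: gconv_unique ut us.
Qed.

Global Opaque csum.

Lemma csumP x M u : 0 <= x < 1 ->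
  (forall k, modulus (u k) <= M * x ^+ k) -> gconv u (csum u).
Proof. by move=> x01 /(gconv_exists x01)[s us]; rewrite (gconv_csum us). Qed.

(** Both iterated sums are compared with the sum over the square of side [n]; by [gconv_tail] the
    tails of its rows and of its columns add up to [O(x ^+ n)]. *)
Lemma gconv_swap x M (u : nat -> nat -> C) (s t : nat -> C) S : 0 <= x < 1 ->
  (forall m n, modulus (u m n) <= M * x ^+ m * x ^+ n) ->
  (forall m, gconv (u m) (s m)) -> (forall n, gconv (u ^~ n) (t n)) ->
  gconv s S -> gconv t S.
Proof.
move=> x01 h us ut sS; have /andP[x0 x1] := x01.
have M0 : 0 <= M.
  by have := h 0%N 0%N; rewrite !expr0 !mulr1; apply: le_trans; exact: modulus_ge0.
have x'0 : 0 < 1 - x by rewrite subr_gt0.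
pose A := M / (1 - x).
have A0 : 0 <= A by rewrite divr_ge0 // ltW.
have hs m : modulus (s m) <= A * x ^+ m.
  by rewrite /A mulrAC; apply: gconv_le (us m) (h m).
have hst m n : modulus (s m - \sum_(k < n) u m k) <= A * x ^+ n * x ^+ m.
  have := gconv_tail n x01 (us m) (h m); rewrite /A; congr (_ <= _); ring.
have h' n m : modulus (u m n) <= M * x ^+ n * x ^+ m by rewrite mulrAC.
have htt m n : modulus (t n - \sum_(k < m) u k n) <= A * x ^+ m * x ^+ n.
  have := gconv_tail m x01 (ut n) (h' n); rewrite /A; congr (_ <= _); ring.
pose B := A / (1 - x).
have hg m : \sum_(k < m) A * x ^+ k <= B.
  have hA k : modulus (A * x ^+ k)%:C%C <= A * x ^+ k.
    by rewrite modulus_real ger0_norm // mulr_ge0 // exprn_ge0.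
  have := ler_sum_geometric 0 m x01 A0 hA.
  rewrite -(rmorph_sum (real_complex R)) modulus_real expr0 mulr1 big_mkord.
  exact: le_trans (ler_norm _).
exists (B + B + B), x; split=> //.
  by rewrite !addr_ge0 // divr_ge0 // ltW.
move=> n.
have e : \sum_(j < n) t j = \sum_(j < n) s j
   - \sum_(j < n) (s j - \sum_(k < n) u j k)
   + \sum_(j < n) (t j - \sum_(k < n) u k j).
  have ex : \sum_(j < n) \sum_(k < n) u j k = \sum_(j < n) \sum_(k < n) u k j.
    exact: exchange_big.
  by rewrite !sumrB ex; ring.
rewrite e.
rewrite (_ : S - _ = (S - \sum_(j < n) s j) + \sum_(j < n) (s j - \sum_(k < n) u j k)
   - \sum_(j < n) (t j - \sum_(k < n) u k j)); last by ring.
apply: le_trans (ler_modulusB _ _) _; rewrite mulrDl; apply: lerD; last first.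
  apply: le_trans (ler_modulus_sum _ _ _) _.
  apply: (@le_trans _ _ (\sum_(j < n) (A * x ^+ j) * x ^+ n)).
    by apply: ler_sum => j _; apply: le_trans (htt _ _) _; rewrite mulrAC.
  by rewrite -mulr_suml ler_wpM2r ?exprn_ge0.
apply: le_trans (ler_modulusD _ _) _; rewrite mulrDl; apply: lerD.
  by rewrite /B mulrAC; exact: gconv_tail.
apply: le_trans (ler_modulus_sum _ _ _) _.
apply: (@le_trans _ _ (\sum_(j < n) (A * x ^+ j) * x ^+ n)).
  by apply: ler_sum => j _; apply: le_trans (hst _ _) _; rewrite mulrAC.
by rewrite -mulr_suml ler_wpM2r ?exprn_ge0.
Qed.

(** Each of the [k.+1] summands of [1 + x + ... + x ^+ k] is at least [x ^+ k]. *)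
Lemma ler_natM_geometric x k : 0 <= x < 1 -> k.+1%:R * x ^+ k <= (1 - x)^-1.
Proof.
move=> x01; have /andP[x0 x1] := x01.
apply: (@le_trans _ _ (\sum_(j < k.+1) x ^+ j)).
  rewrite -[X in X%:R]card_ord -mulr_natl mulr_natl -sumr_const /=.
  rewrite mulr_suml; apply: ler_sum => j _; rewrite mul1r.
  by apply: ler_wiXn2l; rewrite ?(ltW x1) // -ltnS.
have hA j : modulus (1 * x ^+ j)%:C%C <= 1 * x ^+ j.
  by rewrite mul1r modulus_real ger0_norm // exprn_ge0.
have := ler_sum_geometric 0 k.+1 x01 ler01 hA.
rewrite -(rmorph_sum (real_complex R)) modulus_real expr0 mulr1 mul1r big_mkord.
apply: le_trans; rewrite ger0_norm ?sumr_ge0 // => [|j _]; last by rewrite mul1r exprn_ge0.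
by apply: ler_sum => j _; rewrite mul1r.
Qed.

Lemma ler_sqrM_geometric y : 0 <= y < 1 -> exists K x,
  [/\ 0 <= K, 0 <= x < 1 & forall k, k.+1%:R ^+ 2 * y ^+ k <= K * x ^+ k].
Proof.
(* With [r] the fourth root of [y], [(k + 1)^2 y^k = ((k + 1) r^k)^2 (r^2)^k]; the square is bounded
   by [ler_natM_geometric] and the ratio [r^2] is left. *)
move=> /andP[y0 y1]; pose r := Num.sqrt (Num.sqrt y).
have r4 : y = r ^+ 2 * r ^+ 2 by rewrite /r !sqr_sqrtr ?sqrtr_ge0 // -expr2 sqr_sqrtr.
have r01 : 0 <= r < 1.
  rewrite sqrtr_ge0 /= /r -[X in _ < X]sqrtr1 ltr_sqrt // -[X in _ < X]sqrtr1 ltr_sqrt //.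
have /andP[r0 r1] := r01.
exists ((1 - r)^-1 ^+ 2), (r ^+ 2); split; first exact: sqr_ge0.
  by rewrite sqr_ge0 /= expr_lt1.
move=> k; rewrite r4 exprMn mulrA ler_wpM2r ?exprn_ge0 //.
rewrite -exprM mulnC exprM -exprMn ler_pXn2r ?nnegrE ?mulr_ge0 ?exprn_ge0 ?invr_ge0 ?subr_ge0 //; last exact: ltW.
exact: ler_natM_geometric.
Qed.

End GeometricConvergence.

Section PowerSeries.
Variable R : realType.
Local Notation C := R[i].
Implicit Types (b : nat -> C) (z w : C) (r M : R).

Definition psum b z : C := csum (fun k => b k * z ^+ k).

(** Radius of convergence at least 1, in the form of Abel's lemma. *)
Definition pcoef b := forall r, 0 < r < 1 -> exists M, forall k, modulus (b k) * r ^+ k <= M.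

Definition pderiv b : nat -> C := fun k => k.+1%:R * b k.+1.

Lemma ler_term r M b z k : 0 < r -> modulus (b k) * r ^+ k <= M ->
  modulus (b k * z ^+ k) <= M * (modulus z / r) ^+ k.
Proof.
move=> r0 h; rewrite modulusM modulusX expr_div_n mulrA ler_pdivlMr ?exprn_gt0 //.
by rewrite mulrAC ler_wpM2r // exprn_ge0 // modulus_ge0.
Qed.

Lemma ratio01 r z : modulus z < r -> 0 <= modulus z / r < 1.
Proof.
move=> zr; have r0 : 0 < r := le_lt_trans (modulus_ge0 z) zr.
by rewrite divr_ge0 ?modulus_ge0 ?(ltW r0) //= ltr_pdivrMr // mul1r.
Qed.

Lemma gconv_psum_bound r M b z : (forall k, modulus (b k) * r ^+ k <= M) ->
  modulus z < r -> gconv (fun k => b k * z ^+ k) (psum b z).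
Proof.
move=> h zr; have r0 : 0 < r := le_lt_trans (modulus_ge0 z) zr.
by apply: csumP (ratio01 zr) _ => k; exact: ler_term (h k).
Qed.

Lemma ler_psum r M b z : (forall k, modulus (b k) * r ^+ k <= M) ->
  modulus z < r -> modulus (psum b z) <= M / (1 - modulus z / r).
Proof.
move=> h zr; have r0 : 0 < r := le_lt_trans (modulus_ge0 z) zr.
apply: gconv_le (ratio01 zr) (gconv_psum_bound h zr) _ => k.
exact: ler_term (h k).
Qed.

Lemma exists_between z : modulus z < 1 -> exists r, 0 < r < 1 /\ modulus z < r.
Proof.
move=> z1; exists ((1 + modulus z) / 2); have := modulus_ge0 z.
by split; [apply/andP|]; lra.
Qed.

Lemma gconv_psum b z : pcoef b -> modulus z < 1 ->
  gconv (fun k => b k * z ^+ k) (psum b z).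
Proof.
move=> hb /exists_between[r [r01 zr]]; have [M hM] := hb r r01.
exact: gconv_psum_bound hM zr.
Qed.

Lemma psumE b z s : gconv (fun k => b k * z ^+ k) s -> psum b z = s.
Proof. exact: gconv_csum. Qed.

Lemma psum_fin b z N : (forall k, (N <= k)%N -> b k = 0) ->
  psum b z = \sum_(k < N) b k * z ^+ k.
Proof.
move=> h; apply: psumE.
apply: (@gconv_fin _ (fun k => b k * z ^+ k)) => k Nk.
by rewrite h // mul0r.
Qed.

Lemma eq_psum b b' z : b =1 b' -> psum b z = psum b' z.
Proof. by move=> /funext ->. Qed.

Lemma pcoef_bounded b M : (forall k, modulus (b k) <= M) -> pcoef b.
Proof.
move=> h r /andP[r0 r1]; exists M => k; apply: le_trans (h k).
by rewrite ler_piMr ?modulus_ge0 // exprn_ile1 // ltW.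
Qed.

Lemma pcoefD b b' : pcoef b -> pcoef b' -> pcoef (fun k => b k + b' k).
Proof.
move=> h h' r r01; have [M hM] := h r r01; have [M' hM'] := h' r r01.
exists (M + M') => k; apply: le_trans (lerD (hM k) (hM' k)).
rewrite -mulrDl ler_wpM2r ?ler_modulusD // exprn_ge0 //.
by case/andP: r01 => /ltW.
Qed.

Lemma pcoefZ c b : pcoef b -> pcoef (fun k => c * b k).
Proof.
move=> h r r01; have [M hM] := h r r01; exists (modulus c * M) => k.
by rewrite modulusM -mulrA ler_wpM2l ?modulus_ge0.
Qed.

Lemma pcoef_fin b N : (forall k, (N <= k)%N -> b k = 0) -> pcoef b.
Proof.
move=> h; apply: (@pcoef_bounded _ (\sum_(k < N) modulus (b k))) => k.
have [Nk|kN] := leqP N k.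
  by rewrite h // modulus0 sumr_ge0 // => ? _; exact: modulus_ge0.
by rewrite (bigD1 (Ordinal kN)) //= lerDl sumr_ge0 // => ? _; exact: modulus_ge0.
Qed.

Lemma psumD b b' z : pcoef b -> pcoef b' -> modulus z < 1 ->
  psum (fun k => b k + b' k) z = psum b z + psum b' z.
Proof.
move=> h h' z1; apply: psumE.
have := gconvD (gconv_psum h z1) (gconv_psum h' z1).
by congr gconv; apply/funext => k; rewrite mulrDl.
Qed.

Lemma psumZ c b z : pcoef b -> modulus z < 1 ->
  psum (fun k => c * b k) z = c * psum b z.
Proof.
move=> h z1; apply: psumE; have := gconvZ c (gconv_psum h z1).
by congr gconv; apply/funext => k; rewrite mulrA.
Qed.

Definition pshift b : nat -> C := fun k => if k is k'.+1 then b k' else 0.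

Lemma psum_shift b z : pcoef b -> modulus z < 1 ->
  psum (pshift b) z = z * psum b z.
Proof.
move=> h z1; apply: psumE; have := gconvZ z (gconv_psum h z1).
move=> g; rewrite -[z * _]add0r -[X in X + _](mul0r (z ^+ 0)).
apply: (@gconv_shift _ (fun k => pshift b k * z ^+ k)).
by move: g; congr gconv; apply/funext => k; rewrite /= exprS mulrCA.
Qed.

Lemma pderiv_bound r M b : 0 < r -> (forall k, modulus (b k) * r ^+ k <= M) ->
  forall q, 0 < q < r -> forall k,
  modulus (pderiv b k) * q ^+ k <= M / r / (1 - q / r).
Proof.
move=> r0 h q /andP[q0 qr] k.
have M0 : 0 <= M.
  by apply: le_trans (h 0%N); rewrite mulr_ge0 ?modulus_ge0 // expr0.
rewrite /pderiv modulusM modulus_nat mulrAC.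
have -> : q ^+ k = (q / r) ^+ k * r ^+ k by rewrite -exprMn divfK ?gt_eqF.
have q01 : 0 <= q / r < 1.
  by rewrite divr_ge0 ?ltW //= ltr_pdivrMr // mul1r.
rewrite [X in X <= _](_ : _ = (modulus (b k.+1) * r ^+ k) * (k.+1%:R * (q / r) ^+ k)); last by ring.
apply: ler_pM.
- by rewrite mulr_ge0 ?modulus_ge0 // exprn_ge0 // ltW.
- by rewrite mulr_ge0 // exprn_ge0 //; case/andP: q01.
- by rewrite ler_pdivlMr // -mulrA -exprSr h.
- exact: ler_natM_geometric.
Qed.

Lemma pcoef_deriv b : pcoef b -> pcoef (pderiv b).
Proof.
move=> h q /andP[q0 q1]; pose r := (1 + q) / 2.
have r01 : 0 < r < 1 by rewrite /r; apply/andP; lra.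
have [M hM] := h r r01; case/andP: r01 => r0 r1.
have qr : 0 < q < r by rewrite q0 /= /r; lra.
by eexists => k; apply: pderiv_bound r0 hM _ qr k.
Qed.

Let err z w k : C := w ^+ k - z ^+ k - k%:R * z ^+ k.-1 * (w - z).

(** Induction on the recursion [err k.+1 = w * err k + k z^(k-1) (w - z)^2], with
    [k^2 + k <= (k + 1)^2]. The factor [r ^+ 2] on the left avoids the exponent [k - 2]. *)
Let err_bound z w r k : 0 < r -> modulus z <= r -> modulus w <= r ->
  modulus (err z w k) * r ^+ 2 <= k%:R ^+ 2 * r ^+ k * modulus (w - z) ^+ 2.
Proof.
move=> r0 zr wr; elim: k => [|k IH].
  by rewrite /err !expr0 subrr mul0r mul0r subrr modulus0 expr0n /= !mul0r.
have -> : err z w k.+1 = w * err z w k + k%:R * z ^+ k.-1 * (w - z) ^+ 2.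
  rewrite /err /= !exprS -[k.+1%:R]natr1.
  by case: k {IH} => [|k] /=; [rewrite !expr0|rewrite !exprS]; ring.
apply: le_trans (ler_wpM2r _ (ler_modulusD _ _)) _; first exact: sqr_ge0.
rewrite mulrDl.
have h1 : modulus (w * err z w k) * r ^+ 2 <= r * (k%:R ^+ 2 * r ^+ k * modulus (w - z) ^+ 2).
  rewrite modulusM -[X in X <= _]mulrA.
  exact: ler_pM (modulus_ge0 w) (mulr_ge0 (modulus_ge0 _) (sqr_ge0 r)) wr IH.
have h2 : modulus (k%:R * z ^+ k.-1 * (w - z) ^+ 2) * r ^+ 2 <= k%:R * r ^+ k.+1 * modulus (w - z) ^+ 2.
  rewrite !modulusM modulus_nat !modulusX mulrAC ler_wpM2r ?sqr_ge0 // -mulrA.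
  case: k {IH h1} => [|k] /=; first by rewrite !mul0r.
  rewrite ler_wpM2l // (_ : r ^+ k.+2 = r ^+ k * r ^+ 2); last by rewrite -exprD addn2.
  by rewrite ler_wpM2r ?sqr_ge0 // lerXn2r ?nnegrE ?modulus_ge0 // ltW.
apply: le_trans (lerD h1 h2) _.
rewrite [X in X <= _](_ : _ = (k%:R ^+ 2 + k%:R) * (r ^+ k.+1 * modulus (w - z) ^+ 2)); last by rewrite [r ^+ k.+1]exprS; ring.
rewrite -[X in _ <= X]mulrA ler_wpM2r ?mulr_ge0 ?exprn_ge0 ?modulus_ge0 ?(ltW r0) //.
rewrite -natr1; have : 0 <= k%:R :> R by []. nra.
Qed.

(** [K] depends on the radii only and the estimate is linear in [M], so that [psum2_increment] can
    use it uniformly in the other variable. *)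
Lemma psum_taylor q r : 0 < q < r -> exists2 K, 0 <= K & forall M b,
  (forall k, modulus (b k) * r ^+ k <= M) ->
  forall z w, modulus z <= q -> modulus w <= q ->
  modulus (psum b w - psum b z - psum (pderiv b) z * (w - z)) <=
    M * K * modulus (w - z) ^+ 2.
Proof.
move=> /andP[q0 qr]; have r0 := lt_trans q0 qr.
have q01 : 0 <= q / r < 1.
  by rewrite divr_ge0 ?ltW //= ltr_pdivrMr // mul1r.
have [K [x [K0 x01 hK]]] := ler_sqrM_geometric q01.
have x1 : 0 < 1 - x by rewrite subr_gt0; case/andP: x01.
exists (K / q ^+ 2 / (1 - x)).
  by rewrite !divr_ge0 // ?sqr_ge0 // ltW.
move=> M b h z w zq wq.
have M0 : 0 <= M.
  by apply: le_trans (h 0%N); rewrite mulr_ge0 ?modulus_ge0 // expr0.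
have zr := le_lt_trans zq qr; have wr := le_lt_trans wq qr.
have g : gconv (fun k => b k * err z w k)
    (psum b w - psum b z - psum (pderiv b) z * (w - z)).
  have g1 := gconvB (gconv_psum_bound h wr) (gconv_psum_bound h zr).
  pose p := (q + r) / 2.
  have pr : 0 < p < r by rewrite /p; apply/andP; lra.
  have zp : modulus z < p by apply: le_lt_trans zq _; rewrite /p; lra.
  have := gconv_psum_bound (pderiv_bound r0 h pr) zp.
  move=> /(gconvZ (w - z)) g2.
  have := @gconv_shift _ (fun k => (w - z) * (k%:R * b k * z ^+ k.-1)) _ g2.
  rewrite !mul0r mulr0 add0r => /(gconvB g1).
  rewrite [(w - z) * psum _ _]mulrC; congr gconv; apply/funext => k.
  by rewrite /err; ring.
have := gconv_le x01 g (M := M * K / q ^+ 2 * modulus (w - z) ^+ 2).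
rewrite (_ : _ / (1 - x) = M * (K / q ^+ 2 / (1 - x)) * modulus (w - z) ^+ 2); last by ring.
apply => k; rewrite modulusM.
have e := err_bound k q0 zq wq.
rewrite -ler_pdivlMr ?exprn_gt0 // in e.
apply: le_trans (ler_wpM2l (modulus_ge0 _) e) _.
rewrite [X in X <= _](_ : _ = modulus (b k) * (k%:R ^+ 2 * q ^+ k) * (modulus (w - z) ^+ 2 / q ^+ 2)); last by ring.
rewrite [X in _ <= X](_ : _ = M * (K * x ^+ k) * (modulus (w - z) ^+ 2 / q ^+ 2)); last by ring.
rewrite ler_wpM2r ?divr_ge0 ?sqr_ge0 //.
have -> : q ^+ k = r ^+ k * (q / r) ^+ k by rewrite -exprMn mulrCA divff ?gt_eqF // mulr1.
rewrite [X in X <= _](_ : _ = (modulus (b k) * r ^+ k) * (k%:R ^+ 2 * (q / r) ^+ k)); last by ring.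
apply: ler_pM => //.
- by rewrite mulr_ge0 ?modulus_ge0 // exprn_ge0 // ltW.
- by rewrite mulr_ge0 ?sqr_ge0 // exprn_ge0 //; case/andP: q01.
apply: le_trans (hK k); rewrite ler_wpM2r ?exprn_ge0 //; first by case/andP: q01.
by rewrite lerXn2r ?nnegrE // ler_nat.
Qed.

Lemma derive1_quadratic (f : C -> C) z (L : C) (K d : R) : 0 < d ->
  (forall w, modulus (w - z) < d ->
    modulus (f w - f z - L * (w - z)) <= K * modulus (w - z) ^+ 2) ->
  is_derive (z : C^o) (1 : C^o) (f : C^o -> C^o) L.
Proof.
move=> d0 h.
pose q (t : C) : C^o := t^-1 *: (((f : C^o -> C^o) \o shift z) (t *: (1 : C^o)) - f z).
have c : q @ (@dnbhs C^o 0) --> (L : C^o).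
  apply/cvgrPdist_lt => e' /gt0_complex[e e0 ->].
  have [N N0 KN] : exists2 N : R, 0 < N & K <= N by exists (`|K| + 1); [by rewrite ltr_wpDl|apply: le_trans (ler_norm _) _; rewrite lerDl].
  pose d' := Num.min d (e / N).
  have d'0 : 0 < d' by rewrite lt_min d0 divr_gt0.
  exists (d'%:C%C); first by rewrite /= ltcR.
  move=> t /=; rewrite sub0r normrN ltc_modulus lt_min => /andP[td te] t0.
  rewrite /q /= ltc_modulus.
  have t0' : 0 < modulus t by rewrite modulus_gt0.
  have -> : L - t^-1 *: (f (t%:A + z) - f z) = - (t^-1 * (f (t + z) - f z - L * t)).
    have -> : t%:A = t :> C^o by exact: mulr1.
    have alg (x y v : C) : v != 0 -> x - v^-1 * y = - (v^-1 * (y - x * v)) by move=> ?; field.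
    exact: alg.
  have := h (t + z); rewrite addrK => /(_ td) ht.
  rewrite modulusN modulusM modulusV mulrC ltr_pdivrMr //.
  apply: le_lt_trans ht _.
  rewrite expr2 mulrA ltr_pM2r //.
  apply: le_lt_trans (_ : N * modulus t < e); first by rewrite ler_wpM2r // ltW.
  by rewrite mulrC -ltr_pdivlMr.
split; first by apply/cvg_ex; exists L.
by apply/cvg_lim.
Qed.

Lemma is_derive_psum b z : pcoef b -> modulus z < 1 ->
  is_derive (z : C^o) (1 : C^o) (psum b : C^o -> C^o) (psum (pderiv b) z).
Proof.
move=> hb z1; have z0 := modulus_ge0 z.
pose q := (1 + modulus z) / 2; pose r := (1 + q) / 2.
have q01 : 0 < q < r by rewrite /q /r /q; apply/andP; lra.
have r01 : 0 < r < 1 by rewrite /q /r /q; apply/andP; lra.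
have [M hM] := hb r r01; have [K K0 hK] := psum_taylor q01.
apply: (@derive1_quadratic _ _ _ (M * K) (q - modulus z)).
  by rewrite /q; lra.
move=> w wz; apply: (hK _ _ hM); first by rewrite /q; lra.
have := ler_modulusD (w - z) z; rewrite subrK; lra.
Qed.

End PowerSeries.

Section DoublePowerSeries.
Variable R : realType.
Local Notation C := R[i].
Implicit Types (a : nat -> nat -> C) (z w : C).

Definition pcoef2 a := forall r, 0 < r < 1 ->
  exists M, forall m n, modulus (a m n) * r ^+ m * r ^+ n <= M.

Definition psum2 a (z : C * C) : C := psum (fun m => psum (a m) z.2) z.1.

Definition ptr a : nat -> nat -> C := fun m n => a n m.

Definition pderiv1 a : nat -> nat -> C := fun m n => m.+1%:R * a m.+1 n.
Definition pderiv2 a : nat -> nat -> C := fun m n => n.+1%:R * a m n.+1.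

Lemma pcoef2_tr a : pcoef2 a -> pcoef2 (ptr a).
Proof. by move=> h r /h[M hM]; exists M => m n; rewrite mulrAC; exact: hM. Qed.

Lemma pcoef2_bounded a (M : R) : (forall m n, modulus (a m n) <= M) -> pcoef2 a.
Proof.
move=> h r /andP[r0 r1]; exists M => m n; apply: le_trans (h m n).
rewrite -mulrA ler_piMr ?modulus_ge0 // mulr_ile1 ?exprn_ge0 ?exprn_ile1 //; exact: ltW.
Qed.

Lemma pcoef2_row a m : pcoef2 a -> pcoef (a m).
Proof.
move=> h r r01; have [M hM] := h r r01; exists (M / r ^+ m) => n.
case/andP: r01 => r0 r1.
by rewrite ler_pdivlMr ?exprn_gt0 // mulrAC.
Qed.

Lemma row_bound a r (M : R) m : 0 < r ->
  (forall m n, modulus (a m n) * r ^+ m * r ^+ n <= M) ->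
  forall n, modulus (a m n) * r ^+ n <= M / r ^+ m.
Proof.
by move=> r0 h n; rewrite ler_pdivlMr ?exprn_gt0 // mulrAC.
Qed.

Lemma rowsum_bound a r (M : R) z : 0 < r ->
  (forall m n, modulus (a m n) * r ^+ m * r ^+ n <= M) -> modulus z < r ->
  forall m, modulus (psum (a m) z) * r ^+ m <= M / (1 - modulus z / r).
Proof.
move=> r0 h zr m; have := ler_psum (row_bound m r0 h) zr.
have z1 : 0 < 1 - modulus z / r by rewrite subr_gt0; have /andP[] := ratio01 zr.
rewrite -ler_pdivlMr ?exprn_gt0 // => /le_trans; apply.
by rewrite mulrAC.
Qed.

Lemma exists_radius (x : R) z : x < 1 -> modulus z < 1 ->
  exists r, [/\ 0 < r, r < 1, x < r & modulus z < r].
Proof.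
move=> x1 z1; exists ((1 + Num.max x (modulus z)) / 2).
have : Num.max x (modulus z) < 1 by rewrite gt_max x1.
have : x <= Num.max x (modulus z) by rewrite le_max lexx.
have : modulus z <= Num.max x (modulus z) by rewrite le_max lexx orbT.
by have := modulus_ge0 z; split; lra.
Qed.

Lemma pcoef2_rowsum a z : pcoef2 a -> modulus z < 1 ->
  pcoef (fun m => psum (a m) z).
Proof.
move=> h z1 r /andP[r0 r1]; have [q [q0 q1 rq zq]] := exists_radius r1 z1.
have q01 : 0 < q < 1 by rewrite q0.
have [M hM] := h q q01; exists (M / (1 - modulus z / q)) => m.
apply: le_trans (rowsum_bound q0 hM zq m).
by rewrite ler_wpM2l ?modulus_ge0 // lerXn2r ?nnegrE // ltW.
Qed.

Lemma psum2_swap a (z : C * C) : pcoef2 a -> modulus z.1 < 1 -> modulus z.2 < 1 ->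
  psum2 a z = psum2 (ptr a) (z.2, z.1).
Proof.
case: z => z w /= h z1 w1.
have [r [r0 r1 zr wr]] := exists_radius z1 w1.
have r01 : 0 < r < 1 by rewrite r0.
have [M hM] := h r r01.
have x01 : 0 <= Num.max (modulus z / r) (modulus w / r) < 1.
  have /andP[a1 a2] := ratio01 zr; have /andP[a3 a4] := ratio01 wr.
  by rewrite le_max a1 gt_max a2 a4.
apply/esym/psumE => /=.
apply: (@gconv_swap _ _ M (fun m n => a m n * z ^+ m * w ^+ n)
   (fun m => psum (a m) w * z ^+ m) _ _ x01).
- move=> m n; rewrite !modulusM !modulusX.
  apply: (@le_trans _ _ ((modulus (a m n) * r ^+ m * r ^+ n) * (modulus z / r) ^+ m * (modulus w / r) ^+ n)).
    rewrite !expr_div_n le_eqVlt; apply/orP; left; apply/eqP; field.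
    by rewrite !expf_neq0 ?gt_eqF.
  have M0 : 0 <= M by apply: le_trans (hM 0%N 0%N); rewrite !mulr1 modulus_ge0.
  have /andP[a1 a2] := ratio01 zr; have /andP[a3 a4] := ratio01 wr.
  apply: ler_pM; rewrite ?exprn_ge0 ?mulr_ge0 ?modulus_ge0 ?exprn_ge0 ?invr_ge0 ?(ltW r0) //.
    apply: ler_pM; rewrite ?exprn_ge0 ?mulr_ge0 ?modulus_ge0 ?exprn_ge0 ?invr_ge0 ?(ltW r0) //.
    by rewrite lerXn2r ?nnegrE // ?le_max ?a1 ?lexx.
  by rewrite lerXn2r ?nnegrE // ?le_max ?a1 ?a3 ?lexx ?orbT.
- move=> m; rewrite mulrC; have := gconvZ (z ^+ m) (gconv_psum (pcoef2_row m h) w1).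
  by congr gconv; apply/funext => n; rewrite mulrCA mulrA.
- move=> n; rewrite mulrC.
  have := gconvZ (w ^+ n) (gconv_psum (pcoef2_row n (pcoef2_tr h)) z1).
  by congr gconv; apply/funext => m; rewrite /ptr mulrC.
- exact: gconv_psum (pcoef2_rowsum h w1) z1.
Qed.

Lemma pcoef2_pderiv1 a : pcoef2 a -> pcoef2 (pderiv1 a).
Proof.
move=> h q /andP[q0 q1]; pose r := (1 + q) / 2.
have r01 : 0 < r < 1 by rewrite /r; apply/andP; lra.
have [M hM] := h r r01; case/andP: r01 => r0 r1.
have qr : 0 < q < r by rewrite q0 /= /r; lra.
have M0 : 0 <= M by apply: le_trans (hM 0%N 0%N); rewrite !mulr1 modulus_ge0.
exists (M / r / (1 - q / r)) => m n.
have hb k : modulus (a k n) * r ^+ k <= M / r ^+ n.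
  by rewrite ler_pdivlMr ?exprn_gt0.
have := pderiv_bound r0 hb qr m; rewrite /pderiv -/(pderiv1 a m n) => hq.
apply: le_trans (ler_wpM2r (exprn_ge0 _ (ltW q0)) hq) _.
rewrite [X in X <= _](_ : _ = M / r / (1 - q / r) * (q / r) ^+ n); last first.
  have alg (m' c q' r' : R) : m' / r' ^+ n / r' * c * q' ^+ n = m' / r' * c * (q' / r') ^+ n.
    by rewrite expr_div_n; set y := (r' ^+ n)^-1; ring.
  exact: alg.
have qr' : 0 <= q / r < 1 by rewrite divr_ge0 ?ltW //= ltr_pdivrMr // mul1r; case/andP: qr.
rewrite ler_piMr //; last by rewrite exprn_ile1 //; case/andP: qr' => // ? /ltW.
have q'0 : 0 <= 1 - q / r by rewrite subr_ge0 ltW //; case/andP: qr'.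
by rewrite divr_ge0 // divr_ge0 // ltW.
Qed.

Lemma pcoef2_pderiv2 a : pcoef2 a -> pcoef2 (pderiv2 a).
Proof. by move=> /pcoef2_tr/pcoef2_pderiv1/pcoef2_tr. Qed.

Lemma psum2_pderiv1 a z w : pcoef2 a -> modulus w < 1 ->
  psum (pderiv (fun m => psum (a m) w)) z = psum2 (pderiv1 a) (z, w).
Proof.
move=> h w1; congr psum; apply/funext => m; rewrite /pderiv /pderiv1.
by rewrite psumZ //; exact: pcoef2_row.
Qed.

Lemma is_derive_psum2_1 a z w : pcoef2 a -> modulus z < 1 -> modulus w < 1 ->
  is_derive (z : C^o) (1 : C^o) (fun x : C^o => psum2 a (x, w) : C^o) (psum2 (pderiv1 a) (z, w)).
Proof.
move=> h z1 w1; rewrite -psum2_pderiv1 //.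
exact: is_derive_psum (pcoef2_rowsum h w1) z1.
Qed.

Lemma near_disc (P : C -> Prop) z : modulus z < 1 ->
  (forall w, modulus w < 1 -> P w) -> \forall w \near (z : C^o), P w.
Proof.
move=> z1 h; exists ((1 - modulus z)%:C%C); first by rewrite /= ltcR subr_gt0.
move=> w /=; rewrite ltc_modulus modulusB => zw; apply: h.
by have := ler_modulusD (w - z) z; rewrite subrK; lra.
Qed.

Lemma bidiscE (z : C * C) : bidisc z <-> modulus z.1 < 1 /\ modulus z.2 < 1.
Proof. by rewrite /bidisc /= -[1]/(1%:C%C) !ltc_modulus. Qed.

Lemma partial1_psum2 (f : C * C -> C) a (z : C * C) : pcoef2 a ->
  (forall x : C * C, bidisc x -> f x = psum2 a x) -> bidisc z ->
  partial1 f z = psum2 (pderiv1 a) z.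
Proof.
case: z => z w h fa /bidiscE[/= z1 w1].
rewrite /partial1 /= derive1E.
have [_ <-] := is_derive_psum2_1 h z1 w1.
apply: (@near_eq_derive _ C^o C^o); apply: near_disc => // x x1; apply: fa; exact/bidiscE.
Qed.

Lemma partial2_psum2 (f : C * C -> C) a (z : C * C) : pcoef2 a ->
  (forall x : C * C, bidisc x -> f x = psum2 a x) -> bidisc z ->
  partial2 f z = psum2 (pderiv2 a) z.
Proof.
case: z => z w h fa zw; have /bidiscE[/= z1 w1] := zw.
rewrite psum2_swap //; last exact: pcoef2_pderiv2.
rewrite -(@partial1_psum2 (fun z : C * C => f (z.2, z.1)) (ptr a)) //.
- exact: pcoef2_tr.
- move=> [x y] /bidiscE[/= x1 y1]; rewrite fa; last exact/bidiscE.
  exact: psum2_swap.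
- exact/bidiscE.
Qed.

Lemma psum2D a b (z : C * C) : pcoef2 a -> pcoef2 b -> bidisc z ->
  psum2 (fun m n => a m n + b m n) z = psum2 a z + psum2 b z.
Proof.
move=> ha hb /bidiscE[z1 z2]; rewrite /psum2 -psumD //; try exact: pcoef2_rowsum.
by apply: eq_psum => m; rewrite psumD //; exact: pcoef2_row.
Qed.

Lemma psum2Z c a (z : C * C) : pcoef2 a -> bidisc z ->
  psum2 (fun m n => c * a m n) z = c * psum2 a z.
Proof.
move=> ha /bidiscE[z1 z2]; rewrite /psum2 -psumZ //; last exact: pcoef2_rowsum.
by apply: eq_psum => m; rewrite psumZ //; exact: pcoef2_row.
Qed.

Lemma pcoef2D a b : pcoef2 a -> pcoef2 b -> pcoef2 (fun m n => a m n + b m n).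
Proof.
move=> h h' r r01; have [M hM] := h r r01; have [M' hM'] := h' r r01.
exists (M + M') => m n; apply: le_trans (lerD (hM m n) (hM' m n)).
have r0 : 0 <= r by case/andP: r01 => /ltW.
by rewrite -!mulrDl -!mulrA ler_wpM2r ?ler_modulusD // mulr_ge0 ?exprn_ge0.
Qed.

Lemma pcoef2Z c a : pcoef2 a -> pcoef2 (fun m n => c * a m n).
Proof.
move=> h r r01; have [M hM] := h r r01; exists (modulus c * M) => m n.
by rewrite modulusM -!mulrA ler_wpM2l ?modulus_ge0 // mulrA.
Qed.

Definition pshift1 a : nat -> nat -> C := fun m => if m is m'.+1 then a m' else fun=> 0.
Definition pshift2 a : nat -> nat -> C := fun m => pshift (a m).

Lemma psum2_shift1 a (z : C * C) : pcoef2 a -> bidisc z -> psum2 (pshift1 a) z = z.1 * psum2 a z.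
Proof.
move=> ha /bidiscE[z1 z2]; rewrite /psum2 -psum_shift //; last exact: pcoef2_rowsum.
by apply: eq_psum => -[|m] //=; rewrite (@psum_fin _ _ _ 0) // big_ord0.
Qed.

Lemma psum2_shift2 a (z : C * C) : pcoef2 a -> bidisc z -> psum2 (pshift2 a) z = z.2 * psum2 a z.
Proof.
move=> ha /bidiscE[z1 z2]; rewrite /psum2 -psumZ //; last exact: pcoef2_rowsum.
by apply: eq_psum => m; rewrite psum_shift //; exact: pcoef2_row.
Qed.

Lemma psum2_fin a (z : C * C) N : (forall m n, (N <= m)%N || (N <= n)%N -> a m n = 0) ->
  psum2 a z = \sum_(m < N) \sum_(n < N) a m n * z.2 ^+ n * z.1 ^+ m.
Proof.
move=> h; rewrite /psum2 (@psum_fin _ _ _ N) => [|m Nm].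
  by apply: eq_bigr => m _; rewrite (@psum_fin _ _ _ N) ?mulr_suml // => n Nn; rewrite h // Nn orbT.
by rewrite (@psum_fin _ _ _ 0) ?big_ord0 // => n _; rewrite h // Nm.
Qed.

Lemma psum_quadratic (b : nat -> C) q r (M : R) : 0 < q < r ->
  (forall k, modulus (b k) * r ^+ k <= M) ->
  exists2 K, 0 <= K & forall z w, modulus z <= q -> modulus w <= q ->
  modulus (psum b w - psum b z - psum (pderiv b) z * (w - z)) <= K * modulus (w - z) ^+ 2.
Proof.
move=> qr h; have [K K0 hK] := psum_taylor qr; exists (M * K); last exact: hK.
by rewrite mulr_ge0 //; apply: le_trans (h 0%N); rewrite mulr1 modulus_ge0.
Qed.

(** The increment is expanded in the first variable at the shifted second coordinate [w + k]; then
    its linear coefficient and the slice through [z] are expanded in the second variable. Only the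
    first expansion needs a bound that is uniform in [k]. *)
Lemma psum2_increment a z w : pcoef2 a -> modulus z < 1 -> modulus w < 1 ->
  exists A B K d, 0 < d /\ forall h k, modulus h < d -> modulus k < d ->
  modulus (psum2 a (z + h, w + k) - psum2 a (z, w) - (A * h + B * k)) <=
   K * Num.max (modulus h) (modulus k) ^+ 2.
Proof.
move=> ha z1 w1; have [q [q0 q1 zq wq]] := exists_radius z1 w1.
pose r := (1 + q) / 2; have r01 : 0 < r < 1 by rewrite /r; apply/andP; lra.
have qr : 0 < q < r by rewrite /r; apply/andP; lra.
have r0 : 0 < r by case/andP: r01.
have [M hM] := ha r r01.
have [K1 K10 hK1] := psum_taylor qr.
have hda := pcoef2_pderiv1 ha.
have hb1 : pcoef (fun n => psum (ptr (pderiv1 a) n) z).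
  exact: pcoef2_rowsum (pcoef2_tr hda) z1.
have [M2 hM2] := hb1 r r01.
have [K2 K20 hK2] := psum_quadratic qr hM2.
have hb2 : pcoef (fun n => psum (ptr a n) z).
  exact: pcoef2_rowsum (pcoef2_tr ha) z1.
have [M3 hM3] := hb2 r r01.
have [K3 K30 hK3] := psum_quadratic qr hM3.
pose G := psum (pderiv (fun n => psum (ptr (pderiv1 a) n) z)) w.
pose M' := M / (1 - q / r).
exists (psum2 (pderiv1 a) (z, w)), (psum (pderiv (fun n => psum (ptr a n) z)) w).
exists (M' * K1 + K2 + modulus G + K3), (Num.min 1 (Num.min (q - modulus z) (q - modulus w))).
split; first by rewrite !lt_min ltr01 !subr_gt0 zq.
move=> h k; rewrite !lt_min => /and3P[h1 hz hw] /and3P[k1 kz kw].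
have zhq : modulus (z + h) <= q by have := ler_modulusD z h; lra.
have wkq : modulus (w + k) <= q by have := ler_modulusD w k; lra.
have wk1 : modulus (w + k) < 1 by apply: le_lt_trans wkq q1.
have wkr : modulus (w + k) < r by apply: le_lt_trans wkq _; case/andP: qr.
have hM1 m : modulus (psum (a m) (w + k)) * r ^+ m <= M'.
  apply: le_trans (rowsum_bound r0 hM wkr m) _.
  have M0 : 0 <= M by apply: le_trans (hM 0%N 0%N); rewrite !mulr1 modulus_ge0.
  have x0 : 0 < 1 - q / r by rewrite subr_gt0 ltr_pdivrMr // mul1r; case/andP: qr.
  rewrite /M' ler_wpM2l // lef_pV2 ?posrE //; last first.
    by rewrite subr_gt0 ltr_pdivrMr // mul1r.
  by rewrite lerD2l lerN2 ler_wpM2r // invr_ge0 ltW.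
have ez : z + h - z = h by rewrite addrAC subrr add0r.
have ew : w + k - w = k by rewrite addrAC subrr add0r.
have e1 : modulus (psum2 a (z + h, w + k) - psum2 a (z, w + k) - psum2 (pderiv1 a) (z, w + k) * h)
    <= M' * K1 * modulus h ^+ 2.
  have := hK1 _ _ hM1 z (z + h) (ltW zq) zhq.
  by rewrite psum2_pderiv1 // ez.
have e2 : modulus (psum2 (pderiv1 a) (z, w + k) - psum2 (pderiv1 a) (z, w) - G * k)
    <= K2 * modulus k ^+ 2.
  have := hK2 w (w + k) (ltW wq) wkq.
  by rewrite ew !(@psum2_swap (pderiv1 a)).
have e3 : modulus (psum2 a (z, w + k) - psum2 a (z, w) - psum (pderiv (fun n => psum (ptr a n) z)) w * k)
    <= K3 * modulus k ^+ 2.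
  have := hK3 w (w + k) (ltW wq) wkq.
  by rewrite ew !(@psum2_swap a).
have M'0 : 0 <= M' by apply: le_trans (hM1 0%N); rewrite mulr1 modulus_ge0.
move: e1 e2 e3; move: (psum2 a _) (psum2 a (z, w + k)) (psum2 a (z, w)) (psum2 (pderiv1 a) (z, w + k)) (psum2 _ (z, w)).
move: (psum (pderiv _) w) G M'0 => X6 G M'0.
clear hK1 hK2 hK3 hM hM1 hM2 hM3 hda hb1 hb2 ha zhq wkq wk1 wkr ez ew.
move=> X1 X2 X5 X3 X4 e1 e2 e3.
have -> : X1 - X5 - (X4 * h + X6 * k) = (X1 - X2 - X3 * h) + (X3 - X4 - G * k) * h + G * k * h
    + (X2 - X5 - X6 * k) by ring.
set T := Num.max _ _.
have hT : modulus h <= T by rewrite le_max lexx.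
have kT : modulus k <= T by rewrite le_max lexx orbT.
have h0 := modulus_ge0 h; have k0 := modulus_ge0 k; have T0 : 0 <= T := le_trans h0 hT.
have hh : modulus h ^+ 2 <= T ^+ 2 by rewrite lerXn2r ?nnegrE.
have kk : modulus k ^+ 2 <= T ^+ 2 by rewrite lerXn2r ?nnegrE.
have hk : modulus k * modulus h <= T ^+ 2 by rewrite expr2; apply: ler_pM.
rewrite [X in _ <= X](_ : _ = M' * K1 * T ^+ 2 + K2 * T ^+ 2 + modulus G * T ^+ 2 + K3 * T ^+ 2); last by ring.
apply: le_trans (ler_modulusD _ _) _; apply: lerD; last first.
  by apply: le_trans e3 _; rewrite ler_wpM2l.
apply: le_trans (ler_modulusD _ _) _; apply: lerD; last first.
  by rewrite !modulusM -mulrA ler_wpM2l ?modulus_ge0.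
apply: le_trans (ler_modulusD _ _) _; apply: lerD.
  by apply: le_trans e1 _; rewrite ler_wpM2l // mulr_ge0.
rewrite modulusM; apply: le_trans (ler_wpM2r h0 e2) _; rewrite -mulrA ler_wpM2l //.
apply: le_trans kk; rewrite ler_piMr ?sqr_ge0 // ltW //.
Qed.

Lemma differentiable_psum2 a (f : C * C -> C) : pcoef2 a ->
  (forall x : C * C, bidisc x -> f x = psum2 a x) -> holomorphic_bidisc f.
Proof.
move=> ha fa [z w] zw; have /bidiscE[/= z1 w1] := zw.
have [A [B [K [d [d0 hd]]]]] := psum2_increment ha z1 w1.
pose L (h : C^o * C^o) : C^o := A * h.1 + B * h.2.
have linL : linear L.
  by move=> c x y; rewrite /L /= -[c *: (A * _ + _)]/(c * (_ + _)) -[c *: x.1]/(c * x.1) -[c *: x.2]/(c * x.2); ring.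
pose Lm := GRing.isLinear.Build _ _ _ _ _ linL.
pose Ll : {linear (C^o * C^o)%type -> C^o} := HB.pack L Lm.
have normE (x : C^o * C^o) : `|x| = (Num.max (modulus x.1) (modulus x.2))%:C%C.
  by rewrite prod_normE -!modulusE /Order.max ltcR; case: ifP.
have bnd (x : C^o * C^o) : `|L x| <= ((modulus A + modulus B)%:C%C) * `|x|.
  rewrite normE.
  rewrite -rmorphM /= -modulusE lecR /L.
  apply: le_trans (ler_modulusD _ _) _; rewrite !modulusM mulrDl.
  by apply: lerD; rewrite ler_wpM2l ?modulus_ge0 // le_max lexx ?orbT.
have cL : continuous Ll.
  apply/linear_bounded_continuous/linear_boundedP.
  exists ((modulus A + modulus B)%:C%C); split; first by rewrite complex_real.
  move=> r Mr x; apply: le_trans (bnd x) _.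
  by rewrite ler_wpM2r // ltW.
have e : ((f : C^o * C^o -> C^o) \o shift ((z, w) : C^o * C^o)) = cst (f (z, w)) + Ll +o_ (0 : C^o * C^o) id.
  apply/eqaddoP => e' /gt0_complex[e e0 ->].
  have [N N0 KN] : exists2 N : R, 0 < N & K <= N.
    by exists (`|K| + 1); [rewrite ltr_wpDl|apply: le_trans (ler_norm _) _; rewrite lerDl].
  have w1' : 0 < Num.min (Num.min d (e / N)) (Num.min (1 - modulus z) (1 - modulus w)).
    by rewrite !lt_min d0 divr_gt0 // !subr_gt0 z1.
  apply/(@nbhs_norm0P _ (C^o * C^o)%type); exists ((Num.min (Num.min d (e / N)) (Num.min (1 - modulus z) (1 - modulus w)))%:C%C).
    by rewrite /= ltcR.
  move=> [h k]; rewrite /= normE ltcR /=.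
  set t := Num.max _ _; rewrite !lt_min => /andP[/andP[td te] /andP[tz tw]].
  have ht : modulus h <= t by rewrite le_max lexx.
  have kt : modulus k <= t by rewrite le_max lexx orbT.
  have t0 : 0 <= t := le_trans (modulus_ge0 h) ht.
  rewrite -[(f \o _ - _) _]/(f ((h, k) + (z, w)) - (f (z, w) + (A * h + B * k))).
  rewrite -modulusE -rmorphM lecR /=.
  have -> : (h, k) + (z, w) = (z + h, w + k) by rewrite [z + h]addrC [w + k]addrC.
  rewrite !fa //; last first.
    apply/bidiscE; split => /=.
      by have := ler_modulusD z h; lra.
    by have := ler_modulusD w k; lra.
  rewrite opprD addrA.
  apply: le_trans (hd h k (le_lt_trans ht td) (le_lt_trans kt td)) _.
  rewrite -/t expr2 mulrA ler_wpM2r //.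
  apply: le_trans (ler_wpM2r t0 KN) _.
  by rewrite mulrC -ler_pdivlMr // ltW.
have du := diff_unique cL e.
by apply/diff_locallyP; rewrite du.
Qed.

End DoublePowerSeries.

(** * Riesz representation and left inverses *)

Section Hilbert.
Variables (R : realType) (H : completeNormedModType R[i]).
Variables (dot : {dot H for Num.conj}) (Hdot : hilbert_inner dot).
Local Notation C := R[i].
Implicit Types (x y z u v : H) (a b : C).

Definition nrm x : R := Re `|x|.

Lemma nrmE x : (nrm x)%:C%C = `|x|.
Proof. by rewrite /nrm RRe_real // ger0_real. Qed.

Lemma nrm_ge0 x : 0 <= nrm x.
Proof. by rewrite -ler0c nrmE. Qed.

Lemma nrm0 : nrm 0 = 0.
Proof. by rewrite /nrm normr0. Qed.

Lemma nrm_eq0 x : (nrm x == 0) = (x == 0).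
Proof. by rewrite -(inj_eq (@complexI R)) nrmE normr_eq0. Qed.

Lemma nrmZ a x : nrm (a *: x) = modulus a * nrm x.
Proof. by apply: (@complexI R); rewrite rmorphM /= !nrmE modulusE normrZ. Qed.

Lemma nrmN x : nrm (- x) = nrm x.
Proof. by rewrite /nrm normrN. Qed.

Lemma nrmD x y : nrm (x + y) <= nrm x + nrm y.
Proof. by rewrite -lecR rmorphD /= !nrmE ler_normD. Qed.

Lemma dotDl x y z : dot (x + y) z = dot x z + dot y z.
Proof. exact: linearDl. Qed.
Lemma dotDr x y z : dot x (y + z) = dot x y + dot x z.
Proof. exact: linearDr. Qed.
Lemma dotZl a x z : dot (a *: x) z = a * dot x z.
Proof. exact: linearZl_LR. Qed.
Lemma dotZr a x z : dot x (a *: z) = a^*%C * dot x z.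
Proof. exact: linearZr_LR. Qed.
Lemma dot0l z : dot 0 z = 0. Proof. exact: linear0l. Qed.
Lemma dot0r z : dot z 0 = 0. Proof. exact: linear0r. Qed.
Lemma dotNr x z : dot x (- z) = - dot x z. Proof. exact: linearNr. Qed.
Lemma dotBl x y z : dot (x - y) z = dot x z - dot y z.
Proof. exact: linearBl. Qed.
Lemma dotBr x y z : dot x (y - z) = dot x y - dot x z.
Proof. exact: linearBr. Qed.

Lemma dotC x y : dot x y = (dot y x)^*%C.
Proof. by have := hermC dot x y; rewrite expr0 mul1r. Qed.

Lemma dot_suml (I : Type) (r : seq I) (P : pred I) (F : I -> H) z :
  dot (\sum_(i <- r | P i) F i) z = \sum_(i <- r | P i) dot (F i) z.
Proof. by apply: (big_morph (fun x => dot x z)) => [x y|]; rewrite ?dotDl ?dot0l. Qed.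

Lemma dot_sumr (I : Type) (r : seq I) (P : pred I) (F : I -> H) z :
  dot z (\sum_(i <- r | P i) F i) = \sum_(i <- r | P i) dot z (F i).
Proof. by apply: (big_morph (fun x => dot z x)) => [x y|]; rewrite ?dotDr ?dot0r. Qed.

Lemma dotxx x : dot x x = (nrm x ^+ 2)%:C%C.
Proof. by rewrite Hdot rmorphXn /= nrmE. Qed.

Lemma sqr_nrm x : nrm x ^+ 2 = Re (dot x x).
Proof. by rewrite dotxx. Qed.

Lemma sqr_nrmD x y : nrm (x + y) ^+ 2 = nrm x ^+ 2 + nrm y ^+ 2 + 2 * Re (dot x y).
Proof.
rewrite !sqr_nrm dotDl !dotDr (dotC y x) !ReD ReJ; ring.
Qed.

Lemma dot_inj x y : (forall z, dot z x = dot z y) -> x = y.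
Proof.
move=> h; apply/eqP; rewrite -subr_eq0 -nrm_eq0 -sqrf_eq0 sqr_nrm.
by rewrite dotBr h subrr.
Qed.

Lemma CauchySchwarz_dot x y : modulus (dot x y) <= nrm x * nrm y.
Proof.
have [->|y0] := eqVneq y 0.
  by rewrite dot0r modulus0 mulr_ge0 ?nrm_ge0.
have ny : 0 < nrm y by rewrite lt_def nrm_eq0 y0 nrm_ge0.
rewrite -(@ler_pXn2r _ 2) ?nnegrE ?modulus_ge0 ?mulr_ge0 ?nrm_ge0 // exprMn.
pose t := (- (nrm y ^+ 2)^-1)%:C%C * dot x y.
have := sqr_ge0 (nrm (x + t *: y)).
rewrite sqr_nrmD nrmZ dotZr exprMn /t modulusM modulus_real.
rewrite conjcM conjc_real -mulrA [_^*%C * _]mulrC mulcJ ReZ /=.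
rewrite normrN ger0_norm ?invr_ge0 ?sqr_ge0 // exprMn => h.
rewrite -ler_pdivrMr ?exprn_gt0 //.
have e : (nrm y ^+ 2)^-1 ^+ 2 * modulus (dot x y) ^+ 2 * nrm y ^+ 2 = modulus (dot x y) ^+ 2 / nrm y ^+ 2.
  by field; rewrite gt_eqF.
lra.
Qed.

Lemma complete_nrm (u : nat -> H) :
  (forall e, 0 < e -> exists N, forall m n, (N <= m)%N -> (N <= n)%N -> nrm (u m - u n) <= e) ->
  exists l, forall e, 0 < e -> exists N, forall n, (N <= n)%N -> nrm (u n - l) <= e.
Proof.
move=> h.
have /cauchy_cvg c : cauchy (u @ \oo).
  apply/cauchyP => e' /gt0_complex[e e0 ->].
  have [N hN] := h (e / 2) (divr_gt0 e0 (ltr0Sn _ _)).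
  exists (u N); exists N => // n /= Nn.
  rewrite -ball_normE /= -nrmE ltcR.
  by apply: le_lt_trans (hN _ _ (leqnn N) Nn) _; lra.
exists (lim (u @ \oo)) => e e0.
have e0' : (0 : C) < e%:C%C by rewrite ltcR.
have /cvgrPdist_le/(_ _ e0')[N _ hN] := c.
by exists N => n Nn; rewrite -lecR nrmE distrC; exact: hN.
Qed.

Lemma closure_nrm (S : set H) x : closure S x -> forall e, 0 < e ->
  exists2 y, S y & nrm (x - y) <= e.
Proof.
move=> cx e e0; have e0' : (0 : C) < e%:C%C by rewrite ltcR.
have [y [Sy]] := cx _ (nbhsx_ballx x _ e0').
by rewrite -ball_normE /= -nrmE ltcR => /ltW ?; exists y.
Qed.

Lemma bounded_opP (T : H -> H) : bounded_op T ->
  exists2 M, 0 <= M & forall x, nrm (T x) <= M * nrm x.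
Proof.
move=> [M hM]; exists (modulus M); first exact: modulus_ge0.
move=> x.
rewrite -lecR rmorphM /= !nrmE modulusE.
have M0 : 0 <= M * `|x| := le_trans (normr_ge0 _) (hM x).
apply: le_trans (hM x) _; rewrite -[X in X <= _](ger0_norm M0) normrM normr_id.
exact: lexx.
Qed.

(* Minimising [|T u|^2 - 2 Re (phi u)]: with [T = id] this is the Riesz
   representation, with [phi k = dot (T k) h] the projection on the range. *)
Lemma energy_minimizer (T : {linear H -> H}) (B : R) (phi : H -> C) (M : R) :
  (forall x, nrm (T x) <= B * nrm x) -> (forall x, nrm x <= nrm (T x)) ->
  (forall x y, phi (x + y) = phi x + phi y) ->
  (forall a x, phi (a *: x) = a * phi x) ->
  (forall x, modulus (phi x) <= M * nrm (T x)) ->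
  exists u, forall k, phi k = dot (T k) (T u).
Proof.
move=> TB Tge phiD phiZ phiM.
have phiN x : phi (- x) = - phi x by rewrite -scaleN1r phiZ mulN1r.
pose J u := nrm (T u) ^+ 2 - 2 * Re (phi u).
have Jlb u : - M ^+ 2 <= J u.
  have := phiM u; have := ler_Re_modulus (phi u).
  rewrite /J ler_norml => /andP[_ h1] h2.
  have := sqr_ge0 (nrm (T u) - M); nra.
(* The parallelogram law for [T u] and [T v]. If [J u] and [J v] exceed the infimum by at most [p]
   and [q], the right-hand side is at most [2 (p + q)]; hence minimising sequences are Cauchy. *)
have Jpar u v : nrm (T (u - v)) ^+ 2 = 2 * J u + 2 * J v - 4 * J (2^-1 *: (u + v)).
  have e1 : T (u - v) = T u - T v by exact: linearB.
  have e2 : T (2^-1 *: (u + v)) = 2^-1 *: (T u + T v) by rewrite linearZ linearD.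
  rewrite /J e1 e2 nrmZ exprMn !sqr_nrmD nrmN dotNr ReN phiZ phiD.
  have -> : (2^-1 : C) = (2^-1 : R)%:C%C by rewrite fmorphV /= rmorph_nat.
  rewrite modulus_real ReZ ReD ger0_norm ?invr_ge0 //.
  by field.
pose S := [set J u | u in [set: H]].
have S0 : has_inf S.
  by split; [exists (J 0), 0|exists (- M ^+ 2) => _ [u _ <-]].
have Jge u : inf S <= J u by apply: ge_inf; [case: S0|exists u].
have /choice[w hw] : forall n : nat, exists u, J u <= inf S + n.+1%:R^-1.
  move=> n; have n0 : 0 < n.+1%:R^-1 :> R by rewrite invr_gt0.
  by have [_ [u _ <-] /ltW h] := inf_adherent n0 S0; exists u.
have wcauchy m n : nrm (w m - w n) ^+ 2 <= 2 * (m.+1%:R^-1 + n.+1%:R^-1).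
  apply: (@le_trans _ _ (nrm (T (w m - w n)) ^+ 2)).
    by rewrite lerXn2r ?nnegrE ?nrm_ge0.
  have lin (a b c i p q : R) : a <= i + p -> b <= i + q -> i <= c ->
    2 * a + 2 * b - 4 * c <= 2 * (p + q) by lra.
  by rewrite Jpar; exact: lin (hw m) (hw n) (Jge _).
have inv_small (e : R) : 0 < e -> exists N, forall n, (N <= n)%N -> n.+1%:R^-1 <= e.
  move=> e0; exists (Num.bound e^-1) => n Nn.
  rewrite -[e]invrK lef_pV2 ?posrE ?invr_gt0 //.
  apply: le_trans (ltW (archi_boundP _)) _; first by rewrite invr_ge0 ltW.
  by rewrite ler_nat; apply: leq_trans Nn _.
have hw' (e : R) : 0 < e -> exists N, forall n, (N <= n)%N -> J (w n) <= inf S + e.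
  move=> /inv_small[N hN]; exists N => n Nn.
  by apply: le_trans (hw n) _; rewrite lerD2l hN.
have [u hu] : exists l, forall e, 0 < e -> exists N, forall n, (N <= n)%N -> nrm (w n - l) <= e.
  apply: complete_nrm => e e0.
  have [N hN] := inv_small (e ^+ 2 / 4) (divr_gt0 (exprn_gt0 _ e0) (ltr0Sn _ _)).
  exists N => m n Nm Nn.
  rewrite -(@ler_pXn2r _ 2) ?nnegrE ?nrm_ge0 ?(ltW e0) //.
  apply: le_trans (wcauchy m n) _; move: (hN m Nm) (hN n Nn).
  by move: (m.+1%:R^-1) (n.+1%:R^-1) => a b; lra.
(* The sign of [B] is not assumed; a negative [B] forces all norms to vanish. *)
have B0 : 0 <= B \/ forall x, nrm x = 0.
  have [B0|Bn] := leP 0 B; [by left|right=> x].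
  have := TB x; have := nrm_ge0 (T x); have := nrm_ge0 x; nra.
have Ju : J u <= inf S.
  apply/ler_addgt0Pl => e e0.
  case: B0 => [B0|z0]; last first.
    have z x : x = 0 by apply/eqP; rewrite -nrm_eq0 z0.
    have [N hN] := hw' e e0.
    by rewrite (_ : u = w N) 1?addrC ?hN // (z u) (z (w N)).
  have M0 : 0 <= M * B \/ forall x, nrm (T x) = 0.
    have [M0|Mn] := leP 0 M; [by left; rewrite mulr_ge0|right=> x].
    have := phiM x; have := modulus_ge0 (phi x); have := nrm_ge0 (T x); nra.
  pose A := nrm (T u).
  have Jdiff x : J u <= J x + 2 * A * (B * nrm (x - u)) + 2 * (`|M| * (B * nrm (x - u))).
    have -> : J x = J u + nrm (T (x - u)) ^+ 2 + 2 * Re (dot (T u) (T (x - u))) - 2 * Re (phi (x - u)).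
      have e1 : nrm (T x) ^+ 2 = nrm (T u) ^+ 2 + nrm (T (x - u)) ^+ 2 + 2 * Re (dot (T u) (T (x - u))).
        by rewrite -sqr_nrmD -linearD [u + _]addrC subrK.
      have e2 : phi x = phi u + phi (x - u) by rewrite -phiD addrC subrK.
      rewrite /J e1 e2 ReD; ring.
    have := ler_Re_modulus (dot (T u) (T (x - u))).
    have := CauchySchwarz_dot (T u) (T (x - u)).
    have := ler_Re_modulus (phi (x - u)); have := phiM (x - u); have := TB (x - u).
    have := nrm_ge0 (T (x - u)); have := ler_norm M.
    rewrite !ler_norml -/A => a1 a2 a3 a4 /andP[a5 a6] a7 /andP[a8 a9].
    have A0 : 0 <= A := nrm_ge0 _.
    have b1 : A * nrm (T (x - u)) <= A * (B * nrm (x - u)) by rewrite ler_wpM2l.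
    have b2 : M * nrm (T (x - u)) <= `|M| * (B * nrm (x - u)).
      by apply: le_trans (ler_wpM2r a2 a1) _; rewrite ler_wpM2l.
    have := sqr_ge0 (nrm (T (x - u))); lra.
  pose K := 2 * A * B + 2 * `|M| * B + 1.
  have K0 : 0 < K.
    by rewrite /K ltr_wpDl // addr_ge0 // mulr_ge0 // mulr_ge0 // nrm_ge0.
  have [N hN] := hw' (e / 2) (divr_gt0 e0 (ltr0Sn _ _)).
  have [N' hN'] := hu (e / 2 / K) (divr_gt0 (divr_gt0 e0 (ltr0Sn _ _)) K0).
  have h1 := hN _ (leq_maxl N N'); have h2 := hN' _ (leq_maxr N N').
  have := Jdiff (w (maxn N N')).
  rewrite ler_pdivlMr // /K in h2.
  have := nrm_ge0 (w (maxn N N') - u); lra.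
(* First variation of [J] at its minimum, along real multiples of [k]. *)
have crit k : Re (dot (T k) (T u)) = Re (phi k).
  have key (t : R) : 0 <= 2 * t * (Re (dot (T u) (T k)) - Re (phi k)) + t ^+ 2 * nrm (T k) ^+ 2.
    have := le_trans Ju (Jge (u + t%:C%C *: k)).
    have eT : T (u + t%:C%C *: k) = T u + t%:C%C *: T k by rewrite linearD linearZ.
    rewrite /J eT sqr_nrmD nrmZ dotZr phiD phiZ exprMn ReD conjc_real !ReZ.
    rewrite modulus_real real_normK ?num_real //; lra.
  rewrite dotC ReJ; set d := Re (dot _ _) in key *; set p := Re _ in key *.
  apply/eqP; rewrite -subr_eq0; apply/negPn/negP => n0.
  (* One more than the coefficient of [t ^+ 2], which may vanish; at [t = - (d - p) / n2] the
     quadratic of [key] is still negative. *)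
  pose n2 := nrm (T k) ^+ 2 + 1.
  have n20 : 0 < n2 by rewrite ltr_wpDl // sqr_ge0.
  have := key (- (d - p) / n2).
  have -> : 2 * (- (d - p) / n2) * (d - p) + (- (d - p) / n2) ^+ 2 * nrm (T k) ^+ 2 =
     (d - p) ^+ 2 / n2 * (-1 - 1 / n2).
    have -> : nrm (T k) ^+ 2 = n2 - 1 by rewrite /n2 addrK.
    by field; rewrite gt_eqF.
  rewrite pmulr_rge0; last by rewrite divr_gt0 // exprn_even_gt0.
  have : 0 < 1 / n2 by rewrite divr_gt0.
  lra.
exists u => k; apply: complex_eqP; first by rewrite crit.
(* The direction ['i%C *: k] turns equality of real parts into equality of imaginary parts. *)
have := crit ('i%C *: k).
rewrite linearZ dotZl phiZ /= !ReMc /= !mul0r !sub0r !mul1r.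
by move/oppr_inj.
Qed.

Lemma riesz (phi : H -> C) (M : R) :
  (forall x y, phi (x + y) = phi x + phi y) ->
  (forall a x, phi (a *: x) = a * phi x) ->
  (forall x, modulus (phi x) <= M * nrm x) ->
  exists u, forall k, phi k = dot k u.
Proof.
move=> phiD phiZ phiM.
by apply: (@energy_minimizer (idfun : {linear H -> H}) 1 phi M) => // x; rewrite mul1r.
Qed.

Section Adjoint.
Variable T : {linear H -> H}.
Hypothesis Tb : bounded_op T.

Lemma adjointP x y : dot (T x) y = dot x (adjoint dot T y).
Proof.
rewrite /adjoint; case: xgetP => [z _ /= h|/(_ _)]; first exact: h.
have [M M0 hM] := bounded_opP Tb.
have [u hu] : exists u, forall k, dot (T k) y = dot k u.
  apply: (@riesz _ (M * nrm y)).
  - by move=> a b; rewrite linearD dotDl.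
  - by move=> a b; rewrite linearZ dotZl.
  - move=> a; apply: le_trans (CauchySchwarz_dot _ _) _.
    by rewrite mulrAC ler_wpM2r ?nrm_ge0.
by move=> /(_ u); case.
Qed.

Hypothesis Tge : forall x, nrm x <= nrm (T x).

Local Notation L := (left_inv dot T).

(** Injective because [T] does not decrease norms. A preimage of [y] is a vector [u] with
    [dot k y = dot (T k) (T u)] for all [k], which the energy minimiser provides. *)
Lemma adjoint_comp_bij : set_bij setT setT (adjoint dot T \o T).
Proof.
split=> //.
- move=> x y _ _ /= e; apply/eqP; rewrite -subr_eq0 -nrm_eq0 eq_le nrm_ge0 andbT.
  apply: le_trans (Tge _) _; rewrite le_eqVlt; apply/orP; left.
  rewrite -sqrf_eq0 sqr_nrm adjointP.
  have -> : adjoint dot T (T (x - y)) = 0.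
    by apply: dot_inj => z; rewrite -adjointP dot0r linearB dotBr !adjointP e subrr.
  by rewrite dot0r.
- move=> y _ /=.
  have [M M0 hM] := bounded_opP Tb.
  have [u hu] : exists u, forall k, dot k y = dot (T k) (T u).
    apply: (@energy_minimizer T M _ (nrm y)) => //.
    + by move=> a b; rewrite dotDl.
    + by move=> a b; rewrite dotZl.
    + move=> a; apply: le_trans (CauchySchwarz_dot _ _) _.
      by rewrite mulrC ler_wpM2l ?nrm_ge0.
  by exists u => //; apply: dot_inj => z; rewrite -adjointP -hu.
Qed.

(** [T (L h)] is the orthogonal projection of [h] on the range of [T]. All later facts about [L]
    follow from this property and [left_inv_unique]. *)
Lemma left_invP h k : dot (T k) (h - T (L h)) = 0.
Proof.
rewrite dotBr 2!adjointP.
have [_ _ sur] := adjoint_comp_bij.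
have e : adjoint dot T (T (L h)) = adjoint dot T h.
  apply: (@pinvK _ _ (fun=> 0) setT (adjoint dot T \o T)).
  by rewrite inE; have [k' _ <-] := sur (adjoint dot T h) I; exists k'.
by rewrite e subrr.
Qed.

Lemma left_inv_unique h u : (forall k, dot (T k) (h - T u) = 0) -> L h = u.
Proof.
move=> hu; apply/eqP; rewrite -subr_eq0 -nrm_eq0 eq_le nrm_ge0 andbT.
apply: le_trans (Tge _) _; rewrite le_eqVlt; apply/orP; left.
rewrite -sqrf_eq0 sqr_nrm linearB.
have -> : T (L h) - T u = (h - T u) - (h - T (L h)).
  by rewrite opprB [RHS]addrC addrA subrK.
rewrite -[X in dot X _](_ : T (L h - u) = _); last by rewrite linearB /= opprB [RHS]addrC addrA subrK.
by rewrite dotBr hu left_invP subrr.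
Qed.

End Adjoint.

End Hilbert.

(** * Cauchy coefficients of holomorphic functions *)

Section IntervalIntegral.
Variable R : realType.
Local Notation mu := (@lebesgue_measure R).
Implicit Types (f g : R -> R) (a b c e m : R).

Definition itvint a b f : R := \int[mu]_(t in `[a, b]) f t.

Definition citv a b f := {within `[a, b], continuous (f : R -> R^o)}.

Lemma citv_integrable a b f : citv a b f -> mu.-integrable `[a, b] (EFin \o f).
Proof. by move=> h; apply: continuous_compact_integrable => //; exact: segment_compact. Qed.

Lemma citv_sub a b c d f : a <= c -> d <= b -> citv a b f -> citv c d f.
Proof.
move=> ac db; apply: continuous_subspaceW => x /=; rewrite !in_itv /= => /andP[cx xd].
by rewrite (le_trans ac cx) (le_trans xd db).
Qed.

Lemma citvT f a b : continuous f -> citv a b f.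
Proof. by move=> cf; apply: continuous_subspaceT. Qed.

Lemma citvD a b f g : citv a b f -> citv a b g -> citv a b (fun t => f t + g t).
Proof. by move=> cf cg x; apply: cvgD; [exact: cf|exact: cg]. Qed.

Lemma citvB a b f g : citv a b f -> citv a b g -> citv a b (fun t => f t - g t).
Proof. by move=> cf cg x; apply: cvgB; [exact: cf|exact: cg]. Qed.

Lemma citvM a b f g : citv a b f -> citv a b g -> citv a b (fun t => f t * g t).
Proof. by move=> cf cg x; apply: cvgM; [exact: cf|exact: cg]. Qed.

Lemma citv_cst a b c : citv a b (fun=> c).
Proof. by move=> x; exact: cvg_cst. Qed.

Lemma itvint_cst a b c : a <= b -> itvint a b (fun=> c) = c * (b - a).
Proof.
move=> ab; rewrite /itvint Rintegral_cst //= lebesgue_measure_itv /= lte_fin.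
by case: ltgtP ab => //= -> _; rewrite subrr.
Qed.

Lemma itvintD a b f g : citv a b f -> citv a b g ->
  itvint a b (fun t => f t + g t) = itvint a b f + itvint a b g.
Proof. by move=> cf cg; rewrite /itvint RintegralD //; exact: citv_integrable. Qed.

Lemma itvintB a b f g : citv a b f -> citv a b g ->
  itvint a b (fun t => f t - g t) = itvint a b f - itvint a b g.
Proof. by move=> cf cg; rewrite /itvint RintegralB //; exact: citv_integrable. Qed.

Lemma itvintZ a b c f : citv a b f -> itvint a b (fun t => c * f t) = c * itvint a b f.
Proof. by move=> cf; rewrite /itvint RintegralZl //; exact: citv_integrable. Qed.

Lemma itvint_le a b f g : citv a b f -> citv a b g ->
  (forall t, a <= t <= b -> f t <= g t) -> itvint a b f <= itvint a b g.
Proof.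
by move=> cf cg h; apply: le_Rintegral => //; exact: citv_integrable.
Qed.

Lemma eq_itvint a b f g : (forall t, a <= t <= b -> f t = g t) -> itvint a b f = itvint a b g.
Proof.
by move=> h; apply: eq_Rintegral => t; rewrite inE /= in_itv /= => /h.
Qed.

Lemma itvint_split a b c f : a <= c -> c <= b -> citv a b f ->
  itvint a b f = itvint a c f + itvint c b f.
Proof.
move=> ac cb cf.
have := @Rintegral_itvB _ f (BLeft a) (BRight b) c (citv_integrable cf).
rewrite !bnd_simp => /(_ ac cb) e.
rewrite /itvint -(@Rintegral_itv_obnd_cbnd _ c) -?e; first by rewrite addrC subrK.
apply: integrableS (citv_integrable (citv_sub ac (lexx b) cf)) => //.
by apply: subset_itvr; rewrite bnd_simp.
Qed.

Lemma itvint_estimate a b f m e : a <= b -> citv a b f ->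
  (forall t, a <= t <= b -> `|f t - m| <= e) ->
  `|itvint a b f - m * (b - a)| <= e * (b - a).
Proof.
move=> ab cf h.
rewrite -!itvint_cst // -itvintB ?ler_norml //; last exact: citv_cst.
have cg : citv a b (fun t => f t - m) by apply: citvB => //; exact: citv_cst.
have -> : - itvint a b (fun=> e) = itvint a b (fun=> - e) by rewrite !itvint_cst // mulNr.
apply/andP; split; apply: itvint_le => //; try exact: citv_cst.
  by move=> t /h; rewrite ler_norml => /andP[].
by move=> t /h; rewrite ler_norml => /andP[].
Qed.

End IntervalIntegral.

(** * Goursat's lemma by bisection of rectangles *)

Section Goursat.
Variable R : realType.

Let half_itv (lo hi x L l : R) : lo <= x -> x + L <= hi -> 0 < l -> L = 2 * l ->
  [/\ x + l <= hi, lo <= x + l, x + l + l <= hi & x + l + l <= x + L] /\ x + l <= x + L /\ x <= x + l.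
Proof. by move=> h1 h2 h3 h4; split; [split|split]; lra. Qed.

Let quarter (n n1 n2 n3 n4 : R) : n <= n1 + n2 + n3 + n4 ->
  n1 < n / 4 -> n2 < n / 4 -> n3 < n / 4 -> n / 4 <= n4.
Proof. lra. Qed.

Let dist_in (x z t L : R) : x <= z <= x + L -> x <= t <= x + L -> `|t - z| <= L.
Proof. by move=> /andP[h1 h2] /andP[h3 h4]; rewrite ler_norml; apply/andP; split; lra. Qed.

Let diff_bound (f1 f2 z A B y0 x1 x2 D : R) : `|f2 - z - (A * x2 + B * y0)| <= D ->
  `|f1 - z - (A * x1 + B * y0)| <= D -> `|f2 - f1 - A * (x2 - x1)| <= 2 * D.
Proof.
by rewrite !ler_norml => /andP[? ?] /andP[? ?]; apply/andP; split; lra.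
Qed.

Let cell_bound (J1 J2 A e l m : R) : `|J1 - A * l * m| <= 2 * e * (l + m) * m ->
  `|J2 - A * m * l| <= 2 * e * (l + m) * l -> `|J1 - J2| <= 2 * e * (l + m) ^+ 2.
Proof.
by rewrite !ler_norml expr2 => /andP[? ?] /andP[? ?]; apply/andP; split; lra.
Qed.

Let final_bound (E S : R) k : 0 < E -> 0 < S ->
  E / 4 ^+ k <= 2 * (E / (8 * S ^+ 2)) * (S / 2 ^+ k) ^+ 2 -> False.
Proof.
move=> E0 S0; rewrite expr_div_n -exprM mulnC exprM.
have -> : (2 : R) ^+ 2 = 4 by rewrite -natrX.
have -> : 2 * (E / (8 * S ^+ 2)) * (S ^+ 2 / 4 ^+ k) = E / 4 ^+ k / 4.
  by set q := (4 ^+ k)^-1; field; rewrite gt_eqF.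
have : 0 < E / 4 ^+ k by rewrite divr_gt0 // exprn_gt0.
by move: (E / _) => q; lra.
Qed.

Variables (u v : R -> R -> R) (a b c d : R).
Hypotheses (ab : a < b) (cd : c < d).
Hypothesis cu : forall x, a <= x <= b -> citv c d (u x).
Hypothesis cv : forall y, c <= y <= d -> citv a b (v ^~ y).

(* First-order expansions of u and v with u_x = v_y. *)
Hypothesis duv : forall x0 y0, a <= x0 <= b -> c <= y0 <= d -> exists A B C,
  forall e, 0 < e -> exists2 r, 0 < r &
  forall x y, a <= x <= b -> c <= y <= d -> `|x - x0| < r -> `|y - y0| < r ->
  `|u x y - u x0 y0 - (A * (x - x0) + B * (y - y0))| <= e * (`|x - x0| + `|y - y0|) /\
  `|v x y - v x0 y0 - (C * (x - x0) + A * (y - y0))| <= e * (`|x - x0| + `|y - y0|).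

(** Formally the integral of [u_x - v_y] over the rectangle. The derivatives are not assumed to be
    integrable, so only the additivity of this boundary expression and the expansions at single
    points are used. *)
Let eta x1 x2 y1 y2 := (itvint y1 y2 (u x2) - itvint y1 y2 (u x1))
  - (itvint x1 x2 (v ^~ y2) - itvint x1 x2 (v ^~ y1)).

Let eta_split x1 x x2 y1 y y2 : a <= x1 -> x1 <= x -> x <= x2 -> x2 <= b ->
  c <= y1 -> y1 <= y -> y <= y2 -> y2 <= d ->
  eta x1 x2 y1 y2 = eta x1 x y1 y + eta x x2 y1 y + eta x1 x y y2 + eta x x2 y y2.
Proof.
move=> ax1 x1x xx2 x2b cy1 y1y yy2 y2d.
have hu t : a <= t <= b -> itvint y1 y2 (u t) = itvint y1 y (u t) + itvint y y2 (u t).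
  by move=> tab; apply: itvint_split => //; apply: citv_sub (cu tab).
have hv t : c <= t <= d -> itvint x1 x2 (v ^~ t) = itvint x1 x (v ^~ t) + itvint x x2 (v ^~ t).
  by move=> tcd; apply: itvint_split => //; apply: citv_sub (cv tcd).
rewrite /eta !hu ?hv; try by apply/andP; split; lra.
ring.
Qed.

Let lx k := (b - a) / 2 ^+ k.
Let ly k := (d - c) / 2 ^+ k.

Let lx_gt0 k : 0 < lx k. Proof. by rewrite divr_gt0 ?subr_gt0 // exprn_gt0. Qed.
Let ly_gt0 k : 0 < ly k. Proof. by rewrite divr_gt0 ?subr_gt0 // exprn_gt0. Qed.
Let lxS k : lx k = 2 * lx k.+1.
Proof. by rewrite /lx exprS; field; rewrite expf_neq0. Qed.
Let lyS k : ly k = 2 * ly k.+1.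
Proof. by rewrite /ly exprS; field; rewrite expf_neq0. Qed.

Let cell k (p : R * R) := eta p.1 (p.1 + lx k) p.2 (p.2 + ly k).

Let inside k (p : R * R) := [/\ a <= p.1, p.1 + lx k <= b, c <= p.2 & p.2 + ly k <= d].

Let child k (p q : R * R) := inside k.+1 q /\
  [/\ p.1 <= q.1, q.1 + lx k.+1 <= p.1 + lx k, p.2 <= q.2, q.2 + ly k.+1 <= p.2 + ly k
    & `|cell k p| / 4 <= `|cell k.+1 q| ].

(** The hypothesis [inside k p] stands under the existential quantifier so that choice yields a
    total function of [(k, p)]. *)
Let bisect k p : exists q, inside k p -> child k p q.
Proof.
case: p => x y; have [[/= ax xb cy yd]|] := pselect (inside k (x, y)); last by exists (x, y).
have l0 := lx_gt0 k.+1; have l0' := ly_gt0 k.+1; have lE := lxS k; have lE' := lyS k.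
have e : cell k (x, y) = cell k.+1 (x, y) + cell k.+1 (x + lx k.+1, y)
    + cell k.+1 (x, y + ly k.+1) + cell k.+1 (x + lx k.+1, y + ly k.+1).
  rewrite /cell /= (@eta_split x (x + lx k.+1) _ y (y + ly k.+1)); try lra.
  have -> : x + lx k.+1 + lx k.+1 = x + lx k by rewrite lE; ring.
  by have -> : y + ly k.+1 + ly k.+1 = y + ly k by rewrite lE'; ring.
have : `|cell k (x, y)| <= `|cell k.+1 (x, y)| + `|cell k.+1 (x + lx k.+1, y)|
    + `|cell k.+1 (x, y + ly k.+1)| + `|cell k.+1 (x + lx k.+1, y + ly k.+1)|.
  rewrite e; do 3 (apply: le_trans (ler_normD _ _) _; rewrite lerD2r).
  exact: lexx.
move=> h.
have [[? ? ? ?] [? ?]] := half_itv ax xb l0 lE.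
have [[? ? ? ?] [? ?]] := half_itv cy yd l0' lE'.
have [h1|h1] := leP (`|cell k (x, y)| / 4) `|cell k.+1 (x, y)|.
  by exists (x, y) => _; split.
have [h2|h2] := leP (`|cell k (x, y)| / 4) `|cell k.+1 (x + lx k.+1, y)|.
  by exists (x + lx k.+1, y) => _; split.
have [h3|h3] := leP (`|cell k (x, y)| / 4) `|cell k.+1 (x, y + ly k.+1)|.
  by exists (x, y + ly k.+1) => _; split.
exists (x + lx k.+1, y + ly k.+1) => _; split=> //; split => //.
exact: quarter h h1 h2 h3.
Qed.

Lemma nested_limit (x l : nat -> R) : (forall k, x k <= x k.+1) ->
  (forall k, x k.+1 + l k.+1 <= x k + l k) -> (forall k, 0 <= l k) ->
  exists z, forall k, x k <= z <= x k + l k.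
Proof.
move=> hx hl l0.
have mx k n : (k <= n)%N -> x k <= x n.
  by move=> /subnK <-; elim: (n - k)%N => // j IH; apply: le_trans IH (hx _).
have ml k n : (k <= n)%N -> x n + l n <= x k + l k.
  by move=> /subnK <-; elim: (n - k)%N => // j IH; apply: le_trans (hl _) IH.
have ub k : ubound (range x) (x k + l k).
  move=> _ [n _ <-]; have [kn|/ltnW nk] := leqP k n.
    by apply: le_trans (ml _ _ kn); rewrite lerDl.
  by apply: le_trans (mx _ _ nk) _; rewrite lerDl.
exists (sup (range x)) => k; apply/andP; split.
  by apply: ub_le_sup; [exists (x 0%N + l 0%N)|exists k].
by apply: ge_sup => //; exists (x 0%N), 0%N.
Qed.

Theorem goursat : itvint c d (u b) - itvint c d (u a) = itvint a b (v ^~ d) - itvint a b (v ^~ c).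
Proof.
suff : eta a b c d = 0 by rewrite /eta; lra.
apply/eqP/negPn/negP => n0.
have /choice[f hf] : forall kp : nat * (R * R), exists q, inside kp.1 kp.2 ->
   child kp.1 kp.2 q.
  by case=> k p; exact: bisect.
pose p := fix p k := if k is k'.+1 then f (k', p k') else (a, c).
have in0 : inside 0 (a, c) by split; rewrite /= ?lexx // /lx /ly expr0 divr1; lra.
have inp k : inside k (p k).
  by elim: k => [//|k IH] /=; have [] := hf (k, p k) IH.
have step k := hf (k, p k) (inp k).
have [x0 hx0] : exists z, forall k, (p k).1 <= z <= (p k).1 + lx k.
  apply: nested_limit => k; try exact/ltW/lx_gt0.
  - by have [_ []] := step k.
  - by have [_ []] := step k.
have [y0 hy0] : exists z, forall k, (p k).2 <= z <= (p k).2 + ly k.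
  apply: nested_limit => k; try exact/ltW/ly_gt0.
  - by have [_ []] := step k.
  - by have [_ []] := step k.
have big k : `|eta a b c d| / 4 ^+ k <= `|cell k (p k)|.
  elim: k => [|k IH].
    rewrite expr0 divr1 /cell /= /lx /ly expr0 !divr1.
    by rewrite [a + _]addrC subrK [c + _]addrC subrK.
  have [_ [_ _ _ _]] := step k; apply: le_trans.
  by rewrite exprS invfM [X in _ * X]mulrC mulrA ler_pM2r.
have x0ab : a <= x0 <= b.
  by have [] := inp 0%N; have := hx0 0%N; rewrite /= => /andP[? ?] *; apply/andP; split; lra.
have y0cd : c <= y0 <= d.
  by have [] := inp 0%N; have := hy0 0%N; rewrite /= => /andP[? ?] *; apply/andP; split; lra.
have [A [B [C hABC]]] := duv x0ab y0cd.
pose S := (b - a) + (d - c).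
have S0 : 0 < S by rewrite addr_gt0 ?subr_gt0.
(* Chosen so that the upper bound [2 e (S / 2^k)^2] on the [k]-th cell is a quarter of the lower
   bound [|eta| / 4^k] kept by the bisection. *)
pose e := `|eta a b c d| / (8 * S ^+ 2).
have e0 : 0 < e by rewrite divr_gt0 ?normr_gt0 // mulr_gt0 // exprn_gt0.
have [r r0 hr] := hABC e e0.
have [k hk] : exists k, S / 2 ^+ k < r.
  have /cvgrPdist_lt/(_ _ r0)[N _ /(_ N (leqnn N))] :
      (fun k => S * (2^-1 : R) ^+ k) @ \oo --> (0 : R).
    by apply: cvg_geometric; rewrite ger0_norm ?invr_ge0 // invf_lt1 // ltr1n.
  rewrite sub0r normrN exprVn => h; exists N; exact: le_lt_trans (ler_norm _) h.
have sk : lx k + ly k = S / 2 ^+ k by rewrite /lx /ly -mulrDl.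
have := big k; have := inp k; have := hx0 k; have := hy0 k.
case: (p k) => x y /= /andP[yy0 y0y] /andP[xx0 x0x] [/= ax xb cy yd].
have lx0 := lx_gt0 k; have ly0 := ly_gt0 k.
have hx0' : x <= x0 <= x + lx k by rewrite xx0.
have hy0' : y <= y0 <= y + ly k by rewrite yy0.
have xin : x <= x <= x + lx k by rewrite lexx lerDl ltW.
have xin' : x <= x + lx k <= x + lx k by rewrite lexx lerDl ltW.
have yin : y <= y <= y + ly k by rewrite lexx lerDl ltW.
have yin' : y <= y + ly k <= y + ly k by rewrite lexx lerDl ltW.
have skx : lx k < r by apply: le_lt_trans hk; rewrite -sk lerDl ltW.
have sky : ly k < r by apply: le_lt_trans hk; rewrite -sk lerDr ltW.
have est x' y' : x <= x' <= x + lx k -> y <= y' <= y + ly k ->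
  `|u x' y' - u x0 y0 - (A * (x' - x0) + B * (y' - y0))| <= e * (lx k + ly k) /\
  `|v x' y' - v x0 y0 - (A * (y' - y0) + C * (x' - x0))| <= e * (lx k + ly k).
  move=> hx' hy'; have dx := dist_in hx0' hx'; have dy := dist_in hy0' hy'.
  have x'ab : a <= x' <= b.
    by case/andP: hx' => h1 h2; rewrite (le_trans ax h1) (le_trans h2 xb).
  have y'cd : c <= y' <= d.
    by case/andP: hy' => h1 h2; rewrite (le_trans cy h1) (le_trans h2 yd).
  have [h5 h6] := hr x' y' x'ab y'cd (le_lt_trans dx skx) (le_lt_trans dy sky).
  rewrite [A * (y' - y0) + _]addrC.
  by split; [apply: le_trans h5 _|apply: le_trans h6 _]; rewrite ler_pM2l // lerD.
have xab : a <= x <= b by rewrite ax (le_trans _ xb) // lerDl ltW.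
have xab' : a <= x + lx k <= b by rewrite xb (le_trans ax) // lerDl ltW.
have ycd : c <= y <= d by rewrite cy (le_trans _ yd) // lerDl ltW.
have ycd' : c <= y + ly k <= d by rewrite yd (le_trans cy) // lerDl ltW.
have cu1 := citv_sub cy yd (cu xab).
have cu2 := citv_sub cy yd (cu xab').
have cv1 := citv_sub ax xb (cv ycd).
have cv2 := citv_sub ax xb (cv ycd').
have rd (z w t : R) : z + w - t - (z - t) = w by ring.
(* [u_x] and [v_y] share the value [A] at the limit point, so [I1] and [I2] both approximate [A]
   times the area of the cell, and [A] cancels in [cell_bound]. *)
have I1 : `|itvint y (y + ly k) (fun t => u (x + lx k) t - u x t) - A * lx k * (y + ly k - y)|
    <= 2 * e * (lx k + ly k) * (y + ly k - y).
  apply: itvint_estimate; [by rewrite lerDl ltW|exact: citvB|move=> t ht].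
  have [h1 _] := est _ _ xin' ht; have [h2 _] := est _ _ xin ht.
  have := diff_bound h1 h2; rewrite rd !mulrA; exact.
have I2 : `|itvint x (x + lx k) (fun t => v t (y + ly k) - v t y) - A * ly k * (x + lx k - x)|
    <= 2 * e * (lx k + ly k) * (x + lx k - x).
  apply: itvint_estimate; [by rewrite lerDl ltW|exact: citvB|move=> t ht].
  have [_ h1] := est _ _ ht yin'; have [_ h2] := est _ _ ht yin.
  have := diff_bound h1 h2; rewrite rd !mulrA; exact.
rewrite /cell /= {2}/eta -!itvintB //.
have rw (z w : R) : z + w - z = w by rewrite addrAC subrr add0r.
rewrite !rw in I1 I2; move=> /le_trans/(_ (cell_bound I1 I2)).
by rewrite sk; apply: final_bound => //; rewrite normr_gt0.
Qed.

End Goursat.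

Lemma derivable_littleo (K : numFieldType) (f : K -> K^o) (a : K^o) (L : K) :
  is_derive a (1 : K^o) f L -> forall e, 0 < e ->
  \forall h \near (0 : K^o), `|f (h + a) - f a - L * h| <= e * `|h|.
Proof.
move=> [df dfE] e e0; have := derivable_nbhs df; rewrite dfE => /eqaddoP/(_ _ e0).
apply: filterS => h hh.
suff <- : f (h * 1 + a) - (f a + h * L) = f (h + a) - f a - L * h by exact: hh.
by rewrite mulr1 opprD addrA [h * L]mulrC.
Qed.

Section ComplexContinuity.
Variable R : realType.
Local Notation C := R[i].

Lemma continuous_Re : continuous (@complex.Re R : C^o -> R^o).
Proof.
move=> z; apply/(@cvgrPdist_lt _ R^o _ _ (nbhs_filter (z : C^o))) => e e0.
exists (e%:C%C) => [|w /=]; first by rewrite /= ltcR.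
rewrite ltc_modulus -ReB => h; exact: le_lt_trans (ler_Re_modulus _) h.
Qed.

Lemma continuous_Im : continuous (@complex.Im R : C^o -> R^o).
Proof.
move=> z; apply/(@cvgrPdist_lt _ R^o _ _ (nbhs_filter (z : C^o))) => e e0.
exists (e%:C%C) => [|w /=]; first by rewrite /= ltcR.
rewrite ltc_modulus -ImB => h; exact: le_lt_trans (ler_Im_modulus _) h.
Qed.

Lemma cvg_complex (T : Type) (F : set_system T) (FF : Filter F) (f : T -> C) (z : C) :
  (fun t => Re (f t)) @ F --> (Re z : R^o) -> (fun t => Im (f t)) @ F --> (Im z : R^o) ->
  f @ F --> (z : C^o).
Proof.
move=> /cvgrPdist_lt hR /cvgrPdist_lt hI; apply/(@cvgrPdist_lt _ C^o) => e' /gt0_complex[e e0 ->].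
have e20 : 0 < e / 2 by rewrite divr_gt0.
have := hR _ e20; have := hI _ e20; apply: filterS2 => t /= h1 h2.
rewrite ltc_modulus; apply: le_lt_trans (ler_modulus_ReIm _) _.
by rewrite ReB ImB [e]splitr ltrD.
Qed.

Lemma continuous_expi : continuous (@expi R : R -> C^o).
Proof.
move=> t; apply: cvg_complex; [exact: continuous_cos|exact: continuous_sin].
Qed.

Lemma continuous_rc : continuous (real_complex R : R -> C^o).
Proof. by move=> t; apply: cvg_complex; [exact: cvg_id|exact: cvg_cst]. Qed.

Lemma continuous_polar (r : R) : continuous (@polar R r : R -> C^o).
Proof.
move=> t; rewrite (_ : @polar R r = fun t => r%:C%C * expi t); last by apply/funext => s; exact: polarE.
by apply: (@cvgM C); [exact: cvg_cst|exact: continuous_expi].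
Qed.

Lemma continuous_exp_polar : continuous (fun p : R * R => polar (expR p.1) p.2 : C^o).
Proof.
move=> p; rewrite (_ : (fun _ => _) = fun p : R * R => (expR p.1)%:C%C * expi p.2); last first.
  by apply/funext => s; exact: polarE.
apply: (@cvgM C).
  apply: (@cvg_comp _ _ _ (fun p : R * R => expR p.1) (real_complex R) _ (nbhs (expR p.1))).
    apply: cvg_comp; first exact: cvg_fst.
    exact: continuous_expR.
  exact: continuous_rc.
by apply: (@cvg_comp _ _ _ (fun p : R * R => p.2) (@expi R) _ (nbhs p.2)); [exact: cvg_snd|exact: continuous_expi].
Qed.

Lemma near_disc_ball (z : C) (e : R) : 0 < e -> \forall w \near (z : C^o), modulus (w - z) < e.
Proof.
move=> e0; exists (e%:C%C) => [|w /=]; first by rewrite /= ltcR.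
by rewrite ltc_modulus modulusB.
Qed.

Lemma expi_expansion (e : R) : 0 < e -> exists2 r, 0 < r &
  forall h k : R, `|h| < r -> `|k| < r ->
  modulus (polar (expR h) k - 1 - Complex h k) <= e * (`|h| + `|k|).
Proof.
move=> e0.
(* The errors below add up to at most [d |h| + 8 d |k|]; the product [|h| |k|] is absorbed by
   [|h| < d]. *)
have [d [d0 d1 d8]] : exists d, [/\ 0 < d, d <= 1 & 8 * d <= e].
  exists (Num.min (e / 8) 1); rewrite lt_min divr_gt0 //= ge_min lexx orbT; split=> //.
  by rewrite mulrC -ler_pdivlMr // ge_min lexx.
have lin (f : R -> R) (L : R) : is_derive (0 : R) (1 : R) f L ->
    exists2 r, 0 < r & forall h, `|h| < r -> `|f h - f 0 - L * h| <= d * `|h|.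
  move=> /derivable_littleo/(_ _ d0) /nbhs_norm0P[r /= r0 hr]; exists r => // h hh.
  by have := hr h hh; rewrite /= addr0.
have [r1 r10 h1] := lin expR _ (is_derive_expR 0).
have [r2 r20 h2] := lin cos _ (is_derive_cos 0).
have [r3 r30 h3] := lin sin _ (is_derive_sin 0).
rewrite expR0 in h1; rewrite cos0 sin0 oppr0 in h2; rewrite sin0 cos0 in h3.
exists (Num.min (Num.min (Num.min r1 r2) r3) d) => [|h k]; first by rewrite !lt_min r10 r20 r30 d0.
rewrite !lt_min => /andP[/andP[/andP[ha hb] hc] hd] /andP[/andP[/andP[ka kb] kc] kd].
have e1 := h1 _ ha; have e2 := h2 _ kb; have e3 := h3 _ kc.
rewrite mul1r in e1; rewrite mul0r subr0 in e2; rewrite subr0 mul1r in e3.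
have hh0 := normr_ge0 h; have kk0 := normr_ge0 k.
set x := expR h in e1 *; set c := cos k in e2 *; set s := sin k in e3 *.
have x3 : `|x - 1| <= 2 * `|h|.
  have -> : x - 1 = (x - 1 - h) + h by rewrite subrK.
  by apply: le_trans (ler_normD _ _) _; nra.
have x2 : `|x| <= 3.
  have -> : x = (x - 1) + 1 by rewrite subrK.
  by apply: le_trans (ler_normD _ _) _; rewrite normr1; nra.
apply: le_trans (ler_modulus_ReIm _) _.
rewrite /polar /= -/x -/c -/s.
have eR : `|x * c - 1 - h| <= 3 * (d * `|k|) + d * `|h|.
  have -> : x * c - 1 - h = x * (c - 1) + (x - 1 - h) by ring.
  apply: le_trans (ler_normD _ _) _; rewrite normrM lerD //.
  by apply: ler_pM.
have eI : `|x * s - 0 - k| <= d * `|k| + 2 * `|h| * (2 * `|k|).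
  have -> : x * s - 0 - k = (s - k) + (x - 1) * s by ring.
  apply: le_trans (ler_normD _ _) _; rewrite normrM lerD //.
  apply: ler_pM => //.
  have -> : s = (s - k) + k by rewrite subrK.
  by apply: le_trans (ler_normD _ _) _; nra.
apply: le_trans (_ : _ <= `|x * c - 1 - h| + `|x * s - 0 - k|) _.
  by rewrite le_eqVlt ?ReB ?ImB /= eqxx.
apply: le_trans (lerD eR eI) _.
have : `|h| * `|k| <= d * `|k| by rewrite ler_wpM2r // ltW.
have : 8 * d * `|h| <= e * `|h| by rewrite ler_wpM2r.
have : 8 * d * `|k| <= e * `|k| by rewrite ler_wpM2r.
have : 0 <= d * `|h| by rewrite mulr_ge0 // ltW.
have : 0 <= d * `|k| by rewrite mulr_ge0 // ltW.
move=> *; lra.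
Qed.

Lemma derivable_modulus (g : C -> C) (w L : C) :
  is_derive (w : C^o) (1 : C^o) (g : C^o -> C^o) L -> forall e : R, 0 < e ->
  exists2 r, 0 < r & forall w', modulus (w' - w) < r ->
    modulus (g w' - g w - L * (w' - w)) <= e * modulus (w' - w).
Proof.
move=> dg e e0; have e0' : (0 : C) < e%:C%C by rewrite ltcR.
have := derivable_littleo dg e0' => /(@nbhs_norm0P _ C^o)[_ /gt0_complex[r r0 ->] hr].
exists r => // w' ww'.
have := hr (w' - w); rewrite /= ltc_modulus => /(_ ww').
by rewrite subrK -!modulusE -rmorphM lecR.
Qed.

(** This is [exp (x + i y)]: annuli become rectangles and products become translations, which lets
    Goursat's lemma for rectangles act on circles. *)
Let P (x y : R) : C := polar (expR x) y.

Let PD x h y k : P (x + h) (y + k) = P x y * P h k.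
Proof. by rewrite /P !polarE expRD expiD rmorphM /=; ring. Qed.

Lemma modulus_exp_polar x y : modulus (P x y) = expR x.
Proof. by rewrite modulus_polar // ltW // expR_gt0. Qed.

Lemma exp_polar_expansion (g : C -> C) (L : C) x0 y0 :
  is_derive (P x0 y0 : C^o) (1 : C^o) (g : C^o -> C^o) L ->
  forall e : R, 0 < e -> exists2 r, 0 < r & forall x y : R, `|x - x0| < r -> `|y - y0| < r ->
   modulus (g (P x y) - g (P x0 y0) - L * P x0 y0 * Complex (x - x0) (y - y0))
     <= e * (`|x - x0| + `|y - y0|).
Proof.
move=> dg e e0; pose m := expR x0; have m0 : 0 < m := expR_gt0 _.
have e1 : 0 < e / 4 / m by rewrite !divr_gt0.
have [r1 r10 h1] := derivable_modulus dg e1.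
pose n := modulus L * m + 1; have n0 : 0 < n by rewrite ltr_wpDl // mulr_ge0 ?modulus_ge0 // ltW.
have e2 : 0 < Num.min 1 (e / 2 / n) by rewrite lt_min ltr01 !divr_gt0.
have [r2 r20 h2] := expi_expansion e2.
exists (Num.min r2 (r1 / 4 / m)) => [|x y]; first by rewrite lt_min r20 !divr_gt0.
rewrite !lt_min => /andP[xr xr'] /andP[yr yr'].
have := h2 _ _ xr yr; set h := x - x0; set k := y - y0; set s := `|h| + `|k|.
have s0 : 0 <= s by rewrite addr_ge0.
set E := _ - _ => hE.
have eP : P x y - P x0 y0 = P x0 y0 * (Complex h k + E).
  have -> : P x y = P x0 y0 * P h k by rewrite -PD /h /k ![_ + (_ - _)]addrC !subrK.
  by rewrite /E -/(P h k); ring.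
have hhk : modulus (Complex h k) <= s by exact: ler_modulus_ReIm.
have E1 : modulus E <= s.
  by apply: le_trans hE _; rewrite ler_piMl // ge_min lexx.
have d1 : modulus (P x y - P x0 y0) <= 2 * m * s.
  rewrite eP modulusM modulus_exp_polar -/m [2 * m]mulrC -mulrA ler_pM2l //.
  by apply: le_trans (ler_modulusD _ _) _; lra.
have d2 : modulus (P x y - P x0 y0) < r1.
  apply: le_lt_trans d1 _.
  have : s < r1 / 2 / m.
    by rewrite /s; move: xr' yr'; rewrite -/h -/k !ltr_pdivlMr // => *; rewrite mulrDl; lra.
  by rewrite ltr_pdivlMr // => *; lra.
have -> : g (P x y) - g (P x0 y0) - L * P x0 y0 * Complex h k =
   (g (P x y) - g (P x0 y0) - L * (P x y - P x0 y0)) + L * P x0 y0 * E.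
  by rewrite eP; ring.
apply: le_trans (ler_modulusD _ _) _; rewrite [e]splitr mulrDl lerD //.
  apply: le_trans (h1 _ d2) _; apply: le_trans (ler_wpM2l (ltW e1) d1) _.
  rewrite le_eqVlt; apply/orP; left; apply/eqP; field; rewrite gt_eqF //.
rewrite !modulusM modulus_exp_polar -/m.
have E2 : modulus E <= e / 2 / n * s.
  by apply: le_trans hE _; rewrite ler_wpM2r // ge_min lexx orbT.
apply: le_trans (ler_wpM2l _ E2) _; first by rewrite mulr_ge0 ?modulus_ge0 // ltW.
rewrite mulrA ler_wpM2r //.
rewrite mulrCA ler_piMr ?divr_ge0 ?(ltW e0) //.
by rewrite ler_pdivrMr // mul1r /n; lra.
Qed.

End ComplexContinuity.

Section ParameterIntegral.
Variable R : realType.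

Lemma continuous_slice (phi : R * R -> R) x y : {for (x, y), continuous (phi : R * R -> R^o)} ->
  {for y, continuous (fun t => phi (x, t) : R^o)}.
Proof.
move=> h A /h [[B D] [/= nB nD] BD]; apply: filterS nD => t Dt.
by apply: (BD (x, t)); split => //=; exact: nbhs_singleton.
Qed.

Lemma continuous_slice1 (phi : R * R -> R) x y : {for (x, y), continuous (phi : R * R -> R^o)} ->
  {for x, continuous (fun t => phi (t, y) : R^o)}.
Proof.
move=> h A /h [[B D] [/= nB nD] BD]; apply: filterS nB => t Bt.
by apply: (BD (t, y)); split => //=; exact: nbhs_singleton.
Qed.

Lemma citv_for (a b : R) (f : R -> R) : (forall t, a <= t <= b -> {for t, continuous (f : R -> R^o)}) -> citv a b f.
Proof.
move=> h; apply: continuous_in_subspaceT => t; rewrite inE /= in_itv /=; exact: h.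
Qed.

(** The tube lemma: compactness of the segment makes the continuity at the points [(x, y)] uniform
    in [y]. *)
Lemma cvg_itvint_param (phi : R * R -> R) (x c d : R) : c <= d ->
  (forall y, c <= y <= d -> {for (x, y), continuous (phi : R * R -> R^o)}) ->
  forall e : R, 0 < e -> \forall x' \near x,
  (forall y, c <= y <= d -> `|phi (x', y) - phi (x, y)| <= e).
Proof.
move=> cd h e e0.
have : \forall x' \near x, `[c, d]%classic `<=` (fun y => `|phi (x', y) - phi (x, y)| <= e).
  have /compact_near_coveringP/(_ R (nbhs x) (fun x' y => `|phi (x', y) - phi (x, y)| <= e) _) H := @segment_compact R c d.
  apply: H => y; rewrite /= in_itv /= => ycd.
  have hy := h y ycd.
  have e2 : 0 < e / 2 by rewrite divr_gt0.
  have /cvgrPdist_lt/(_ _ e2) [[A B] [/= nA nB] AB] := hy.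
  exists (B, A) => // -[y' x'] [/= By' Ax'].
  have h1 := AB (x', y') (conj Ax' By'); have h2 := AB (x, y') (conj (nbhs_singleton nA) By').
  rewrite /= in h1 h2.
  have -> : phi (x', y') - phi (x, y') = (phi (x, y) - phi (x, y')) - (phi (x, y) - phi (x', y')) by ring.
  by apply: le_trans (ler_normB _ _) _; rewrite [e]splitr lerD // ltW.
by apply: filterS => x' hx' y ycd; apply: hx'; rewrite /= in_itv.
Qed.

Lemma continuous_itvint_param (phi : R * R -> R) (x c d : R) : c <= d ->
  (\forall x' \near x, citv c d (fun y => phi (x', y))) ->
  (forall y, c <= y <= d -> {for (x, y), continuous (phi : R * R -> R^o)}) ->
  {for x, continuous (fun x => itvint c d (fun y => phi (x, y)) : R^o)}.
Proof.
move=> cd cphi h; apply/cvgrPdist_le => e e0.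
pose m := d - c + 1; have m0 : 0 < m by rewrite /m; lra.
have em : 0 < e / m by rewrite divr_gt0.
have := cvg_itvint_param cd h em; apply: filterS2 cphi => x' cx' hx'.
have cx : citv c d (fun y => phi (x, y)).
  by apply: citv_for => y /h; exact: continuous_slice.
rewrite -itvintB //.
have := @itvint_estimate R c d (fun y => phi (x, y) - phi (x', y)) 0 (e / m) cd (citvB cx cx').
rewrite mul0r subr0 => est; apply: le_trans (est _) _ => [t tcd|].
  by rewrite subr0 distrC; exact: hx'.
by rewrite mulrAC ler_pdivrMr // ler_pM2l // /m; lra.
Qed.

Lemma bounded_rect (phi : R * R -> R) (a b c d : R) :
  (forall x y, a <= x <= b -> c <= y <= d -> {for (x, y), continuous (phi : R * R -> R^o)}) ->
  exists M, forall x y, a <= x <= b -> c <= y <= d -> `|phi (x, y)| <= M.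
Proof.
move=> h.
have cpt : compact (`[a, b]%classic `*` `[c, d]%classic).
  by apply: compact_setX; exact: segment_compact.
have /compact_near_coveringP := cpt.
move=> /(_ R (pinfty_nbhs R) (fun M p => `|phi p| <= M) _) H.
have : \forall M \near +oo, (`[a, b]%classic `*` `[c, d]%classic) `<=` (fun p => `|phi p| <= M).
  apply: H => -[x y] [/=]; rewrite !in_itv /= => xab ycd.
  have /cvgrPdist_lt/(_ _ ltr01) hxy := h x y xab ycd.
  exists ([set p : R * R | `|phi (x, y) - phi p| < 1], [set M : R | `|phi (x, y)| + 1 < M]).
    split => //=; exists (`|phi (x, y)| + 1); split => //; exact: num_real.
  move=> [p M] [/= hp hM].
  have -> : phi p = phi (x, y) - (phi (x, y) - phi p) by ring.
  apply: le_trans (ler_normB _ _) _; lra.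
move=> [M [_ hM]]; exists (M + 1) => x y xab ycd.
by apply: (hM (M + 1)); rewrite ?ltrDl // /= !in_itv.
Qed.

Lemma bounded_itv (f : R -> R) (a b : R) : citv a b f -> exists M, forall t, a <= t <= b -> `|f t| <= M.
Proof.
move=> cf; have [ab|ba] := leP a b; last first.
  by exists 0 => t /andP[h1 h2]; have := le_trans h1 h2; rewrite leNgt ba.
have [c1 _ h1] := EVT_max ab cf.
have [c2 _ h2] := EVT_min ab cf.
exists (`|f c1| + `|f c2|) => t tab.
have tin : t \in `[a, b]%R by rewrite in_itv.
rewrite ler_norml; apply/andP; split.
  have := h2 t tin; have := ler_norm (- f c2); rewrite normrN; have := normr_ge0 (f c1); lra.
have := h1 t tin; have := ler_norm (f c1); have := normr_ge0 (f c2); lra.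
Qed.

Lemma itvint_deriv (f F : R -> R) (a b : R) : a < b -> continuous (f : R -> R^o) ->
  (forall t, is_derive (t : R^o) (1 : R^o) (F : R^o -> R^o) (f t)) -> itvint a b f = F b - F a.
Proof.
move=> ab cf dF.
have cF : continuous (F : R -> R^o).
  by move=> t; apply/differentiable_continuous/derivable1_diffP; have [] := dF t.
have := @continuous_FTC2 R f F a b ab (citvT cf).
rewrite /itvint /Rintegral => -> //.
  split; first by move=> t _; have [] := dF t.
  - by apply: cvg_at_right_filter; exact: cF.
  - by apply: cvg_at_left_filter; exact: cF.
by move=> t _; rewrite derive1E; have [_ ->] := dF t.
Qed.

Lemma cosD_period k x : cos (x + 2 * pi * k%:R) = cos x :> R.
Proof.
elim: k => [|k IH]; first by rewrite mulr0 addr0.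
by rewrite -[k.+1%:R]natr1 mulrDr mulr1 addrA mulr_natl cosD2pi -mulr_natl.
Qed.

Lemma sinD_period k x : sin (x + 2 * pi * k%:R) = sin x :> R.
Proof.
elim: k => [|k IH]; first by rewrite mulr0 addr0.
by rewrite -[k.+1%:R]natr1 mulrDr mulr1 addrA mulr_natl sinD2pi -mulr_natl.
Qed.

Lemma continuous_cosM (k : R) : continuous (fun t => cos (k * t) : R^o).
Proof.
by move=> t; apply: continuous_comp; [apply: mulrl_continuous|exact: continuous_cos].
Qed.

Lemma continuous_sinM (k : R) : continuous (fun t => sin (k * t) : R^o).
Proof.
by move=> t; apply: continuous_comp; [apply: mulrl_continuous|exact: continuous_sin].
Qed.

Lemma twopi_gt0 : 0 < 2 * pi :> R.
Proof. by rewrite mulr_gt0 // pi_gt0. Qed.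

Lemma itvint_cos k (a : R) : itvint a (a + 2 * pi) (fun t => cos (k.+1%:R * t)) = 0.
Proof.
have k0 : k.+1%:R != 0 :> R by rewrite pnatr_eq0.
have dF (t : R) : is_derive (t : R^o) (1 : R^o) ((fun t => k.+1%:R^-1 * sin (k.+1%:R * t)) : R^o -> R^o) (cos (k.+1%:R * t)).
  have d1 : is_derive (t : R^o) (1 : R^o) (fun t : R^o => k.+1%:R *: t) (k.+1%:R *: 1).
    exact: is_deriveZ.
  have d2 := @is_derive1_comp _ (@sin R) (fun t : R => k.+1%:R * t) t _ _ (is_derive_sin _) d1.
  have := @is_deriveZ _ _ _ _ (k.+1%:R^-1) _ _ _ d2.
  by rewrite -[_ *: 1]/(_ * 1) mulr1 -[_ *: (_ * _)]/(_ * (_ * _)) mulrCA mulVf // mulr1.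
rewrite (itvint_deriv _ (@continuous_cosM _) dF); last by rewrite ltrDl twopi_gt0.
by rewrite mulrDr [k.+1%:R * (_ * _)]mulrC sinD_period subrr.
Qed.

Lemma itvint_sin k (a : R) : itvint a (a + 2 * pi) (fun t => sin (k.+1%:R * t)) = 0.
Proof.
have k0 : k.+1%:R != 0 :> R by rewrite pnatr_eq0.
have dF (t : R) : is_derive (t : R^o) (1 : R^o) ((fun t => - k.+1%:R^-1 * cos (k.+1%:R * t)) : R^o -> R^o) (sin (k.+1%:R * t)).
  have d1 : is_derive (t : R^o) (1 : R^o) (fun t : R^o => k.+1%:R *: t) (k.+1%:R *: 1).
    exact: is_deriveZ.
  have d2 := @is_derive1_comp _ (@cos R) (fun t : R => k.+1%:R * t) t _ _ (is_derive_cos _) d1.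
  have := @is_deriveZ _ _ _ _ (- k.+1%:R^-1) _ _ _ d2.
  suff -> : - k.+1%:R^-1 *: (- sin (k.+1%:R * t) * k.+1%:R%:A) = sin (k.+1%:R * t) :> R^o by [].
  rewrite -[k.+1%:R%:A]/(k.+1%:R * 1) -[LHS]/(- k.+1%:R^-1 * (- sin (k.+1%:R * t) * (k.+1%:R * 1))).
  by rewrite mulr1 mulrA mulrNN mulrAC mulVf // mul1r.
rewrite (itvint_deriv _ (@continuous_sinM _) dF); last by rewrite ltrDl twopi_gt0.
by rewrite mulrDr [k.+1%:R * (_ * _)]mulrC cosD_period subrr.
Qed.

End ParameterIntegral.

(** * Circular means of holomorphic functions *)

Section MeanValue.
Variable R : realType.
Local Notation C := R[i].

Let P (x y : R) : C := polar (expR x) y.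

(** Goursat's lemma for [g (exp (x + i y))] on [[x1, x2]] times [[0, 2 pi]]: the two horizontal
    sides cancel by periodicity, and the vertical ones are the two means. *)
Lemma mean_const_Re (g : C -> C) (x1 x2 : R) : x1 < x2 ->
  (forall x y, x1 <= x <= x2 -> exists L, is_derive (P x y : C^o) (1 : C^o) (g : C^o -> C^o) L) ->
  itvint 0 (2 * pi) (fun y => Re (g (P x2 y))) = itvint 0 (2 * pi) (fun y => Re (g (P x1 y))).
Proof.
move=> x12 dg.
have cg x y : x1 <= x <= x2 -> {for (x, y), continuous (fun p => g (P p.1 p.2) : C^o)}.
  move=> hx; have [L [dL _]] := dg x y hx.
  apply: (@cvg_comp _ _ _ (fun p : R * R => P p.1 p.2) g _ (nbhs (P x y : C^o))).
    exact: (@continuous_exp_polar R (x, y)).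
  by have /derivable1_diffP/differentiable_continuous := dL.
have cR x y : x1 <= x <= x2 -> {for (x, y), continuous (fun p => Re (g (P p.1 p.2)) : R^o)}.
  move=> hx; apply: (@cvg_comp _ _ _ (fun p : R * R => g (P p.1 p.2)) (@complex.Re R) _ (nbhs (g (P x y) : C^o))).
    exact: cg.
  exact: continuous_Re.
have cI x y : x1 <= x <= x2 -> {for (x, y), continuous (fun p => Im (g (P p.1 p.2)) : R^o)}.
  move=> hx; apply: (@cvg_comp _ _ _ (fun p : R * R => g (P p.1 p.2)) (@complex.Im R) _ (nbhs (g (P x y) : C^o))).
    exact: cg.
  exact: continuous_Im.
have := @goursat R (fun x y => Re (g (P x y))) (fun x y => Im (g (P x y))) x1 x2 0 (2 * pi) x12 (twopi_gt0 R).
have per x : P x (2 * pi) = P x 0.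
  by rewrite /P !polarE -[2 * pi]add0r expi2pi.
have -> : (fun x => Im (g (P x (2 * pi)))) = (fun x => Im (g (P x 0))).
  by apply/funext => x; rewrite per.
rewrite subrr => H; apply/eqP; rewrite -subr_eq0; apply/eqP; apply: H.
- move=> x hx; apply: citv_for => t _; exact: (continuous_slice (cR x t hx)).
- move=> y _; apply: citv_for => t ht.
  exact: (continuous_slice1 (cI t y ht)).
- move=> x0 y0 hx0 _; have [L dL] := dg x0 y0 hx0.
  pose D := L * P x0 y0.
  exists (Re D), (- Im D), (Im D) => e e0.
  have [r r0 hr] := exp_polar_expansion dL e0.
  exists r => // x y _ _ hx hy; have := hr x y hx hy; rewrite -/(P x y) -/(P x0 y0) -/D.
  set E := _ - _ => hE.
  have eR : Re E = Re (g (P x y)) - Re (g (P x0 y0)) - (Re D * (x - x0) + - Im D * (y - y0)).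
    by rewrite /E !ReB ReMc /= mulNr.
  have eI : Im E = Im (g (P x y)) - Im (g (P x0 y0)) - (Im D * (x - x0) + Re D * (y - y0)).
    by rewrite /E !ImB ImMc /= [Re D * _ + _]addrC.
  rewrite -eR -eI; split; [exact: le_trans (ler_Re_modulus _) hE|exact: le_trans (ler_Im_modulus _) hE].
Qed.

End MeanValue.

Section CircleIntegral.
Variable R : realType.
Local Notation C := R[i].
Implicit Types phi psi : R -> C.

Definition cint phi : C :=
  Complex (itvint 0 (2 * pi) (fun t => Re (phi t))) (itvint 0 (2 * pi) (fun t => Im (phi t))).

Lemma citv_Re phi a b : continuous (phi : R -> C^o) -> citv a b (fun t => Re (phi t)).
Proof.
by move=> c; apply: citvT => t; apply: cvg_comp (c t) _; exact: continuous_Re.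
Qed.

Lemma citv_Im phi a b : continuous (phi : R -> C^o) -> citv a b (fun t => Im (phi t)).
Proof.
by move=> c; apply: citvT => t; apply: cvg_comp (c t) _; exact: continuous_Im.
Qed.

Lemma continuousDc phi psi : continuous (phi : R -> C^o) -> continuous (psi : R -> C^o) ->
  continuous (fun t => phi t + psi t : C^o).
Proof. by move=> c d t; apply: (@cvgD C); [exact: c|exact: d]. Qed.

Lemma continuousMc phi psi : continuous (phi : R -> C^o) -> continuous (psi : R -> C^o) ->
  continuous (fun t => phi t * psi t : C^o).
Proof. by move=> c d t; apply: (@cvgM C); [exact: c|exact: d]. Qed.

Lemma continuousZc (c : C) phi : continuous (phi : R -> C^o) -> continuous (fun t => c * phi t : C^o).
Proof. by move=> d t; apply: (@cvgM C); [exact: cvg_cst|exact: d]. Qed.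

Lemma cintD phi psi : continuous (phi : R -> C^o) -> continuous (psi : R -> C^o) ->
  cint (fun t => phi t + psi t) = cint phi + cint psi.
Proof.
move=> c d; apply: complex_eqP; rewrite ?ReD ?ImD /= -itvintD; try exact: citv_Re; try exact: citv_Im.
  by apply: eq_itvint => t _; rewrite ReD.
by apply: eq_itvint => t _; rewrite ImD.
Qed.

Lemma cintZ c phi : continuous (phi : R -> C^o) -> cint (fun t => c * phi t) = c * cint phi.
Proof.
move=> d; have dR := @citv_Re phi 0 (2 * pi) d; have dI := @citv_Im phi 0 (2 * pi) d.
have cc (x : R) g : citv 0 (2 * pi) g -> citv 0 (2 * pi) (fun t => x * g t).
  by apply: citvM; exact: citv_cst.
apply: complex_eqP; rewrite ?ReMc ?ImMc /= -!itvintZ // -?itvintB -?itvintD; try exact: cc.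
  by apply: eq_itvint => t _; rewrite ReMc.
by apply: eq_itvint => t _; rewrite ImMc.
Qed.

Lemma eq_cint phi psi : (forall t, 0 <= t <= 2 * pi -> phi t = psi t) -> cint phi = cint psi.
Proof. by move=> h; rewrite /cint; congr Complex; apply: eq_itvint => t /h ->. Qed.

Lemma cint_cst c : cint (fun=> c) = (2 * pi)%:C%C * c.
Proof.
have p0 := twopi_gt0 R.
by apply: complex_eqP; rewrite ?ReZ ?ImZ /= itvint_cst ?(ltW p0) // subr0 mulrC.
Qed.

(** Real and imaginary parts are estimated separately, hence [4 * pi] where [2 * pi] would be
    optimal. *)
Lemma cint_bound phi M : continuous (phi : R -> C^o) ->
  (forall t, 0 <= t <= 2 * pi -> modulus (phi t) <= M) -> modulus (cint phi) <= 4 * pi * M.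
Proof.
move=> c h; have p0 := ltW (twopi_gt0 R).
have h1 := @itvint_estimate R 0 (2 * pi) _ 0 M p0 (@citv_Re phi 0 (2 * pi) c).
have h2 := @itvint_estimate R 0 (2 * pi) _ 0 M p0 (@citv_Im phi 0 (2 * pi) c).
rewrite mul0r !subr0 in h1 h2; apply: le_trans (ler_modulus_ReIm _) _ => /=.
have -> : 4 * pi * M = M * (2 * pi) + M * (2 * pi) by ring.
apply: lerD.
  by apply: h1 => t /h ht; rewrite subr0; exact: le_trans (ler_Re_modulus _) ht.
by apply: h2 => t /h ht; rewrite subr0; exact: le_trans (ler_Im_modulus _) ht.
Qed.

Lemma continuous_expiM (k : R) : continuous (fun t => expi (k * t) : C^o).
Proof.
by move=> t; apply: (@continuous_comp _ _ _ (fun t => k * t)); [exact: mulrl_continuous|exact: continuous_expi].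
Qed.

Lemma cint_expi k : cint (fun t => expi (k.+1%:R * t)) = 0.
Proof.
have hc := itvint_cos k (0 : R); have hs := itvint_sin k (0 : R); rewrite !add0r in hc hs.
by apply: complex_eqP; [exact: hc|exact: hs].
Qed.

Lemma cint_expiN k : cint (fun t => expi (- k.+1%:R * t)) = 0.
Proof.
have hc := itvint_cos k (0 : R); have hs := itvint_sin k (0 : R); rewrite !add0r in hc hs.
apply: complex_eqP => /=.
  by rewrite -[RHS]hc; apply: eq_itvint => t _; rewrite mulNr cosN.
rewrite -[RHS](mulr0 (-1)) -[in RHS]hs -itvintZ; last exact/citvT/continuous_sinM.
by apply: eq_itvint => t _; rewrite mulNr sinN mulN1r.
Qed.

Lemma cint_expi_expi m n :
  cint (fun t => expi (- m%:R * t) * expi (n%:R * t)) = (2 * pi)%:C%C * (m == n)%:R.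
Proof.
have e t : expi (- m%:R * t) * expi (n%:R * t) = expi ((n%:R - m%:R) * t) :> C.
  by rewrite -expiD; congr expi; ring.
rewrite (eq_cint (fun t _ => e t)); have [mn|nm|->] := ltngtP m n.
- rewrite mulr0 -[n](subnK mn) -[RHS](cint_expi (n - m.+1)); apply: eq_cint => t _.
  by congr (expi (_ * _)); rewrite natrD -!natr1; ring.
- rewrite mulr0 -[m](subnK nm) -[RHS](cint_expiN (m - n.+1)); apply: eq_cint => t _.
  by congr (expi (_ * _)); rewrite natrD -!natr1; ring.
rewrite -cint_cst; apply: eq_cint => t _; by rewrite subrr mul0r expi0.
Qed.

Lemma cint_sum (n : nat) (F : 'I_n -> R -> C) : (forall i, continuous (F i : R -> C^o)) ->
  cint (fun t => \sum_(i < n) F i t) = \sum_(i < n) cint (F i) /\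
  continuous (fun t => \sum_(i < n) F i t : C^o).
Proof.
elim: n F => [|n IH] F cF.
  split; last by rewrite (_ : (fun t => _) = fun=> 0); [exact: cst_continuous|apply/funext => t; rewrite big_ord0].
  by rewrite big_ord0 -[RHS](mulr0 (2 * pi)%:C%C) -cint_cst; apply: eq_cint => t _; rewrite big_ord0.
have [h c] := IH (fun i => F (widen_ord (leqnSn n) i)) (fun i => cF _).
have e : (fun t => \sum_(i < n.+1) F i t) = (fun t => \sum_(i < n) F (widen_ord (leqnSn n) i) t + F ord_max t).
  by apply/funext => t; rewrite big_ord_recr.
have key phi psi : continuous (phi : R -> C^o) -> continuous (psi : R -> C^o) ->
    cint (fun t => phi t + psi t) = cint phi + cint psi /\ continuous (fun t => phi t + psi t : C^o).
  by move=> c1 c2; split; [exact: cintD|exact: continuousDc].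
by rewrite e big_ord_recr /= -h; exact: (key _ _ c (cF ord_max)).
Qed.

Lemma gconv_cint (u : nat -> R -> C) (s : R -> C) K x : 0 <= x < 1 ->
  (forall k, continuous (u k : R -> C^o)) -> continuous (s : R -> C^o) ->
  (forall t, 0 <= t <= 2 * pi -> gconv (u ^~ t) (s t)) ->
  (forall k t, 0 <= t <= 2 * pi -> modulus (u k t) <= K * x ^+ k) ->
  gconv (fun k => cint (u k)) (cint s).
Proof.
move=> x01 cu cs us uK.
have p0 := ltW (twopi_gt0 R).
have K0 : 0 <= K.
  have := uK 0%N 0; rewrite lexx p0 expr0 mulr1 => h; apply: le_trans (h isT); exact: modulus_ge0.
have x1 : 0 < 1 - x by case/andP: x01; rewrite subr_gt0.
exists (4 * pi * (K / (1 - x))), x; split=> //.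
  by rewrite mulr_ge0 ?divr_ge0 ?(ltW x1) // mulr_ge0 // pi_ge0.
move=> n.
have [h c] := @cint_sum n (fun i => u i) (fun i => cu i).
pose S t := \sum_(i < n) u i t.
have tl t (ht : 0 <= t <= 2 * pi) : modulus (s t - S t) <= K * x ^+ n / (1 - x).
  by exact: (gconv_tail n x01 (us t ht) (fun k => uK k t ht)).
rewrite -h -/S; have {c} : continuous (S : R -> C^o) by exact: c.
move: (S) tl => {h}T tl c.
have cN : continuous (fun t => -1 * T t : C^o) by exact: continuousZc.
rewrite -mulN1r -(@cintZ (-1) T c) -(@cintD s _ cs cN) -mulrA.
apply: cint_bound (@continuousDc s _ cs cN) _ => t ht.
by rewrite mulN1r [leRHS]mulrAC; exact: tl.
Qed.

End CircleIntegral.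

Section CauchySeries.
Variable R : realType.
Local Notation C := R[i].

Lemma continuous_polar2 (p : R * R) : {for p, continuous (fun p => polar p.1 p.2 : C^o)}.
Proof.
rewrite (_ : (fun p : R * R => _) = fun p => (p.1)%:C%C * expi p.2); last by apply/funext => q; exact: polarE.
apply: (@cvgM C); apply: (@continuous_comp _ _ _ _ _ p).
- exact: cvg_fst.
- exact: continuous_rc.
- exact: cvg_snd.
- exact: continuous_expi.
Qed.

Lemma eq_right_limit (J : R -> R) (p q c : R) : p < q -> {for p, continuous (J : R -> R^o)} ->
  (forall s : R, p < s -> s < q -> J s = c) -> J p = c.
Proof.
move=> pq cJ h; apply/eqP; rewrite -subr_eq0 -normr_eq0; apply/negPn/negP => n0.
have e0 : 0 < `|J p - c| by rewrite lt_def n0 normr_ge0.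
have /cvgrPdist_lt/(_ _ e0)/nbhs_ballP[d /= d0 hd] := cJ.
have [m [m0 m1 m2]] : exists m : R, [/\ 0 < m, m < d & m < q - p].
  exists (Num.min d (q - p) / 2); split.
  - by rewrite divr_gt0 // lt_min d0 subr_gt0.
  - rewrite ltr_pdivrMr // gt_min; apply/orP; left; lra.
  - rewrite ltr_pdivrMr // gt_min; apply/orP; right; lra.
have := hd (p + m); rewrite /ball /= (h (p + m)) ?ltrDl // -?ltrBrDl //.
rewrite ltxx opprD addrA subrr sub0r normrN gtr0_norm // => H.
by have := H m1.
Qed.

Lemma eq_left_limit (J : R -> R) (p q c : R) : q < p -> {for p, continuous (J : R -> R^o)} ->
  (forall s : R, q < s -> s < p -> J s = c) -> J p = c.
Proof.
move=> pq cJ h.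
rewrite -[p]opprK; apply: (@eq_right_limit (fun x => J (- x)) (- p) (- q)).
- by rewrite ltrN2.
- apply: (@continuous_comp _ _ _ (fun x : R => - x) J); first exact: opp_continuous.
  by rewrite opprK.
by move=> s s1 s2; apply: h; [rewrite ltrNr|rewrite ltrNl].
Qed.

(** The mean is constant in the radius on either side of the exceptional radius [a], continuous in
    the radius, and 0 at radius 0. So it vanishes below [a], at [a], and then above [a]. *)
Lemma mean_zero_Re (g : C -> C) (a rho : R) : 0 < rho < 1 ->
  (forall w, modulus w < 1 -> {for w, continuous (g : C^o -> C^o)}) -> g 0 = 0 ->
  (forall w, 0 < modulus w < 1 -> modulus w != a ->
     exists L, is_derive (w : C^o) (1 : C^o) (g : C^o -> C^o) L) ->
  itvint 0 (2 * pi) (fun y => Re (g (polar rho y))) = 0.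
Proof.
move=> /andP[r0 r1] cg g0 dg.
pose J r := itvint 0 (2 * pi) (fun y => Re (g (polar r y))).
have p0 := twopi_gt0 R.
have cgp (r y : R) : 0 <= r < 1 -> {for (r, y), continuous (fun p => Re (g (polar p.1 p.2)) : R^o)}.
  move=> /andP[q0 q1]; apply: (@cvg_comp _ _ _ (fun p : R * R => g (polar p.1 p.2)) (@complex.Re R) _ (nbhs (g (polar r y) : C^o))); last exact: continuous_Re.
  apply: (@cvg_comp _ _ _ (fun p : R * R => polar p.1 p.2) g _ (nbhs (polar r y : C^o))).
    exact: (@continuous_polar2 (r, y)).
  by apply: cg; rewrite modulus_polar.
have cgN (r y : R) : `|r| < 1 -> {for (r, y), continuous (fun p => Re (g (polar p.1 p.2)) : R^o)}.
  move=> q1; apply: (@cvg_comp _ _ _ (fun p : R * R => g (polar p.1 p.2)) (@complex.Re R) _ (nbhs (g (polar r y) : C^o))); last exact: continuous_Re.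
  apply: (@cvg_comp _ _ _ (fun p : R * R => polar p.1 p.2) g _ (nbhs (polar r y : C^o))).
    exact: (@continuous_polar2 (r, y)).
  by apply: cg; rewrite polarE modulusM modulus_expi mulr1 modulus_real.
have cJ (r : R) : 0 <= r < 1 -> {for r, continuous (J : R -> R^o)}.
  move=> /andP[q0 q1]; apply: (@continuous_itvint_param R (fun p => Re (g (polar p.1 p.2))) r 0 (2 * pi)).
  - exact: ltW.
  - have d0 : 0 < 1 - r by rewrite subr_gt0.
    apply: filterS (nbhsx_ballx r _ d0) => s; rewrite /ball /= => rs.
    apply: citv_for => y _; apply: (@continuous_slice R _ s y (cgN s y _)).
    rewrite ltr_norml; move: rs; rewrite ltr_norml; lra.
  - by move=> y _; apply: cgp; rewrite q0.
have const x1 x2 : 0 < x1 -> x1 < x2 -> x2 < 1 -> (x2 < a) || (a < x1) -> J x2 = J x1.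
  move=> h0 h1 h2 ha.
  have x20 := lt_trans h0 h1.
  have := @mean_const_Re R g (ln x1) (ln x2); rewrite !lnK ?posrE //; apply; first by rewrite ltr_ln ?posrE.
  move=> x y /andP[l1 l2].
  have l3 : x1 <= expR x by rewrite -[x1]lnK ?posrE // ler_expR.
  have l4 : expR x <= x2 by rewrite -[x2]lnK ?posrE // ler_expR.
  apply: dg; rewrite modulus_exp_polar; first by rewrite expR_gt0 (le_lt_trans l4).
  by apply/negP => /eqP ea; case/orP: ha; rewrite -ea ltNge ?l4 ?l3.
have J0 : J 0 = 0.
  rewrite -[RHS](mul0r (2 * pi - 0)) -itvint_cst ?(ltW p0) //; apply: eq_itvint => t _.
  by rewrite polarE mul0r g0.
have step1 r : 0 < r -> r < 1 -> r < a -> J r = 0.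
  move=> h0 h1 h2; rewrite -J0; apply/esym.
  apply: (@eq_right_limit J 0 r) => //; first by apply: cJ; rewrite lexx ltr01.
  by move=> s s0 sr; rewrite (const s r) // h2.
have Ja : 0 <= a -> a < 1 -> J a = 0.
  rewrite le_eqVlt => /orP[/eqP <- //|a0] a1.
  apply: (@eq_left_limit J a 0) => //; first by apply: cJ; rewrite a1 ltW.
  by move=> s s0 sa; apply: step1 => //; exact: lt_trans a1.
have [ra|ar|ra] := ltgtP rho a; first exact: step1.
  have [a0|a0] := ltP a 0.
    rewrite -/(J rho) -J0; apply/esym.
    apply: (@eq_right_limit J 0 rho) => //; first by apply: cJ; rewrite lexx ltr01.
    by move=> s s0 sr; rewrite (const s rho) // (lt_trans a0 s0) orbT.
  rewrite -/(J rho) -[RHS](Ja a0 (lt_trans ar r1)); apply/esym.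
  apply: (@eq_right_limit J a rho) => //; first by apply: cJ; rewrite a0 (lt_trans ar).
  by move=> s s0 sr; rewrite (const s rho) ?s0 ?orbT //; exact: le_lt_trans s0.
by rewrite ra; apply: Ja; rewrite -ra // ltW.
Qed.

End CauchySeries.

Section Cauchy.
Variable R : realType.
Local Notation C := R[i].

Lemma continuous_rotate (g : C -> C) w : {for w, continuous (g : C^o -> C^o)} ->
  {for w, continuous (fun w : C^o => Complex 0 (-1) * g w : C^o)}.
Proof.
move=> h; apply: (@cvg_complex R C (nbhs (w : C^o)) _).
  have -> : (fun t => Re (Complex 0 (-1) * g t)) = (fun t => Im (g t)).
    by apply/funext => t; rewrite ReMc /= mul0r sub0r mulN1r opprK.
  rewrite ReMc /= mul0r sub0r mulN1r opprK; apply: cvg_comp h _; exact: continuous_Im.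
have -> : (fun t => Im (Complex 0 (-1) * g t)) = (fun t => - Re (g t)).
  by apply/funext => t; rewrite ImMc /= mul0r add0r mulN1r.
rewrite ImMc /= mul0r add0r mulN1r; apply: cvgN; apply: cvg_comp h _; exact: continuous_Re.
Qed.

Lemma mean_zero (g : C -> C) (a rho : R) : 0 < rho < 1 ->
  (forall w, modulus w < 1 -> {for w, continuous (g : C^o -> C^o)}) -> g 0 = 0 ->
  (forall w, 0 < modulus w < 1 -> modulus w != a -> derivable (g : C^o -> C^o) (w : C^o) (1 : C^o)) ->
  cint (fun t => g (polar rho t)) = 0.
Proof.
move=> r01 cg g0 dg.
have hg w : 0 < modulus w < 1 -> modulus w != a -> exists L, is_derive (w : C^o) (1 : C^o) (g : C^o -> C^o) L.
  by move=> h1 h2; exists ('D_1 (g : C^o -> C^o) (w : C^o)); apply: DeriveDef => //; exact: dg.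
apply: complex_eqP => /=; first exact: (mean_zero_Re r01 cg g0 hg).
(* The real part of [- i g] is the imaginary part of [g]. *)
have := @mean_zero_Re R (fun w => Complex 0 (-1) * g w) a rho r01.
under eq_itvint => t _ do rewrite ReMc /= mul0r sub0r mulN1r opprK.
apply.
- by move=> w /cg; exact: (@continuous_rotate g w).
- by rewrite g0 mulr0.
- move=> w h1 h2; have [L dL] := hg w h1 h2; exists (Complex 0 (-1) *: (L : C^o)).
  exact: (@is_deriveZ C C^o C^o g (Complex 0 (-1)) w 1 L dL).
Qed.

Definition hol1 (f : C -> C) := forall w, modulus w < 1 -> derivable (f : C^o -> C^o) (w : C^o) (1 : C^o).

Lemma hol1_continuous f w : hol1 f -> modulus w < 1 -> {for w, continuous (f : C^o -> C^o)}.
Proof. by move=> h /h /derivable1_diffP /differentiable_continuous. Qed.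

Section Kernel.
Variables (f : C -> C) (z0 : C).
Hypotheses (hf : hol1 f) (z01 : modulus z0 < 1).

Let L : C := 'D_1 (f : C^o -> C^o) (z0 : C^o).
Let q w := if w == z0 then L else (f w - f z0) / (w - z0).

Let q_derivable w : modulus w < 1 -> w != z0 -> derivable (q : C^o -> C^o) (w : C^o) (1 : C^o).
Proof.
move=> w1 wz.
have d1 : derivable (fun v : C^o => f v - f z0 : C^o) (w : C^o) (1 : C^o).
  by apply: (@derivableB C C^o C^o f (cst (f z0))); [exact: hf|exact: derivable_cst].
have d2 : derivable (fun v : C^o => v - z0 : C^o) (w : C^o) (1 : C^o).
  by apply: (@derivableB C C^o C^o id (cst z0)); [exact: derivable_id|exact: derivable_cst].
have nz : w - z0 != 0 by rewrite subr_eq0.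
have d3 := @derivableV C C^o (fun v : C => v - z0) (w : C^o) (1 : C^o) nz d2.
have d4 := @derivableM C C^o (fun v : C => f v - f z0) _ (w : C^o) (1 : C^o) d1 d3.
apply: (@near_eq_derivable C C^o C^o _ q _ _ _ d4).
have m0 : 0 < modulus (w - z0) by rewrite modulus_gt0.
apply: filterS (near_disc_ball w m0) => v hv.
rewrite /q; case: eqP => [e|_] //.
by move: hv; rewrite e modulusB ltxx.
Qed.

Let q_continuous w : modulus w < 1 -> {for w, continuous (q : C^o -> C^o)}.
Proof.
move=> w1; have [->|wz] := eqVneq w z0; last first.
  by have /derivable1_diffP/differentiable_continuous := q_derivable w1 wz.
have dL : is_derive (z0 : C^o) (1 : C^o) (f : C^o -> C^o) L by apply: DeriveDef => //; exact: hf.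
apply/(@cvgrPdist_le _ C^o _ (nbhs (z0 : C^o)) _) => e /gt0_complex[e' e0 ->].
have [r r0 hr] := derivable_modulus dL e0.
apply: filterS (near_disc_ball z0 r0) => v hv; rewrite lec_modulus.
rewrite {1}/q eqxx /q; case: eqP => [_|/eqP vz]; first by rewrite subrr modulus0 ltW.
have nz : v - z0 != 0 by rewrite subr_eq0.
have m0 : 0 < modulus (v - z0) by rewrite modulus_gt0.
have := hr v hv; rewrite modulusB => H.
by rewrite -(ler_pM2r m0) -modulusM mulrBl divfK.
Qed.

(** Cauchy's formula for [f - f z0]: the integrand is [w * q w] with [q] the difference quotient at
    [z0]. At [z0] itself [q] is only shown to be continuous, which is why [mean_zero] admits an
    exceptional circle; here it is the circle through [z0]. *)
Lemma cint_cauchy rho : 0 < rho < 1 -> modulus z0 < rho ->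
  cint (fun t => (f (polar rho t) - f z0) * (polar rho t / (polar rho t - z0))) = 0.
Proof.
move=> r01 zr.
rewrite -[RHS](@mean_zero (fun w => w * q w) (modulus z0) rho r01).
- apply: eq_cint => t _; rewrite /q; case: eqP => [e|_]; last by rewrite mulrCA.
  by have := zr; rewrite -e modulus_polar ?ltxx // ltW; case/andP: r01.
- move=> w w1; apply: (@continuousM C C^o id q); [exact: cvg_id|exact: q_continuous].
- by rewrite mul0r.
move=> w /andP[w0 w1] wz; apply: (@derivableM C C^o id q); first exact: derivable_id.
by apply: q_derivable => //; apply: contraNneq wz => ->.
Qed.

End Kernel.

Lemma polar_neq0 (rho t : R) : 0 < rho -> polar rho t != 0 :> C.
Proof. by move=> r0; rewrite -modulus_gt0 modulus_polar // ltW. Qed.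

Lemma polarV (rho t : R) k : (polar rho t ^+ k)^-1 = ((rho ^+ k)^-1)%:C%C * expi (- k%:R * t) :> C.
Proof.
rewrite polarE exprMn expiX invfM expiV mulNr; congr (_ * _).
by rewrite -[in RHS]/(real_complex R _) fmorphV rmorphXn.
Qed.

Definition cauchy (f : C -> C) (rho : R) k : C :=
  ((2 * pi)^-1 * (rho ^+ k)^-1)%:C%C * cint (fun t => expi (- k%:R * t) * f (polar rho t)).

Lemma continuous_on_circle f (rho : R) : hol1 f -> 0 <= rho < 1 -> continuous (fun t => f (polar rho t) : C^o).
Proof.
move=> hf /andP[r0 r1] t.
apply: (@cvg_comp _ _ _ (@polar R rho) f _ (nbhs (polar rho t : C^o))).
  exact: continuous_polar.
by apply: hol1_continuous => //; rewrite modulus_polar.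
Qed.

Lemma bounded_on_circle (g : R -> C) : continuous (g : R -> C^o) ->
  exists2 M, 0 <= M & forall t, 0 <= t <= 2 * pi -> modulus (g t) <= M.
Proof.
move=> c; have [M1 h1] := bounded_itv (@citv_Re _ g 0 (2 * pi) c).
have [M2 h2] := bounded_itv (@citv_Im _ g 0 (2 * pi) c).
have h t : 0 <= t <= 2 * pi -> modulus (g t) <= M1 + M2.
  by move=> ht; apply: le_trans (ler_modulus_ReIm _) _; apply: lerD; [exact: h1|exact: h2].
exists (M1 + M2) => //; apply: le_trans (h 0 _); first exact: modulus_ge0.
by rewrite lexx ltW // twopi_gt0.
Qed.

Lemma gconv_geometric (x : C) : modulus x < 1 -> gconv (fun k => x ^+ k) (1 - x)^-1.
Proof.
move=> x1; have x1' : 1 - x != 0.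
  by rewrite subr_eq0; apply: contraTneq x1 => <-; rewrite modulus1 ltxx.
exists (modulus (1 - x)^-1), (modulus x); split; rewrite ?modulus_ge0 ?x1 // => n.
have -> : (1 - x)^-1 - \sum_(k < n) x ^+ k = (1 - x)^-1 * x ^+ n.
  apply: (mulfI x1'); rewrite mulrBr mulVKf // divff //.
  by rewrite -[1 - x]opprB mulNr -subrX1 opprB opprB addrC subrK.
by rewrite modulusM modulusX.
Qed.

(** Expand [polar rho t / (polar rho t - z0)] in [cint_cauchy] as a geometric series and integrate
    termwise. *)
Lemma cauchy_series f (rho : R) z0 : hol1 f -> modulus z0 < rho < 1 ->
  gconv (fun k => cauchy f rho k * z0 ^+ k) (f z0).
Proof.
move=> hf /andP[zr r1].
have r0 : 0 < rho := le_lt_trans (modulus_ge0 _) zr.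
have z1 : modulus z0 < 1 := lt_trans zr r1.
have r01 : 0 < rho < 1 by rewrite r0.
have cf : continuous (fun t => f (polar rho t) : C^o) by apply: continuous_on_circle; rewrite ?r1 ?ltW.
pose h t := f (polar rho t) - f z0.
have ch : continuous (h : R -> C^o).
  by apply: (@continuousDc R _ (fun=> - f z0) cf); exact: cst_continuous.
have [M M0 hM] := bounded_on_circle ch.
pose u k t := h t * ((polar rho t ^+ k)^-1 * z0 ^+ k).
have x01 : 0 <= modulus z0 / rho < 1 by rewrite divr_ge0 ?modulus_ge0 ?ltW //= ltr_pdivrMr // mul1r.
have uE k : u k = (fun t => (z0 ^+ k * ((rho ^+ k)^-1)%:C%C) * (expi (- k%:R * t) * h t)).
  apply/funext => t; rewrite /u polarV.
  by move: (expi _) (h t) (z0 ^+ k) (_%:C%C) => a b c d; ring.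
have ce k : continuous (fun t : R => expi (- k%:R * t) * h t : C^o) by exact: (@continuousMc R _ h (@continuous_expiM R (- k%:R)) ch).
have cef k : continuous (fun t : R => expi (- k%:R * t) * f (polar rho t) : C^o) by exact: (@continuousMc R _ _ (@continuous_expiM R (- k%:R)) cf).
have cu k : continuous (u k : R -> C^o) by rewrite uE; exact: (@continuousZc R _ _ (ce k)).
have q t : modulus (z0 / polar rho t) = modulus z0 / rho by rewrite modulusM modulusV modulus_polar // ltW.
have sE t : h t * (polar rho t / (polar rho t - z0)) = h t * (1 - z0 / polar rho t)^-1.
  have p0 := polar_neq0 t r0; congr (_ * _).
  have -> : 1 - z0 / polar rho t = (polar rho t - z0) / polar rho t by rewrite mulrBl divff.
  by rewrite invfM invrK mulrC.
have cs : continuous (fun t : R => h t * (polar rho t / (polar rho t - z0)) : C^o).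
  apply: (@continuousMc R h _ ch); apply: (@continuousMc R (@polar R rho)); first exact: continuous_polar.
  move=> t; apply: (@cvgV C).
    by rewrite subr_eq0; apply: contraTneq zr => <-; rewrite modulus_polar ?ltxx // ltW.
  by apply: (@cvgB C C^o); [exact: continuous_polar|exact: cvg_cst].
have := @gconv_cint R u _ M (modulus z0 / rho) x01 cu cs.
rewrite cint_cauchy // => H.
have {H} : gconv (fun k => cint (u k)) 0.
  apply: H => [t _|k t ht].
    have g := gconvZ (h t) (@gconv_geometric (z0 / polar rho t) _).
    rewrite sE; move: (g); rewrite q; case/andP: x01 => _ -> /(_ isT).
    rewrite (_ : (fun k => h t * _) = u ^~ t) //; apply/funext => k.
    by rewrite /u exprMn exprVn mulrC [in RHS]mulrC [z0 ^+ k * _]mulrC.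
  rewrite /u modulusM; apply: ler_pM; rewrite ?modulus_ge0 //; first exact: hM.
  by rewrite mulrC -exprVn -exprMn modulusX q.
move=> /(gconvZ ((2 * pi)^-1)%:C%C); rewrite mulr0 => H.
(* Restores the value [f z0] subtracted in [h], which affects the coefficient of index 0 only. *)
pose d k : C := f z0 * (k == 0%N)%:R.
have /(gconvD H) : gconv d (f z0).
  have := @gconv_fin R d 1; rewrite big_ord1 /d eqxx mulr1; apply => -[|k] //.
  by rewrite mulr0.
rewrite add0r; congr (gconv _ _); apply/funext => k.
have cE : continuous (fun t : R => expi (- k%:R * t) : C^o) by exact: continuous_expiM.
have cEf : continuous (fun t : R => - f z0 * expi (- k%:R * t) : C^o) by exact: (continuousZc cE).
have I0 : cint (fun t : R => expi (- k%:R * t)) = (2 * pi)%:C%C * (k == 0%N)%:R.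
  rewrite -cint_expi_expi; apply: eq_cint => t _; by rewrite mul0r expi0 mulr1.
have Ih : cint (fun t => expi (- k%:R * t) * h t) =
    cint (fun t => expi (- k%:R * t) * f (polar rho t)) - f z0 * ((2 * pi)%:C%C * (k == 0%N)%:R).
  rewrite -I0 -mulNr -(@cintZ _ _ _ cE) -(@cintD _ _ _ (cef k) cEf).
  by apply: eq_cint => t _; rewrite /h; move: (expi _) (f _) (f _) => a b c; ring.
rewrite uE (@cintZ _ _ _ (ce k)) Ih /cauchy /d.
have tp : (2 * pi)%:C%C != 0 :> C by rewrite -modulus_gt0 modulus_real normr_gt0 gt_eqF // twopi_gt0.
have eV (x : R) : (x^-1)%:C%C = x%:C%C^-1 :> C by rewrite -[LHS]/(real_complex R _) fmorphV.
have eM : ((2 * pi)^-1 * (rho ^+ k)^-1)%:C%C = ((2 * pi)^-1)%:C%C * ((rho ^+ k)^-1)%:C%C :> C.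
  by rewrite -[LHS]/(real_complex R _) rmorphM.
rewrite eM !eV.
have rk : (rho ^+ k)%:C%C != 0 :> C by rewrite -modulus_gt0 modulus_real normr_gt0 gt_eqF // exprn_gt0.
have key (p r z F I : C) (b : nat) : p != 0 -> r != 0 -> z / r * b%:R = b%:R ->
    p^-1 * (z * r^-1 * (I - F * (p * b%:R))) + F * b%:R = p^-1 * r^-1 * I * z.
  move=> p0 _ zb; transitivity (p^-1 * (z * r^-1 * I) - F * (z / r * b%:R) * (p^-1 * p) + F * b%:R); first ring.
  by rewrite zb mulVf // mulr1 subrK; ring.
apply: key => //; case: (k) => [|k']; last by rewrite mulr0.
by rewrite eqxx mulr1 !expr0 -[1%:C%C]/(1 : C) divr1.
Qed.

End Cauchy.

(** * Power series of holomorphic functions on the bidisc *)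

Section CauchyTwoVariables.
Variable R : realType.
Local Notation C := R[i].

Lemma twopiC_neq0 : (2 * pi)%:C%C != 0 :> C.
Proof. by rewrite -modulus_gt0 modulus_real normr_gt0 gt_eqF // twopi_gt0. Qed.

Lemma real_complexV (x : R) : (x^-1)%:C%C = x%:C%C^-1 :> C.
Proof. by rewrite -[LHS]/(real_complex R _) fmorphV. Qed.

Section At.
Variables (T : topologicalType) (phi psi : T -> C) (x : T).
Hypotheses (cphi : {for x, continuous (phi : T -> C^o)}) (cpsi : {for x, continuous (psi : T -> C^o)}).

Lemma continuousMc_at : {for x, continuous (fun t => phi t * psi t : C^o)}.
Proof. by apply: (@cvgM C); [exact: cphi|exact: cpsi]. Qed.

Lemma continuous_Re_at : {for x, continuous (fun t => Re (phi t) : R^o)}.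
Proof. by apply: cvg_comp cphi _; exact: continuous_Re. Qed.

Lemma continuous_Im_at : {for x, continuous (fun t => Im (phi t) : R^o)}.
Proof. by apply: cvg_comp cphi _; exact: continuous_Im. Qed.

End At.

Lemma ltr_half (rho : R) : 0 < rho -> 0 < rho / 2 < rho.
Proof. by move=> r0; lra. Qed.

(** Integrating against [expi (- j%:R * t)] over a smaller circle isolates the [j]-th term. *)
Lemma pcoef_unique (b : nat -> C) (rho M : R) : 0 < rho -> (forall k, modulus (b k) * rho ^+ k <= M) ->
  (forall z, modulus z < rho -> gconv (fun k => b k * z ^+ k) 0) -> forall j, b j = 0.
Proof.
move=> r0 hb h j; have /andP[] := ltr_half r0; move: (rho / 2) => q q0 qr.
pose u k t := (b k * (q ^+ k)%:C%C) * (expi (- j%:R * t) * expi (k%:R * t)).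
have ce k : continuous (fun t : R => expi (- j%:R * t) * expi (k%:R * t) : C^o).
  exact: (@continuousMc R _ _ (@continuous_expiM R (- j%:R)) (@continuous_expiM R k%:R)).
have cu k : continuous (u k : R -> C^o) by exact: (continuousZc (ce k)).
have uE k t : u k t = expi (- j%:R * t) * (b k * polar q t ^+ k).
  rewrite /u polarE exprMn expiX -[_%:C%C]/(real_complex R _) rmorphXn /=.
  by move: (expi (k%:R * t)) (expi _) (_ ^+ k) => x y z; ring.
have x01 : 0 <= q / rho < 1 by rewrite divr_ge0 ?ltW //= ltr_pdivrMr // mul1r.
have := @gconv_cint R u (fun=> 0) M (q / rho) x01 cu (@cst_continuous _ _ _).
rewrite cint_cst mulr0 => H.
have {H}H : gconv (fun k => cint (u k)) 0.
  apply: H => [t _|k t _].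
    have := gconvZ (expi (- j%:R * t)) (h (polar q t) _).
    rewrite mulr0 modulus_polar ?ltW // => /(_ qr).
    by congr (gconv _ _); apply/funext => k; rewrite uE.
  rewrite uE modulusM modulus_expi mul1r; apply: le_trans (ler_term _ r0 (hb k)) _.
  by rewrite modulus_polar // ltW.
have uJ k : cint (u k) = b k * (q ^+ k)%:C%C * ((2 * pi)%:C%C * (j == k)%:R).
  by rewrite -cint_expi_expi -(cintZ _ (ce k)).
have g : gconv (fun k => cint (u k)) (b j * (q ^+ j)%:C%C * (2 * pi)%:C%C).
  have := @gconv_fin R (fun k => cint (u k)) j.+1.
  have -> : \sum_(k < j.+1) cint (u k) = b j * (q ^+ j)%:C%C * (2 * pi)%:C%C.
    rewrite big_ord_recr /= big1 ?add0r; first by rewrite uJ eqxx mulr1.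
    by move=> i _; rewrite uJ gtn_eqF ?mulr0.
  by apply=> k jk; rewrite uJ ltn_eqF ?mulr0.
have /eqP := gconv_unique g H.
rewrite mulf_eq0 (negPf twopiC_neq0) orbF mulf_eq0.
have /negPf -> : (q ^+ j)%:C%C != 0 :> C by rewrite -modulus_gt0 modulus_real normr_gt0 gt_eqF // exprn_gt0.
by rewrite orbF => /eqP.
Qed.

Lemma cauchy_bound (f : C -> C) (rho M : R) k : 0 < rho -> continuous (fun t => f (polar rho t) : C^o) ->
  (forall t, 0 <= t <= 2 * pi -> modulus (f (polar rho t)) <= M) ->
  modulus (cauchy f rho k) * rho ^+ k <= 2 * M.
Proof.
move=> r0 cf hM; rewrite /cauchy modulusM modulus_real.
have rk : 0 < rho ^+ k by rewrite exprn_gt0.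
have tp := twopi_gt0 R.
rewrite gtr0_norm ?mulr_gt0 ?invr_gt0 //.
have mod1 t : modulus (expi (- k%:R * t) * f (polar rho t)) = modulus (f (polar rho t)).
  by rewrite modulusM modulus_expi mul1r.
have := @cint_bound R (fun t => expi (- k%:R * t) * f (polar rho t)) M
  (@continuousMc R _ _ (@continuous_expiM R (- k%:R)) cf)
  (fun t ht => eq_ind_r (fun x => x <= M) (hM t ht) (mod1 t)).
set I := modulus _ => H.
have -> : (2 * pi)^-1 * (rho ^+ k)^-1 * I * rho ^+ k = I / (2 * pi).
  have key (p x J : R) : 0 < p -> 0 < x -> p^-1 * x^-1 * J * x = J / p by move=> p0 x0; field; rewrite !gt_eqF.
  exact: key.
rewrite ler_pdivrMr //; apply: le_trans H _; rewrite le_eqVlt; apply/orP; left; apply/eqP; ring.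
Qed.

Lemma cauchy_unique (f : C -> C) (rho rho' : R) k : hol1 f -> 0 < rho < 1 -> 0 < rho' < 1 ->
  cauchy f rho k = cauchy f rho' k.
Proof.
move=> hf /andP[r0 r1] /andP[s0 s1].
apply/eqP; rewrite -subr_eq0; apply/eqP; move: k.
have c (r : R) : 0 < r -> r < 1 -> exists2 M, 0 <= M & forall k, modulus (cauchy f r k) * r ^+ k <= M.
  move=> q0 q1; have cf : continuous (fun t => f (polar r t) : C^o) by apply: continuous_on_circle; rewrite ?q1 ?ltW.
  have [M M0 hM] := bounded_on_circle cf.
  by exists (2 * M); [rewrite mulr_ge0|move=> k; exact: cauchy_bound].
have [M M0 hM] := c rho r0 r1; have [N N0 hN] := c rho' s0 s1.
have [m [m0 mr ms]] : exists m, [/\ 0 < m, m <= rho & m <= rho'].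
  by exists (Num.min rho rho'); rewrite lt_min r0 s0 !ge_min !lexx orbT.
have mono (r : R) x K k : 0 <= x -> m <= r -> x * r ^+ k <= K -> x * m ^+ k <= K.
  move=> x0 mr' h; apply: le_trans h; rewrite ler_wpM2l // lerXn2r // nnegrE ltW //; exact: lt_le_trans mr'.
apply: (@pcoef_unique _ m (M + N) m0) => [k|z zm].
  apply: le_trans (ler_wpM2r _ (ler_modulusB _ _)) _; first by rewrite exprn_ge0 // ltW.
  rewrite mulrDl; apply: lerD.
    by apply: (mono rho); rewrite ?modulus_ge0.
  by apply: (mono rho'); rewrite ?modulus_ge0.
have h1 : modulus z < rho < 1 by rewrite r1 (lt_le_trans zm).
have h2 : modulus z < rho' < 1 by rewrite s1 (lt_le_trans zm).
have := gconvB (cauchy_series hf h1) (cauchy_series hf h2).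
by rewrite subrr; congr (gconv _ _); apply/funext => k; rewrite mulrBl.
Qed.

Section Bidisc.
Variable f : C * C -> C.
Hypothesis hf : holomorphic_bidisc f.

Lemma hol1_slice1 w : modulus w < 1 -> hol1 (fun z => f (z, w)).
Proof.
move=> w1 z z1; apply/derivable1_diffP.
have d : differentiable (f : C^o * C^o -> C^o) ((z, w) : C^o * C^o) by apply: hf; apply/bidiscE.
have dp : differentiable (fun x : C^o => (x, w : C^o) : C^o * C^o) (z : C^o).
  by apply: differentiable_pair.
exact: (@differentiable_comp C C^o (C^o * C^o)%type C^o _ f _ dp d).
Qed.

Lemma hol1_slice2 z : modulus z < 1 -> hol1 (fun w => f (z, w)).
Proof.
move=> z1 w w1; apply/derivable1_diffP.
have d : differentiable (f : C^o * C^o -> C^o) ((z, w) : C^o * C^o) by apply: hf; apply/bidiscE.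
have dp : differentiable (fun x : C^o => (z : C^o, x) : C^o * C^o) (w : C^o).
  by apply: differentiable_pair.
exact: (@differentiable_comp C C^o (C^o * C^o)%type C^o _ f _ dp d).
Qed.

Lemma continuous_torus (rho : R) (p : R * R) : 0 <= rho < 1 ->
  {for p, continuous (fun p => f (polar rho p.1, polar rho p.2) : C^o)}.
Proof.
move=> /andP[r0 r1].
have d : differentiable (f : C^o * C^o -> C^o) ((polar rho p.1, polar rho p.2) : C^o * C^o).
  by apply: hf; apply/bidiscE; rewrite /= !modulus_polar.
have c := differentiable_continuous d.
apply: (@cvg_comp _ _ _ (fun p : R * R => (polar rho p.1, polar rho p.2)) f _
  (nbhs ((polar rho p.1, polar rho p.2) : C^o * C^o))) => //.
move=> A [[B D] [/= nB nD] BD].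
have c1 : \forall q \near p, B (polar rho q.1).
  have : {for p, continuous (fun q : R * R => polar rho q.1 : C^o)}.
    by apply: (@continuous_comp _ _ _ fst); [exact: cvg_fst|exact: continuous_polar].
  by move=> /(_ B nB).
have c2 : \forall q \near p, D (polar rho q.2).
  have : {for p, continuous (fun q : R * R => polar rho q.2 : C^o)}.
    by apply: (@continuous_comp _ _ _ snd); [exact: cvg_snd|exact: continuous_polar].
  by move=> /(_ D nD).
by apply: filterS2 c1 c2 => q h1 h2; apply: BD.
Qed.

Lemma continuous_cauchy_slice (rho : R) n : 0 < rho < 1 ->
  continuous (fun s => cauchy (fun w => f (polar rho s, w)) rho n : C^o).
Proof.
move=> /andP[r0 r1].
have r01 : 0 <= rho < 1 by rewrite r1 ltW.
pose G (p : R * R) : C := expi (- n%:R * p.2) * f (polar rho p.1, polar rho p.2).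
have cG p : {for p, continuous (G : R * R -> C^o)}.
  have c1 : {for p, continuous (fun p : R * R => expi (- n%:R * p.2) : C^o)}.
    by apply: (@cvg_comp _ _ _ snd (fun t : R => expi (- n%:R * t)) _ (nbhs p.2)); [exact: cvg_snd|exact: continuous_expiM].
  exact: (continuousMc_at c1 (@continuous_torus rho p r01)).
have cR p : {for p, continuous (fun p => Re (G p) : R^o)}.
  exact: (continuous_Re_at (cG p)).
have cI p : {for p, continuous (fun p => Im (G p) : R^o)}.
  exact: (continuous_Im_at (cG p)).
have tp := ltW (twopi_gt0 R).
have c : continuous (fun s => cint (fun t => G (s, t)) : C^o).
  move=> s; apply: (@cvg_complex R R (nbhs s) _).
    apply: (@continuous_itvint_param R (fun p => Re (G p)) s 0 (2 * pi) tp) => //.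
    by apply: filterS (@filterT _ (nbhs s) _) => x _; apply: citv_for => y _; exact: (@continuous_slice R _ x y (cR (x, y))).
  apply: (@continuous_itvint_param R (fun p => Im (G p)) s 0 (2 * pi) tp) => //.
  by apply: filterS (@filterT _ (nbhs s) _) => x _; apply: citv_for => y _; exact: (@continuous_slice R _ x y (cI (x, y))).
exact: (continuousZc c).
Qed.

Definition bidisc_coef (rho : R) m n : C := cauchy (fun z => cauchy (fun w => f (z, w)) rho n) rho m.

Local Notation A := bidisc_coef.

Lemma torus_bound (rho : R) : 0 < rho < 1 ->
  exists2 M, 0 <= M & forall s t, 0 <= s <= 2 * pi -> 0 <= t <= 2 * pi ->
    modulus (f (polar rho s, polar rho t)) <= M.
Proof.
move=> /andP[r0 r1].
have r01 : 0 <= rho < 1 by rewrite r1 ltW.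
have cR p : {for p, continuous (fun p => Re (f (polar rho p.1, polar rho p.2)) : R^o)}.
  exact: (continuous_Re_at (@continuous_torus rho p r01)).
have cI p : {for p, continuous (fun p => Im (f (polar rho p.1, polar rho p.2)) : R^o)}.
  exact: (continuous_Im_at (@continuous_torus rho p r01)).
have [M1 h1] := @bounded_rect R _ 0 (2 * pi) 0 (2 * pi) (fun x y _ _ => cR (x, y)).
have [M2 h2] := @bounded_rect R _ 0 (2 * pi) 0 (2 * pi) (fun x y _ _ => cI (x, y)).
have h s t : 0 <= s <= 2 * pi -> 0 <= t <= 2 * pi -> modulus (f (polar rho s, polar rho t)) <= M1 + M2.
  by move=> hs ht; apply: le_trans (ler_modulus_ReIm _) _; apply: lerD; [exact: h1|exact: h2].
have z0 : 0 <= (0 : R) <= 2 * pi by rewrite lexx ltW // twopi_gt0.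
by exists (M1 + M2) => //; apply: le_trans (h 0 0 z0 z0); exact: modulus_ge0.
Qed.

Lemma bidisc_coef_bound (rho : R) : 0 < rho < 1 ->
  exists2 M, 0 <= M & forall m n, modulus (A rho m n) * rho ^+ m * rho ^+ n <= M.
Proof.
move=> r01; have [M M0 hM] := torus_bound r01.
have /andP[r0 r1] := r01; have r01' : 0 <= rho < 1 by rewrite r1 ltW.
have rn n : 0 < rho ^+ n by rewrite exprn_gt0.
exists (2 * (2 * M)) => [|m n]; first by rewrite !mulr_ge0.
rewrite -ler_pdivlMr // -mulrA.
apply: (@cauchy_bound (fun z => cauchy (fun w => f (z, w)) rho n)) => //.
  exact: continuous_cauchy_slice.
move=> s hs; rewrite ler_pdivlMr //; apply: cauchy_bound => // [|t ht]; last exact: hM.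
by apply: (continuous_on_circle (hol1_slice2 _) r01'); rewrite modulus_polar // ltW.
Qed.

(** For each point of the circle in the first variable, expand in the second by the one-variable
    theorem; the coefficients are bounded uniformly along the circle, so the series may be
    integrated termwise. *)
Lemma cauchy_slice_series (rho : R) m w : 0 < rho < 1 -> modulus w < rho ->
  gconv (fun n => A rho m n * w ^+ n) (cauchy (fun z => f (z, w)) rho m).
Proof.
move=> r01 wr; have /andP[r0 r1] := r01; have r01' : 0 <= rho < 1 by rewrite r1 ltW.
have [M M0 hM] := torus_bound r01.
have w1 := lt_trans wr r1.
pose B n s := cauchy (fun w => f (polar rho s, w)) rho n.
have cB n : continuous (B n : R -> C^o) by exact: continuous_cauchy_slice.
have cE : continuous (fun t : R => expi (- m%:R * t) : C^o) by exact: continuous_expiM.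
have ceB n : continuous (fun t : R => expi (- m%:R * t) * B n t : C^o) by exact: (continuousMc cE (cB n)).
have cf : continuous (fun t : R => f (polar rho t, w) : C^o).
  exact: (continuous_on_circle (hol1_slice1 w1) r01').
have cef : continuous (fun t : R => expi (- m%:R * t) * f (polar rho t, w) : C^o) by exact: (continuousMc cE cf).
pose u n t := w ^+ n * (expi (- m%:R * t) * B n t).
have cu n : continuous (u n : R -> C^o) by exact: (continuousZc (ceB n)).
have x01 : 0 <= modulus w / rho < 1 by rewrite divr_ge0 ?modulus_ge0 ?ltW //= ltr_pdivrMr // mul1r.
have H : gconv (fun n => cint (u n)) (cint (fun t : R => expi (- m%:R * t) * f (polar rho t, w))).
  apply: (@gconv_cint R u _ (2 * M) (modulus w / rho) x01 cu cef) => [t _|n t ht].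
    have h2 : modulus w < rho < 1 by rewrite wr.
    have pr : modulus (polar rho t) < 1 by rewrite modulus_polar // ltW.
    have := gconvZ (expi (- m%:R * t)) (cauchy_series (hol1_slice2 pr) h2).
    congr (gconv _ _); apply/funext => n; rewrite /u /B.
    by move: (cauchy _ _ _) (expi _) (w ^+ n) => a b c; ring.
  rewrite /u modulusM modulusM modulus_expi mul1r mulrC modulusX.
  have rn : 0 < rho ^+ n by rewrite exprn_gt0.
  rewrite expr_div_n mulrA [leRHS]mulrAC ler_wpM2r ?exprn_ge0 ?modulus_ge0 // ler_pdivlMr //.
  have pr : modulus (polar rho t) < 1 by rewrite modulus_polar // ltW.
  have cft := continuous_on_circle (hol1_slice2 pr) r01'.
  exact: (@cauchy_bound (fun w => f (polar rho t, w)) rho M n r0 cft (fun t' => hM t t' ht)).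
have := gconvZ (((2 * pi)^-1 * (rho ^+ m)^-1)%:C%C) H.
congr (gconv _ _); apply/funext => n; rewrite (@cintZ _ _ _ (ceB n)).
have -> : A rho m n = ((2 * pi)^-1 * (rho ^+ m)^-1)%:C%C * cint (fun t : R => expi (- m%:R * t) * B n t) by [].
by move: (cint _) (_%:C%C) (w ^+ n) => a b c; ring.
Qed.

Lemma bidisc_coef_unique (rho rho' : R) m n : 0 < rho < 1 -> 0 < rho' < 1 -> A rho m n = A rho' m n.
Proof.
move=> r01 s01; apply/eqP; rewrite -subr_eq0; apply/eqP; move: n.
have /andP[r0 r1] := r01; have /andP[s0 s1] := s01.
have [M M0 hM] := bidisc_coef_bound r01; have [N N0 hN] := bidisc_coef_bound s01.
have [q [q0 qr qs]] : exists q, [/\ 0 < q, q <= rho & q <= rho'].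
  by exists (Num.min rho rho'); rewrite lt_min r0 s0 !ge_min !lexx orbT.
have mono (r : R) x K k : 0 <= x -> q <= r -> x * r ^+ k <= K -> x * q ^+ k <= K.
  move=> x0 mr' h; apply: le_trans h; rewrite ler_wpM2l // lerXn2r // nnegrE ltW //; exact: lt_le_trans mr'.
apply: (@pcoef_unique _ q (M / rho ^+ m + N / rho' ^+ m) q0) => [n|w wq].
  apply: le_trans (ler_wpM2r _ (ler_modulusB _ _)) _; first by rewrite exprn_ge0 // ltW.
  rewrite mulrDl; apply: lerD.
    by apply: (mono rho); rewrite ?modulus_ge0 // ler_pdivlMr ?exprn_gt0 // mulrAC.
  by apply: (mono rho'); rewrite ?modulus_ge0 // ler_pdivlMr ?exprn_gt0 // mulrAC.
have w1 := lt_trans (lt_le_trans wq qr) r1.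
have := gconvB (cauchy_slice_series m r01 (lt_le_trans wq qr)) (cauchy_slice_series m s01 (lt_le_trans wq qs)).
rewrite (@cauchy_unique _ rho rho' m (hol1_slice1 w1) r01 s01) subrr.
by congr (gconv _ _); apply/funext => k; rewrite mulrBl.
Qed.

Theorem holomorphic_bidisc_series :
  exists2 a, pcoef2 a & forall z, bidisc z -> f z = psum2 a z.
Proof.
have h01 : 0 < (2^-1 : R) < 1 by lra.
(* The radius 1/2 is arbitrary: at a given point a larger radius [r] is used, and the coefficients
   do not depend on the radius. *)
exists (A 2^-1) => [r r01|z /bidiscE[z1 z2]].
  have [M _ hM] := bidisc_coef_bound r01; exists M => m n.
  by rewrite (bidisc_coef_unique m n h01 r01).
have [r [r0 r1 zr1 zr2]] := exists_radius z1 z2.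
have r01 : 0 < r < 1 by rewrite r0.
case: z z1 z2 zr1 zr2 => z w /= z1 w1 zr wr.
have zr1 : modulus z < r < 1 by rewrite zr.
rewrite /psum2 /=; apply/esym; apply: psumE.
have := cauchy_series (hol1_slice1 w1) zr1.
congr (gconv _ _); apply/funext => m; congr (_ * _); apply/esym; apply: psumE.
have -> : (fun n => A 2^-1 m n * w ^+ n) = (fun n => A r m n * w ^+ n).
  by apply/funext => n; rewrite (bidisc_coef_unique m n h01 r01).
exact: cauchy_slice_series.
Qed.

End Bidisc.

End CauchyTwoVariables.

(** * Integration over the disc *)

Section AffineInvariance.
Variable R : realType.
Local Notation leb := (@lebesgue_measure R).
Local Open Scope ereal_scope.

Lemma affine_preimage (c a : R) (x y : R) : (0 < c)%R ->
  (fun t => c * t + a)%R @^-1` `]x, y] = `](x - a) / c, (y - a) / c]%classic%R.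
Proof.
move=> c0; apply/seteqP; split => t /=; rewrite !in_itv /=;
  by rewrite ltr_pdivrMr // ler_pdivlMr // ltrBlDr lerBrDr mulrC.
Qed.

Lemma measurable_affine (c a : R) : measurable_fun setT (fun t : R => c * t + a)%R.
Proof. by apply: measurable_funD => //; exact: measurable_funM. Qed.

Lemma lebesgue_affine (c a : R) (c0 : (0 < c)%R) (A : set (measurableTypeR R)) : measurable A ->
  leb A = c%:E * leb ((fun t : R => c * t + a)%R @^-1` A).
Proof.
move=> mA.
pose phi (t : measurableTypeR R) : measurableTypeR R := (c * t + a)%R.
have mphi : measurable_fun setT phi by exact: measurable_affine.
pose m := [the measure _ _ of pushforward leb phi].
apply: (lebesgue_measure_unique (mu := [the measure _ _ of mscale (NngNum (ltW c0)) (m mphi)])) => //.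
move=> _ [[x y]] _ <- /=.
rewrite /mscale /= /pushforward affine_preimage // !lebesgue_measure_itv /= !lte_fin.
rewrite ltr_pM2r ?invr_gt0 // ltrD2r; case: ifP => _; last by rewrite mule0.
by rewrite -!EFinD -EFinM; congr EFin; field; rewrite gt_eqF.
Qed.

Lemma ge0_integral_affine (c a : R) (f : measurableTypeR R -> \bar R) : (0 < c)%R -> measurable_fun setT f ->
  (forall x, 0 <= f x) ->
  \int[leb]_x f x = c%:E * \int[leb]_x f (c * x + a)%R.
Proof.
move=> c0 mf f0.
pose phi (t : measurableTypeR R) : measurableTypeR R := (c * t + a)%R.
have mphi : measurable_fun setT phi by exact: measurable_affine.
pose m := [the measure _ _ of pushforward leb phi].
rewrite (eq_measure_integral [the measure _ _ of mscale (NngNum (ltW c0)) (m mphi)]); last first.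
  by move=> A mA _; exact: (@lebesgue_affine c a c0).
rewrite ge0_integral_mscale //=; congr (_ * _).
by rewrite ge0_integral_pushforward.
Qed.

Local Notation T := (measurableTypeR R).
Local Notation leb2 := (leb \x leb).
Implicit Types f : T * T -> \bar R.

Lemma measurable_slice1 f y : measurable_fun setT f -> measurable_fun setT (fun x => f (x, y)).
Proof. by move=> mf; apply: (measurableT_comp mf); apply: measurable_fun_pair. Qed.

Lemma measurable_slice2 f x : measurable_fun setT f -> measurable_fun setT (fun y => f (x, y)).
Proof. by move=> mf; apply: (measurableT_comp mf); apply: measurable_fun_pair. Qed.

Lemma measurable_lin (a b : R) : measurable_fun setT (fun p : T * T => (a * p.1 + b * p.2)%R : T).
Proof.
by apply: measurable_funD; apply: measurable_funM.
Qed.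

Definition lin2 (a b c d : R) (p : T * T) : T * T := (a * p.1 + b * p.2, c * p.1 + d * p.2)%R.

Lemma measurable_lin2 a b c d : measurable_fun setT (lin2 a b c d).
Proof. by apply: measurable_fun_pair; exact: measurable_lin. Qed.

Lemma measurable_comp_lin2 f a b c d : measurable_fun setT f -> measurable_fun setT (f \o lin2 a b c d).
Proof. by move=> mf; apply: measurableT_comp => //; exact: measurable_lin2. Qed.

Lemma integral_shear1 f c : measurable_fun setT f -> (forall p, 0 <= f p) ->
  \int[leb2]_p f p = \int[leb2]_p f (lin2 1 c 0 1 p).
Proof.
move=> mf f0; rewrite fubini_tonelli2 // [RHS]fubini_tonelli2 //; last exact: measurable_comp_lin2.
apply: eq_integral => y _; rewrite /fubini_G (@ge0_integral_affine 1 (c * y)%R) //.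
  rewrite mul1e; apply: eq_integral => x _; by rewrite /lin2 /= mul0r add0r !mul1r.
exact: measurable_slice1.
Qed.

Lemma integral_shear2 f c : measurable_fun setT f -> (forall p, 0 <= f p) ->
  \int[leb2]_p f p = \int[leb2]_p f (lin2 1 0 c 1 p).
Proof.
move=> mf f0; rewrite fubini_tonelli1 // [RHS]fubini_tonelli1 //; last exact: measurable_comp_lin2.
apply: eq_integral => x _; rewrite /fubini_F (@ge0_integral_affine 1 (c * x)%R) //.
  rewrite mul1e; apply: eq_integral => y _; by rewrite /lin2 /= mul0r addr0 !mul1r addrC.
exact: measurable_slice2.
Qed.

Lemma integral_dilation f (r : R) : (0 < r)%R -> measurable_fun setT f -> (forall p, 0 <= f p) ->
  \int[leb2]_p f p = (r ^+ 2)%:E * \int[leb2]_p f (lin2 r 0 0 r p).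
Proof.
move=> r0 mf f0; rewrite fubini_tonelli1 // [in RHS]fubini_tonelli1 //; last exact: measurable_comp_lin2.
have mF : measurable_fun setT (fubini_F leb f) by exact: measurable_fun_fubini_tonelli_F.
rewrite (@ge0_integral_affine r 0 _ r0 mF) => [|x]; last exact: integral_ge0.
rewrite expr2 EFinM -muleA; congr (_ * _).
rewrite -ge0_integralZl //; last 3 first.
- apply: (@measurable_fun_fubini_tonelli_F _ _ _ _ _ _ (f \o lin2 r 0 0 r)) => //.
  exact: measurable_comp_lin2.
- by move=> x; exact: f0.
- by move=> x _; exact: integral_ge0.
- by rewrite lee_fin ltW.
apply: eq_integral => x _; rewrite /fubini_F (@ge0_integral_affine r 0) //; last exact: measurable_slice2.
by congr (_ * _); apply: eq_integral => y _; rewrite /lin2 /= !mul0r !addr0 add0r.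
Qed.

Lemma lin2_comp a b c d a' b' c' d' p : lin2 a b c d (lin2 a' b' c' d' p) =
  lin2 (a * a' + b * c') (a * b' + b * d') (c * a' + d * c') (c * b' + d * d') p.
Proof. by rewrite /lin2 /=; congr (_, _); ring. Qed.

(** A rotation is a product of three shears with parameters [- t], [s], [- t], where [t] is the
    tangent of half the angle. Each shear preserves the integral by Tonelli and translation
    invariance. *)
Let rotation_shears f c s : (c ^+ 2 + s ^+ 2 = 1)%R -> (1 + c != 0)%R ->
  measurable_fun setT f -> (forall p, 0 <= f p) ->
  \int[leb2]_p f p = \int[leb2]_p f (lin2 c (- s) s c p).
Proof.
move=> cs c1 mf f0; pose t := (s / (1 + c))%R.
have st : (s * t = 1 - c)%R.
  by rewrite /t mulrA -expr2; apply: (mulIf c1); rewrite divfK //; move: cs => /eqP; rewrite -subr_eq0 => /eqP cs; apply/eqP; rewrite -subr_eq0 -[eqbRHS]cs; apply/eqP; ring.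
have tc : (t * (1 + c) = s)%R by rewrite /t divfK.
have m1 : measurable_fun setT (f \o lin2 1 (- t) 0 1) by exact: measurable_comp_lin2.
have m2 : measurable_fun setT (f \o lin2 1 (- t) 0 1 \o lin2 1 0 s 1) by exact: (measurable_comp_lin2 _ _ _ _ m1).
rewrite (integral_shear1 (- t) mf f0) (integral_shear2 s m1 (fun p => f0 _)).
rewrite (integral_shear1 (- t) m2 (fun p => f0 _)).
apply: eq_integral => p _ /=; rewrite !lin2_comp; congr (f (lin2 _ _ _ _ p)).
- by rewrite -[RHS](subKr 1)%R -st; ring.
- by rewrite -[in RHS]tc; transitivity (- t * (1 + (1 - s * t)))%R; [ring|rewrite st; ring].
- by ring.
- by rewrite -[RHS](subKr 1)%R -st; ring.
Qed.

Lemma integral_rotation f (t : R) : measurable_fun setT f -> (forall p, 0 <= f p) ->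
  \int[leb2]_p f p = \int[leb2]_p f (lin2 (cos t) (- sin t) (sin t) (cos t) p).
Proof.
move=> mf f0.
(* The three shears do not exist for the half turn, where [cos t = -1]; it is composed of two
   rotations by [t / 2], whose cosine is 0. *)
have [c1|c1] := eqVneq (1 + cos t)%R 0%R; last by apply: rotation_shears => //; exact: cos2Dsin2.
have ct : (cos t = cos (t / 2) ^+ 2 - sin (t / 2) ^+ 2)%R.
  by rewrite {1}[t]splitr cosD -!expr2.
have st : (sin t = 2 * cos (t / 2) * sin (t / 2))%R.
  by rewrite {1}[t]splitr sinD; ring.
have h1 := cos2Dsin2 (t / 2).
have c2 : (cos (t / 2) = 0)%R.
  apply/eqP; rewrite -sqrf_eq0; apply/eqP; move: c1; rewrite ct; move: h1.
  move: (cos _ ^+ 2)%R (sin _ ^+ 2)%R => x y; lra.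
have nz : (1 + cos (t / 2) != 0)%R by rewrite c2 addr0 oner_eq0.
rewrite (rotation_shears h1 nz mf f0) (rotation_shears h1 nz (measurable_comp_lin2 _ _ _ _ mf) (fun p => f0 _)).
apply: eq_integral => p _ /=; rewrite lin2_comp ct st; congr (f (lin2 _ _ _ _ p)); ring.
Qed.

End AffineInvariance.

(** * The area of the unit disc *)

Section DiscArea.
Variable R : realType.
Local Notation leb := (@lebesgue_measure R).
Local Notation T := (measurableTypeR R).
Local Notation leb2 := (leb \x leb)%E.

Definition disc : set (T * T) := [set p | p.1 ^+ 2 + p.2 ^+ 2 < 1].

Lemma measurable_sqr (D : set (T * T)) : measurable_fun D (fun p : T * T => p.1 ^+ 2 + p.2 ^+ 2 : T).
Proof.
apply: measurable_funTS.
by apply: measurable_funD; apply: measurable_funX.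
Qed.

Lemma measurable_disc : measurable disc.
Proof.
have := @measurable_sqr setT measurableT `]-oo, 1[%classic (measurable_itv _).
rewrite setTI; congr measurable; apply/seteqP; split => p /=; by rewrite in_itv.
Qed.

Lemma xsection_disc (x : R) : xsection disc x = `]- Num.sqrt (1 - x ^+ 2), Num.sqrt (1 - x ^+ 2)[%classic.
Proof.
apply/seteqP; split => y; rewrite /xsection /= inE /disc /= in_itv /=.
  move=> h; have h1 : y ^+ 2 < 1 - x ^+ 2 by lra.
  have h2 : 0 < 1 - x ^+ 2 by apply: le_lt_trans h1; exact: sqr_ge0.
  rewrite -ltr_norml -sqrtr_sqr ltr_sqrt //.
rewrite -ltr_norml => h.
have s0 : 0 < Num.sqrt (1 - x ^+ 2) by apply: le_lt_trans h.
have h2 : 0 < 1 - x ^+ 2 by rewrite -sqrtr_gt0.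
have : `|y| ^+ 2 < Num.sqrt (1 - x ^+ 2) ^+ 2 by rewrite ltrXn2r // nnegrE ?sqrtr_ge0.
rewrite sqr_sqrtr ?ltW // real_normK ?num_real //; lra.
Qed.

Lemma leb2_disc_integral : leb2 disc = (\int[leb]_(x in `[(-1)%R, 1%R]%classic) (2 * Num.sqrt (1 - x ^+ 2))%:E)%E.
Proof.
rewrite /product_measure1 [RHS]integral_mkcond; apply: eq_integral => x _ /=.
rewrite xsection_disc lebesgue_measure_itv /= lte_fin /patch mem_setE in_itv /=.
have s0 := sqrtr_ge0 (1 - x ^+ 2).
have -> : (if - Num.sqrt (1 - x ^+ 2) < Num.sqrt (1 - x ^+ 2)
   then ((Num.sqrt (1 - x ^+ 2))%:E + (- - Num.sqrt (1 - x ^+ 2))%:E)%E else 0%E) =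
   (2 * Num.sqrt (1 - x ^+ 2))%:E.
  case: ifP => [_|/negbT]; first by rewrite -EFinD; congr EFin; ring.
  rewrite -leNgt => h; congr EFin; move: h s0; set s := Num.sqrt _; lra.
case: ifP => // /negbT; rewrite -ler_norml -ltNge => h.
have -> : Num.sqrt (1 - x ^+ 2) = 0.
  apply: ler0_sqrtr; rewrite subr_le0 -[x ^+ 2]real_normK ?num_real // expr_ge1 //; exact: ltW.
by rewrite mulr0.
Qed.

Lemma itvint_sqrt : itvint (-1) 1 (fun x : R => 2 * Num.sqrt (1 - x ^+ 2)) = pi.
Proof.
have p2 : 0 < pi / 2 :> R by rewrite divr_gt0 // pi_gt0.
have cG : continuous (fun x : R => 2 * Num.sqrt (1 - x ^+ 2) : R^o).
  move=> x; apply: cvgM; first exact: cvg_cst.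
  apply: (@cvg_comp _ _ _ (fun x : R => 1 - x ^+ 2) (@Num.sqrt R) _ (nbhs (1 - x ^+ 2))); last exact: sqrt_continuous.
  by apply: cvgB; [exact: cvg_cst|exact: exprn_continuous].
have dsin : derive1 (@sin R) = @cos R.
  by apply/funext => x; rewrite derive1E; have [_ ->] := is_derive_sin x.
have sN : sin (- (pi / 2)) = -1 :> R by rewrite sinN sin_pihalf.
have := @integration_by_substitution_increasing R (@sin R) (fun x : R => 2 * Num.sqrt (1 - x ^+ 2)) (- (pi / 2)) (pi / 2).
rewrite sN sin_pihalf dsin => /(_ _ _ _ _ _ _ _)H.
rewrite /itvint /Rintegral H.
- transitivity (itvint (- (pi / 2)) (pi / 2) (fun t : R => 1 + cos (2 * t))).
    apply: eq_itvint => t /andP[t1 t2] /=.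
    have c0 : 0 <= cos t by apply: cos_ge0_pihalf; rewrite t1.
    rewrite -[LHS]/(2 * Num.sqrt (1 - sin t ^+ 2) * cos t) -cos2sin2 sqrtr_sqr ger0_norm // -mulrA -expr2.
    have -> : cos (2 * t) = cos t ^+ 2 - sin t ^+ 2 by rewrite mulr_natl mulr2n cosD -!expr2.
    by have := cos2Dsin2 t; move: (cos t ^+ 2) (sin t ^+ 2) => c s; lra.
  have dF (t : R) : is_derive (t : R^o) (1 : R^o) ((fun t => t + 2^-1 * sin (2 * t)) : R^o -> R^o) (1 + cos (2 * t)).
    have d1 : is_derive (t : R^o) (1 : R^o) (fun t : R^o => 2 *: t) (2 *: 1) by exact: is_deriveZ.
    have d2 := @is_derive1_comp _ (@sin R) (fun t : R => 2 * t) t _ _ (is_derive_sin _) d1.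
    have d3 := @is_deriveZ _ _ _ _ (2^-1 : R) _ _ _ d2.
    have := @is_deriveD _ _ _ _ _ _ _ _ _ (is_derive_id (t : R^o) (1 : R^o)) d3.
    suff -> : 1 + 2^-1 *: (cos (2 * t) * 2%:A) = 1 + cos (2 * t) :> R^o by [].
    by congr (_ + _); rewrite -[2%:A]/(2 * 1) -[LHS]/(2^-1 * (cos (2 * t) * (2 * 1))); field.
  have cf : continuous (fun t : R => 1 + cos (2 * t) : R^o).
    by move=> t; apply: cvgD; [exact: cvg_cst|exact: continuous_cosM].
  rewrite (itvint_deriv _ cf dF); last by lra.
  rewrite mulrN sinN mulrCA divff ?mulr1 // sinpi; lra.
- by lra.
- by move=> x y xi yi; rewrite ltr_sin.
- by move=> x _; exact: continuous_cos.
- by apply/cvg_ex; exists (cos (- (pi / 2))); apply: cvg_at_right_filter; exact: continuous_cos.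
- by apply/cvg_ex; exists (cos (pi / 2)); apply: cvg_at_left_filter; exact: continuous_cos.
- split; first by move=> x _; exact: derivable_sin.
  + by apply: cvg_at_right_filter; exact: continuous_sin.
  + by apply: cvg_at_left_filter; exact: continuous_sin.
- exact: continuous_subspaceT.
Qed.

Lemma leb2_disc : leb2 disc = (pi%:E)%E.
Proof.
have cG : continuous (fun x : R => 2 * Num.sqrt (1 - x ^+ 2) : R^o).
  move=> x; apply: cvgM; first exact: cvg_cst.
  apply: (@cvg_comp _ _ _ (fun x : R => 1 - x ^+ 2) (@Num.sqrt R) _ (nbhs (1 - x ^+ 2))); last exact: sqrt_continuous.
  by apply: cvgB; [exact: cvg_cst|exact: exprn_continuous].
rewrite leb2_disc_integral -itvint_sqrt /itvint /Rintegral fineK //.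
by apply: integrable_fin_num => //; exact: citv_integrable (citvT cG).
Qed.

End DiscArea.

(** * Parseval's identity on circles *)

Section Parseval.
Variable R : realType.
Local Notation C := R[i].
Local Notation leb := (@lebesgue_measure R).

Lemma real_complexM (x y : R) : (x * y)%:C%C = x%:C%C * y%:C%C :> C.
Proof. by rewrite -[LHS]/(real_complex R _) rmorphM. Qed.

Lemma gconv_nneseries (v : nat -> R) (s : C) : (forall k, 0 <= v k) ->
  gconv (fun k => (v k)%:C%C) s -> (\sum_(0 <= k <oo) (v k)%:E = (Re s)%:E)%E.
Proof.
move=> v0 [K [x [K0 /andP[x0 x1] h]]].
apply: cvg_lim => //.
have -> : (fun n => \sum_(0 <= k < n) (v k)%:E)%E = EFin \o (fun n => \sum_(k < n) v k).
  by apply/funext => n; rewrite /= sumEFin big_mkord.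
apply: cvg_EFin; first exact: nearW.
rewrite [X in X @ _ --> _](_ : _ = (fun n => \sum_(k < n) v k)); last by apply/funext.
have c0 : K * x ^+ n @[n --> \oo] --> (0 : R).
  rewrite -[X in _ --> X](mulr0 K); apply: cvgM; first exact: cvg_cst.
  by apply: cvg_expr; rewrite ger0_norm.
apply/cvgrPdist_le => e e0.
have /cvgrPdist_le/(_ _ e0) := c0; apply: filterS => n; rewrite sub0r normrN => hn.
apply: le_trans (le_trans (ler_norm _) hn); apply: le_trans (h n).
apply: le_trans (ler_Re_modulus _); rewrite ReB Re_sum /=.
by [].
Qed.

Lemma continuous_conj (T : topologicalType) (phi : T -> C) : continuous (phi : T -> C^o) ->
  continuous (fun t => (phi t)^*%C : C^o).
Proof.
move=> c t; apply: (@cvg_complex R T (nbhs t) _); rewrite ?ReJ ?ImJ.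
  under eq_fun do rewrite ReJ; exact: (continuous_Re_at (c t)).
under eq_fun do rewrite ImJ; apply: cvgN; exact: (continuous_Im_at (c t)).
Qed.

Lemma cint_conj (phi : R -> C) : continuous (phi : R -> C^o) -> cint (fun t => (phi t)^*%C) = (cint phi)^*%C.
Proof.
move=> c; apply: complex_eqP; rewrite ?ReJ ?ImJ /=.
  by apply: eq_itvint => t _; rewrite ReJ.
rewrite -[RHS]mulN1r -itvintZ; last exact: citv_Im.
by apply: eq_itvint => t _; rewrite ImJ mulN1r.
Qed.

Lemma hol1_psum (b : nat -> C) : pcoef b -> hol1 (psum b).
Proof. by move=> pb w w1; have [] := is_derive_psum pb w1. Qed.

Section Coefficients.
Variables (b : nat -> C) (z : C).
Hypotheses (pb : pcoef b) (z1 : modulus z < 1).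

Let F t : C := psum b (expi t * z).

Lemma modulus_rotate (w : C) t : modulus (expi t * w) = modulus w.
Proof. by rewrite modulusM modulus_expi mul1r. Qed.

Lemma continuous_psum_circle : continuous (F : R -> C^o).
Proof.
move=> t; apply: (@cvg_comp _ _ _ (fun t : R => expi t * z) (psum b) _ (nbhs (expi t * z : C^o))).
  have : continuous (fun t : R => expi t * z : C^o).
    by apply: (@continuousMc R (@expi R) (fun=> z)); [exact: continuous_expi|exact: cst_continuous].
  exact.
by apply: hol1_continuous; [exact: hol1_psum|rewrite modulus_rotate].
Qed.

Let bound : exists M x, [/\ 0 <= x < 1 & forall k, modulus (b k * z ^+ k) <= M * x ^+ k].
Proof.
have [r [/andP[r0 r1] zr]] := exists_between z1.
have [M hM] : exists M, forall k, modulus (b k) * r ^+ k <= M by apply: pb; rewrite r0.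
by exists M, (modulus z / r); split; [exact: ratio01|move=> k; exact: ler_term].
Qed.

Lemma cint_psum_coef j : cint (fun t => expi (- j%:R * t) * F t) = (2 * pi)%:C%C * (b j * z ^+ j).
Proof.
have [M [x [x01 hM]]] := bound.
pose u k t := (b k * z ^+ k) * (expi (- j%:R * t) * expi (k%:R * t)).
have ce k : continuous (fun t : R => expi (- j%:R * t) * expi (k%:R * t) : C^o).
  exact: (@continuousMc R _ _ (@continuous_expiM R (- j%:R)) (@continuous_expiM R k%:R)).
have cu k : continuous (u k : R -> C^o) by exact: (continuousZc (ce k)).
have cs : continuous (fun t : R => expi (- j%:R * t) * F t : C^o).
  exact: (@continuousMc R _ _ (@continuous_expiM R (- j%:R)) continuous_psum_circle).
have uJ k : cint (u k) = b k * z ^+ k * ((2 * pi)%:C%C * (j == k)%:R).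
  by rewrite -cint_expi_expi -(cintZ _ (ce k)).
have H : gconv (fun k => cint (u k)) (cint (fun t => expi (- j%:R * t) * F t)).
  apply: (@gconv_cint R u _ M x x01 cu cs) => [t _|k t _].
    have := gconvZ (expi (- j%:R * t)) (gconv_psum pb (z := expi t * z) _).
    rewrite modulus_rotate => /(_ z1); rewrite /u; congr (gconv _ _); apply/funext => k.
    by rewrite exprMn expiX; move: (expi _) (expi _) (z ^+ k) (b k) => p q r s; ring.
  by rewrite /u modulusM [modulus (expi _ * _)]modulusM !modulus_expi !mulr1.
apply: (gconv_unique H).
have := @gconv_fin R (fun k => cint (u k)) j.+1.
rewrite big_ord_recr /= big1 ?add0r; last by move=> i _; rewrite uJ gtn_eqF ?mulr0.
rewrite uJ eqxx mulr1 mulrC; apply=> k jk; by rewrite uJ ltn_eqF ?mulr0.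
Qed.

(** Only one of the two factors of [F * F^*] is expanded: the remaining integrals are conjugates of
    the coefficient integrals [cint_psum_coef], so no double series arises. *)
Lemma parseval_itvint :
  (\sum_(0 <= k <oo) (2 * pi * (modulus (b k) ^+ 2 * modulus z ^+ 2 ^+ k))%:E
    = (itvint 0 (2 * pi) (fun t => modulus (F t) ^+ 2))%:E)%E.
Proof.
have [M [x [x01 hM]]] := bound.
have cF := continuous_psum_circle; have cJ := continuous_conj cF.
have [B B0 hB] := bounded_on_circle cF.
pose u k t := (b k * z ^+ k) * (expi (k%:R * t) * (F t)^*%C).
have ce k : continuous (fun t : R => expi (k%:R * t) * (F t)^*%C : C^o).
  exact: (@continuousMc R _ _ (@continuous_expiM R k%:R) cJ).
have cu k : continuous (u k : R -> C^o) by exact: (continuousZc (ce k)).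
have cs : continuous (fun t : R => F t * (F t)^*%C : C^o) by exact: (continuousMc cF cJ).
have cE k : continuous (fun t : R => expi (- k%:R * t) * F t : C^o).
  exact: (@continuousMc R _ _ (@continuous_expiM R (- k%:R)) cF).
have uJ k : cint (u k) = (2 * pi * (modulus (b k) ^+ 2 * modulus z ^+ 2 ^+ k))%:C%C.
  rewrite (cintZ _ (ce k)).
  have -> : cint (fun t : R => expi (k%:R * t) * (F t)^*%C) = ((2 * pi)%:C%C * (b k * z ^+ k))^*%C.
    rewrite -cint_psum_coef -(cint_conj (cE k)); apply: eq_cint => t _.
    by rewrite conjcM conj_expi mulNr opprK.
  have -> : modulus (b k) ^+ 2 * modulus z ^+ 2 ^+ k = modulus (b k * z ^+ k) ^+ 2.
    rewrite modulusM modulusX [RHS]exprMn; congr (_ * _).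
    by rewrite -exprM mulnC exprM.
  have cr : (2 * pi)%:C%C^*%C = (2 * pi)%:C%C :> C by apply: complex_eqP; rewrite ?ReJ ?ImJ //= oppr0.
  by rewrite conjcM cr mulrCA mulcJ -real_complexM.
have H : gconv (fun k => cint (u k)) (cint (fun t => F t * (F t)^*%C)).
  apply: (@gconv_cint R u _ (M * B) x x01 cu cs) => [t _|k t ht].
    have := gconvZ (F t)^*%C (gconv_psum pb (z := expi t * z) _).
    rewrite modulus_rotate => /(_ z1); rewrite [F t * _]mulrC /u; congr (gconv _ _); apply/funext => k.
    by rewrite exprMn expiX; move: (expi _) ((F t)^*%C) (z ^+ k) (b k) => p q r s; ring.
  rewrite /u modulusM [modulus (expi _ * _)]modulusM modulus_expi mul1r modulusJ mulrAC.
  by apply: ler_pM; rewrite ?modulus_ge0 //; exact: hB.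
have v0 k : 0 <= 2 * pi * (modulus (b k) ^+ 2 * modulus z ^+ 2 ^+ k).
  by rewrite !mulr_ge0 ?pi_ge0 ?exprn_ge0 ?modulus_ge0.
rewrite (gconv_nneseries (s := cint (fun t => F t * (F t)^*%C)) v0); last first.
  by move: H; congr (gconv _ _); apply/funext => k; rewrite uJ.
by congr EFin; apply: eq_itvint => t _; rewrite mulcJ.
Qed.

Lemma citv_modulus2 a c (phi : R -> C) : continuous (phi : R -> C^o) -> citv a c (fun t => modulus (phi t) ^+ 2).
Proof.
move=> cp; have -> : (fun t => modulus (phi t) ^+ 2) = (fun t => Re (phi t) * Re (phi t) + Im (phi t) * Im (phi t)).
  by apply/funext => t; rewrite sqr_modulus !expr2.
by apply: citvD; apply: citvM; first [exact: citv_Re|exact: citv_Im].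
Qed.

Lemma itvint_fin a c (f : R -> R) : citv a c f -> (\int[leb]_(t in `[a, c]) (f t)%:E = (itvint a c f)%:E)%E.
Proof.
move=> cf; rewrite /itvint /Rintegral fineK //.
by apply: integrable_fin_num => //; exact: citv_integrable.
Qed.

Lemma parseval :
  (int_angle (fun t => (modulus (psum b (expi t * z)) ^+ 2)%:E) =
   (2 * pi)%:E * \sum_(0 <= k <oo) (modulus (b k) ^+ 2 * modulus z ^+ 2 ^+ k)%:E)%E.
Proof.
rewrite /int_angle itvint_fin; last by apply: citv_modulus2; exact: continuous_psum_circle.
rewrite -parseval_itvint -nneseriesZl => [|k _].
  by apply: eq_eseriesr => k _; rewrite EFinM.
by rewrite lee_fin !mulr_ge0 ?exprn_ge0 ?modulus_ge0.
Qed.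

End Coefficients.

End Parseval.

Section ComplexMeasurable.
Variable R : realType.
Local Notation C := R[i].
Variables (d : measure_display) (T : measurableType d) (D : set T).
Implicit Types f g : T -> C.

Definition cmeas f := measurable_fun D (fun t => Re (f t)) /\ measurable_fun D (fun t => Im (f t)).

Lemma cmeas_cst c : cmeas (fun=> c).
Proof. by split; exact: measurable_cst. Qed.

Lemma cmeasD f g : cmeas f -> cmeas g -> cmeas (fun t => f t + g t).
Proof.
move=> [fR fI] [gR gI]; split.
  by under eq_fun do rewrite ReD; exact: measurable_funD.
by under eq_fun do rewrite ImD; exact: measurable_funD.
Qed.

Lemma cmeasM f g : cmeas f -> cmeas g -> cmeas (fun t => f t * g t).
Proof.
move=> [fR fI] [gR gI]; split.
  by under eq_fun do rewrite ReMc; apply: measurable_funB; exact: measurable_funM.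
by under eq_fun do rewrite ImMc; apply: measurable_funD; exact: measurable_funM.
Qed.

Lemma cmeasX f n : cmeas f -> cmeas (fun t => f t ^+ n).
Proof.
move=> mf; elim: n => [|n IH]; first exact: cmeas_cst.
by under eq_fun do rewrite exprS; exact: cmeasM.
Qed.

Lemma cmeas_sum n (f : 'I_n -> T -> C) : (forall i, cmeas (f i)) -> cmeas (fun t => \sum_(i < n) f i t).
Proof.
elim: n f => [|n IH] f mf.
  by under eq_fun do rewrite big_ord0; exact: cmeas_cst.
by under eq_fun do rewrite big_ord_recr /=; apply: cmeasD => //; apply: IH.
Qed.

Lemma gconv_cvg (u : nat -> C) s : gconv u s ->
  (fun n => Re (\sum_(k < n) u k)) @ \oo --> Re s /\ (fun n => Im (\sum_(k < n) u k)) @ \oo --> Im s.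
Proof.
move=> [K [x [K0 /andP[x0 x1] h]]].
have c0 : K * x ^+ n @[n --> \oo] --> (0 : R).
  rewrite -[X in _ --> X](mulr0 K); apply: cvgM; first exact: cvg_cst.
  by apply: cvg_expr; rewrite ger0_norm.
split; apply/cvgrPdist_le => e e0; have /cvgrPdist_le/(_ _ e0) := c0;
  apply: filterS => n; rewrite sub0r normrN => hn;
  apply: le_trans (le_trans (ler_norm _) hn); apply: le_trans (h n).
  by rewrite -ReB; exact: ler_Re_modulus.
by rewrite -ImB; exact: ler_Im_modulus.
Qed.

Lemma cmeas_gconv (u : nat -> T -> C) (s : T -> C) : (forall k, cmeas (u k)) ->
  (forall t, D t -> gconv (u ^~ t) (s t)) -> cmeas s.
Proof.
move=> mu us; split.
  apply: (@measurable_fun_cvg _ _ _ _ (fun n t => Re (\sum_(k < n) u k t))).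
    by move=> n; have [] := @cmeas_sum n (fun k => u k) (fun k => mu k).
  by move=> t /us /gconv_cvg[].
apply: (@measurable_fun_cvg _ _ _ _ (fun n t => Im (\sum_(k < n) u k t))).
  by move=> n; have [] := @cmeas_sum n (fun k => u k) (fun k => mu k).
by move=> t /us /gconv_cvg[].
Qed.

Lemma cmeas_psum (b : nat -> C) (u : T -> C) : pcoef b -> cmeas u ->
  (forall t, D t -> modulus (u t) < 1) -> cmeas (fun t => psum b (u t)).
Proof.
move=> pb mu u1; apply: (@cmeas_gconv (fun k t => b k * u t ^+ k)) => [k|t Dt].
  by apply: cmeasM; [exact: cmeas_cst|exact: cmeasX].
by apply: gconv_psum => //; exact: u1.
Qed.

Lemma measurable_modulus2 f : cmeas f -> measurable_fun D (fun t => modulus (f t) ^+ 2).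
Proof.
move=> [fR fI]; under eq_fun do rewrite sqr_modulus.
by apply: measurable_funD; exact: measurable_funX.
Qed.

Lemma cmeas_expi (u : T -> R) : measurable_fun D u -> cmeas (fun t => expi (u t)).
Proof.
move=> mu; split => /=.
  by apply: measurableT_comp => //; apply: continuous_measurable_fun; exact: continuous_cos.
by apply: measurableT_comp => //; apply: continuous_measurable_fun; exact: continuous_sin.
Qed.

End ComplexMeasurable.

Section ProductSigmaFinite.
Context d1 d2 (T1 : measurableType d1) (T2 : measurableType d2) (R : realType).
Variables (m1 : {sigma_finite_measure set T1 -> \bar R}) (m2 : {sigma_finite_measure set T2 -> \bar R}).

Lemma product_sigma_finite : sigma_finite setT (m1 \x m2)%E.
Proof.
have [F FT Foo] := sigma_finiteT m1; have [G GT Goo] := sigma_finiteT m2.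
exists (fun n => if (unpickle n : option (nat * nat)) is Some p then F p.1 `*` G p.2 else set0).
  apply/esym/seteqP; split => // -[x y] _.
  have [i _ Fx] : (\bigcup_k F k) x by rewrite -FT.
  have [j _ Gy] : (\bigcup_k G k) y by rewrite -GT.
  by exists (pickle (i, j)) => //=; rewrite pickleK.
move=> k; case: (unpickle k) => [p|]; last by split; rewrite ?measure0.
have [mF oF] := Foo p.1; have [mG oG] := Goo p.2.
by split; [exact: measurableX|rewrite product_measure1E // lte_mul_pinfty // ge0_fin_numE].
Qed.

(* The library's canonical sigma-finite structure on products is shadowed by the one
   on products of sub-probabilities. *)
Definition product_sf : {sigma_finite_measure set (T1 * T2)%type -> \bar R} :=
  HB.pack_for (SigmaFiniteMeasure.type (T1 * T2)%type R) (product_measure1 m1 m2)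
   (Measure_isSigmaFinite.Build _ _ _ (product_measure1 m1 m2) product_sigma_finite).

End ProductSigmaFinite.

(** * Radial moments and a weighted Bergman norm *)

Section DiscIntegral.
Variable R : realType.
Local Notation C := R[i].
Local Notation leb := (@lebesgue_measure R).
Local Notation TR := (measurableTypeR R).
Local Notation leb2 := (leb \x leb)%E.
Local Open Scope ereal_scope.

Lemma mule_cancel (a : \bar R) (c : R) : (0 < c)%R -> (c^-1)%:E * (c%:E * a) = a.
Proof. by move=> c0; rewrite muleA -EFinM mulVf ?mul1e // gt_eqF. Qed.

Definition cpt (p : TR * TR) : C := Complex p.1 p.2.

Lemma modulus_cpt p : (modulus (cpt p) ^+ 2 = p.1 ^+ 2 + p.2 ^+ 2)%R.
Proof. by rewrite sqr_modulus. Qed.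

Lemma discE p : disc p <-> (modulus (cpt p) < 1)%R.
Proof.
rewrite /disc /= -modulus_cpt; split => [h|h]; last by rewrite exprn_ilt1 ?modulus_ge0.
by move: h; rewrite expr_lt1 ?modulus_ge0.
Qed.

Lemma int_discE (g : C -> \bar R) : int_disc g = (pi^-1)%:E * \int[leb2]_(p in @disc R) g (cpt p).
Proof. by []. Qed.

Lemma eq_int_disc (g h : C -> \bar R) : (forall z, (modulus z < 1)%R -> g z = h z) -> int_disc g = int_disc h.
Proof. by move=> e; rewrite !int_discE; congr (_ * _); apply: eq_integral => p /set_mem /discE; exact: e. Qed.

Definition disc_measurable (g : C -> \bar R) := measurable_fun (@disc R) (g \o cpt).

Lemma int_disc_ge0 (g : C -> \bar R) : (forall z, (modulus z < 1)%R -> 0 <= g z) -> 0 <= int_disc g.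
Proof.
move=> g0; rewrite int_discE mule_ge0 ?lee_fin ?invr_ge0 ?pi_ge0 //.
by apply: integral_ge0 => p /discE; exact: g0.
Qed.

Lemma int_disc_nneseries (g : nat -> C -> \bar R) : (forall k, disc_measurable (g k)) ->
  (forall k z, (modulus z < 1)%R -> 0 <= g k z) ->
  int_disc (fun z => \sum_(0 <= k <oo) g k z) = \sum_(0 <= k <oo) int_disc (g k).
Proof.
move=> mg g0; rewrite int_discE integral_nneseries.
- by rewrite -nneseriesZl // => k _; apply: integral_ge0 => p /discE; exact: g0.
- exact: measurable_disc.
- by move=> k; exact: mg.
- by move=> k p /discE; exact: g0.
Qed.

Lemma int_discZ (c : R) (g : C -> \bar R) : (0 <= c)%R -> disc_measurable g ->
  (forall z, (modulus z < 1)%R -> 0 <= g z) ->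
  int_disc (fun z => c%:E * g z) = c%:E * int_disc g.
Proof.
move=> c0 mg g0; rewrite int_discE ge0_integralZl //; first by rewrite muleCA.
- exact: measurable_disc.
- by move=> p /discE; exact: g0.
Qed.

Lemma int_disc_rotate (g : C -> \bar R) t : disc_measurable g -> (forall z, (modulus z < 1)%R -> 0 <= g z) ->
  int_disc (fun z => g (expi t * z)%R) = int_disc g.
Proof.
move=> mg g0; rewrite !int_discE; congr (_ * _); apply/esym.
have mD := @measurable_disc R.
have mg' : measurable_fun setT ((g \o cpt) \_ (@disc R)) by exact: (measurable_restrictT (g \o cpt) mD).1.
rewrite integral_mkcond (integral_rotation t mg') => [|p]; last first.
  by rewrite /patch; case: ifP => // /set_mem /discE; exact: g0.
rewrite [RHS]integral_mkcond; apply: eq_integral => p _.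
have e : cpt (lin2 (cos t) (- sin t) (sin t) (cos t) p) = (expi t * cpt p)%R.
  by apply: complex_eqP; rewrite ?ReMc ?ImMc /= ?mulNr // addrC.
rewrite /patch /= e; congr (if _ then _ else _).
by apply/idP/idP => /set_mem /discE; rewrite ?e ?modulus_rotate => h; apply/mem_set/discE; rewrite ?e ?modulus_rotate.
Qed.

Lemma cmeas_cpt : cmeas (@disc R) cpt.
Proof. by split; apply: measurable_funTS => //=; [exact: measurable_fst|exact: measurable_snd]. Qed.

Lemma disc_measurable_psum (b : nat -> C) : pcoef b ->
  disc_measurable (fun z => (modulus (psum b z) ^+ 2)%:E).
Proof.
move=> pb; apply/measurable_EFinP; apply: (@measurable_modulus2 _ _ _ _ (fun p => psum b (cpt p))).
by apply: cmeas_psum => //; [exact: cmeas_cpt|move=> p /discE].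
Qed.

Lemma disc_measurable_radial (k : nat) : disc_measurable (fun z => (modulus z ^+ 2 ^+ k)%:E).
Proof.
apply/measurable_EFinP; apply: measurable_funX.
by apply: (@measurable_modulus2 _ _ _ _ cpt); exact: cmeas_cpt.
Qed.

Lemma disc_measurableM (g h : C -> \bar R) : disc_measurable g -> disc_measurable h ->
  disc_measurable (fun z => g z * h z).
Proof. exact: emeasurable_funM. Qed.

(* Averaging over rotations replaces [g] by its circular means. *)
Lemma int_disc_mean (g : C -> \bar R) :
  measurable_fun (@disc R `*` `[0%R, (2 * pi)%R]%classic : set ((TR * TR) * TR)%type)
    (fun q => g (expi q.2 * cpt q.1)%R) ->
  (forall z, (modulus z < 1)%R -> 0 <= g z) ->
  (2 * pi)%:E * int_disc g = int_disc (fun z => int_angle (fun t => g (expi t * z)%R)).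
Proof.
move=> mg g0.
have mD := @measurable_disc R.
have mI : measurable (`[0%R, (2 * pi)%R]%classic : set TR) by exact: measurable_itv.
have m1 : disc_measurable g.
  rewrite /disc_measurable; have -> : g \o cpt = (fun q : (TR * TR) * TR => g (expi q.2 * cpt q.1)%R) \o (fun p => (p, 0%R)).
    by apply/funext => p /=; rewrite expi0 mul1r.
  apply: (measurable_comp _ _ mg) => //.
  - exact: measurableX.
  - by move=> _ [p Dp <-]; split => //=; rewrite in_itv /= lexx mulr_ge0 // pi_ge0.
  - by apply: measurable_funTS; exact: measurable_fun_pair.
have p0 : (0 <= 2 * pi :> R)%R by rewrite mulr_ge0 // pi_ge0.
have I0 : 0 <= int_disc g by exact: int_disc_ge0.
pose F (q : (TR * TR) * TR) : \bar R := ((fun q => g (expi q.2 * cpt q.1)%R) \_ (@disc R `*` `[0%R, (2 * pi)%R]%classic)) q.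
have mF : measurable_fun setT F by apply/(measurable_restrictT _ _).1 => //; exact: measurableX.
have F0 q : 0 <= F q.
  rewrite /F /patch; case: ifP => // /set_mem[/= /discE h _]; apply: g0; by rewrite modulus_rotate.
have fub := @fubini_tonelli _ _ _ _ R (product_sf leb leb) leb F mF F0.
have -> : int_disc (fun z => int_angle (fun t => g (expi t * z)%R)) = (pi^-1)%:E * \int[leb2]_p \int[leb]_t F (p, t).
  rewrite int_discE; congr (_ * _); rewrite integral_mkcond; apply: eq_integral => p _.
  rewrite /patch; case: ifPn => [Dp|Dp].
    rewrite /int_angle integral_mkcond; apply: eq_integral => t _.
    by rewrite /F /patch in_setX Dp.
  rewrite -[LHS](integral0 leb setT); apply: eq_integral => t _.
  by rewrite /F /patch in_setX (negPf Dp).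
rewrite [X in _ = _ * X]fub.
have -> : \int[leb]_t \int[leb2]_p F (p, t) = \int[leb]_(t in `[0%R, (2 * pi)%R]) (pi%:E * int_disc g).
  rewrite [RHS]integral_mkcond; apply: eq_integral => t _.
  rewrite /patch; case: ifPn => [Dt|Dt].
    rewrite -(int_disc_rotate t m1 g0) int_discE muleA -EFinM divff ?gt_eqF ?pi_gt0 // mul1e.
    rewrite [RHS]integral_mkcond; apply: eq_integral => p _.
    by rewrite /F /patch in_setX Dt andbT.
  rewrite -[RHS](integral0 leb2 setT); apply: eq_integral => p _.
  by rewrite /F /patch in_setX (negPf Dt) andbF.
have lI : leb `[0%R, (2 * pi)%R]%classic = (2 * pi)%:E.
  by rewrite lebesgue_measure_itv /= lte_fin mulr_gt0 ?pi_gt0 // oppr0 adde0.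
rewrite integral_cst // [X in _ = _ * (_ * X)]lI.
by rewrite -[pi%:E * _ * _]muleA mule_cancel ?pi_gt0 // muleC.
Qed.

Lemma cmeas_rotated (D : set ((TR * TR) * TR)%type) : cmeas D (fun q => expi q.2 * cpt q.1)%R.
Proof.
apply: cmeasM; first by apply: cmeas_expi; apply: measurable_funTS; exact: measurable_snd.
have m1 : measurable_fun setT (fun q : (TR * TR) * TR => q.1) by exact: measurable_fst.
split => /=; apply: measurable_funTS.
  by apply: (measurableT_comp (f := fst)); [exact: measurable_fst|exact: m1].
by apply: (measurableT_comp (f := snd)); [exact: measurable_snd|exact: m1].
Qed.

Lemma measurable_rotated_psum (b : nat -> C) : pcoef b ->
  cmeas (@disc R `*` `[0%R, (2 * pi)%R]%classic : set ((TR * TR) * TR)%type)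
    (fun q => psum b (expi q.2 * cpt q.1)%R).
Proof.
move=> pb; apply: cmeas_psum => //; first exact: cmeas_rotated.
by move=> q [/= /discE h _]; rewrite modulus_rotate.
Qed.

(* [moment k] is the integral of [|z|^(2k)]; dilating the disc by [r] relates it to
   the annulus [r < |z| < 1], and [r -> 1] forces the value [1 / (k + 1)]. *)
Definition moment k := int_disc (fun z : C => (modulus z ^+ 2 ^+ k)%:E).

Lemma int_disc_le (g h : C -> \bar R) : disc_measurable g -> disc_measurable h ->
  (forall z, (modulus z < 1)%R -> 0 <= g z) -> (forall z, (modulus z < 1)%R -> g z <= h z) ->
  int_disc g <= int_disc h.
Proof.
move=> mg mh g0 gh; rewrite !int_discE lee_pmul2l ?fin_numE // ?lte_fin ?invr_gt0 ?pi_gt0 //.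
apply: ge0_le_integral => //.
- exact: measurable_disc.
- by move=> p /discE; exact: g0.
- by move=> p /discE; exact: gh.
Qed.

Lemma int_disc_cst1 : int_disc (fun _ : C => 1) = 1.
Proof.
rewrite int_discE integral_cst; last exact: measurable_disc.
by rewrite mul1e [X in _ * X]leb2_disc -EFinM mulVf // gt_eqF // pi_gt0.
Qed.

Lemma moment_le1 k : moment k <= 1.
Proof.
rewrite -int_disc_cst1; apply: int_disc_le.
- exact: disc_measurable_radial.
- exact: measurable_cst.
- by move=> z _; rewrite lee_fin !exprn_ge0 ?modulus_ge0.
- by move=> z h; rewrite lee_fin !exprn_ile1 ?exprn_ge0 ?modulus_ge0 ?(ltW h) // exprn_ile1 ?modulus_ge0 ?ltW.
Qed.

Lemma moment_ge0 k : 0 <= moment k.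
Proof. by apply: int_disc_ge0 => z _; rewrite lee_fin !exprn_ge0 ?modulus_ge0. Qed.

Lemma moment_fin k : exists2 m : R, (0 <= m)%R & moment k = m%:E.
Proof.
have := moment_le1 k; have := moment_ge0 k.
by case: (moment k) => // m; rewrite !lee_fin => m0 _; exists m.
Qed.

Lemma measurable_ball (r : R) : measurable [set p : TR * TR | (modulus (cpt p) < r)%R].
Proof.
have [r0|r0] := leP r 0%R.
  rewrite (_ : [set p | _] = set0) //; apply/seteqP; split => p //= h.
  by have := le_lt_trans (modulus_ge0 (cpt p)) h; rewrite ltNge r0.
have m2 : measurable_fun setT (fun p : TR * TR => modulus (cpt p) ^+ 2 : TR)%R.
  by under eq_fun do rewrite modulus_cpt; exact: measurable_sqr.
have := m2 measurableT `]-oo, (r ^+ 2)%R[%classic (measurable_itv _).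
rewrite setTI; congr measurable; apply/seteqP; split => p /=; rewrite in_itv /=;
  by rewrite ltr_sqr ?nnegrE ?modulus_ge0 // ltW.
Qed.

Lemma int_disc_dilation k (r : R) : (0 < r < 1)%R ->
  int_disc (fun z : C => if (modulus z < r)%R then (modulus z ^+ 2 ^+ k)%:E else 0)
   = ((r ^+ 2) ^+ k.+1)%:E * moment k.
Proof.
move=> /andP[r0 r1].
rewrite /moment !int_discE muleCA; congr (_ * _).
pose f (p : TR * TR) : \bar R := ((fun p => if (modulus (cpt p) < r)%R then (modulus (cpt p) ^+ 2 ^+ k)%:E else 0) \_ (@disc R)) p.
have mD := @measurable_disc R.
have fE p : f p = if (modulus (cpt p) < r)%R then (modulus (cpt p) ^+ 2 ^+ k)%:E else 0.
  rewrite /f /patch; case: ifPn => // /negP; rewrite mem_setE => h.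
  by case: ifP => // h2; exfalso; apply: h; apply/discE; exact: lt_trans r1.
have scale p : cpt (lin2 r 0 0 r p) = (r%:C%C * cpt p)%R.
  by apply: complex_eqP; rewrite ?ReZ ?ImZ /= !mul0r ?addr0 ?add0r.
have mscale p : modulus (cpt (lin2 r 0 0 r p)) = (r * modulus (cpt p))%R.
  by rewrite scale modulusM modulus_real gtr0_norm.
have fr p : f (lin2 r 0 0 r p) = ((fun p => (r ^+ 2 ^+ k)%:E * (modulus (cpt p) ^+ 2 ^+ k)%:E) \_ (@disc R)) p.
  rewrite fE mscale -[ltRHS]mulr1 ltr_pM2l // /patch.
  have -> : (p \in @disc R) = (modulus (cpt p) < 1)%R.
    by apply/idP/idP => [/set_mem /discE|h] //; apply/mem_set/discE.
  case: ifP => // _; rewrite -EFinM; congr EFin.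
  have -> : ((r * modulus (cpt p)) ^+ 2 = r ^+ 2 * modulus (cpt p) ^+ 2)%R by exact: exprMn.
  exact: exprMn.
have mf : measurable_fun setT f.
  have mS := measurable_ball r.
  have -> : f = (fun p => (modulus (cpt p) ^+ 2 ^+ k)%:E) \_ [set p : TR * TR | (modulus (cpt p) < r)%R].
    by apply/funext => p; rewrite fE /patch mem_setE.
  apply: (measurable_restrictT _ _).1 => //; apply/measurable_EFinP; apply: measurable_funX.
  apply: measurable_funTS; under eq_fun do rewrite modulus_cpt; exact: measurable_sqr.
have f0 p : 0 <= f p by rewrite fE; case: ifP => // _; rewrite lee_fin !exprn_ge0 ?modulus_ge0.
rewrite integral_mkcond -/f (integral_dilation r0 mf f0).
under [in LHS]eq_integral do rewrite fr.
rewrite -integral_mkcond ge0_integralZl //.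
- by rewrite muleA -EFinM -exprS.
- exact: disc_measurable_radial.
- by move=> p _; rewrite lee_fin !exprn_ge0 ?modulus_ge0.
- by rewrite lee_fin !exprn_ge0 // ltW.
Qed.

Let annulus k r := int_disc (fun z : C => if (modulus z < r)%R then 0 else (modulus z ^+ 2 ^+ k)%:E).

Let disc_measurable_if (r : R) (g h : C -> \bar R) : disc_measurable g -> disc_measurable h ->
  disc_measurable (fun z => if (modulus z < r)%R then g z else h z).
Proof.
move=> mg mh; apply: (@measurable_fun_if _ _ _ _ (g \o cpt) (h \o cpt) _ (@measurable_disc R) (fun p => (modulus (cpt p) < r)%R)).
- apply: (measurable_fun_bool true); rewrite (_ : _ @^-1` _ = [set p | (modulus (cpt p) < r)%R]).
    by apply: measurableI; [exact: measurable_disc|exact: measurable_ball].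
  by apply/seteqP; split.
- by apply: measurable_funS mg => //; exact: measurable_disc.
- by apply: measurable_funS mh => //; exact: measurable_disc.
Qed.

Let moment_split k (r : R) : (0 < r < 1)%R ->
  moment k = ((r ^+ 2) ^+ k.+1)%:E * moment k + annulus k r.
Proof.
move=> r01; rewrite -(int_disc_dilation _ r01) /annulus !int_discE -ge0_muleDr; last 2 first.
- by apply: integral_ge0 => p _; case: ifP => // _; rewrite lee_fin !exprn_ge0 ?modulus_ge0.
- by apply: integral_ge0 => p _; case: ifP => // _; rewrite lee_fin !exprn_ge0 ?modulus_ge0.
rewrite /moment int_discE -ge0_integralD; last 5 first.
- exact: measurable_disc.
- by move=> p _; case: ifP => // _; rewrite lee_fin !exprn_ge0 ?modulus_ge0.
- apply: (disc_measurable_if r (disc_measurable_radial k) (h := cst 0)); exact: measurable_cst.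
- by move=> p _; case: ifP => // _; rewrite lee_fin !exprn_ge0 ?modulus_ge0.
- by apply: (disc_measurable_if r (g := cst 0) _ (disc_measurable_radial k)); exact: measurable_cst.
congr (_ * _); apply: eq_integral => p _; by case: ifP => _; rewrite ?adde0 ?add0e.
Qed.

Let annulus_bounds k (r : R) : (0 < r < 1)%R ->
  ((r ^+ 2) ^+ k)%:E * annulus 0 r <= annulus k r /\ annulus k r <= annulus 0 r.
Proof.
move=> /andP[r0 r1].
have ma j : disc_measurable (fun z : C => if (modulus z < r)%R then 0 else (modulus z ^+ 2 ^+ j)%:E).
  by apply: (disc_measurable_if r (g := cst 0) _ (disc_measurable_radial j)); exact: measurable_cst.
have a0 j (z : C) : 0 <= (if (modulus z < r)%R then 0 else (modulus z ^+ 2 ^+ j)%:E).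
  by case: ifP => // _; rewrite lee_fin !exprn_ge0 ?modulus_ge0.
have rk : (0 <= (r ^+ 2) ^+ k)%R by rewrite !exprn_ge0 // ltW.
split.
  rewrite -int_discZ //; apply: int_disc_le => //.
  - by apply: disc_measurableM => //; exact: measurable_cst.
  - by move=> z _; rewrite mule_ge0.
  - move=> z _; case: ifP => [_|/negbT]; first by rewrite mule0.
    rewrite -leNgt => rz; rewrite expr0 mule1 lee_fin !lerXn2r // ?nnegrE ?exprn_ge0 ?modulus_ge0 // ?ltW //.
apply: int_disc_le => // z z1; case: ifP => // _; rewrite lee_fin expr0.
by rewrite !exprn_ile1 ?exprn_ge0 ?modulus_ge0 ?(ltW z1).
Qed.

Lemma bernoulli (x : R) k : (0 <= x <= 1)%R -> (1 - k%:R * (1 - x) <= x ^+ k)%R.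
Proof.
move=> /andP[x0 x1]; elim: k => [|k IH]; first by rewrite mul0r subr0 expr0.
rewrite exprS -natr1; apply: le_trans (ler_wpM2l x0 IH).
have k0 : (0 <= k%:R :> R)%R by [].
rewrite -subr_ge0; set K := k%:R in k0 *.
have -> : (x * (1 - K * (1 - x)) - (1 - (K + 1) * (1 - x)) = K * (1 - x) ^+ 2)%R by ring.
by rewrite mulr_ge0 // sqr_ge0.
Qed.

Lemma moment_eq k : moment k = (k.+1%:R^-1)%:E.
Proof.
have [J J0 eJ] := moment_fin k.
have e1 : moment 0 = 1 by rewrite -int_disc_cst1; apply: eq_int_disc => z _; rewrite expr0.
(* With [x = r^2], [moment_split] at 0 gives the annulus area [1 - x], and at [k] it gives
   [(1 - x^(k+1)) J], which lies between [x^k (1 - x)] and [1 - x]. Divide by [1 - x]. *)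
have key (x : R) : (0 < x < 1)%R -> (x ^+ k <= J * k.+1%:R /\ J * k.+1%:R * x ^+ k <= 1)%R.
  move=> /andP[x0 x1]; pose r := Num.sqrt x.
  have r0 : (0 < r)%R by rewrite sqrtr_gt0.
  have rx : (r ^+ 2 = x)%R by rewrite sqr_sqrtr // ltW.
  have r1 : (r < 1)%R by rewrite -sqrtr1 ltr_sqrt.
  have r01 : (0 < r < 1)%R by rewrite r0.
  have s0 := moment_split 0 r01; have sk := moment_split k r01.
  have [b1 b2] := annulus_bounds k r01.
  rewrite e1 mule1 expr1 rx in s0; rewrite eJ rx in sk; rewrite rx in b1.
  have [A eA] : exists A, annulus 0 r = A%:E.
    move: s0; case: (annulus 0 r) => [A| |] // _; by exists A.
  have [B eB] : exists B, annulus k r = B%:E.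
    move: sk; case: (annulus k r) => [B| |] // _; by exists B.
  rewrite eA -EFinD in s0; rewrite eB -EFinM -EFinD in sk; rewrite eA eB in b1 b2.
  move: s0 sk b1 b2 => [s0] [sk]; rewrite -EFinM !lee_fin => b1 b2.
  have x1' : (0 < 1 - x)%R by rewrite subr_gt0.
  have geo : ((1 - x) * \sum_(i < k.+1) x ^+ i = 1 - x ^+ k.+1)%R.
    by rewrite -[(1 - x)%R]opprB mulNr -subrX1 opprB.
  set S := (\sum_(i < k.+1) x ^+ i)%R in geo.
  have S1 : (S <= k.+1%:R)%R.
    rewrite -[k.+1 in leRHS]card_ord -sumr_const; apply: ler_sum => i _.
    by rewrite exprn_ile1 // ltW.
  have S2 : (k.+1%:R * x ^+ k <= S)%R.
    rewrite -[k.+1 in leLHS]card_ord mulr_natl -sumr_const; apply: ler_sum => i _.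
    by rewrite ler_wiXn2l // ?(ltW x0) ?(ltW x1) // -ltnS.
  have eJS : (B = (1 - x) * (J * S))%R.
    by rewrite mulrCA geo mulrBr mulr1; apply/eqP; rewrite eq_sym subr_eq addrC mulrC -sk.
  have eA' : (A = 1 - x)%R by lra.
  rewrite eJS eA' in b1 b2.
  have h1 : (x ^+ k <= J * S)%R by rewrite -(ler_pM2l x1') mulrC.
  have h2 : (J * S <= 1)%R by rewrite -(ler_pM2l x1') mulr1.
  split; first by apply: le_trans h1 _; rewrite ler_wpM2l.
  by apply: le_trans h2; rewrite -mulrA ler_wpM2l.
rewrite eJ; congr EFin.
have k1 : (0 < k.+1%:R :> R)%R by rewrite ltr0n.
have yB : (J * k.+1%:R <= k.+1%:R)%R.
  have J1 : (J <= 1)%R by rewrite -lee_fin -eJ moment_le1.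
  by rewrite -[leRHS]mul1r ler_wpM2r // ltW.
have kk : (0 <= k%:R :> R)%R by [].
suff : (J * k.+1%:R = 1)%R by move=> h; apply: (mulIf (lt0r_neq0 k1)); rewrite h mulVf // gt_eqF.
set y := (J * k.+1%:R)%R in key yB *; have y0 : (0 <= y)%R by rewrite mulr_ge0.
(* [c] dominates both [k] and [k * y], because [y <= k + 1]; these are the two losses in Bernoulli's
   inequality. *)
pose c : R := (k%:R * k.+1%:R + 1)%R.
have c0 : (0 < c)%R by rewrite ltr_wpDl // mulr_ge0 // ltW.
have main e : (0 < e)%R -> (1 <= y + e /\ y <= 1 + e)%R.
  move=> e0.
  have [d [d0 d1 d2]] : exists d : R, [/\ 0 < d, d < 1 & c * d <= e]%R.
    exists (Num.min (2^-1) (e / c))%R; split.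
    - by rewrite lt_min invr_gt0 ltr0n divr_gt0.
    - by rewrite gt_min; apply/orP; left; rewrite invf_lt1 // ltr1n.
    - by rewrite mulrC -ler_pdivlMr // ge_min lexx orbT.
  have x01 : (0 < 1 - d < 1)%R by apply/andP; split; lra.
  have [h1 h2] := key _ x01.
  have x01' : (0 <= 1 - d <= 1)%R by apply/andP; split; lra.
  have bn := bernoulli k x01'; rewrite opprB addrCA subrr addr0 in bn.
  have kd : (k%:R * d <= e)%R.
    apply: le_trans d2; rewrite ler_wpM2r ?(ltW d0) // /c; apply: ler_wpDr => //.
    by rewrite -[leLHS]mulr1 ler_wpM2l // ler1n.
  split; first by lra.
  have h3 : (y * (1 - k%:R * d) <= 1)%R by apply: le_trans h2; rewrite ler_wpM2l.
  have h4 : (y * (k%:R * d) <= e)%R.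
    apply: le_trans d2; rewrite mulrA ler_wpM2r ?(ltW d0) // /c; apply: ler_wpDr => //.
    by rewrite mulrC ler_wpM2l.
  by move: h3 h4; rewrite mulrBr mulr1; lra.
apply/eqP; rewrite eq_le; apply/andP; split; apply/ler_addgt0Pr => e /main[]//.
Qed.

(* The integral of [|z|^(2k) (1 - |z|^2)] over the disc. *)
Definition ew (k : nat) : R := (k.+1%:R^-1 - k.+2%:R^-1)%R.

Lemma ew_ge0 k : (0 <= ew k)%R.
Proof. by rewrite subr_ge0 lef_pV2 ?posrE ?ltr0n // ler_nat. Qed.

Lemma sub_sqr_modulus_ge0 (z : C) : (modulus z < 1)%R -> (0 <= 1 - modulus z ^+ 2)%R.
Proof. by move=> h; rewrite subr_ge0 exprn_ile1 ?modulus_ge0 // ltW. Qed.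

Lemma disc_measurable_1B : disc_measurable (fun z => (1 - modulus z ^+ 2)%:E).
Proof.
apply/measurable_EFinP; apply: measurable_funB; first exact: measurable_cst.
by apply: (@measurable_modulus2 _ _ _ _ cpt); exact: cmeas_cpt.
Qed.

Lemma disc_measurable_weight k : disc_measurable (fun z => ((1 - modulus z ^+ 2) * modulus z ^+ 2 ^+ k)%:E).
Proof.
under [X in disc_measurable X]eq_fun do rewrite EFinM.
by apply: disc_measurableM; [exact: disc_measurable_1B|exact: disc_measurable_radial].
Qed.

Lemma weighted_moment k :
  int_disc (fun z : C => ((1 - modulus z ^+ 2) * modulus z ^+ 2 ^+ k)%:E) = (ew k)%:E.
Proof.
have w0 (z : C) : (modulus z < 1)%R -> 0 <= ((1 - modulus z ^+ 2) * modulus z ^+ 2 ^+ k)%:E.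
  by move=> h; rewrite lee_fin mulr_ge0 ?sub_sqr_modulus_ge0 // !exprn_ge0 ?modulus_ge0.
have s : moment k = moment k.+1 + int_disc (fun z : C => ((1 - modulus z ^+ 2) * modulus z ^+ 2 ^+ k)%:E).
  rewrite /moment !int_discE -ge0_muleDr; last 2 first.
  - by apply: integral_ge0 => p _; rewrite lee_fin !exprn_ge0 ?modulus_ge0.
  - by apply: integral_ge0 => p /discE; exact: w0.
  rewrite -ge0_integralD; last 5 first.
  - exact: measurable_disc.
  - by move=> p _; rewrite lee_fin !exprn_ge0 ?modulus_ge0.
  - exact: disc_measurable_radial.
  - by move=> p /discE; exact: w0.
  - exact: disc_measurable_weight.
  congr (_ * _); apply: eq_integral => p _; rewrite -EFinD; congr EFin.
  by rewrite mulrBl mul1r -exprS addrC subrK.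
move: s; rewrite !moment_eq; case: (int_disc _) => // x [s]; congr EFin.
by rewrite /ew s addrAC subrr add0r.
Qed.

Lemma int_angleZ (c : R) (f : R -> R) : citv 0 (2 * pi)%R f ->
  int_angle (fun t => (c * f t)%:E) = c%:E * int_angle (fun t => (f t)%:E).
Proof.
move=> cf; rewrite /int_angle !itvint_fin //; first by rewrite itvintZ.
by apply: citvM => //; exact: citv_cst.
Qed.

Lemma int_disc_bergman (g : nat -> C) : pcoef g ->
  int_disc (fun z => ((1 - modulus z ^+ 2) * modulus (psum g z) ^+ 2)%:E) =
  \sum_(0 <= k <oo) (ew k * modulus (g k) ^+ 2)%:E.
Proof.
move=> pg.
have tp : (0 < 2 * pi :> R)%R by exact: twopi_gt0.
suff : (2 * pi)%:E * int_disc (fun z => ((1 - modulus z ^+ 2) * modulus (psum g z) ^+ 2)%:E) =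
    (2 * pi)%:E * \sum_(0 <= k <oo) (ew k * modulus (g k) ^+ 2)%:E.
  by move=> h; rewrite -[LHS](mule_cancel _ tp) h mule_cancel.
rewrite int_disc_mean; last 2 first.
- apply/measurable_EFinP; apply: measurable_funM; last first.
    by apply: (@measurable_modulus2 _ _ _ _ (fun q => psum g (expi q.2 * cpt q.1)%R)); exact: measurable_rotated_psum.
  apply: measurable_funB; first exact: measurable_cst.
  by apply: (@measurable_modulus2 _ _ _ _ (fun q => expi q.2 * cpt q.1)%R); exact: cmeas_rotated.
- by move=> z h; rewrite lee_fin mulr_ge0 ?sub_sqr_modulus_ge0 // exprn_ge0 ?modulus_ge0.
transitivity (int_disc (fun z => \sum_(0 <= k <oo) ((2 * pi * modulus (g k) ^+ 2)%:E * ((1 - modulus z ^+ 2) * modulus z ^+ 2 ^+ k)%:E))).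
  apply: eq_int_disc => z z1.
  transitivity (int_angle (fun t => ((1 - modulus z ^+ 2) * modulus (psum g (expi t * z)) ^+ 2)%:E)).
    by congr int_angle; apply/funext => t; rewrite modulus_rotate.
  rewrite int_angleZ; last by apply: citv_modulus2; exact: continuous_psum_circle.
  rewrite parseval // -!nneseriesZl //.
  - by apply: eq_eseriesr => k _; rewrite -!EFinM; congr EFin; ring.
  - by move=> k _; rewrite -EFinM lee_fin mulr_ge0 ?(ltW tp) // mulr_ge0 // !exprn_ge0 ?modulus_ge0.
  - by move=> k _; rewrite lee_fin mulr_ge0 // !exprn_ge0 ?modulus_ge0.
rewrite int_disc_nneseries; last 2 first.
- by move=> k; apply: disc_measurableM; [exact: measurable_cst|exact: disc_measurable_weight].
- by move=> k z h; rewrite -EFinM lee_fin !mulr_ge0 ?pi_ge0 ?sub_sqr_modulus_ge0 ?exprn_ge0 ?modulus_ge0.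
rewrite -nneseriesZl => [|k _]; last by rewrite lee_fin mulr_ge0 ?ew_ge0 ?exprn_ge0 ?modulus_ge0.
apply: eq_eseriesr => k _; rewrite int_discZ.
- by rewrite weighted_moment -!EFinM; congr EFin; ring.
- by rewrite !mulr_ge0 ?pi_ge0 ?exprn_ge0 ?modulus_ge0.
- exact: disc_measurable_weight.
- by move=> z h; rewrite lee_fin mulr_ge0 ?sub_sqr_modulus_ge0 // !exprn_ge0 ?modulus_ge0.
Qed.

End DiscIntegral.

(** * Poisson integrals of squared power series *)

Section PartialSums.
Variable R : realType.
Local Notation C := R[i].
Implicit Types b : nat -> C.

Definition part k (t : R) b : C := \sum_(m < k.+1) b m * expi (m%:R * t).

Lemma continuous_part k b : continuous (fun t : R => part k t b : C^o).
Proof.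
have [_ c] := @cint_sum R k.+1 _ (fun m => @continuousZc R (b m) _ (@continuous_expiM R m%:R)).
exact: c.
Qed.

(* The coefficients of [psum b z / (1 - e^(-it) z)]. *)
Definition quot b (t : R) k : C := expi (- k%:R * t) * part k t b.

Lemma modulus_quot b t k : modulus (quot b t k) = modulus (part k t b).
Proof. by rewrite modulusM modulus_expi mul1r. Qed.

Lemma quotS b t k : quot b t k.+1 = expi (- t) * quot b t k + b k.+1.
Proof.
rewrite /quot /part big_ord_recr /= mulrDr [RHS]addrC [LHS]addrC; congr (_ + _).
  by rewrite mulrCA -expiD mulNr addNr expi0 mulr1.
by rewrite [RHS]mulrA -expiD; congr (expi _ * _); rewrite -[k.+1%:R]natr1; ring.
Qed.

Lemma pcoef_quot b t : pcoef b -> pcoef (quot b t).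
Proof.
move=> pb q /andP[q0 q1].
have [r [r0 r1]] : exists r, q < r /\ r < 1 by exists ((q + 1) / 2); split; lra.
have rpos := lt_trans q0 r0.
have [M hM] : exists M, forall k, modulus (b k) * r ^+ k <= M by apply: pb; rewrite rpos.
have M0 : 0 <= M by apply: le_trans (hM 0%N); rewrite mulr_ge0 ?modulus_ge0 ?exprn_ge0 // ltW.
have x01 : 0 <= q / r < 1 by rewrite divr_ge0 ?(ltW q0) ?(ltW rpos) //= ltr_pdivrMr // mul1r.
exists (M * (1 - q / r)^-1) => k; rewrite modulus_quot.
apply: le_trans (ler_wpM2l M0 (ler_natM_geometric k x01)).
have bd m : (m <= k)%N -> modulus (b m) <= M / r ^+ k.
  move=> mk; rewrite ler_pdivlMr ?exprn_gt0 //; apply: le_trans (hM m).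
  by rewrite ler_wpM2l ?modulus_ge0 // ler_wiXn2l // ltW.
have : modulus (part k t b) <= k.+1%:R * (M / r ^+ k).
  apply: le_trans (ler_modulus_sum _ _ _) _; rewrite -[k.+1 in leRHS]card_ord mulr_natl -sumr_const.
  by apply: ler_sum => m _; rewrite modulusM modulus_expi mulr1 bd // -ltnS.
move=> /(ler_wpM2r (exprn_ge0 k (ltW q0))) => h; apply: le_trans h _.
rewrite expr_div_n; move: (k.+1%:R) (q ^+ k) ((r ^+ k)^-1) => x y z.
by rewrite le_eqVlt; apply/orP; left; apply/eqP; ring.
Qed.

Lemma psum_quot b t z : pcoef b -> modulus z < 1 ->
  (1 - expi (- t) * z) * psum (quot b t) z = psum b z.
Proof.
move=> pb z1; have pq := pcoef_quot t pb.
have ps : pcoef (pshift (quot b t)).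
  move=> r r01; have [M hM] := pq r r01; have /andP[r0 r1] := r01.
  exists M; case=> [|k] /=.
    by rewrite modulus0 mul0r; apply: le_trans (hM 0%N); rewrite mulr_ge0 ?modulus_ge0 ?exprn_ge0 // ltW.
  apply: le_trans (hM k); rewrite exprS mulrCA.
  by rewrite ler_piMl ?(ltW r1) // mulr_ge0 ?modulus_ge0 ?exprn_ge0 // ltW.
rewrite mulrBl mul1r -mulrA -psum_shift // -mulNr -psumZ // -psumD //; last exact: pcoefZ.
apply: eq_psum => -[|k] /=.
  by rewrite mulr0 addr0 /quot /part big_ord1 !mul0r mulNr mul0r oppr0 expi0 mul1r mulr1.
by rewrite quotS mulNr addrAC subrr add0r.
Qed.

Lemma psum_geometric z : modulus z < 1 -> psum (fun=> 1 : C) z = (1 - z)^-1.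
Proof.
move=> z1; apply: psumE; have := gconv_geometric z1.
by congr (gconv _ _); apply/funext => k; rewrite mul1r.
Qed.

Lemma pcoef1 : @pcoef R (fun=> 1).
Proof. by apply: (@pcoef_bounded _ _ 1) => k; rewrite modulus1. Qed.

(** The factor [1 / |1 - e^(-it) z|^2] is written with the geometric series, so that its continuity
    and measurability are those of a power series. *)
Definition poisson_kernel (z : C) (t : R) : R := (1 - modulus z ^+ 2) * modulus (psum (fun=> 1 : C) (expi (- t) * z)) ^+ 2.

Lemma poisson_kernelE z t : modulus z < 1 ->
  (1 - modulus z ^+ 2) / modulus (polar 1 t - z) ^+ 2 = poisson_kernel z t.
Proof.
move=> z1; rewrite /poisson_kernel psum_geometric ?modulus_rotate // modulusV exprVn.
congr (_ / _ ^+ 2); rewrite -[LHS](modulus_rotate _ (- t)) mulrBr polarE mul1r -expiD addNr expi0.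
by [].
Qed.

(** For fixed [t] this moves the Poisson kernel into the function: what remains is the radial weight
    [1 - |z|^2] of [int_disc_bergman], and the coefficients of the quotient have the moduli of
    partial sums. *)
Lemma poisson_kernel_psum b z t : pcoef b -> modulus z < 1 ->
  modulus (psum b z) ^+ 2 * poisson_kernel z t = (1 - modulus z ^+ 2) * modulus (psum (quot b t) z) ^+ 2.
Proof.
move=> pb z1; rewrite -(psum_quot t pb z1) /poisson_kernel psum_geometric ?modulus_rotate //.
have nz : 1 - expi (- t) * z != 0.
  rewrite subr_eq0; apply: contraTneq z1 => e.
  by rewrite -(modulus_rotate z (- t)) -e modulus1 ltxx.
rewrite modulusM modulusV.
have : modulus (1 - expi (- t) * z) != 0 by rewrite modulus_eq0.
by move: (modulus _) (modulus _) (modulus _) => x y w x0; field.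
Qed.

Lemma poisson_kernel_ge0 z t : modulus z < 1 -> 0 <= poisson_kernel z t.
Proof. by move=> z1; rewrite mulr_ge0 ?sub_sqr_modulus_ge0 ?exprn_ge0 ?modulus_ge0. Qed.

End PartialSums.

Section PoissonIntegral.
Variable R : realType.
Local Notation C := R[i].
Local Notation leb := (@lebesgue_measure R).
Local Notation TR := (measurableTypeR R).
Local Notation leb2 := (leb \x leb)%E.
Local Open Scope ereal_scope.

Definition I2pi : set TR := `[0%R, (2 * pi)%R[%classic.

Lemma measurable_I2pi : measurable I2pi.
Proof. exact: measurable_itv. Qed.

Section Tonelli.
Context d (T : measurableType d) (m : {sigma_finite_measure set T -> \bar R}) (I : set T).
Hypothesis mI : measurable I.
Variable h : C -> T -> \bar R.
Hypothesis mh : measurable_fun (@disc R `*` I : set ((TR * TR) * T)%type) (fun q => h (cpt q.1) q.2).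
Hypothesis h0 : forall z t, (modulus z < 1)%R -> I t -> 0 <= h z t.

Let F (q : (TR * TR) * T) : \bar R := ((fun q => h (cpt q.1) q.2) \_ (@disc R `*` I)) q.

Let mF : measurable_fun setT F.
Proof.
apply: (measurable_restrictT _ _).1 => //; apply: measurableX => //; exact: measurable_disc.
Qed.

Let F0 q : 0 <= F q.
Proof. by rewrite /F /patch; case: ifP => // /set_mem[/= /discE z1 It]; exact: h0. Qed.

Let inner1 p : \int[m]_t F (p, t) = ((fun p => \int[m]_(t in I) h (cpt p) t) \_ (@disc R)) p.
Proof.
rewrite /patch; case: ifPn => [Dp|Dp].
  rewrite [RHS]integral_mkcond; apply: eq_integral => t _.
  by rewrite /F /patch in_setX Dp.
rewrite -[RHS](integral0 m setT); apply: eq_integral => t _.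
by rewrite /F /patch in_setX (negPf Dp).
Qed.

Let inner2 t : \int[leb2]_p F (p, t) = ((fun t => \int[leb2]_(p in @disc R) h (cpt p) t) \_ I) t.
Proof.
rewrite /patch; case: ifPn => [Dt|Dt].
  rewrite [RHS]integral_mkcond; apply: eq_integral => p _.
  by rewrite /F /patch in_setX Dt andbT.
rewrite -[RHS](integral0 leb2 setT); apply: eq_integral => p _.
by rewrite /F /patch in_setX (negPf Dt) andbF.
Qed.

Lemma disc_measurable_integral : disc_measurable (fun z => \int[m]_(t in I) h z t).
Proof.
have mD := @measurable_disc R.
apply: (measurable_restrictT _ mD).2.
rewrite (_ : _ \_ _ = fubini_F m F); first exact: measurable_fun_fubini_tonelli_F.
by apply/funext => p; rewrite /fubini_F inner1.
Qed.

Lemma int_disc_tonelli :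
  int_disc (fun z => \int[m]_(t in I) h z t) = \int[m]_(t in I) int_disc (h ^~ t).
Proof.
have pi0 : (0 <= pi^-1 :> R)%R by rewrite invr_ge0 pi_ge0.
have mG : measurable_fun I (fun t => \int[leb2]_(p in @disc R) h (cpt p) t).
  apply: (measurable_restrictT _ mI).2.
  rewrite (_ : _ \_ _ = fubini_G (product_sf leb leb) F).
    by apply: measurable_fun_fubini_tonelli_G.
  by apply/funext => t; rewrite /fubini_G inner2.
rewrite int_discE.
have -> : \int[m]_(t in I) int_disc (h ^~ t) = (pi^-1)%:E * \int[m]_(t in I) \int[leb2]_(p in @disc R) h (cpt p) t.
  rewrite -ge0_integralZl // => t It; apply: integral_ge0 => p /discE z1; exact: h0.
congr (_ * _); rewrite integral_mkcond [RHS]integral_mkcond.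
transitivity (\int[product_sf leb leb]_p \int[m]_t F (p, t)).
  by apply: eq_integral => p _; rewrite inner1.
rewrite (@fubini_tonelli _ _ _ _ R (product_sf leb leb) m F mF F0).
by apply: eq_integral => t _; rewrite inner2.
Qed.

End Tonelli.

Variable mu : circle_measure R.

Lemma measurable_poisson_kernel_slice (D : set TR) (z : C) : (modulus z < 1)%R ->
  measurable_fun D (fun t : TR => poisson_kernel z t).
Proof.
move=> z1; apply: measurable_funTS.
have ce : continuous (fun t : R => expi (- t) : C^o).
  by move=> s; apply: (@continuous_comp _ _ _ (fun t : R => - t)%R); [exact: opp_continuous|exact: continuous_expi].
have cz : continuous (fun t : R => (expi (- t) * z)%R : C^o).
  exact: (@continuousMc R _ (fun=> z) ce (@cst_continuous _ _ _)).
have cE : continuous (fun t : R => psum (fun=> 1%R) (expi (- t) * z)%R : C^o).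
  move=> t; apply: (@cvg_comp _ _ _ (fun t : R => expi (- t) * z)%R (psum (fun=> 1%R)) _ (nbhs ((expi (- t) * z)%R : C^o))).
    exact: (cz t).
  by apply: hol1_continuous; [apply: hol1_psum; exact: pcoef1|rewrite modulus_rotate].
apply: measurable_funM; first exact: measurable_cst.
apply: (@measurable_modulus2 _ _ _ _ (fun t : TR => psum (fun=> 1%R) (expi (- t) * z)%R)); split;
  apply: continuous_measurable_fun => t; [exact: (continuous_Re_at (cE t))|exact: (continuous_Im_at (cE t))].
Qed.

Lemma poissonE (z : C) : (modulus z < 1)%R ->
  poisson mu z = \int[mu]_(t in I2pi) ((2 * pi)^-1 * poisson_kernel z t)%:E.
Proof.
move=> z1; rewrite /poisson -ge0_integralZl.
- by apply: eq_integral => t _; rewrite poisson_kernelE.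
- exact: measurable_I2pi.
- apply/measurable_EFinP; have := measurable_poisson_kernel_slice (D := I2pi) z1.
  by apply: eq_measurable_fun => t _; rewrite poisson_kernelE.
- by move=> t _; rewrite poisson_kernelE // lee_fin poisson_kernel_ge0.
- by rewrite lee_fin invr_ge0 mulr_ge0 // pi_ge0.
Qed.

(** The contribution of the [k]-th Taylor coefficient of [quot b t] to its weighted Bergman norm,
    integrated over [t]. *)
Definition qS k (b : nat -> C) : \bar R :=
  ((2 * pi)^-1 * ew R k)%:E * \int[mu]_(t in I2pi) (modulus (part k t b) ^+ 2)%:E.

Lemma qS_ge0 k b : 0 <= qS k b.
Proof.
rewrite mule_ge0 ?lee_fin ?mulr_ge0 ?ew_ge0 ?invr_ge0 ?mulr_ge0 ?pi_ge0 //.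
by apply: integral_ge0 => t _; rewrite lee_fin exprn_ge0 ?modulus_ge0.
Qed.

Lemma cmeas_prod_fst d (T : measurableType d) (D : set ((TR * TR) * T)%type) : cmeas D (fun q => cpt q.1).
Proof.
have m1 : measurable_fun setT (fun q : (TR * TR) * T => q.1) by exact: measurable_fst.
split => /=; apply: measurable_funTS.
  by apply: (measurableT_comp (f := fst)); [exact: measurable_fst|exact: m1].
by apply: (measurableT_comp (f := snd)); [exact: measurable_snd|exact: m1].
Qed.

Lemma measurable_poisson_kernel :
  measurable_fun (@disc R `*` I2pi : set ((TR * TR) * TR)%type) (fun q => poisson_kernel (cpt q.1) q.2).
Proof.
apply: measurable_funM.
  apply: measurable_funB; first exact: measurable_cst.
  by apply: (@measurable_modulus2 _ _ _ _ (fun q : (TR * TR) * TR => cpt q.1)); exact: cmeas_prod_fst.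
apply: (@measurable_modulus2 _ _ _ _ (fun q : (TR * TR) * TR => psum (fun=> 1%R) (expi (- q.2) * cpt q.1)%R)).
apply: cmeas_psum; first exact: pcoef1.
  apply: cmeasM; last exact: cmeas_prod_fst.
  by apply: cmeas_expi; apply: measurableT_comp => //; apply: measurable_funTS; exact: measurable_snd.
by move=> q [/= /discE z1 _]; rewrite modulus_rotate.
Qed.

Lemma disc_measurable_poisson : disc_measurable (poisson mu).
Proof.
have := @disc_measurable_integral _ TR mu I2pi measurable_I2pi (fun z t => ((2 * pi)^-1 * poisson_kernel z t)%:E).
move=> /(_ _ _)H; have {}H : disc_measurable (fun z => \int[mu]_(t in I2pi) ((2 * pi)^-1 * poisson_kernel z t)%:E).
  apply: H.
    apply/measurable_EFinP; apply: measurable_funM; first exact: measurable_cst.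
    exact: measurable_poisson_kernel.
  by move=> z t z1 _; rewrite lee_fin mulr_ge0 ?poisson_kernel_ge0 // invr_ge0 mulr_ge0 // pi_ge0.
apply: (eq_measurable_fun _ _ H) => p /set_mem /discE z1; by rewrite /= poissonE.
Qed.

Lemma poisson_ge0 z : (modulus z < 1)%R -> 0 <= poisson mu z.
Proof.
move=> z1; rewrite poissonE //; apply: integral_ge0 => t _.
by rewrite lee_fin mulr_ge0 ?poisson_kernel_ge0 // invr_ge0 mulr_ge0 // pi_ge0.
Qed.

Lemma measurable_part (D : set TR) k b : measurable_fun D (fun t => (modulus (part k t b) ^+ 2)%:E).
Proof.
apply/measurable_EFinP; apply: measurable_funTS.
apply: (@measurable_modulus2 _ _ _ _ (fun t : TR => part k t b)); split; apply: continuous_measurable_fun => t.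
  exact: (continuous_Re_at (@continuous_part R k b t)).
exact: (continuous_Im_at (@continuous_part R k b t)).
Qed.

Lemma qS_integral k b :
  qS k b = \int[mu]_(t in I2pi) (((2 * pi)^-1 * ew R k)%:E * (modulus (part k t b) ^+ 2)%:E).
Proof.
rewrite /qS ge0_integralZl //.
- exact: measurable_I2pi.
- exact: measurable_part.
- by move=> t _; rewrite lee_fin exprn_ge0 ?modulus_ge0.
- by rewrite lee_fin mulr_ge0 ?ew_ge0 ?invr_ge0 ?mulr_ge0 ?pi_ge0.
Qed.

(** Tonelli brings the disc integral inside; for each [t] it is the weighted Bergman norm of
    [quot b t] by [poisson_kernel_psum]. The resulting series is then integrated termwise against
    [mu]. *)
Theorem int_disc_poisson b : pcoef b ->
  int_disc (fun z => (modulus (psum b z) ^+ 2)%:E * poisson mu z) = \sum_(0 <= k <oo) qS k b.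
Proof.
move=> pb.
have c0 : (0 <= (2 * pi)^-1 :> R)%R by rewrite invr_ge0 mulr_ge0 // pi_ge0.
have mk : measurable_fun (@disc R `*` I2pi : set ((TR * TR) * TR)%type)
    (fun q => (modulus (psum b (cpt q.1)) ^+ 2 * ((2 * pi)^-1 * poisson_kernel (cpt q.1) q.2))%:E).
  apply/measurable_EFinP; apply: measurable_funM.
    apply: (@measurable_modulus2 _ _ _ _ (fun q : (TR * TR) * TR => psum b (cpt q.1))).
    by apply: cmeas_psum => //; [exact: cmeas_prod_fst|move=> q [/= /discE]].
  by apply: measurable_funM; [exact: measurable_cst|exact: measurable_poisson_kernel].
have k0 z t : (modulus z < 1)%R -> I2pi t ->
    0 <= (modulus (psum b z) ^+ 2 * ((2 * pi)^-1 * poisson_kernel z t))%:E.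
  move=> z1 _; rewrite lee_fin; apply: mulr_ge0; first by rewrite exprn_ge0 ?modulus_ge0.
  by apply: mulr_ge0 => //; exact: poisson_kernel_ge0.
transitivity (int_disc (fun z => \int[mu]_(t in I2pi) (modulus (psum b z) ^+ 2 * ((2 * pi)^-1 * poisson_kernel z t))%:E)).
  apply: eq_int_disc => z z1; rewrite poissonE // -ge0_integralZl.
  - by apply: eq_integral => t _.
  - exact: measurable_I2pi.
  - apply/measurable_EFinP; apply: measurable_funM; first exact: measurable_cst.
    exact: measurable_poisson_kernel_slice.
  - by move=> t _; rewrite lee_fin mulr_ge0 ?poisson_kernel_ge0.
  - by rewrite lee_fin exprn_ge0 ?modulus_ge0.
rewrite (@int_disc_tonelli _ TR mu I2pi measurable_I2pi _ mk k0).
transitivity (\int[mu]_(t in I2pi) \sum_(0 <= k <oo) ((2 * pi)^-1 * ew R k)%:E * (modulus (part k t b) ^+ 2)%:E).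
  apply: eq_integral => t _.
  transitivity (int_disc (fun z => ((2 * pi)^-1)%:E * ((1 - modulus z ^+ 2) * modulus (psum (quot b t) z) ^+ 2)%:E)).
    by apply: eq_int_disc => z z1; rewrite -EFinM -poisson_kernel_psum //; congr EFin; ring.
  have pq := pcoef_quot t pb.
  rewrite int_discZ //; last 2 first.
  - under [X in disc_measurable X]eq_fun do rewrite EFinM.
    by apply: disc_measurableM; [exact: disc_measurable_1B|exact: disc_measurable_psum].
  - by move=> z z1; rewrite lee_fin mulr_ge0 ?sub_sqr_modulus_ge0 ?exprn_ge0 ?modulus_ge0.
  rewrite int_disc_bergman // -nneseriesZl.
    by apply: eq_eseriesr => k _; rewrite modulus_quot -!EFinM; congr EFin; ring.
  by move=> k _; rewrite lee_fin mulr_ge0 ?ew_ge0 ?exprn_ge0 ?modulus_ge0.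
have w0 k : (0 <= (2 * pi)^-1 * ew R k)%R by rewrite mulr_ge0 ?ew_ge0.
rewrite integral_nneseries.
- apply: eq_eseriesr => k _; by rewrite qS_integral.
- exact: measurable_I2pi.
- by move=> k; apply: emeasurable_funM; [exact: measurable_cst|exact: measurable_part].
- by move=> k t _; rewrite -EFinM lee_fin mulr_ge0 ?exprn_ge0 ?modulus_ge0.
Qed.

End PoissonIntegral.

(** * The norm as a sum of quadratic forms *)

Section ComplexIntegral.
Variable R : realType.
Local Notation C := R[i].
Local Notation TR := (measurableTypeR R).
Variable nu : {finite_measure set TR -> \bar R}.
Implicit Types f g : TR -> C.

Definition bmeas f := cmeas setT f /\ exists M, forall t, modulus (f t) <= M.

Lemma bmeas_cst c : bmeas (fun=> c).
Proof. by split; [exact: cmeas_cst|exists (modulus c)]. Qed.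

Lemma bmeasM f g : bmeas f -> bmeas g -> bmeas (fun t => f t * g t).
Proof.
move=> [mf [M hM]] [mg [K hK]]; split; first exact: cmeasM.
by exists (M * K) => t; rewrite modulusM ler_pM ?modulus_ge0.
Qed.

Lemma bmeasZ (c : C) f : bmeas f -> bmeas (fun t => c * f t).
Proof. by move=> mf; apply: bmeasM => //; exact: bmeas_cst. Qed.

Lemma bmeasJ f : bmeas f -> bmeas (fun t => (f t)^*%C).
Proof.
move=> [[mRe mIm] [M hM]]; split; last by exists M => t; rewrite modulusJ.
split; first by under eq_fun do rewrite ReJ.
by under eq_fun do rewrite ImJ; exact: measurableT_comp.
Qed.

Lemma bmeas_sum n (f : 'I_n -> TR -> C) : (forall i, bmeas (f i)) -> bmeas (fun t => \sum_(i < n) f i t).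
Proof.
move=> mf; split; first by apply: cmeas_sum => i; case: (mf i).
have /choice[M hM] i : exists M, forall t, modulus (f i t) <= M by case: (mf i).
exists (\sum_(i < n) M i) => t; apply: le_trans (ler_modulus_sum _ _ _) _.
by apply: ler_sum => i _; exact: hM.
Qed.

Lemma bmeas_expi (k : R) : bmeas (fun t => expi (k * t)).
Proof.
split; last by exists 1 => t; rewrite modulus_expi.
by apply: cmeas_expi; apply: measurable_funM; [exact: measurable_cst|exact: measurable_id].
Qed.

Let bounded_integrable (g : TR -> R) (M : R) : measurable_fun setT g -> (forall t, `|g t| <= M) ->
  nu.-integrable (@I2pi R) (EFin \o g).
Proof.
move=> mg hM; apply: measurable_bounded_integrable.
- exact: measurable_I2pi.
- rewrite ltey_eq; apply/orP; left; apply: fin_num_measure; exact: measurable_I2pi.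
- exact: measurable_funTS.
- exists M; split; first by rewrite num_real.
  by move=> K MK t _; apply: le_trans (hM t) (ltW MK).
Qed.

Lemma bmeas_integrable f : bmeas f ->
  nu.-integrable (@I2pi R) (EFin \o (fun t => Re (f t))) /\
  nu.-integrable (@I2pi R) (EFin \o (fun t => Im (f t))).
Proof.
move=> [[mRe mIm] [M hM]]; split; apply: bounded_integrable => // t.
  exact: le_trans (ler_Re_modulus _) (hM t).
exact: le_trans (ler_Im_modulus _) (hM t).
Qed.

Definition zint f : C :=
  Complex (\int[nu]_(t in @I2pi R) Re (f t)) (\int[nu]_(t in @I2pi R) Im (f t)).

Lemma eq_zint f g : (forall t, @I2pi R t -> f t = g t) -> zint f = zint g.
Proof. by move=> h; rewrite /zint; congr Complex; apply: eq_Rintegral => t /set_mem tI; rewrite h. Qed.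

Lemma zintD f g : bmeas f -> bmeas g -> zint (fun t => f t + g t) = zint f + zint g.
Proof.
move=> /bmeas_integrable[fR fI] /bmeas_integrable[gR gI].
apply: complex_eqP; rewrite /zint /=.
  by under eq_Rintegral do rewrite ReD; rewrite RintegralD //; exact: measurable_I2pi.
by under eq_Rintegral do rewrite ImD; rewrite RintegralD //; exact: measurable_I2pi.
Qed.

Lemma zintZ c f : bmeas f -> zint (fun t => c * f t) = c * zint f.
Proof.
move=> /bmeas_integrable[fR fI].
have mI := @measurable_I2pi R.
have iZ (x : R) (g : TR -> R) : nu.-integrable (@I2pi R) (EFin \o g) -> nu.-integrable (@I2pi R) (EFin \o (fun t => x * g t)).
  by move=> h; have := integrableZl mI x h.
apply: complex_eqP; rewrite /zint /= ?ReMc ?ImMc /=.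
  under eq_Rintegral do rewrite ReMc.
  by rewrite RintegralB ?RintegralZl //; exact: iZ.
under eq_Rintegral do rewrite ImMc.
by rewrite RintegralD ?RintegralZl //; exact: iZ.
Qed.

Lemma zint0 : zint (fun=> 0) = 0.
Proof.
rewrite -[RHS](mul0r (zint (fun=> 0))) -(zintZ 0 (bmeas_cst 0)).
by apply: eq_zint => t _; rewrite mul0r.
Qed.

Lemma zint_sum n (f : 'I_n -> TR -> C) : (forall i, bmeas (f i)) ->
  zint (fun t => \sum_(i < n) f i t) = \sum_(i < n) zint (f i).
Proof.
elim: n f => [|n IH] f mf.
  by rewrite big_ord0 -[RHS]zint0; apply: eq_zint => t _; rewrite big_ord0.
rewrite big_ord_recr -IH //= -zintD //; last exact: bmeas_sum.
by apply: eq_zint => t _; rewrite big_ord_recr.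
Qed.

Lemma zintJ f : bmeas f -> zint (fun t => (f t)^*%C) = (zint f)^*%C.
Proof.
move=> /bmeas_integrable[fR fI]; have mI := @measurable_I2pi R.
apply: complex_eqP; rewrite /zint /=; first by apply: eq_Rintegral => t _; rewrite ReJ.
rewrite -mulN1r -RintegralZl //.
by apply: eq_Rintegral => t _; rewrite ImJ mulN1r.
Qed.

Lemma integral_Re f : bmeas f ->
  (\int[nu]_(t in @I2pi R) (Re (f t))%:E = (Re (zint f))%:E)%E.
Proof.
move=> /bmeas_integrable[fR fI].
rewrite /= /Rintegral fineK //; apply: integrable_fin_num => //; exact: measurable_I2pi.
Qed.

Definition gram (e : nat -> TR -> C) m p : C := zint (fun t => e m t * (e p t)^*%C).

Lemma gram_sum (e : nat -> TR -> C) N (x y : nat -> C) : (forall m, bmeas (e m)) ->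
  zint (fun t => (\sum_(m < N) x m * e m t) * (\sum_(p < N) y p * e p t)^*%C)
  = \sum_(m < N) \sum_(p < N) x m * (y p)^*%C * gram e m p.
Proof.
move=> me.
have mm m p : bmeas (fun t => e m t * (e p t)^*%C) by apply: bmeasM => //; exact: bmeasJ.
transitivity (zint (fun t => \sum_(m < N) \sum_(p < N) x m * (y p)^*%C * (e m t * (e p t)^*%C))).
  apply: eq_zint => t _; rewrite conjc_sum mulr_suml; apply: eq_bigr => m _.
  by rewrite mulr_sumr; apply: eq_bigr => p _; rewrite conjcM mulrACA.
rewrite zint_sum => [|m]; last by apply: bmeas_sum => p; exact: bmeasZ.
apply: eq_bigr => m _; rewrite zint_sum => [|p]; last exact: bmeasZ.
by apply: eq_bigr => p _; rewrite zintZ.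
Qed.

End ComplexIntegral.

Section DoubleForm.
Variable R : realType.
Local Notation C := R[i].
Local Notation TR := (measurableTypeR R).

(** The quadratic form of the tensor product of [A] and [B] at the array [a]. *)
Definition qform N1 N2 (A B : nat -> nat -> C) (a : nat -> nat -> C) : R :=
  Re (\sum_(n < N2) \sum_(q < N2) (\sum_(m < N1) \sum_(p < N1) a m n * (a p q)^*%C * A m p) * B n q).

Variables (nu1 nu2 : {finite_measure set TR -> \bar R}) (e1 e2 : nat -> TR -> C).
Hypotheses (me1 : forall m, bmeas (e1 m)) (me2 : forall m, bmeas (e2 m)).

Lemma integral_form1 N (x : nat -> C) :
  (\int[nu2]_(s in @I2pi R) (modulus (\sum_(n < N) x n * e2 n s) ^+ 2)%:E =
   (Re (\sum_(n < N) \sum_(q < N) x n * (x q)^*%C * gram nu2 e2 n q))%:E)%E.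
Proof.
rewrite -gram_sum // -integral_Re; first by apply: eq_integral => s _; rewrite sqr_modulusE.
by apply: bmeasM; [|apply: bmeasJ]; apply: bmeas_sum => n; exact: bmeasZ.
Qed.

Lemma integral_qform N1 N2 (a : nat -> nat -> C) :
  (\int[nu1]_(t in @I2pi R) \int[nu2]_(s in @I2pi R)
     (modulus (\sum_(n < N2) (\sum_(m < N1) a m n * e1 m t) * e2 n s) ^+ 2)%:E =
   (qform N1 N2 (gram nu1 e1) (gram nu2 e2) a)%:E)%E.
Proof.
have my n : bmeas (fun t => \sum_(m < N1) a m n * e1 m t) by apply: bmeas_sum => m; exact: bmeasZ.
have myy n q : bmeas (fun t => (\sum_(m < N1) a m n * e1 m t) * (\sum_(m < N1) a m q * e1 m t)^*%C).
  by apply: bmeasM => //; exact: bmeasJ.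
under eq_integral do rewrite (@integral_form1 N2 (fun n => \sum_(m < N1) a m n * e1 m _)).
have mz n q : bmeas (fun t => gram nu2 e2 n q * ((\sum_(m < N1) a m n * e1 m t) * (\sum_(m < N1) a m q * e1 m t)^*%C)).
  exact: bmeasZ.
rewrite integral_Re; last first.
  apply: bmeas_sum => n; apply: bmeas_sum => q.
  by apply: bmeasM => //; exact: bmeas_cst.
congr (Re _)%:E; rewrite zint_sum => [|n]; last first.
  by apply: bmeas_sum => q; apply: bmeasM => //; exact: bmeas_cst.
apply: eq_bigr => n _; rewrite zint_sum => [|q]; last by apply: bmeasM => //; exact: bmeas_cst.
apply: eq_bigr => q _; rewrite -(@gram_sum _ nu1 e1 N1 (a ^~ n) (a ^~ q)) // [RHS]mulrC -zintZ //.
by apply: eq_zint => t _; rewrite mulrC.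
Qed.

End DoubleForm.

(** * Abel means of series with nonnegative terms *)

Section AbelSums.
Variable R : realType.
Implicit Types (v : nat -> \bar R) (r : R).
Local Open Scope ereal_scope.

Lemma le_of_scaled n (x B : \bar R) : 0 <= x -> (forall r, (0 < r < 1)%R -> (r ^+ n)%:E * x <= B) -> x <= B.
Proof.
move=> x0 h.
have B0 : 0 <= B.
  by apply: le_trans (h 2^-1%R _); [rewrite mule_ge0 // lee_fin exprn_ge0|rewrite invr_gt0 ltr0n invf_lt1 ?ltr1n].
case: B h B0 => [b| |] h B0; [|by rewrite leey|by []].
case: x x0 h => [x| |] x0 h; last by [].
- rewrite lee_fin in x0 B0; rewrite lee_fin; apply/ler_addgt0Pr => e e0.
  have [x00|xp] := leP x 0%R; first by apply: le_trans x00 _; rewrite addr_ge0 // ltW.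
  (* Makes [d < 1] and [n d x <= e], so that Bernoulli's inequality at [r = 1 - d] loses at most
     [e]. *)
  pose d := (e / (n.+1%:R * (x + e)))%R.
  have xe : (0 < x + e)%R by rewrite addr_gt0.
  have d0 : (0 < d)%R by rewrite divr_gt0 ?mulr_gt0 ?ltr0n.
  have nd : (n%:R * d * x <= e)%R.
    have -> : (n%:R * d * x = e * ((n%:R / n.+1%:R) * (x / (x + e))))%R.
      by rewrite /d; field; rewrite ?pnatr_eq0 ?gt_eqF.
    rewrite ler_piMr ?(ltW e0) // mulr_ile1 ?divr_ge0 ?ler0n ?(ltW xp) ?(ltW xe) //.
      by rewrite ler_pdivrMr ?ltr0n // mul1r ler_nat.
    by rewrite ler_pdivrMr // mul1r lerDl ltW.
  have d1 : (d < 1)%R.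
    rewrite ltr_pdivrMr ?mulr_gt0 ?ltr0n // mul1r.
    by rewrite (@lt_le_trans _ _ (x + e)%R) ?ltrDr // ler_peMl ?(ltW xe) // ler1n.
  have := @bernoulli R (1 - d) n; have -> : (1 - (1 - d) = d)%R by ring.
  move=> bern.
  have {}bern : (1 - n%:R * d <= (1 - d) ^+ n)%R by apply: bern; apply/andP; split; lra.
  have := h (1 - d)%R; rewrite lee_fin => /(_ _) h1.
  have {}h1 : ((1 - d) ^+ n * x <= b)%R by apply: h1; apply/andP; split; lra.
  have := ler_wpM2r x0 bern; rewrite mulrBl mul1r => h2.
  by lra.
- have := h 2^-1%R; rewrite gt0_muley ?lte_fin ?exprn_gt0 //.
  by apply; rewrite invr_gt0 ltr0n invf_lt1 ?ltr1n.
Qed.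

(** The Abel mean dominates [r ^+ n] times the [n]-th partial sum; then [r] tends to 1. *)
Lemma abel_le v B : (forall k, 0 <= v k) ->
  (forall r, (0 < r < 1)%R -> \sum_(0 <= k <oo) (r ^+ k)%:E * v k <= B) -> \sum_(0 <= k <oo) v k <= B.
Proof.
move=> v0 h; apply: lime_le; first exact: is_cvg_nneseries.
apply: nearW => n; apply: (@le_of_scaled n); first exact: sume_ge0.
move=> r r01; have /andP[r0 r1] := r01; apply: le_trans (h r r01).
apply: le_trans (nneseries_lim_ge n _); last first.
  by move=> k _ _; rewrite mule_ge0 // lee_fin exprn_ge0 // ltW.
rewrite ge0_sume_distrr // big_nat [leRHS]big_nat; apply: lee_sum => k /andP[_ kn].
apply: lee_wpmul2r => //; rewrite lee_fin; apply: ler_wiXn2l; [exact: ltW|exact: ltW|exact: ltnW].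
Qed.

Lemma le_abel v r : (forall k, 0 <= v k) -> (0 < r < 1)%R ->
  \sum_(0 <= k <oo) (r ^+ k)%:E * v k <= \sum_(0 <= k <oo) v k.
Proof.
move=> v0 /andP[r0 r1]; apply: lee_nneseries => k _.
  by rewrite mule_ge0 // lee_fin exprn_ge0 // ltW.
by rewrite gee_pMl // ?lee_fin ?exprn_ile1 // ltW.
Qed.

Lemma abel_homo v r r' : (forall k, 0 <= v k) -> (0 < r)%R -> (r <= r')%R ->
  \sum_(0 <= k <oo) (r ^+ k)%:E * v k <= \sum_(0 <= k <oo) (r' ^+ k)%:E * v k.
Proof.
move=> v0 r0 rr'; apply: lee_nneseries => k _.
  by rewrite mule_ge0 // lee_fin exprn_ge0 // ltW.
apply: lee_wpmul2r => //; rewrite lee_fin; apply: lerXn2r => //; rewrite nnegrE ?(ltW r0) //.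
exact: le_trans (ltW r0) rr'.
Qed.

Lemma abel_swap (c : nat -> nat -> \bar R) q r : (forall m n, 0 <= c m n) -> (0 < q)%R -> (0 < r)%R ->
  \sum_(0 <= n <oo) (q ^+ n)%:E * (\sum_(0 <= m <oo) (r ^+ m)%:E * c m n)
  = \sum_(0 <= m <oo) (r ^+ m)%:E * (\sum_(0 <= n <oo) (q ^+ n)%:E * c m n).
Proof.
move=> c0 q0 r0.
have k0 (x : R) k : (0 < x)%R -> 0 <= (x ^+ k)%:E :> \bar R by move=> x0; rewrite lee_fin exprn_ge0 // ltW.
transitivity (\sum_(0 <= n <oo) \sum_(0 <= m <oo) (q ^+ n)%:E * ((r ^+ m)%:E * c m n)).
  by apply: eq_eseriesr => n _; rewrite nneseriesZl // => m _; rewrite mule_ge0 ?k0.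
rewrite nneseries_interchange => [|m n]; last by rewrite !mule_ge0 ?k0.
apply: eq_eseriesr => m _; rewrite -nneseriesZl => [|n _]; last by rewrite mule_ge0 ?k0.
by apply: eq_eseriesr => n _; rewrite muleCA.
Qed.

(** Removing the weights one index at a time needs two independent ratios [r] and [q]; monotonicity
    replaces both by their maximum. *)
Lemma abel_le2 (c : nat -> nat -> \bar R) B : (forall m n, 0 <= c m n) ->
  (forall r, (0 < r < 1)%R ->
     \sum_(0 <= n <oo) (r ^+ n)%:E * (\sum_(0 <= m <oo) (r ^+ m)%:E * c m n) <= B) ->
  \sum_(0 <= n <oo) \sum_(0 <= m <oo) c m n <= B.
Proof.
move=> c0 h.
have s0 x n : (0 < x)%R -> 0 <= \sum_(0 <= m <oo) (x ^+ m)%:E * c m n.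
  by move=> x0; apply: nneseries_ge0 => m _ _; rewrite mule_ge0 // lee_fin exprn_ge0 // ltW.
have t0 x m : (0 < x)%R -> 0 <= \sum_(0 <= n <oo) (x ^+ n)%:E * c m n.
  by move=> x0; apply: nneseries_ge0 => n _ _; rewrite mule_ge0 // lee_fin exprn_ge0 // ltW.
apply: abel_le => [n|r /andP[r0 r1]]; first exact: nneseries_ge0.
have -> : \sum_(0 <= k <oo) (r ^+ k)%:E * (\sum_(0 <= m <oo) c m k)
    = \sum_(0 <= m <oo) \sum_(0 <= k <oo) (r ^+ k)%:E * c m k.
  rewrite -nneseries_interchange => [|k m]; last by rewrite mule_ge0 // lee_fin exprn_ge0 // ltW.
  by apply: eq_eseriesr => k _; rewrite nneseriesZl.
apply: abel_le => [m|q /andP[q0 q1]]; first exact: t0.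
set M := Num.max r q.
have rM : (r <= M)%R by rewrite le_max lexx.
have qM : (q <= M)%R by rewrite le_max lexx orbT.
have M0 := lt_le_trans r0 rM.
have M1 : (M < 1)%R by rewrite gt_max r1 q1.
apply: le_trans (h M _); last by rewrite M0 M1.
rewrite -abel_swap //; apply: le_trans (abel_homo _ r0 rM) _; first by move=> n; exact: s0.
apply: lee_nneseries => n _; first by rewrite mule_ge0 ?s0 // lee_fin exprn_ge0 // ltW.
by apply: lee_wpmul2l; [rewrite lee_fin exprn_ge0 // ltW|exact: abel_homo].
Qed.

End AbelSums.

Section DirichletIndices.
Variable R : realType.
Local Notation C := R[i].
Local Notation TR := (measurableTypeR R).
Implicit Types (mu : circle_measure R) (a : nat -> nat -> C).

(* The squared norm is a sum of integrals of squares of the functionals [ev].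
   An index [(true, k)] stands for the [k]-th coefficient, [(false, k)] for the
   partial sum of order [k] of the derivative. *)
Definition ebasis (b : bool) (k m : nat) (t : TR) : C :=
  if b then (m == k)%:R else if m is m'.+1 then m%:R * expi (m'%:R * t) else 0.

(** The range [k.+2] is dictated by the index [(false, k)]: the partial sum of order [k] of the
    derivative involves coefficients up to [k + 1]. *)
Definition ev b k t (x : nat -> C) : C := \sum_(m < k.+2) x m * ebasis b k m t.

Lemma ev_true k t x : ev true k t x = x k.
Proof.
have kk : (k < k.+2)%N by rewrite leqW.
rewrite /ev (bigD1 (Ordinal kk) isT) big1 => [|m mk].
  have -> : ebasis true k (Ordinal kk) t = 1 by rewrite /ebasis eqxx.
  by rewrite /= mulr1 addr0.
by rewrite /ebasis (_ : (m == k :> nat) = false) ?mulr0 //; apply: negbTE.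
Qed.

Lemma ev_false k t x : ev false k t x = part k t (pderiv x).
Proof.
rewrite /ev big_ord_recl mulr0 add0r; apply: eq_bigr => m _.
by rewrite /pderiv /= mulrCA mulrA.
Qed.

(** A Dirac mass turns a plain coefficient into an integral, so that the Hardy part and the
    Dirichlet parts of the norm are instances of one formula. *)
Definition numeas mu b : {finite_measure set TR -> \bar R} :=
  if b return {finite_measure set TR -> \bar R} then dirac (0 : TR) else mu.

Definition wt b k : R := if b then 1 else (2 * pi)^-1 * ew R k.

Lemma wt_ge0 b k : 0 <= wt b k.
Proof. by case: b => //=; rewrite mulr_ge0 ?ew_ge0 // invr_ge0 mulr_ge0 ?pi_ge0. Qed.

Lemma bmeas_ebasis b k m : bmeas (ebasis b k m).
Proof.
case: b; first exact: bmeas_cst.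
by case: m => [|m]; [exact: bmeas_cst|apply: bmeasZ; exact: bmeas_expi].
Qed.

Definition bgram mu b k := gram (numeas mu b) (ebasis b k).

Definition qterm mu1 mu2 b1 k b2 l a : R :=
  wt b1 k * wt b2 l * qform k.+2 l.+2 (bgram mu1 b1 k) (bgram mu2 b2 l) a.

Lemma qtermE mu1 mu2 b1 k b2 l a :
  ((qterm mu1 mu2 b1 k b2 l a)%:E = (wt b1 k * wt b2 l)%:E *
    \int[numeas mu1 b1]_(t in @I2pi R) \int[numeas mu2 b2]_(s in @I2pi R)
      (modulus (ev b2 l s (fun n => ev b1 k t (a ^~ n))) ^+ 2)%:E)%E.
Proof.
rewrite /qterm EFinM -integral_qform //; move=> m; exact: bmeas_ebasis.
Qed.

Lemma qterm_ge0 mu1 mu2 b1 k b2 l a : 0 <= qterm mu1 mu2 b1 k b2 l a.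
Proof.
rewrite -lee_fin qtermE mule_ge0 ?lee_fin ?mulr_ge0 ?wt_ge0 //.
by apply: integral_ge0 => t _; apply: integral_ge0 => s _; rewrite lee_fin exprn_ge0 ?modulus_ge0.
Qed.

Lemma qform_tr N1 N2 (A B : nat -> nat -> C) a : qform N1 N2 A B a = qform N2 N1 B A (ptr a).
Proof.
rewrite /qform; congr Re.
under eq_bigr do under eq_bigr do rewrite mulr_suml.
under [RHS]eq_bigr do under eq_bigr do rewrite mulr_suml.
under eq_bigr do under eq_bigr do under eq_bigr do rewrite mulr_suml.
under [RHS]eq_bigr do under eq_bigr do under eq_bigr do rewrite mulr_suml.
transitivity (\sum_(m < N1) \sum_(n < N2) \sum_(q < N2) \sum_(p < N1) a m n * (a p q)^*%C * A m p * B n q).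
  rewrite [RHS]exchange_big; apply: eq_bigr => n _; by rewrite [RHS]exchange_big.
apply: eq_bigr => m _; rewrite [RHS]exchange_big; apply: eq_bigr => n _ /=; rewrite exchange_big.
by apply: eq_bigr => p _; apply: eq_bigr => q _; rewrite mulrAC.
Qed.

Lemma qterm_tr mu1 mu2 b1 k b2 l a : qterm mu1 mu2 b1 k b2 l a = qterm mu2 mu1 b2 l b1 k (ptr a).
Proof. by rewrite /qterm qform_tr [wt b1 k * _]mulrC. Qed.

Lemma integral_numeas_true mu (f : TR -> \bar R) : (forall t, f t = f 0) ->
  (\int[numeas mu true]_(t in @I2pi R) f t = f 0%R)%E.
Proof.
move=> h; have mI := @measurable_I2pi R.
rewrite (_ : f = cst (f 0)); last by apply/funext.
rewrite (@integral_dirac _ TR 0 R _ mI _ (measurable_cst _)).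
by rewrite diracE mem_set ?mul1e //; rewrite /I2pi /= in_itv /= lexx twopi_gt0.
Qed.

Lemma qterm_tt mu1 mu2 k l a : qterm mu1 mu2 true k true l a = modulus (a k l) ^+ 2.
Proof.
apply: EFin_inj; rewrite qtermE mul1r mul1e integral_numeas_true //.
by rewrite integral_numeas_true //= ?ev_true // => s; rewrite !ev_true.
Qed.

Lemma qterm_tf mu1 mu2 k l a : ((qterm mu1 mu2 true k false l a)%:E = qS mu2 l (pderiv (a k)))%E.
Proof.
rewrite qtermE mul1r integral_numeas_true; last first.
  by move=> t; apply: eq_integral => s _; rewrite !ev_false; congr ((modulus _) ^+ 2)%:E;
     apply: eq_bigr => m _; rewrite /pderiv !ev_true.
by congr (_ * _)%E; apply: eq_integral => s _; rewrite !ev_false; congr ((modulus _) ^+ 2)%:E;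
  apply: eq_bigr => m _; rewrite /pderiv !ev_true.
Qed.

(** The tensor square of the one-variable norm. Its four blocks are the Hardy norm ([true true]) and
    the three Dirichlet integrals: [false true], [true false] and [false false] for the first,
    second and third. *)
Definition dnorm mu1 mu2 a : \bar R :=
  (\sum_(b1 : bool) \sum_(0 <= k <oo) \sum_(b2 : bool) \sum_(0 <= l <oo) (qterm mu1 mu2 b1 k b2 l a)%:E)%E.

Definition qsum mu1 mu2 b1 b2 a : \bar R := (\sum_(0 <= k <oo) \sum_(0 <= l <oo) (qterm mu1 mu2 b1 k b2 l a)%:E)%E.

Lemma qsum_tr mu1 mu2 b1 b2 a : qsum mu1 mu2 b1 b2 a = qsum mu2 mu1 b2 b1 (ptr a).
Proof.
rewrite /qsum nneseries_interchange; last by move=> k l; rewrite lee_fin qterm_ge0.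
by apply: eq_eseriesr => l _; apply: eq_eseriesr => k _; rewrite qterm_tr.
Qed.

Lemma dnormE mu1 mu2 a : (dnorm mu1 mu2 a = qsum mu1 mu2 true true a + qsum mu1 mu2 true false a
   + qsum mu1 mu2 false true a + qsum mu1 mu2 false false a)%E.
Proof.
have s0 b1 b2 k : (0 <= \sum_(0 <= l <oo) (qterm mu1 mu2 b1 k b2 l a)%:E)%E.
  by apply: nneseries_ge0 => l _ _; rewrite lee_fin qterm_ge0.
have H b1 : (\sum_(0 <= k <oo) \sum_(b2 : bool) \sum_(0 <= l <oo) (qterm mu1 mu2 b1 k b2 l a)%:E
   = qsum mu1 mu2 b1 true a + qsum mu1 mu2 b1 false a)%E.
  by rewrite /qsum -nneseriesD //; apply: eq_eseriesr => k _; rewrite big_bool.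
rewrite /dnorm big_bool /= (H true) (H false).
exact: addeA.
Qed.

End DirichletIndices.

(** * The Hardy norm and the Dirichlet integrals in terms of coefficients *)

Section HardyNorm.
Variable R : realType.
Local Notation C := R[i].
Variables (a : nat -> nat -> C) (f : C * C -> C).
Hypotheses (pa : pcoef2 a) (fE : forall z, bidisc z -> f z = psum2 a z).
Local Open Scope ereal_scope.

Let realmod (r : R) : (0 < r < 1)%R -> modulus r%:C%C = r.
Proof. by case/andP=> r0 _; rewrite modulus_real ger0_norm // ltW. Qed.

Let polar_mul (r t : R) : polar r t = (expi t * r%:C%C)%R.
Proof. by rewrite polarE mulrC. Qed.

Lemma hardy_torus (r : R) : (0 < r < 1)%R ->
  ((2 * pi) ^- 2)%:E * int_angle (fun s => int_angle (fun t => (modulus (f (polar r s, polar r t)) ^+ 2)%:E))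
  = \sum_(0 <= n <oo) ((r ^+ 2) ^+ n)%:E * (\sum_(0 <= m <oo) ((r ^+ 2) ^+ m)%:E * (modulus (a m n) ^+ 2)%:E).
Proof.
move=> r01; have rm := realmod r01; have /andP[r0 r1] := r01.
have pr s : (modulus (polar r s) < 1)%R by rewrite modulus_polar ?ltW.
have rr1 : (modulus r%:C%C < 1)%R by rewrite rm.
have rk0 n : (0 <= (r ^+ 2) ^+ n)%R by rewrite !exprn_ge0 // ltW.
have pt := pcoef2_tr pa.
pose F n (s : R) : R := (modulus (psum (ptr a n) (expi s * r%:C%C)) ^+ 2)%R.
have cF n : citv 0 (2 * pi)%R (F n).
  by apply: citv_modulus2; apply: continuous_psum_circle => //; exact: pcoef2_row.
have inner s : int_angle (fun t => (modulus (f (polar r s, polar r t)) ^+ 2)%:E)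
    = \sum_(0 <= n <oo) (2 * pi * (r ^+ 2) ^+ n * F n s)%:E.
  transitivity (int_angle (fun t => (modulus (psum (fun n => psum (ptr a n) (polar r s)) (expi t * r%:C%C)) ^+ 2)%:E)).
    apply: eq_integral => t _; rewrite fE; last by apply/bidiscE; split; exact: pr.
    by rewrite -polar_mul (@psum2_swap _ a (polar r s, polar r t) pa (pr s) (pr t)).
  rewrite parseval //; last exact: pcoef2_rowsum.
  rewrite -nneseriesZl => [|n _]; last by rewrite lee_fin mulr_ge0 ?exprn_ge0 ?modulus_ge0.
  by apply: eq_eseriesr => n _; rewrite /F rm -EFinM polar_mul; congr EFin; ring.
have p0 : (0 <= 2 * pi :> R)%R by rewrite ltW // twopi_gt0.
have w0 n : (0 <= 2 * pi * (r ^+ 2) ^+ n)%R by rewrite mulr_ge0.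
have -> : int_angle (fun s => int_angle (fun t => (modulus (f (polar r s, polar r t)) ^+ 2)%:E))
    = \sum_(0 <= n <oo) int_angle (fun s => (2 * pi * (r ^+ 2) ^+ n * F n s)%:E).
  transitivity (int_angle (fun s => \sum_(0 <= n <oo) (2 * pi * (r ^+ 2) ^+ n * F n s)%:E)).
    by apply: eq_integral => s _; rewrite inner.
  apply: integral_nneseries => [|n|n s _]; first exact: measurable_itv.
  - have cn : citv 0 (2 * pi)%R (fun s => 2 * pi * (r ^+ 2) ^+ n * F n s)%R by apply: citvM (cF n); exact: citv_cst.
    by have /integrableP[] := citv_integrable cn.
  - by rewrite lee_fin mulr_ge0 // exprn_ge0 ?modulus_ge0.
rewrite -nneseriesZl => [|n _]; last first.
  by apply: integral_ge0 => s _; rewrite lee_fin mulr_ge0 // exprn_ge0 ?modulus_ge0.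
apply: eq_eseriesr => n _; rewrite int_angleZ // parseval //; last exact: pcoef2_row.
rewrite rm !muleA -!EFinM; congr (_%:E * _).
  by have := @twopiC_neq0 R; have := @twopi_gt0 R; move: (2 * pi)%R => x x0 _; field; rewrite gt_eqF.
by apply: eq_eseriesr => m _; rewrite -EFinM mulrC.
Qed.

(** By Parseval in each variable the torus means are Abel means of ratio [r ^+ 2], and their
    supremum is the full sum. The block [true true] is the same for all measures. *)
Lemma hardy_normsqE mu1 mu2 : hardy_normsq f = qsum mu1 mu2 true true a.
Proof.
have c0 m n : 0 <= (modulus (a m n) ^+ 2)%:E by rewrite lee_fin exprn_ge0 ?modulus_ge0.
have -> : qsum mu1 mu2 true true a = \sum_(0 <= n <oo) \sum_(0 <= m <oo) (modulus (a m n) ^+ 2)%:E.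
  rewrite nneseries_interchange //.
  by apply: eq_eseriesr => m _; apply: eq_eseriesr => n _; rewrite qterm_tt.
have sq01 (r : R) : (0 < r < 1)%R -> (0 < r ^+ 2 < 1)%R.
  by case/andP=> r0 r1; rewrite exprn_gt0 //= exprn_ilt1 // ltW.
apply/eqP; rewrite eq_le; apply/andP; split.
  apply: ge_ereal_sup => y [r]; rewrite /= in_itv /= => r01 <-; rewrite hardy_torus //.
  apply: le_trans (le_abel _ (sq01 _ r01)) _.
    by move=> n; apply: nneseries_ge0 => m _ _; rewrite mule_ge0 // lee_fin !exprn_ge0 // ltW; case/andP: r01.
  apply: lee_nneseries => n _; last exact: le_abel (sq01 _ r01).
  by move=> _; apply: nneseries_ge0 => m _ _; rewrite mule_ge0 // lee_fin !exprn_ge0 // ltW; case/andP: r01.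
apply: abel_le2 => // r /andP[r0 r1].
have s01 : (0 < Num.sqrt r < 1)%R by rewrite sqrtr_gt0 r0 -[ltRHS]sqrtr1 ltr_sqrt.
apply: ereal_sup_ubound; exists (Num.sqrt r); first by rewrite /= in_itv.
by rewrite hardy_torus // sqr_sqrtr // ltW.
Qed.

End HardyNorm.

Section DirichletFormulas.
Variable R : realType.
Local Notation C := R[i].
Local Notation TR := (measurableTypeR R).
Local Open Scope ereal_scope.

Lemma nneseries_mulr (v : nat -> \bar R) x : (forall k, 0 <= v k) -> 0 <= x ->
  \sum_(0 <= k <oo) (v k * x) = (\sum_(0 <= k <oo) v k) * x.
Proof.
move=> v0 x0; rewrite -!ge0_integral_count //; last by move=> k; rewrite mule_ge0.
by rewrite ge0_integralZr.
Qed.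

Lemma int_disc_mulr (g : C -> \bar R) x : disc_measurable g ->
  (forall z, (modulus z < 1)%R -> 0 <= g z) -> 0 <= x ->
  int_disc (fun z => g z * x) = int_disc g * x.
Proof.
move=> mg g0 x0; rewrite !int_discE -muleA ge0_integralZr //; first exact: measurable_disc.
by move=> p /discE; exact: g0.
Qed.

Lemma psum_sum N (c : nat -> C) (A : nat -> nat -> C) : (forall m, pcoef (A m)) ->
  pcoef (fun n => \sum_(m < N) c m * A m n)%R /\
  (forall z, (modulus z < 1)%R -> psum (fun n => \sum_(m < N) c m * A m n)%R z = (\sum_(m < N) c m * psum (A m) z)%R).
Proof.
move=> pA; elim: N => [|N [pS IH]].
  have e : (fun n => \sum_(m < 0) c m * A m n)%R = fun=> 0%R by apply/funext => n; rewrite big_ord0.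
  rewrite e; split; first by apply: (@pcoef_fin R _ 0).
  by move=> z z1; rewrite (@psum_fin R _ _ 0) // !big_ord0.
have e : (fun n => \sum_(m < N.+1) c m * A m n)%R = (fun n => \sum_(m < N) c m * A m n + c N * A N n)%R.
  by apply/funext => n; rewrite big_ord_recr.
rewrite e; split; first by apply: pcoefD => //; exact: pcoefZ.
by move=> z z1; rewrite psumD ?psumZ ?IH //; [rewrite big_ord_recr|exact: pcoefZ].
Qed.

(** Abel means of nonnegative terms increase with [r], so the limit is a supremum. The reflection
    [r |-> - r] makes it a limit from the right of a nonincreasing function. *)
Lemma abel_lim (F : R -> \bar R) (v : nat -> \bar R) : (forall k, 0 <= v k) ->
  (forall r, (0 < r < 1)%R -> F r = \sum_(0 <= k <oo) ((r ^+ 2) ^+ k)%:E * v k) ->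
  lim (F r @[r --> (1 : R)^'-]) = \sum_(0 <= k <oo) v k.
Proof.
move=> v0 FE; apply: cvg_lim => //; apply/cvg_at_leftNP.
have sq01 (r : R) : (0 < r < 1)%R -> (0 < r ^+ 2 < 1)%R.
  by case/andP=> r0 r1; rewrite exprn_gt0 //= exprn_ilt1 // ltW.
have memN (x : R) : x \in Interval (BRight (-1)%R) (BLeft 0%R) -> (0 < - x < 1)%R.
  by rewrite in_itv /= => /andP[x1 x0]; rewrite oppr_gt0 x0 ltrNl x1.
have -> : \sum_(0 <= k <oo) v k
    = ereal_sup [set (F \o -%R) x | x in [set` Interval (BRight (-1)%R) (BLeft 0%R)]].
  apply/eqP; rewrite eq_le; apply/andP; split.
    apply: abel_le => // r /andP[r0 r1].
    have s0 : (0 < Num.sqrt r)%R by rewrite sqrtr_gt0.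
    have s1 : (Num.sqrt r < 1)%R by rewrite -[ltRHS]sqrtr1 ltr_sqrt.
    apply: ereal_sup_ubound; exists (- Num.sqrt r)%R.
      by rewrite /= in_itv /= ltrN2 s1 oppr_lt0 s0.
    by rewrite /= opprK FE ?s0 // sqr_sqrtr // ltW.
  apply: ge_ereal_sup => y [x /memN x01] <-.
  by rewrite /= FE //; apply: le_abel => //; exact: sq01.
apply: nonincreasing_at_right_cvge.
  by rewrite bnd_simp ltrN10.
move=> x y /memN x01 /memN y01 xy; rewrite /= !FE //.
have /andP[y0 _] := y01.
apply: abel_homo => //; first by rewrite exprn_gt0.
by rewrite lerXn2r ?nnegrE ?lerN2 // ltW //; case/andP: x01.
Qed.

Variables (a : nat -> nat -> C) (f : C * C -> C).
Hypotheses (pa : pcoef2 a) (fE : forall z, bidisc z -> f z = psum2 a z).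

(** Parseval in the first variable produces the Abel weights [r^(2m)]; the disc integral left for
    each [m] is [int_disc_poisson] for the row [a m]. *)
Lemma dirichlet2E mu1 mu2 : dirichlet2 mu2 f = qsum mu1 mu2 true false a.
Proof.
have pd m : pcoef (pderiv (a m)) by apply: pcoef_deriv; exact: pcoef2_row.
have q0 m : 0 <= \sum_(0 <= l <oo) qS mu2 l (pderiv (a m)).
  by apply: nneseries_ge0 => l _ _; exact: qS_ge0.
have -> : qsum mu1 mu2 true false a = \sum_(0 <= m <oo) \sum_(0 <= l <oo) qS mu2 l (pderiv (a m)).
  by apply: eq_eseriesr => m _; apply: eq_eseriesr => l _; rewrite qterm_tf.
apply: abel_lim => // r r01; have /andP[r0 r1] := r01.
have rm : modulus r%:C%C = r by rewrite modulus_real ger0_norm // ltW.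
have rr1 : (modulus r%:C%C < 1)%R by rewrite rm.
have rk0 n : (0 <= (r ^+ 2) ^+ n)%R by rewrite !exprn_ge0 // ltW.
have p0 : (0 <= 2 * pi :> R)%R by rewrite ltW // twopi_gt0.
have mp0 m z : (modulus z < 1)%R -> 0 <= (modulus (psum (pderiv (a m)) z) ^+ 2)%:E * poisson mu2 z.
  by move=> z1; rewrite mule_ge0 ?poisson_ge0 // lee_fin exprn_ge0 ?modulus_ge0.
have mmp m : disc_measurable (fun z => (modulus (psum (pderiv (a m)) z) ^+ 2)%:E * poisson mu2 z).
  by apply: disc_measurableM; [exact: disc_measurable_psum|exact: disc_measurable_poisson].
have inner z : (modulus z < 1)%R ->
    int_angle (fun t => (modulus (partial2 f (polar r t, z)) ^+ 2)%:E * poisson mu2 z)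
    = \sum_(0 <= m <oo) (2 * pi * (r ^+ 2) ^+ m)%:E * ((modulus (psum (pderiv (a m)) z) ^+ 2)%:E * poisson mu2 z).
  move=> z1; pose b m := psum (pderiv (a m)) z.
  have pb : pcoef b by apply: (pcoef2_rowsum (pcoef2_pderiv2 pa)).
  transitivity (int_angle (fun t => (modulus (psum b (expi t * r%:C%C)%R) ^+ 2)%:E) * poisson mu2 z).
    rewrite /int_angle -ge0_integralZr //.
    - apply: eq_integral => t _.
      have tz : bidisc (polar r t, z) by apply/bidiscE; rewrite modulus_polar ?(ltW r0).
      by rewrite (partial2_psum2 pa fE tz) /psum2 polarE mulrC.
    - have cb : citv 0 (2 * pi)%R (fun t => modulus (psum b (expi t * r%:C%C)%R) ^+ 2)%R.
        by apply: citv_modulus2; apply: continuous_psum_circle.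
      by have /integrableP[] := citv_integrable cb.
    - by move=> t _; rewrite lee_fin exprn_ge0 ?modulus_ge0.
    - exact: poisson_ge0.
  rewrite parseval // -muleA -nneseries_mulr; [|by move=> m; rewrite lee_fin mulr_ge0 ?exprn_ge0 ?modulus_ge0|exact: poisson_ge0].
  rewrite -nneseriesZl => [|m _]; last by rewrite mule_ge0 ?poisson_ge0 // lee_fin mulr_ge0 ?exprn_ge0 ?modulus_ge0.
  by apply: eq_eseriesr => m _; rewrite rm /b !muleA -!EFinM; congr (_%:E * _); ring.
rewrite (eq_int_disc inner) int_disc_nneseries; last 2 first.
- by move=> m; apply: emeasurable_funM; [exact: measurable_cst|exact: mmp].
- by move=> m z z1; rewrite mule_ge0 ?mp0 // lee_fin mulr_ge0.
rewrite -nneseriesZl => [|m _]; last first.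
  by apply: int_disc_ge0 => z z1; rewrite mule_ge0 ?mp0 // lee_fin mulr_ge0.
have w0 m : (0 <= 2 * pi * (r ^+ 2) ^+ m)%R by rewrite mulr_ge0.
apply: eq_eseriesr => m _; rewrite int_discZ //; last exact: mp0.
rewrite int_disc_poisson // muleA -EFinM; congr (_%:E * _).
by have := @twopi_gt0 R; move: (2 * pi)%R => x x0; rewrite mulKf // gt_eqF.
Qed.

Lemma dirichlet3E mu1 mu2 : dirichlet3 mu1 mu2 f = qsum mu1 mu2 false false a.
Proof.
pose A := pderiv1 (pderiv2 a).
have pA : pcoef2 A by apply: pcoef2_pderiv1; exact: pcoef2_pderiv2.
(* [B k t] takes, for each power [n] of the second variable, the partial sum in the first. It is
   again the coefficient sequence of a power series, so [int_disc_poisson] can be applied a second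
   time, now in the second variable. *)
pose B (k : nat) (t : R) (n : nat) : C := part k t (A^~ n).
have BE k t : B k t = (fun n => \sum_(m < k.+1) expi (m%:R * t) * A m n)%R.
  by apply/funext => n; apply: eq_bigr => m _; rewrite mulrC.
have pB k t : pcoef (B k t).
  by rewrite BE; exact: (@psum_sum k.+1 (fun m => expi (m%:R * t)) A (fun m => pcoef2_row m pA)).1.
have psumB k t z : (modulus z < 1)%R -> psum (B k t) z = part k t (fun m => psum (A m) z).
  move=> z1; rewrite BE (@psum_sum k.+1 (fun m => expi (m%:R * t)) A (fun m => pcoef2_row m pA)).2 //.
  by apply: eq_bigr => m _; rewrite mulrC.
pose c k : R := ((2 * pi)^-1 * ew R k)%R.
have c0 k : (0 <= c k)%R by rewrite mulr_ge0 ?ew_ge0 // invr_ge0 ltW // twopi_gt0.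
pose h k z (t : TR) : \bar R := (modulus (psum (B k t) z) ^+ 2)%:E * poisson mu2 z.
have h0 k z t : (modulus z < 1)%R -> 0 <= h k z t.
  by move=> z1; rewrite mule_ge0 ?poisson_ge0 // lee_fin exprn_ge0 ?modulus_ge0.
have mI := @measurable_I2pi R.
have mh k : measurable_fun (@disc R `*` @I2pi R : set ((TR * TR) * TR)%type) (fun q => h k (cpt q.1) q.2).
  apply: emeasurable_funM.
    have mp : cmeas (@disc R `*` @I2pi R : set ((TR * TR) * TR)%type)
        (fun q => \sum_(m < k.+1) psum (A m) (cpt q.1) * expi (m%:R * q.2))%R.
      apply: cmeas_sum => m; apply: cmeasM.
        apply: cmeas_psum; [exact: pcoef2_row|exact: cmeas_prod_fst|by move=> q [/= /discE]].
      apply: cmeas_expi; apply: measurable_funM; first exact: measurable_cst.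
      by apply: measurable_funTS; exact: measurable_snd.
    apply/measurable_EFinP; have := measurable_modulus2 mp.
    by apply: eq_measurable_fun => q /set_mem[/= /discE z1 _]; rewrite psumB.
  have := @disc_measurable_poisson R mu2; rewrite /disc_measurable => md.
  have mf : measurable_fun (@disc R `*` @I2pi R : set ((TR * TR) * TR)%type) fst by apply: measurable_funTS; exact: measurable_fst.
  apply: (measurable_comp _ _ md mf) => //.
  - exact: measurable_disc.
  - by move=> _ [q [/= qD _] <-].
have step z : (modulus z < 1)%R ->
    int_disc (fun z1 => (modulus (partial1 (partial2 f) (z1, z)) ^+ 2)%:E * poisson mu1 z1 * poisson mu2 z)
    = \sum_(0 <= k <oo) (c k)%:E * \int[mu1]_(t in @I2pi R) h k z t.
  move=> z1; pose b m := psum (A m) z.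
  have P0 : 0 <= poisson mu2 z by exact: poisson_ge0.
  have pb : pcoef b by exact: pcoef2_rowsum.
  have f2 w : bidisc w -> partial2 f w = psum2 (pderiv2 a) w by exact: (partial2_psum2 pa fE).
  transitivity (int_disc (fun w => (modulus (psum b w) ^+ 2)%:E * poisson mu1 w) * poisson mu2 z).
    pose g w := (modulus (psum b w) ^+ 2)%:E * poisson mu1 w.
    transitivity (int_disc (fun w => g w * poisson mu2 z)).
      apply: eq_int_disc => w w1.
      have tz : bidisc (w, z) by apply/bidiscE.
      by rewrite (partial1_psum2 (pcoef2_pderiv2 pa) f2 tz).
    apply: int_disc_mulr; last exact: P0.
    - by apply: disc_measurableM; [exact: disc_measurable_psum|exact: disc_measurable_poisson].
    - by move=> w w1; rewrite mule_ge0 ?poisson_ge0 // lee_fin exprn_ge0 ?modulus_ge0.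
  rewrite int_disc_poisson // -nneseries_mulr //; last by move=> k; exact: qS_ge0.
  apply: eq_eseriesr => k _; rewrite /qS -muleA; congr (_ * _).
  rewrite -ge0_integralZr //.
  - by apply: eq_integral => t _; rewrite /h psumB.
  - exact: measurable_part.
  - by move=> t _; rewrite lee_fin exprn_ge0 ?modulus_ge0.
have mB k n : bmeas (fun t : TR => B k t n).
  by apply: bmeas_sum => m; apply: bmeasZ; exact: bmeas_expi.
have mi k l : measurable_fun (@I2pi R) (fun t => \int[mu2]_(s in @I2pi R) (modulus (part l s (B k t)) ^+ 2)%:E).
  have mE m : bmeas (fun s : TR => expi (m%:R * s)) by exact: bmeas_expi.
  have mF : bmeas (fun t : TR => \sum_(n < l.+1) \sum_(q < l.+1) (B k t n * (B k t q)^*%C * gram mu2 (fun m s => expi (m%:R * s)) n q))%R.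
    apply: bmeas_sum => n; apply: bmeas_sum => q; apply: bmeasM; last exact: bmeas_cst.
    by apply: bmeasM => //; exact: bmeasJ.
  have /(measurable_funTS (D := @I2pi R))/measurable_EFinP := mF.1.1.
  apply: eq_measurable_fun => t _.
  by rewrite /part (@integral_form1 R mu2 _ mE l.+1 (B k t)).
have mq k l : measurable_fun (@I2pi R) (fun t => qS mu2 l (B k t)).
  by apply: emeasurable_funM; [exact: measurable_cst|exact: mi].
rewrite /dirichlet3 (eq_int_disc step) int_disc_nneseries; last 2 first.
- move=> k; apply: emeasurable_funM; first exact: measurable_cst.
  by apply: (@disc_measurable_integral _ _ TR mu1 (@I2pi R)) => // z t z1 _; exact: h0.
- by move=> k z z1; rewrite mule_ge0 ?lee_fin //; apply: integral_ge0 => t _; exact: h0.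
apply: eq_eseriesr => k _.
rewrite int_discZ //; last 2 first.
- by apply: (@disc_measurable_integral _ _ TR mu1 (@I2pi R)) => // z t z1 _; exact: h0.
- by move=> z z1; apply: integral_ge0 => t _; exact: h0.
rewrite (@int_disc_tonelli _ _ TR mu1 (@I2pi R)) //; last by move=> z t z1 _; exact: h0.
transitivity ((c k)%:E * \int[mu1]_(t in @I2pi R) \sum_(0 <= l <oo) qS mu2 l (B k t)).
  by congr (_ * _); apply: eq_integral => t _; rewrite /h int_disc_poisson.
rewrite integral_nneseries //; last by move=> l t _; exact: qS_ge0.
rewrite -nneseriesZl => [|l _]; last by apply: integral_ge0 => t _; exact: qS_ge0.
apply: eq_eseriesr => l _; rewrite qtermE [in RHS]EFinM -[RHS]muleA; congr (_ * _).
have w0 : 0 <= (wt R false l)%:E by rewrite lee_fin wt_ge0.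
transitivity ((wt R false l)%:E * \int[mu1]_(t in @I2pi R) \int[mu2]_(s in @I2pi R) (modulus (part l s (B k t)) ^+ 2)%:E).
  by rewrite -ge0_integralZl // => t _; apply: integral_ge0 => s _; rewrite lee_fin exprn_ge0 ?modulus_ge0.
congr (_ * _); apply: eq_integral => t _; apply: eq_integral => s _.
rewrite ev_false; congr ((modulus _) ^+ 2)%:E; apply: eq_bigr => n _; congr (_ * _)%R.
by rewrite /pderiv ev_false /B /part mulr_sumr; apply: eq_bigr => m _; rewrite /A /pderiv1 /pderiv2 /pderiv; ring.
Qed.

End DirichletFormulas.

Section DirichletNormFormula.
Variable R : realType.
Local Notation C := R[i].
Variables (a : nat -> nat -> C) (f : C * C -> C).
Hypotheses (pa : pcoef2 a) (fE : forall z, bidisc z -> f z = psum2 a z).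

Lemma dirichlet1E mu1 mu2 : dirichlet1 mu1 f = qsum mu1 mu2 false true a.
Proof.
rewrite qsum_tr -(@dirichlet2E _ (ptr a) (fun z => f (z.2, z.1)) (pcoef2_tr pa)) //.
move=> [z w] /bidiscE[z1 w1]; rewrite fE; last by apply/bidiscE.
exact: (@psum2_swap _ a (w, z) pa w1 z1).
Qed.

Lemma dirichletE mu1 mu2 : (dirichlet mu1 mu2 f = qsum mu1 mu2 false true a
  + qsum mu1 mu2 true false a + qsum mu1 mu2 false false a)%E.
Proof. by rewrite /dirichlet (dirichlet1E mu1 mu2) (dirichlet2E pa fE mu1) (dirichlet3E pa fE). Qed.

Theorem dirichlet_normsqE mu1 mu2 : dirichlet_normsq mu1 mu2 f = dnorm mu1 mu2 a.
Proof.
rewrite /dirichlet_normsq dirichletE (hardy_normsqE pa fE mu1 mu2) dnormE.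
move: (qsum mu1 mu2 true true a) (qsum mu1 mu2 true false a) (qsum mu1 mu2 false true a) (qsum mu1 mu2 false false a) => x y z w.
by rewrite [(z + y)%E]addeC !addeA.
Qed.

End DirichletNormFormula.

(** * Gram matrix and truncation of the norm *)

Section QuadraticForms.
Variable R : realType.
Local Notation C := R[i].
Implicit Types (A B : nat -> nat -> C) (a : nat -> nat -> C).

Lemma qform_suml N1 N2 (I : Type) (r : seq I) (c : I -> R) (A : I -> nat -> nat -> C) B a :
  qform N1 N2 (fun m p => \sum_(i <- r) (c i)%:C%C * A i m p) B a
  = \sum_(i <- r) c i * qform N1 N2 (A i) B a.
Proof.
elim: r => [|i r IH].
  rewrite big_nil /qform -[RHS]/(Re (0 : C)); congr Re; rewrite big1 // => n _; rewrite big1 // => q _.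
  by rewrite big1 ?mul0r // => m _; rewrite big1 // => p _; rewrite big_nil mulr0.
rewrite big_cons -IH /qform -ReZ -ReD; congr Re.
rewrite mulr_sumr -big_split; apply: eq_bigr => n _ /=.
rewrite mulr_sumr -big_split; apply: eq_bigr => q _ /=.
rewrite mulrA -mulrDl; congr (_ * _).
rewrite mulr_sumr -big_split; apply: eq_bigr => m _ /=.
rewrite mulr_sumr -big_split; apply: eq_bigr => p _ /=.
by rewrite big_cons mulrDr; congr (_ + _); rewrite mulrCA.
Qed.

Lemma qform_sumr N1 N2 (I : Type) (r : seq I) (c : I -> R) A (B : I -> nat -> nat -> C) a :
  qform N1 N2 A (fun m p => \sum_(i <- r) (c i)%:C%C * B i m p) a
  = \sum_(i <- r) c i * qform N1 N2 A (B i) a.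
Proof.
rewrite qform_tr qform_suml; apply: eq_bigr => i _.
by rewrite [in RHS]qform_tr.
Qed.

Lemma eq_qform N1 N2 A A' B B' a a' :
  (forall m p, (m < N1)%N -> (p < N1)%N -> A m p = A' m p) ->
  (forall n q, (n < N2)%N -> (q < N2)%N -> B n q = B' n q) ->
  (forall m n, (m < N1)%N -> (n < N2)%N -> a m n = a' m n) ->
  qform N1 N2 A B a = qform N1 N2 A' B' a'.
Proof.
move=> eA eB ea; rewrite /qform; congr Re; apply: eq_bigr => n _; apply: eq_bigr => q _.
rewrite eB //; congr (_ * _); apply: eq_bigr => m _; apply: eq_bigr => p _.
by rewrite eA // !ea.
Qed.

(** Extension by zero, which lets forms of different sizes be added in one common size. *)
Definition cut N A : nat -> nat -> C := fun m p => if (m < N)%N && (p < N)%N then A m p else 0.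

Lemma big_ord_cut N K (F : nat -> C) : (K <= N)%N -> (forall m, (K <= m)%N -> F m = 0) ->
  \sum_(m < N) F m = \sum_(m < K) F m.
Proof.
move=> KN F0; rewrite [RHS](big_ord_widen _ _ KN) [RHS]big_mkcond; apply: eq_bigr => m _.
by case: ifP => // /negbT; rewrite -leqNgt => /F0.
Qed.

Lemma qform_cut N1 N2 K1 K2 A B a : (K1 <= N1)%N -> (K2 <= N2)%N ->
  qform N1 N2 (cut K1 A) (cut K2 B) a = qform K1 K2 A B a.
Proof.
have H N1' N2' K A' B' b : (K <= N1')%N -> qform N1' N2' (cut K A') B' b = qform K N2' A' B' b.
  move=> KN; rewrite /qform; congr Re; apply: eq_bigr => n _; apply: eq_bigr => q _; congr (_ * _).
  rewrite (@big_ord_cut N1' K (fun m => \sum_(p < N1') b m n * (b p q)^*%C * cut K A' m p)) //; last first.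
    by move=> m Km; rewrite big1 // => p _; rewrite /cut ltnNge Km mulr0.
  apply: eq_bigr => m _.
  rewrite (@big_ord_cut N1' K (fun p => b m n * (b p q)^*%C * cut K A' m p)) //; last first.
    by move=> p Kp; rewrite /cut [(p < K)%N]ltnNge Kp andbF mulr0.
  by apply: eq_bigr => p _; rewrite /cut !ltn_ord.
by move=> K1N K2N; rewrite H // qform_tr H // qform_tr.
Qed.

Lemma qform_parallelogram N1 N2 A B a a' :
  qform N1 N2 A B (fun m n => a m n + a' m n) + qform N1 N2 A B (fun m n => a m n - a' m n)
  = 2 * (qform N1 N2 A B a + qform N1 N2 A B a').
Proof.
have two (x y z w : C) : x + y = z + w + (z + w) -> Re x + Re y = 2 * (Re z + Re w).
  by move=> h; rewrite -ReD h !ReD; ring.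
apply: two; rewrite -!big_split; apply: eq_bigr => n _; rewrite -!big_split; apply: eq_bigr => q _ /=.
rewrite -!mulrDl; congr (_ * _).
rewrite -!big_split; apply: eq_bigr => m _; rewrite -!big_split; apply: eq_bigr => p _ /=.
have cN (z : C) : (- z)^*%C = - z^*%C by case: z => x y; apply: complex_eqP.
by rewrite !conjcD cN; ring.
Qed.

Lemma cvg_csum (T : Type) (F : set_system T) {FF : Filter F} n (f : 'I_n -> T -> C) (l : 'I_n -> C) :
  (forall i, (f i x : C^o) @[x --> F] --> (l i : C^o)) ->
  (\sum_(i < n) f i x : C^o) @[x --> F] --> (\sum_(i < n) l i : C^o).
Proof.
elim: n f l => [|n IH] f l h.
  by under eq_fun do rewrite big_ord0; rewrite big_ord0; exact: cvg_cst.
under eq_fun do rewrite big_ord_recr; rewrite big_ord_recr.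
by apply: (@cvgD C); [exact: IH|exact: h].
Qed.

Lemma cvg_conj (T : Type) (F : set_system T) {FF : Filter F} (f : T -> C) (l : C) :
  (f x : C^o) @[x --> F] --> (l : C^o) -> ((f x)^*%C : C^o) @[x --> F] --> (l^*%C : C^o).
Proof.
move=> h; apply: (@cvg_comp _ _ _ f (fun z : C => z^*%C) F (nbhs (l : C^o)) _ h).
exact: (@continuous_conj R C^o (fun z => z) (fun z => @cvg_id _ (nbhs (z : C^o))) l).
Qed.

Lemma cvg_qform (T : Type) (F : set_system T) {FF : Filter F} N1 N2 A B (f : T -> nat -> nat -> C) a :
  (forall m n, (f x m n : C^o) @[x --> F] --> (a m n : C^o)) ->
  (qform N1 N2 A B (f x) : R^o) @[x --> F] --> (qform N1 N2 A B a : R^o).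
Proof.
move=> h.
pose S (b : nat -> nat -> C) : C :=
  \sum_(n < N2) \sum_(q < N2) (\sum_(m < N1) \sum_(p < N1) b m n * (b p q)^*%C * A m p) * B n q.
apply: (@cvg_comp _ _ _ (fun x => S (f x)) (fun z : C^o => Re z : R^o) F (nbhs (S a : C^o))); last exact: continuous_Re.
apply: cvg_csum => n; apply: cvg_csum => q; apply: (@cvgM C); last exact: cvg_cst.
apply: cvg_csum => m; apply: cvg_csum => p; apply: (@cvgM C); last exact: cvg_cst.
by apply: (@cvgM C); [exact: h|apply: cvg_conj; exact: h].
Qed.

End QuadraticForms.

(** * Tail weights and the choice of a truncation order *)

Section TailSums.
Variable R : realType.

(* The sum of the [ew k] over [k >= n] is [n.+2 * ew n], which explains the last weight. *)
Definition omega n (b : bool) k : R :=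
  if b then (k <= n.+1)%:R else if (k < n)%N then 1 else if k == n then n.+2%:R else 0.

Arguments omega : simpl never.

Lemma omega_true n k : (k < n.+2)%N -> omega n true k = 1.
Proof. by rewrite /omega ltnS => ->. Qed.

Lemma omega_false_sum n (V : nmodType) (f : nat -> V) (g : R -> V -> V) :
  (forall x, g 1 x = x) -> (forall x, g 0 x = 0) ->
  \sum_(k < n.+2) g (omega n false k) (f k) = \sum_(k < n) f k + g n.+2%:R (f n).
Proof.
move=> g1 g0; rewrite 2!big_ord_recr /= /omega ltnn eqxx [(n.+1 < n)%N]ltnNge leqnSn gtn_eqF //= g0 addr0.
by congr (_ + _); apply: eq_bigr => k _; rewrite ltn_ord g1.
Qed.

Lemma ew_gt0 k : 0 < ew R k.
Proof. by rewrite subr_gt0 ltf_pV2 ?posrE ?ltr0n // ltr_nat. Qed.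

Lemma ew_telescope n N : \sum_(0 <= k < N) ew R (k + n) = n.+1%:R^-1 - (N + n).+1%:R^-1.
Proof.
elim: N => [|N IH]; first by rewrite big_nil subrr.
by rewrite big_nat_recr //= IH /ew addrA subrK.
Qed.

Lemma ew_ratio n : n.+1%:R^-1 / ew R n = n.+2%:R.
Proof.
rewrite /ew; have n1 : (n.+1%:R : R) != 0 by rewrite pnatr_eq0.
have n2 : (n.+2%:R : R) != 0 by rewrite pnatr_eq0.
have e : (n.+2%:R : R) = n.+1%:R + 1 by rewrite natr1.
move: n1 n2; rewrite e; move: (n.+1%:R : R) => x x0 x1.
have -> : x^-1 - (x + 1)^-1 = (x * (x + 1))^-1 by field; rewrite x0 x1.
by field; rewrite x0 x1.
Qed.

Lemma ew_tail n : (\sum_(0 <= k <oo) (ew R (k + n) / ew R n)%:E = (n.+2%:R)%:E)%E.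
Proof.
rewrite -ew_ratio; apply: cvg_lim => //.
have -> : (fun N => (\sum_(0 <= k < N) (ew R (k + n) / ew R n)%:E)%E)
    = EFin \o (fun N => (n.+1%:R^-1 - (N + n).+1%:R^-1) / ew R n).
  by apply/funext => N; rewrite /= sumEFin -mulr_suml ew_telescope.
apply/cvg_EFin; first exact: nearW.
have h : (fun N => (N + n).+1%:R^-1 : R^o) @ \oo --> (0 : R^o).
  by have := @cvg_harmonic R; rewrite -(cvg_shiftn n).
have hh : (fun N => n.+1%:R^-1 - (N + n).+1%:R^-1 : R^o) @ \oo --> (n.+1%:R^-1 : R^o).
  by rewrite -[X in _ --> X]subr0; apply: (@cvgB R); [exact: cvg_cst|exact: h].
by apply: (@cvgM R); [exact: hh|exact: cvg_cst].
Qed.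

Local Open Scope ereal_scope.

Lemma nneseries_fin (r : nat -> \bar R) N : (forall k, 0 <= r k) -> (forall k, (N <= k)%N -> r k = 0) ->
  \sum_(0 <= k <oo) r k = \sum_(k < N) r k.
Proof.
move=> r0 h; rewrite (@nneseries_split _ _ 0 N) // add0n [X in _ + X]eseries0 ?adde0 ?big_mkord // => k Nk _; exact: h.
Qed.

(** Meant for polynomials of degree at most [n + 1]: the partial sums of the derivative no longer
    change from order [n] on, so the infinite tail is a multiple of the term of order [n]. *)
Lemma tail_sum n (r : bool -> nat -> \bar R) : (forall b k, 0 <= r b k) ->
  (forall k, (n.+1 < k)%N -> r true k = 0) ->
  (forall k, (n <= k)%N -> r false k = (ew R k / ew R n)%:E * r false n) ->
  \sum_(b : bool) \sum_(0 <= k <oo) r b k = \sum_(b : bool) \sum_(k < n.+2) (omega n b k)%:E * r b k.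
Proof.
move=> r0 rt rf; rewrite !big_bool /=; congr (_ + _).
  rewrite (@nneseries_fin _ n.+2) //; apply: eq_bigr => k _.
  by rewrite omega_true ?mul1e.
have w0 k : 0 <= (ew R k / ew R n)%:E by rewrite lee_fin divr_ge0 ?ew_ge0.
rewrite (@nneseries_split _ _ 0 n) // add0n.
have -> : \sum_(n <= k <oo) r false k = (n.+2%:R)%:E * r false n.
  rewrite -ew_tail -nneseries_mulr // -(@nneseries_addn _ _ n) //.
  by apply: eq_eseriesr => k _; rewrite addnC rf // leq_addr.
rewrite (@omega_false_sum n _ (r false) (fun x y => x%:E * y)) ?big_mkord // => x; [exact: mul1e|exact: mul0e].
Qed.

(* A summable sequence cannot dominate a multiple of the harmonic one. *)
Lemma pick_index (r : nat -> R) (D : R) N : (0 < N)%N -> (forall k, 0 <= r k)%R ->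
  (forall n, \sum_(k < n) r k <= D)%R -> exists2 n, (N <= n)%N & (n.+2%:R * r n <= 3 * D)%R.
Proof.
move=> N0 r0 rD; apply: contrapT => /forall2NP h.
have D0 : (0 <= D)%R by have := rD 0%N; rewrite big_ord0.
(* If the claim failed, the [N] terms from [N] to [2 N - 1] would all exceed [3 D / (2 N + 1)] and
   would alone sum to more than [D]. *)
have low k : (N <= k < N + N)%N -> (3 * D / (2 * N%:R + 1) < r k)%R.
  move=> /andP[Nk k2]; case: (h k) => // /negP; rewrite -ltNge => hk.
  have kn : (k.+2%:R <= 2 * N%:R + 1 :> R)%R.
    by rewrite -natrM natr1 ler_nat mul2n -addnn ltnS.
  rewrite ltr_pdivrMr ?addr_gt0 ?mulr_gt0 ?ltr0n //; apply: lt_le_trans hk _.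
  by rewrite mulrC ler_wpM2l.
have := rD (N + N)%N; rewrite -(big_mkord xpredT) (big_cat_nat _ (leq_addr N N)) //= => hD.
have sum0 : (0 <= \sum_(0 <= k < N) r k)%R by apply: sumr_ge0.
have : (\sum_(N <= k < N + N) (3 * D / (2 * N%:R + 1)) < \sum_(N <= k < N + N) r k)%R.
  apply: ltr_sum_nat; first by rewrite -[ltnLHS]addn0 ltn_add2l.
  by move=> k /low.
rewrite sumr_const_nat addnK -mulr_natr => hs.
have : (D <= 3 * D / (2 * N%:R + 1) * N%:R)%R.
  have x1 : (1 <= N%:R :> R)%R by rewrite ler1n.
  move: (N%:R : R)%R x1 => x x1.
  rewrite mulrAC ler_pdivlMr; last lra.
  by nra.
by lra.
Qed.

End TailSums.
Arguments omega R n b k : simpl never.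

Section DirichletForm.
Variable R : realType.
Local Notation C := R[i].
Implicit Types (mu : circle_measure R) (a : nat -> nat -> C).

Lemma qterm_parallelogram mu1 mu2 b1 k b2 l a a' :
  qterm mu1 mu2 b1 k b2 l (fun m n => a m n + a' m n) + qterm mu1 mu2 b1 k b2 l (fun m n => a m n - a' m n)
  = 2 * (qterm mu1 mu2 b1 k b2 l a + qterm mu1 mu2 b1 k b2 l a').
Proof. by rewrite /qterm -mulrDr qform_parallelogram mulrCA mulrDr. Qed.

Lemma qterm_local mu1 mu2 b1 k b2 l a a' :
  (forall m n, (m < k.+2)%N -> (n < l.+2)%N -> a m n = a' m n) ->
  qterm mu1 mu2 b1 k b2 l a = qterm mu1 mu2 b1 k b2 l a'.
Proof. by move=> h; rewrite /qterm; congr (_ * _); apply: eq_qform. Qed.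

Lemma integral_qterm_eq mu1 mu2 b1 b2 (F G : R -> R -> C) : (forall t s, F t s = G t s) ->
  (\int[numeas mu1 b1]_(t in @I2pi R) \int[numeas mu2 b2]_(s in @I2pi R) (modulus (F t s) ^+ 2)%:E
   = \int[numeas mu1 b1]_(t in @I2pi R) \int[numeas mu2 b2]_(s in @I2pi R) (modulus (G t s) ^+ 2)%:E)%E.
Proof. by move=> h; apply: eq_integral => t _; apply: eq_integral => s _; rewrite h. Qed.

Lemma ebasis0 b k t : (b, k) <> (true, 0%N) -> ebasis b k 0 t = 0 :> C.
Proof. by case: b k => [] [|k]. Qed.

(** Every functional except the coefficient of index 0 annihilates constants, so [a 0 0] enters only
    the term in which both variables use that coefficient. *)
Lemma qterm_const mu1 mu2 b1 k b2 l a a' :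
  (b1, k, b2, l) <> (true, 0%N, true, 0%N) ->
  (forall m n, (m, n) <> (0%N, 0%N) -> a m n = a' m n) ->
  qterm mu1 mu2 b1 k b2 l a = qterm mu1 mu2 b1 k b2 l a'.
Proof.
move=> hi h; apply: EFin_inj; rewrite [LHS]qtermE [RHS]qtermE.
rewrite (@integral_qterm_eq _ _ _ _ _ (fun t s => ev b2 l s (fun n => ev b1 k t (a' ^~ n)))) // => t s.
rewrite /ev; apply: eq_bigr => n _; rewrite !mulr_suml; apply: eq_bigr => m _.
have [[m0 n0]|mn] := EM ((m : nat, n : nat) = (0%N, 0%N)); last by rewrite h.
rewrite m0 n0; have [e1|e1] := EM ((b1, k) = (true, 0%N)).
  by rewrite (@ebasis0 b2 l s) ?mulr0 // => -[e2 e3]; move: e1 hi => [-> ->]; rewrite e2 e3.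
by rewrite (@ebasis0 b1 k t) // !mulr0 !mul0r.
Qed.

Lemma qterm_true_out mu1 mu2 k b2 l a : (forall n, a k n = 0) -> qterm mu1 mu2 true k b2 l a = 0.
Proof.
move=> h; apply: EFin_inj; rewrite qtermE.
rewrite (eq_integral (cst 0%E)) ?integral0 ?mule0 // => t _.
rewrite (eq_integral (cst 0%E)) ?integral0 // => s _.
rewrite /ev big1 ?modulus0 ?expr0n // => n _.
by have := @ev_true R k t (a ^~ n); rewrite /ev => ->; rewrite h mul0r.
Qed.

Lemma qterm_false_tail mu1 mu2 n0 k b2 l a : (n0 <= k)%N -> (forall m n, (n0.+1 < m)%N -> a m n = 0) ->
  qterm mu1 mu2 false k b2 l a = ew R k / ew R n0 * qterm mu1 mu2 false n0 b2 l a.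
Proof.
move=> nk h; apply: EFin_inj; rewrite [RHS]EFinM [LHS]qtermE [in RHS]qtermE.
rewrite (@integral_qterm_eq _ _ _ _ _ (fun t s => ev b2 l s (fun n => ev false n0 t (a ^~ n)))); last first.
  move=> t s; rewrite /ev; apply: eq_bigr => n _; congr (_ * _).
  apply: (@big_ord_cut R _ _ (fun m => a m n * ebasis false n0 m t)); first by rewrite !ltnS.
  by move=> m mn; rewrite h // mul0r.
rewrite [RHS]muleA -EFinM; congr (_%:E * _)%E.
have x0 : ew R n0 != 0 by rewrite gt_eqF // ew_gt0.
by rewrite /wt; move: (ew R n0) x0 ((2 * pi)^-1) => x x0 y; field.
Qed.

Definition qrow mu1 mu2 b1 k a : \bar R := (\sum_(b2 : bool) \sum_(0 <= l <oo) (qterm mu1 mu2 b1 k b2 l a)%:E)%E.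

Lemma qrow_ge0 mu1 mu2 b1 k a : (0 <= qrow mu1 mu2 b1 k a)%E.
Proof. by apply: sume_ge0 => b2 _; apply: nneseries_ge0 => l _ _; rewrite lee_fin qterm_ge0. Qed.

Lemma dnorm_qrow mu1 mu2 a : dnorm mu1 mu2 a = (\sum_(b1 : bool) \sum_(0 <= k <oo) qrow mu1 mu2 b1 k a)%E.
Proof. by []. Qed.

Lemma dnorm_ge0 mu1 mu2 a : (0 <= dnorm mu1 mu2 a)%E.
Proof. by apply: sume_ge0 => b1 _; apply: nneseries_ge0 => k _ _; exact: qrow_ge0. Qed.

Lemma dnorm_tr mu1 mu2 a : dnorm mu1 mu2 a = dnorm mu2 mu1 (ptr a).
Proof.
rewrite !dnormE (qsum_tr mu1 mu2 true true a) (qsum_tr mu1 mu2 true false a).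
rewrite (qsum_tr mu1 mu2 false true a) (qsum_tr mu1 mu2 false false a).
move: (qsum _ _ true true _) (qsum _ _ true false _) (qsum _ _ false true _) (qsum _ _ false false _) => x y z w.
by rewrite [(x + z + y)%E]addeAC.
Qed.

Lemma qrow_tail mu1 mu2 n k a : (n <= k)%N -> (forall m j, (n.+1 < m)%N -> a m j = 0) ->
  qrow mu1 mu2 false k a = ((ew R k / ew R n)%:E * qrow mu1 mu2 false n a)%E.
Proof.
move=> nk h; rewrite /qrow ge0_sume_distrr; last first.
  by move=> b _; apply: nneseries_ge0 => l _ _; rewrite lee_fin qterm_ge0.
apply: eq_bigr => b _; rewrite -nneseriesZl => [|l _]; last by rewrite lee_fin qterm_ge0.
by apply: eq_eseriesr => l _; rewrite (qterm_false_tail _ _ _ _ nk h) EFinM.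
Qed.

Lemma qrow_out mu1 mu2 k a : (forall j, a k j = 0) -> qrow mu1 mu2 true k a = 0%E.
Proof. by move=> h; rewrite /qrow big1 // => b _; rewrite eseries0 // => l _ _; rewrite qterm_true_out. Qed.

Lemma dnorm_omega mu1 mu2 n a : (forall m j, (n.+1 < m)%N -> a m j = 0) ->
  dnorm mu1 mu2 a = (\sum_(b : bool) \sum_(k < n.+2) (omega R n b k)%:E * qrow mu1 mu2 b k a)%E.
Proof.
move=> h; rewrite dnorm_qrow; apply: tail_sum => [b k|k nk|k nk]; first exact: qrow_ge0.
  by apply: qrow_out => j; exact: h.
exact: qrow_tail.
Qed.

Lemma qrow_omega mu1 mu2 n b1 k a : (forall m j, (n.+1 < j)%N -> a m j = 0) ->
  qrow mu1 mu2 b1 k a = (\sum_(b : bool) \sum_(l < n.+2) (omega R n b l * qterm mu1 mu2 b1 k b l a)%:E)%E.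
Proof.
move=> h; rewrite /qrow (@tail_sum R n (fun b l => (qterm mu1 mu2 b1 k b l a)%:E)).
- by apply: eq_bigr => b _; apply: eq_bigr => l _; rewrite EFinM.
- by move=> b l; rewrite lee_fin qterm_ge0.
- by move=> l nl; rewrite qterm_tr qterm_true_out // => m; exact: h.
- move=> l nl; rewrite -EFinM; congr _%:E; rewrite !(qterm_tr mu1) (@qterm_false_tail mu2 mu1 n l) //.
  by move=> m j; exact: h.
Qed.

(* [cmom mu m p] is the trigonometric moment (2 pi)^-1 \int e^(i (m - p) t) dmu. *)
Definition cmom mu m p : C := ((2 * pi)^-1)%:C%C * gram mu (fun m t => expi (m%:R * t)) m p.

Definition dgram mu m p : C := (m == p)%:R + (minn m p)%:R * cmom mu m p.

Definition wgram mu b k : nat -> nat -> C := cut k.+2 (fun m p => (wt R b k)%:C%C * bgram mu b k m p).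
End DirichletForm.

Section GramFormula.
Variable R : realType.
Local Notation C := R[i].
Local Notation TR := (measurableTypeR R).
Implicit Types (mu : circle_measure R) (a : nat -> nat -> C).

Lemma bgram_true mu k m p : bgram mu true k m p = (m == k)%:R * (p == k)%:R.
Proof.
have e : (fun t => ebasis true k m t * (ebasis true k p t)^*%C) = (fun=> (m == k)%:R * (p == k)%:R) :> (TR -> C).
  by apply/funext => t; rewrite /ebasis; case: (p == k); rewrite ?conjc1 ?conjc0.
rewrite /bgram /gram e; move: (_ * _) => c.
by rewrite /zint /Rintegral !integral_numeas_true //; case: c.
Qed.

Lemma bgram_false mu k m p : bgram mu false k m p =
  (m%:R * p%:R) * gram mu (fun m t => expi (m%:R * t)) m p.
Proof.
rewrite /bgram /gram.
case: m => [|m].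
  by rewrite mul0r mul0r -[RHS](@zint0 R mu); apply: eq_zint => t _; rewrite mul0r.
case: p => [|p].
  by rewrite mulr0 mul0r -[RHS](@zint0 R mu); apply: eq_zint => t _; rewrite /ebasis conjc0 mulr0.
rewrite -zintZ; last by apply: bmeasM; [|apply: bmeasJ]; exact: bmeas_expi.
apply: eq_zint => t _; rewrite /ebasis conjcM !conj_expi.
have -> : (p.+1%:R : C)^*%C = p.+1%:R by rewrite rmorph_nat.
rewrite mulrACA -!expiD; congr (_ * expi _); rewrite -!natr1; ring.
Qed.

(** Abel summation. The pair [(m, p)] with [M = maxn m p > 0] occurs in the derivative sums of order
    [k >= M - 1], whose weights add up to [1 / M]; the factor [m p] from the two derivatives then
    leaves [m p / M = minn m p]. *)
Lemma wgram_sum mu n m p : (m < n.+2)%N -> (p < n.+2)%N ->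
  \sum_(b : bool) \sum_(k < n.+2) (omega R n b k)%:C%C * wgram mu b k m p = dgram mu m p.
Proof.
move=> mn pn; rewrite big_bool /dgram /=; congr (_ + _).
  rewrite (bigD1 (Ordinal mn) isT) big1 => [|k km].
    rewrite /= addr0 /omega -ltnS mn mul1r /wgram /cut bgram_true eqxx mul1r leqW //=.
    case: ifPn => h; first by rewrite mul1r eq_sym.
    by rewrite (_ : (m == p) = false) //; apply: contraNF h => /eqP ->; rewrite leqW.
  rewrite /wgram /cut bgram_true (_ : (m == k :> nat) = false) ?mul0r ?mulr0 ?if_same ?mulr0 //.
  by apply: contraNF km => /eqP e; apply/eqP/val_inj.
have [M0|M0] := posnP (maxn m p).
  have [-> ->] : m = 0%N /\ p = 0%N by move: M0; clear; rewrite /maxn; case: m p => [|m] [|p] //; case: ifP.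
  by rewrite mul0r big1 // => k _; rewrite /wgram /cut bgram_false !mul0r !mulr0 ?if_same ?mulr0.
set M := maxn m p in M0.
have Mn : (M.-1 <= n)%N by rewrite -ltnS prednK // -ltnS /M gtn_max mn pn.
set c := gram mu (fun m t => expi (m%:R * t)) m p.
have S1 : \sum_(k < n.+2) omega R n false k * (if (m < k.+2)%N && (p < k.+2)%N then ew R k else 0) = M%:R^-1.
  have in2 k : (m < k.+2)%N && (p < k.+2)%N = (M.-1 <= k)%N by rewrite -gtn_max -/M -{1}(prednK M0) !ltnS.
  rewrite (@omega_false_sum R n _ (fun k => if (m < k.+2)%N && (p < k.+2)%N then ew R k else 0) (fun x y => x * y)) => [|x|x].
  - rewrite in2 Mn -[n.+2%:R]ew_ratio divfK ?gt_eqF ?ew_gt0 //.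
    have -> : \sum_(i < n) (if (m < i.+2)%N && (p < i.+2)%N then ew R i else 0) = \sum_(0 <= k < n - M.-1) ew R (k + M.-1).
      rewrite -(big_mkord xpredT (fun i => if (m < i.+2)%N && (p < i.+2)%N then ew R i else 0)).
      rewrite (big_cat_nat _ Mn) //= big_nat big1 ?add0r => [|i /andP[_ iM]]; last first.
        by rewrite in2 leqNgt iM.
      rewrite -{1}[M.-1]add0n big_addn; apply: eq_bigr => i _.
      by rewrite in2 leq_addl.
    by rewrite ew_telescope prednK // subnK // subrK.
  - exact: mul1r.
  - exact: mul0r.
transitivity ((M%:R^-1)%:C%C * ((2 * pi)^-1)%:C%C * ((m%:R * p%:R) * c)).
  rewrite -S1 rmorph_sum /= !mulr_suml; apply: eq_bigr => k _.
  rewrite /wgram /cut; case: ifP => _; last by rewrite !mulr0 !mul0r.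
  by rewrite bgram_false /wt -/c !real_complexM; ring.
rewrite /cmom -/c; have mp : (m * p = minn m p * M)%N by rewrite /M; case: (leqP m p) => _ //; rewrite mulnC.
rewrite -natrM mp natrM; have -> : (M%:R^-1)%:C%C = M%:R^-1 :> C by rewrite real_complexV rmorph_nat.
have : (M%:R : C) != 0 by rewrite pnatr_eq0 -lt0n.
by move: (M%:R : C) (((2 * pi)^-1)%:C%C) => x y x0; field.
Qed.

Lemma qform_wgram N mu1 mu2 b1 k b2 l a : (k.+2 <= N)%N -> (l.+2 <= N)%N ->
  qform N N (wgram mu1 b1 k) (wgram mu2 b2 l) a = qterm mu1 mu2 b1 k b2 l a.
Proof.
move=> kN lN; rewrite /wgram qform_cut // /qterm.
have H N1 N2 (x : R) (A B : nat -> nat -> C) b : qform N1 N2 (fun m p => x%:C%C * A m p) B b = x * qform N1 N2 A B b.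
  have := @qform_suml R N1 N2 unit [:: tt] (fun=> x) (fun=> A) B b; rewrite big_seq1 => <-.
  by apply: eq_qform => // m p _ _; rewrite big_seq1.
by rewrite H qform_tr H -qform_tr mulrA.
Qed.

Lemma qform_supp K N A B a : (K <= N)%N -> (forall m n, (K <= m)%N || (K <= n)%N -> a m n = 0) ->
  qform N N A B a = qform K K A B a :> R.
Proof.
move=> KN h; rewrite -(qform_cut A B a KN KN) /qform; congr Re.
apply: eq_bigr => n _; apply: eq_bigr => q _; rewrite /cut.
have [nK|nK] := ltnP n K; last first.
  by rewrite mulr0 big1 ?mul0r // => m _; rewrite big1 // => p _; rewrite h ?nK ?orbT // !mul0r.
have [qK|qK] := ltnP q K; last first.
  by rewrite mulr0 big1 ?mul0r // => m _; rewrite big1 // => p _; rewrite (h p q) ?qK ?orbT // conjc0 mulr0 mul0r.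
congr (_ * _); apply: eq_bigr => m _; apply: eq_bigr => p _.
have [mK|mK] := ltnP m K; last by rewrite h ?mK // !mul0r.
have [pK|pK] := ltnP p K; last by rewrite (h p q) ?pK // conjc0 !mulr0 !mul0r.
by [].
Qed.

Theorem dnorm_gram mu1 mu2 n a : (forall m j, (n.+1 < m)%N || (n.+1 < j)%N -> a m j = 0) ->
  dnorm mu1 mu2 a = (qform n.+2 n.+2 (dgram mu1) (dgram mu2) a)%:E.
Proof.
move=> h; rewrite (@dnorm_omega R mu1 mu2 n) => [|m j mn]; last by rewrite h // mn.
pose I := (bool * 'I_n.+2)%type.
pose w (i : I) : R := omega R n i.1 i.2.
have D mu : forall m p, (m < n.+2)%N -> (p < n.+2)%N ->
    dgram mu m p = \sum_(i : I) (w i)%:C%C * wgram mu i.1 i.2 m p.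
  by move=> m p mn pn; rewrite -(wgram_sum mu mn pn) pair_bigA.
rewrite (eq_qform (D mu1) (D mu2) (fun m n _ _ => erefl)) qform_suml -sumEFin pair_bigA /=.
apply: eq_bigr => i _; rewrite qform_sumr (@qrow_omega R mu1 mu2 n) => [|m j jn]; last by rewrite h // jn orbT.
rewrite EFinM; congr (_ * _)%E; rewrite pair_bigA /= sumEFin; congr EFin; apply: eq_bigr => j _.
have e : qform n.+2 n.+2 (wgram mu1 i.1 i.2) (wgram mu2 j.1 j.2) a = qterm mu1 mu2 i.1 i.2 j.1 j.2 a.
  (* The last order [k = n + 1] involves coefficients up to [n + 2], one more than the form
     contains; those coefficients of [a] vanish. *)
  transitivity (qform n.+3 n.+3 (wgram mu1 i.1 i.2) (wgram mu2 j.1 j.2) a).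
    apply/esym; apply: qform_supp => // m q; exact: h.
  by apply: qform_wgram; rewrite ltnS ltn_ord.
by rewrite e.
Qed.

End GramFormula.

(** * Semicontinuity, parallelogram law and truncation *)

Section DirichletNorm.
Variable R : realType.
Local Notation C := R[i].
Variables mu1 mu2 : circle_measure R.
Implicit Types a : nat -> nat -> C.
Local Notation qt := (qterm mu1 mu2).
Local Notation dn := (dnorm mu1 mu2).

Definition dpart n a : R := \sum_(k < n) \sum_(l < n) \sum_(b1 : bool) \sum_(b2 : bool) qt b1 k b2 l a.

Lemma dpart_le n a : ((dpart n a)%:E <= dn a)%E.
Proof.
have q0 b1 k b2 l : (0 <= (qt b1 k b2 l a)%:E)%E by rewrite lee_fin qterm_ge0.
have -> : (dpart n a)%:E = (\sum_(b1 : bool) \sum_(k < n) \sum_(b2 : bool) \sum_(l < n) (qt b1 k b2 l a)%:E)%E.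
  rewrite exchange_big /= /dpart -sumEFin; apply: eq_bigr => k _.
  rewrite -sumEFin /=.
  transitivity (\sum_(l < n) \sum_(b1 : bool) \sum_(b2 : bool) (qt b1 k b2 l a)%:E)%E.
    by apply: eq_bigr => l _; rewrite -sumEFin; apply: eq_bigr => b1 _; rewrite sumEFin.
  by rewrite exchange_big; apply: eq_bigr => b1 _; rewrite exchange_big.
apply: lee_sum => b1 _; apply: le_trans (nneseries_lim_ge n _); last by move=> k _ _; exact: qrow_ge0.
rewrite big_mkord; apply: lee_sum => k _; apply: lee_sum => b2 _.
by apply: le_trans (nneseries_lim_ge n _); rewrite ?big_mkord.
Qed.

Lemma dnorm_le a (B : R) : (forall n, dpart n a <= B) -> (dn a <= B%:E)%E.
Proof.
move=> h.
have q0 b1 k b2 l : (0 <= (qt b1 k b2 l a)%:E)%E by rewrite lee_fin qterm_ge0.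
rewrite dnorm_qrow -nneseries_sum; last by move=> b1 k _; exact: qrow_ge0.
apply: lime_le.
  by apply: is_cvg_nneseries => k _ _; apply: sume_ge0 => b1 _; exact: qrow_ge0.
apply: nearW => K.
have -> : (\sum_(0 <= k < K) \sum_(b1 : bool) qrow mu1 mu2 b1 k a =
    \sum_(0 <= l <oo) (\sum_(k < K) \sum_(b1 : bool) \sum_(b2 : bool) qt b1 k b2 l a)%:E)%E.
  rewrite big_mkord.
  transitivity (\sum_(0 <= l <oo) \sum_(k < K) \sum_(b1 : bool) \sum_(b2 : bool) (qt b1 k b2 l a)%:E)%E.
    rewrite nneseries_sum; last by move=> k l _; apply: sume_ge0 => b1 _; apply: sume_ge0.
    apply: eq_bigr => k _; rewrite nneseries_sum; last by move=> b1 l _; apply: sume_ge0.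
    by apply: eq_bigr => b1 _; rewrite nneseries_sum.
  apply: eq_eseriesr => l _; rewrite -sumEFin; apply: eq_bigr => k _; rewrite -sumEFin.
  by apply: eq_bigr => b1 _; rewrite sumEFin.
have s0 k l : 0 <= \sum_(b1 : bool) \sum_(b2 : bool) qt b1 k b2 l a.
  by apply: sumr_ge0 => b1 _; apply: sumr_ge0 => b2 _; exact: qterm_ge0.
apply: lime_le.
  by apply: is_cvg_nneseries => l _ _; rewrite lee_fin; apply: sumr_ge0.
apply: nearW => L; rewrite sumEFin lee_fin; apply: le_trans (h (maxn K L)).
rewrite big_mkord exchange_big /= /dpart.
apply: (@le_trans _ _ (\sum_(k < K) \sum_(l < maxn K L) \sum_(b1 : bool) \sum_(b2 : bool) qt b1 k b2 l a)).
  apply: ler_sum => k _.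
  rewrite [leLHS](big_ord_widen _ (fun l => \sum_(b1 : bool) \sum_(b2 : bool) qt b1 k b2 l a) (leq_maxr K L)).
  by rewrite big_mkcond; apply: ler_sum => l _; case: ifP.
rewrite [leLHS](big_ord_widen _ (fun k => \sum_(l < maxn K L) \sum_(b1 : bool) \sum_(b2 : bool) qt b1 k b2 l a) (leq_maxl K L)).
by rewrite big_mkcond; apply: ler_sum => k _; case: ifP => // _; apply: sumr_ge0.
Qed.

Lemma cvg_qterm (T : Type) (F : set_system T) {FF : Filter F} b1 k b2 l (f : T -> nat -> nat -> C) a :
  (forall m n, (f x m n : C^o) @[x --> F] --> (a m n : C^o)) ->
  (qt b1 k b2 l (f x) : R^o) @[x --> F] --> (qt b1 k b2 l a : R^o).
Proof. by move=> h; apply: (@cvgM R); [exact: cvg_cst|exact: cvg_qform]. Qed.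

Lemma cvg_rsum (T : Type) (F : set_system T) {FF : Filter F} (I : Type) (r : seq I) (f : I -> T -> R) (l : I -> R) :
  (forall i, (f i x : R^o) @[x --> F] --> (l i : R^o)) ->
  (\sum_(i <- r) f i x : R^o) @[x --> F] --> (\sum_(i <- r) l i : R^o).
Proof.
move=> h; elim: r => [|i r IH].
  by under eq_fun do rewrite big_nil; rewrite big_nil; exact: cvg_cst.
under eq_fun do rewrite big_cons; rewrite big_cons.
by apply: (@cvgD R); [exact: h|exact: IH].
Qed.

(** The norm is the supremum of the finite sections [dpart], each of which is a continuous function
    of finitely many coefficients. *)
Lemma dnorm_lsc (f : nat -> nat -> nat -> C) a (B : R) :
  (forall m n, (f i m n : C^o) @[i --> \oo] --> (a m n : C^o)) ->
  (forall i, (dn (f i) <= B%:E)%E) -> (dn a <= B%:E)%E.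
Proof.
move=> h hB; apply: dnorm_le => n.
have : (dpart n (f i) : R^o) @[i --> \oo] --> (dpart n a : R^o).
  apply: cvg_rsum => k; apply: cvg_rsum => l; apply: cvg_rsum => b1; apply: cvg_rsum => b2.
  exact: cvg_qterm.
move=> c; apply: (cvgr_to_le c); apply: nearW => i.
by rewrite -lee_fin; exact: le_trans (dpart_le n (f i)) (hB i).
Qed.

Lemma dnorm_series a : dn a = (\sum_(0 <= k <oo) \sum_(0 <= l <oo)
  (\sum_(b1 : bool) \sum_(b2 : bool) qt b1 k b2 l a)%:E)%E.
Proof.
have q0 b1 k b2 l : (0 <= (qt b1 k b2 l a)%:E)%E by rewrite lee_fin qterm_ge0.
rewrite dnorm_qrow -nneseries_sum; last by move=> b1 k _; exact: qrow_ge0.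
apply: eq_eseriesr => k _.
transitivity (\sum_(0 <= l <oo) \sum_(b1 : bool) \sum_(b2 : bool) (qt b1 k b2 l a)%:E)%E.
  rewrite nneseries_sum; last by move=> b1 l _; apply: sume_ge0.
  by apply: eq_bigr => b1 _; rewrite nneseries_sum.
by apply: eq_eseriesr => l _; rewrite -sumEFin; apply: eq_bigr => b1 _; rewrite sumEFin.
Qed.

Lemma dnorm_parallelogram a a' :
  (dn (fun m n => a m n + a' m n)%R + dn (fun m n => a m n - a' m n)%R = 2%:E * (dn a + dn a'))%E.
Proof.
pose s a k l := \sum_(b1 : bool) \sum_(b2 : bool) qt b1 k b2 l a.
have s0 x k l : (0 <= (s x k l)%:E)%E.
  by rewrite lee_fin; apply: sumr_ge0 => b1 _; apply: sumr_ge0 => b2 _; exact: qterm_ge0.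
have ss x k : (0 <= \sum_(0 <= l <oo) (s x k l)%:E)%E by apply: nneseries_ge0.
have H x y : (dn x + dn y = \sum_(0 <= k <oo) \sum_(0 <= l <oo) (s x k l + s y k l)%:E)%E.
  transitivity (\sum_(0 <= k <oo) (\sum_(0 <= l <oo) (s x k l)%:E + \sum_(0 <= l <oo) (s y k l)%:E))%E.
    by rewrite nneseriesD // !dnorm_series.
  apply: eq_eseriesr => k _; transitivity (\sum_(0 <= l <oo) ((s x k l)%:E + (s y k l)%:E))%E.
    by rewrite nneseriesD.
  by apply: eq_eseriesr => l _; rewrite EFinD.
have st x y k l : (0 <= (s x k l + s y k l)%:E)%E by rewrite EFinD adde_ge0.
rewrite !H -nneseriesZl => [|k _]; last by apply: nneseries_ge0.
apply: eq_eseriesr => k _; rewrite -nneseriesZl // ; apply: eq_eseriesr => l _; rewrite -EFinM; congr EFin.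
rewrite /s -!big_split mulr_sumr; apply: eq_bigr => b1 _ /=.
by rewrite -!big_split mulr_sumr; apply: eq_bigr => b2 _ /=; exact: qterm_parallelogram.
Qed.

Lemma eq_dnorm a a' : (forall m n, a m n = a' m n) -> dn a = dn a'.
Proof. by move=> h; congr dn; apply/funext => m; apply/funext => n. Qed.

(** Pythagoras for a constant and a series without constant term; it is what makes the vector
    representing 1 orthogonal to both ranges. *)
Lemma dnorm_const (c : C) a : a 0%N 0%N = 0 ->
  dn (fun m n => if (m == 0%N) && (n == 0%N) then c else a m n) = ((modulus c ^+ 2)%:E + dn a)%E.
Proof.
move=> a0; set a' := (X in dn X).
pose s a k l := \sum_(b1 : bool) \sum_(b2 : bool) qt b1 k b2 l a.
pose d k l : R := if (k == 0%N) && (l == 0%N) then modulus c ^+ 2 else 0.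
have sE k l : s a' k l = d k l + s a k l.
  rewrite /s !big_bool /= /d.
  have e b1 b2 : (b1, k, b2, l) <> (true, 0%N, true, 0%N) -> qt b1 k b2 l a' = qt b1 k b2 l a.
    by move=> h; apply: qterm_const h _ => -[|m] [|n].
  rewrite (e true false) // (e false true) // (e false false) //.
  case: ifPn => [/andP[/eqP -> /eqP ->]|kl].
    by rewrite !qterm_tt /a' /= a0 modulus0 expr0n /=; ring.
  by rewrite (e true true) ?add0r // => -[k0 l0]; move: kl; rewrite k0 l0.
have s0 x k l : (0 <= (s x k l)%:E)%E.
  by rewrite lee_fin; apply: sumr_ge0 => b1 _; apply: sumr_ge0 => b2 _; exact: qterm_ge0.
have d0 k l : (0 <= (d k l)%:E)%E by rewrite lee_fin /d; case: ifP => // _; rewrite exprn_ge0 ?modulus_ge0.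
rewrite !dnorm_series.
transitivity (\sum_(0 <= k <oo) (\sum_(0 <= l <oo) (d k l)%:E + \sum_(0 <= l <oo) (s a k l)%:E))%E.
  apply: eq_eseriesr => k _; rewrite -nneseriesD //; apply: eq_eseriesr => l _.
  by rewrite -EFinD -sE.
rewrite nneseriesD; last 2 first.
- by move=> k _ _; apply: nneseries_ge0.
- by move=> k _ _; apply: nneseries_ge0.
congr (_ + _)%E; rewrite (@nneseries_fin _ _ 1).
- by rewrite big_ord1 (@nneseries_fin _ _ 1) // ?big_ord1 // => -[].
- by move=> k; apply: nneseries_ge0.
- by case=> // k _; rewrite eseries0.
Qed.

Lemma qrow_false_local k a a' : (forall m n, (m < k.+2)%N -> a m n = a' m n) ->
  qrow mu1 mu2 false k a = qrow mu1 mu2 false k a'.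
Proof.
move=> h; apply: eq_bigr => b2 _; apply: eq_eseriesr => l _; congr EFin.
by apply: qterm_local => m n mk _; exact: h.
Qed.

Lemma qrow_true_local k a a' : (forall n, a k n = a' k n) ->
  qrow mu1 mu2 true k a = qrow mu1 mu2 true k a'.
Proof.
move=> h; apply: eq_bigr => b2 _; apply: eq_eseriesr => l _; rewrite [LHS]qtermE [RHS]qtermE.
rewrite (@integral_qterm_eq _ _ _ _ _ _ (fun t s => ev b2 l s (fun n => ev true k t (a' ^~ n)))) // => t s.
rewrite /ev; apply: eq_bigr => n _; congr (_ * _).
by rewrite -/(ev true k t (a ^~ n)) -/(ev true k t (a' ^~ n)) !ev_true h.
Qed.

Definition trunc1 n a : nat -> nat -> C := fun m j => if (m <= n.+1)%N then a m j else 0.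

(** The cut keeps the derivative sums up to order [n] and freezes the later ones at order [n], where
    they carry [n.+2] times the weight of that order. One unit of this is bounded crudely by the
    additional term. *)
Lemma dnorm_trunc1 n a : (dn (trunc1 n a) <= dn a + (n.+2%:R)%:E * qrow mu1 mu2 false n a)%E.
Proof.
rewrite (@dnorm_omega _ _ _ n) => [|m j mn]; last by rewrite /trunc1 leqNgt mn.
rewrite dnorm_qrow !big_bool /= -addeA; apply: leeD.
  apply: le_trans (nneseries_lim_ge n.+2 _); last by move=> k _ _; exact: qrow_ge0.
  rewrite big_mkord; apply: lee_sum => k _; rewrite omega_true // mul1e.
  by rewrite (@qrow_true_local k _ a) // => j; rewrite /trunc1 -ltnS ltn_ord.
rewrite (@omega_false_sum R n _ (fun k => qrow mu1 mu2 false k (trunc1 n a)) (fun x y => x%:E * y)%E) => [|x|x]; last 2 first.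
- exact: mul1e.
- exact: mul0e.
apply: leeD.
  apply: le_trans (nneseries_lim_ge n _); last by move=> k _ _; exact: qrow_ge0.
  rewrite big_mkord; apply: lee_sum => k _.
  rewrite (@qrow_false_local k _ a) // => m j mk; rewrite /trunc1 ifT //.
  by rewrite -ltnS (leq_trans mk) // !ltnS ltnW.
by rewrite (@qrow_false_local n _ a) // => m j mk; rewrite /trunc1 -ltnS mk.
Qed.

Lemma trunc1_exists a (D : R) N : (0 < N)%N -> (dn a <= D%:E)%E ->
  exists2 n, (N <= n)%N & (dn (trunc1 n a) <= (4 * D)%:E)%E.
Proof.
move=> N0 hD.
have rs : (\sum_(0 <= k <oo) qrow mu1 mu2 false k a <= D%:E)%E.
  apply: le_trans hD; rewrite dnorm_qrow big_bool /= leeDr //.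
  by apply: nneseries_ge0 => k _ _; exact: qrow_ge0.
have rle n : (\sum_(k < n) qrow mu1 mu2 false k a <= D%:E)%E.
  apply: le_trans rs; rewrite -(big_mkord xpredT (fun k => qrow mu1 mu2 false k a)).
  by apply: nneseries_lim_ge => k _ _; exact: qrow_ge0.
have rfin k : qrow mu1 mu2 false k a \is a fin_num.
  rewrite ge0_fin_numE ?qrow_ge0 //; apply: le_lt_trans (ltry D); apply: le_trans (rle k.+1).
  by rewrite big_ord_recr /= leeDr // sume_ge0 // => i _; exact: qrow_ge0.
pose r k := fine (qrow mu1 mu2 false k a).
have [||n Nn hn] := @pick_index R r D N N0.
- by move=> k; rewrite fine_ge0 // qrow_ge0.
- by move=> n; rewrite -lee_fin -sumEFin; under eq_bigr do rewrite /r fineK //; exact: rle.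
exists n => //; apply: le_trans (dnorm_trunc1 n a) _.
have -> : ((4 * D)%:E = D%:E + (3 * D)%:E)%E by rewrite -EFinD; congr EFin; ring.
by apply: leeD => //; rewrite -(fineK (rfin n)) -EFinM lee_fin.
Qed.

End DirichletNorm.

Section Truncation.
Variable R : realType.
Local Notation C := R[i].

(** One cut in each variable, at a cost of a factor 4 each. *)
Lemma trunc_exists (mu1 mu2 : circle_measure R) (a : nat -> nat -> C) (D : R) N :
  (dnorm mu1 mu2 a <= D%:E)%E -> exists K (a' : nat -> nat -> C),
  [/\ forall m n, (K.+1 < m)%N || (K.+1 < n)%N -> a' m n = 0,
      forall m n, (m <= N)%N -> (n <= N)%N -> a' m n = a m n
    & (dnorm mu1 mu2 a' <= (16 * D)%:E)%E].
Proof.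
move=> hD; have [n Nn h1] := trunc1_exists (ltn0Sn N) hD.
rewrite dnorm_tr in h1; have [n' Nn' h2] := trunc1_exists (ltn0Sn N) h1.
exists (maxn n n'), (ptr (trunc1 n' (ptr (trunc1 n a)))); split.
- move=> m j h; rewrite /ptr /trunc1; case: ifP => // jn; case: ifP => // mn.
  have jK : (j <= (maxn n n').+1)%N by rewrite (leq_trans jn) // ltnS leq_maxr.
  have mK : (m <= (maxn n n').+1)%N by rewrite (leq_trans mn) // ltnS leq_maxl.
  by move: h; rewrite ltnNge mK ltnNge jK.
- move=> m j mN jN; rewrite /ptr /trunc1 ifT ?ifT //.
    by rewrite (leq_trans mN) // (leq_trans _ (leqW Nn)) // leqW.
  by rewrite (leq_trans jN) // (leq_trans _ (leqW Nn')) // leqW.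
- by rewrite dnorm_tr; move: h2; have -> : 4 * (4 * D) = 16 * D by ring.
Qed.

End Truncation.

(** * Finite Dirichlet integrals control the Hardy norm *)

Section HardyFromDirichlet.
Variable R : realType.
Local Notation C := R[i].
Local Notation TR := (measurableTypeR R).

Lemma sqr_modulusB_le (z w : C) : modulus (z - w) ^+ 2 <= 2 * (modulus z ^+ 2 + modulus w ^+ 2).
Proof.
apply: (@le_trans _ _ ((modulus z + modulus w) ^+ 2)).
  by rewrite lerXn2r ?nnegrE ?addr_ge0 ?modulus_ge0 ?ler_modulusB.
move: (modulus z) (modulus w) => p q; rewrite -subr_ge0.
have -> : 2 * (p ^+ 2 + q ^+ 2) - (p + q) ^+ 2 = (p - q) ^+ 2 by ring.
exact: sqr_ge0.
Qed.

Local Open Scope ereal_scope.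

Lemma circle_measure_I2pi (mu : circle_measure R) : mu (@I2pi R) = mu setT.
Proof.
have mI := @measurable_I2pi R.
rewrite -[in RHS](setUv (@I2pi R)) measureU ?setICr //; last exact: measurableC.
by rewrite [X in _ + X](circle_measure_supp mu) adde0.
Qed.

(** [(k + 1) b_(k+1) e^(ikt)] is the difference of two consecutive partial sums of the derivative.
    Integrate its square; [ew k (k + 1)^2 = (k + 1) / (k + 2)] is at least 1/2, and [ew]
    decreases. *)
Lemma coef_le_qS (mu : circle_measure R) (b : nat -> C) k :
  mu setT * (modulus (b k.+1) ^+ 2)%:E <=
  (8 * pi)%:E * (qS mu k (pderiv b) + (if k is k'.+1 then qS mu k' (pderiv b) else 0)).
Proof.
have mI := @measurable_I2pi R.
pose x := pderiv b; pose I j := \int[mu]_(t in @I2pi R) (modulus (part j t x) ^+ 2)%:E.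
pose J := if k is k'.+1 then I k' else 0.
have I0 j : 0 <= I j by apply: integral_ge0 => t _; rewrite lee_fin exprn_ge0 ?modulus_ge0.
have J0 : 0 <= J by rewrite /J; case: (k).
have le2 : mu setT * (modulus (x k) ^+ 2)%:E <= 2%:E * (I k + J).
  rewrite -circle_measure_I2pi muleC -integral_cst //.
  have msq j : measurable_fun (@I2pi R) (fun t : TR => (modulus (part j t x) ^+ 2)%:E) by exact: measurable_part.
  have sq0 j (t : TR) : 0 <= (modulus (part j t x) ^+ 2)%:E by rewrite lee_fin exprn_ge0 ?modulus_ge0.
  rewrite /J; case: k {J J0} => [|k].
    rewrite adde0 -ge0_integralZl //; apply: ge0_le_integral => //.
    - by move=> t _; rewrite lee_fin exprn_ge0 ?modulus_ge0.
    - by apply: emeasurable_funM; [exact: measurable_cst|exact: msq].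
    move=> t _; rewrite /part big_ord1 -EFinM lee_fin modulusM modulus_expi mulr1.
    by rewrite ler_peMl ?exprn_ge0 ?modulus_ge0 // ler1n.
  rewrite -ge0_integralD // -ge0_integralZl //; last 2 first.
  - by apply: emeasurable_funD.
  - by move=> t _; rewrite adde_ge0.
  apply: ge0_le_integral => //.
  - by move=> t _; rewrite lee_fin exprn_ge0 ?modulus_ge0.
  - by apply: emeasurable_funM; [exact: measurable_cst|apply: emeasurable_funD].
  move=> t _; rewrite -EFinD -EFinM lee_fin.
  have -> : modulus (x k.+1) = modulus (part k.+1 t x - part k t x)%R.
    have -> : part k.+1 t x = (x k.+1 * expi (k.+1%:R * t) + part k t x)%R.
      by rewrite /part big_ord_recr addrC.
    by rewrite addrK modulusM modulus_expi mulr1.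
  exact: sqr_modulusB_le.
have ew2 : (1 <= 2 * (ew R k * k.+1%:R ^+ 2))%R.
  have -> : (ew R k * k.+1%:R ^+ 2 = k.+1%:R / k.+2%:R)%R.
    rewrite /ew; have e : (k.+2%:R : R)%R = (k.+1%:R + 1)%R by rewrite natr1.
    have k1 : (k.+1%:R + 1 : R)%R != 0%R by rewrite natr1 pnatr_eq0.
    have k0 : (k.+1%:R : R)%R != 0%R by rewrite pnatr_eq0.
    by rewrite e; move: (k.+1%:R : R)%R k0 k1 => y y0 y1; field; rewrite y0 y1.
  rewrite mulrA ler_pdivlMr ?ltr0n // mul1r -natrM ler_nat.
  by rewrite mul2n -addnn addnS addSn !ltnS leq_addr.
have ewS j : (ew R j.+1 <= ew R j)%R.
  have ewE i : (ew R i = (i.+1%:R * i.+2%:R)^-1)%R.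
    rewrite /ew; have e : (i.+2%:R : R)%R = (i.+1%:R + 1)%R by rewrite natr1.
    have i1 : (i.+1%:R + 1 : R)%R != 0%R by rewrite natr1 pnatr_eq0.
    have i0 : (i.+1%:R : R)%R != 0%R by rewrite pnatr_eq0.
    by rewrite e; move: (i.+1%:R : R)%R i0 i1 => y y0 y1; field; rewrite y0 y1.
  by rewrite !ewE lef_pV2 ?posrE -?natrM ?ltr0n // ler_nat leq_mul.
have bx : modulus (x k) = (k.+1%:R * modulus (b k.+1))%R by rewrite /x /pderiv modulusM modulus_nat.
have c2 : (0 < 2 * pi :> R)%R by exact: twopi_gt0.
apply: (@le_trans _ _ ((2 * ew R k)%:E * (mu setT * (modulus (x k) ^+ 2)%:E))).
  rewrite muleCA; apply: lee_wpmul2l => //; rewrite -EFinM lee_fin bx exprMn.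
  by rewrite mulrA -[leLHS]mul1r ler_wpM2r ?exprn_ge0 ?modulus_ge0 // -mulrA.
apply: (@le_trans _ _ ((2 * ew R k)%:E * (2%:E * (I k + J)))).
  by apply: lee_wpmul2l => //; rewrite lee_fin mulr_ge0 ?ew_ge0.
have qSE j : (8 * pi)%:E * qS mu j x = (4 * ew R j)%:E * I j.
  rewrite /qS muleA -EFinM; congr (_%:E * _).
  by move: c2; rewrite pmulr_rgt0 //; move: (pi : R) (ew R j) => p e p0; field; rewrite gt_eqF.
have -> : (2 * ew R k)%:E * (2%:E * (I k + J)) = (4 * ew R k)%:E * I k + (4 * ew R k)%:E * J.
  by rewrite muleA -EFinM -ge0_muleDr //; congr (_%:E * _); ring.
set q' := (X in qS mu k (pderiv b) + X).
have q'0 : 0 <= q' by rewrite /q'; case: (k) => // k'; exact: qS_ge0.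
rewrite [leRHS]ge0_muleDr ?qS_ge0 // qSE leeD2l // /J /q'.
case: (k) => [|k']; first by rewrite !mule0.
rewrite qSE; apply: lee_wpmul2r => //; rewrite lee_fin.
by have := ewS k'; lra.
Qed.

Lemma nneseries_shift0 (v : nat -> \bar R) : (forall k, 0 <= v k) ->
  \sum_(0 <= k <oo) v k = v 0%N + \sum_(0 <= k <oo) v k.+1.
Proof.
move=> v0; rewrite (@nneseries_split _ _ 0 1) // add0n big_nat1; congr (_ + _).
by rewrite -(@nneseries_addn _ _ 1) //; apply: eq_eseriesr => k _; rewrite addn1.
Qed.

(** Sum [coef_le_qS] over [k]: each [qS] occurs at most twice, which doubles the constant. *)
Lemma hardy1_le (mu : circle_measure R) (b : nat -> C) :
  mu setT * \sum_(0 <= k <oo) (modulus (b k.+1) ^+ 2)%:E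
  <= (16 * pi)%:E * \sum_(0 <= k <oo) qS mu k (pderiv b).
Proof.
have p0 (c : R) : (0 <= c)%R -> (0 <= c * pi)%R by move=> c0; rewrite mulr_ge0 // pi_ge0.
pose q' k := if k is k'.+1 then qS mu k' (pderiv b) else 0.
have q0 k : 0 <= qS mu k (pderiv b) by exact: qS_ge0.
have q'0 k : 0 <= q' k by case: k.
have -> : mu setT * \sum_(0 <= k <oo) (modulus (b k.+1) ^+ 2)%:E = \sum_(0 <= k <oo) (modulus (b k.+1) ^+ 2)%:E * mu setT.
  by rewrite muleC nneseries_mulr // => k; rewrite lee_fin exprn_ge0 ?modulus_ge0.
apply: (@le_trans _ _ (\sum_(0 <= k <oo) (8 * pi)%:E * (qS mu k (pderiv b) + q' k))).
  apply: lee_nneseries => k _; first by rewrite mule_ge0 // lee_fin exprn_ge0 ?modulus_ge0.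
  by rewrite muleC; exact: coef_le_qS.
rewrite nneseriesZl => [|k _]; last exact: adde_ge0.
rewrite nneseriesD //.
have -> : \sum_(0 <= k <oo) q' k = \sum_(0 <= k <oo) qS mu k (pderiv b).
  by rewrite nneseries_shift0 //= add0e.
have -> : (16 * pi)%:E = (8 * pi)%:E + (8 * pi)%:E :> \bar R by rewrite -EFinD; congr EFin; ring.
by rewrite ge0_muleDr ?ge0_muleDl ?lee_fin ?p0 //; apply: nneseries_ge0.
Qed.

(** Split off [a 0 0]. The rest of the row of index 0 is controlled by [mu2] and the block
    [true false], all other rows by [mu1] and the block [false true]; both masses must be
    positive. *)
Lemma hardy_of_dirichlet (mu1 mu2 : circle_measure R) (a : nat -> nat -> C) :
  mu1 setT * mu2 setT != 0 -> qsum mu1 mu2 false true a < +oo -> qsum mu1 mu2 true false a < +oo ->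
  qsum mu1 mu2 true true a < +oo.
Proof.
move=> m0 hft htf.
have p0 : 0 <= (16 * pi : R)%:E by rewrite lee_fin mulr_ge0 // pi_ge0.
have fin (mu : circle_measure R) : exists m : R, mu setT = m%:E.
  by exists (fine (mu setT)); rewrite fineK // fin_num_measure.
have [M1 hM1] := fin mu1; have [M2 hM2] := fin mu2.
have M10 : (0 < M1)%R.
  by rewrite -lte_fin -hM1 lt0e measure_ge0 andbT; apply: contraNneq m0 => ->; rewrite mul0e.
have M20 : (0 < M2)%R.
  by rewrite -lte_fin -hM2 lt0e measure_ge0 andbT; apply: contraNneq m0 => ->; rewrite mule0.
have ltp (M : R) (x y : \bar R) : (0 < M)%R -> M%:E * x <= (16 * pi)%:E * y -> 0 <= y -> y < +oo -> x < +oo.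
  move=> M0 h y0 yoo; have yf : y \is a fin_num by rewrite ge0_fin_numE.
  rewrite ltey; apply/eqP => xoo; move: h; rewrite xoo gt0_muley ?lte_fin //.
  by rewrite -(fineK yf) -EFinM leye_eq.
have sq0 m n : 0 <= (modulus (a m n) ^+ 2)%:E by rewrite lee_fin exprn_ge0 ?modulus_ge0.
have -> : qsum mu1 mu2 true true a = \sum_(0 <= m <oo) \sum_(0 <= n <oo) (modulus (a m n) ^+ 2)%:E.
  by apply: eq_eseriesr => m _; apply: eq_eseriesr => n _; rewrite qterm_tt.
rewrite nneseries_shift0 => [|m]; last exact: nneseries_ge0.
apply: lte_add_pinfty.
  rewrite nneseries_shift0 //; apply: lte_add_pinfty; first exact: ltry.
  have q0 m : 0 <= \sum_(0 <= l <oo) qS mu2 l (pderiv (a m)).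
    by apply: nneseries_ge0 => l _ _; exact: qS_ge0.
  have tfE : qsum mu1 mu2 true false a = \sum_(0 <= m <oo) \sum_(0 <= l <oo) qS mu2 l (pderiv (a m)).
    by apply: eq_eseriesr => m _; apply: eq_eseriesr => l _; rewrite qterm_tf.
  apply: (ltp M2 _ (\sum_(0 <= l <oo) qS mu2 l (pderiv (a 0%N)))) => //.
    by rewrite -hM2; exact: hardy1_le.
  by apply: le_lt_trans htf; rewrite tfE [leRHS]nneseries_shift0 // leeDl // nneseries_ge0.
rewrite nneseries_interchange //.
have q0 n : 0 <= \sum_(0 <= k <oo) qS mu1 k (pderiv (ptr a n)).
  by apply: nneseries_ge0 => k _ _; exact: qS_ge0.
have ftE : qsum mu1 mu2 false true a = \sum_(0 <= n <oo) \sum_(0 <= k <oo) qS mu1 k (pderiv (ptr a n)).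
  by rewrite qsum_tr; apply: eq_eseriesr => n _; apply: eq_eseriesr => k _; rewrite qterm_tf.
apply: (ltp M1 _ (qsum mu1 mu2 false true a)) => //; last by rewrite ftE nneseries_ge0.
rewrite ftE -nneseriesZl => [|n _]; last by apply: nneseries_ge0.
rewrite -nneseriesZl => [|n _]; last exact: q0.
apply: lee_nneseries => n _; first by rewrite mule_ge0 ?lee_fin ?(ltW M10) // nneseries_ge0.
by rewrite -hM1; exact: (hardy1_le mu1 (ptr a n)).
Qed.

End HardyFromDirichlet.

(** * Herglotz's theorem *)

Section RootsOfUnity.
Variable R : realType.
Local Notation C := R[i].

Lemma cos_neq1 (x : R) : 0 < x < 2 * pi -> cos x != 1.
Proof.
move=> /andP[x0 x1]; have s0 : 0 < sin (x / 2) by apply: sin_gt0_pi; apply/andP; split; lra.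
have e : cos x = cos (x / 2) ^+ 2 - sin (x / 2) ^+ 2 by rewrite {1}[x]splitr cosD !expr2.
have := cos2Dsin2 (x / 2); have s2 : 0 < sin (x / 2) ^+ 2 by rewrite exprn_gt0.
by move=> h; apply/eqP => c1; rewrite c1 in e; lra.
Qed.

Lemma expi_natM2pi k : expi (k%:R * (2 * pi)) = 1 :> C.
Proof. by rewrite -expiX -[2 * pi]add0r expi2pi expi0 expr1n. Qed.

Definition root_angle N j : R := 2 * pi * (j%:R / N%:R).

Lemma sum_roots N a b : (a < N + b)%N -> (b < N + a)%N ->
  \sum_(j < N) expi (a%:R * root_angle N j) * (expi (b%:R * root_angle N j))^*%C
  = if a == b then N%:R else 0 :> C.
Proof.
move=> aN bN.
have N0 : (0 < N)%N by case: N aN bN => [|//]; rewrite !add0n => h1 h2; have := ltn_trans h1 h2; rewrite ltnn.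
have nN : (N%:R : R) != 0 by rewrite pnatr_eq0 -lt0n.
have NR0 : (0 < N%:R :> R) by rewrite ltr0n.
pose x : R := (a%:R - b%:R) * (2 * pi / N%:R); pose z : C := expi x.
have -> : \sum_(j < N) expi (a%:R * root_angle N j) * (expi (b%:R * root_angle N j))^*%C = \sum_(j < N) z ^+ j.
  apply: eq_bigr => j _; rewrite conj_expi -expiD /z expiX; congr expi; rewrite /x /root_angle.
  by move: (pi : R) (N%:R : R) nN => p n n0; field.
have [ab|ab] := eqVneq a b.
  have -> : z = 1 by rewrite /z /x ab subrr mul0r expi0.
  by under eq_bigr do rewrite expr1n; rewrite sumr_const card_ord.
have zN : z ^+ N = 1.
  rewrite /z expiX (_ : N%:R * x = a%:R * (2 * pi) + (- (b%:R * (2 * pi)))); last first.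
    by rewrite /x; move: (pi : R) (N%:R : R) nN => p n n0; field.
  by rewrite expiD -conj_expi !expi_natM2pi mul1r conjc1.
have z1 : z - 1 != 0.
  rewrite subr_eq0; apply/eqP => e.
  have cx : cos x = 1 by have := congr1 (@complex.Re R) e.
  have aRN : (a%:R < N%:R + b%:R :> R) by rewrite -natrD ltr_nat.
  have bRN : (b%:R < N%:R + a%:R :> R) by rewrite -natrD ltr_nat.
  have p0 := @twopi_gt0 R.
  have c0 : 0 < 2 * pi / N%:R :> R by rewrite divr_gt0.
  have cN : 2 * pi = 2 * pi / N%:R * N%:R :> R by rewrite divfK.
  have [lt|lt|/(mulrIn (oner_neq0 R))/eqP] := ltgtP (a%:R : R) b%:R; last by rewrite (negPf ab).
    have := @cos_neq1 (- x); rewrite cosN cx eqxx => /(_ _)/negP; apply => //.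
    rewrite /x -mulNr opprB mulr_gt0 ?subr_gt0 //= {2}cN mulrC ltr_pM2l //; lra.
  have := @cos_neq1 x; rewrite cx eqxx => /(_ _)/negP; apply => //.
  by rewrite /x mulr_gt0 ?subr_gt0 //= {2}cN mulrC ltr_pM2l //; lra.
by apply: (mulfI z1); rewrite mulr0 -subrX1 zN subrr.
Qed.

End RootsOfUnity.

(** * Integrals of monotone functions along an ultrafilter *)

Section MonotoneIntegrals.
Variable R : realType.
Local Notation leb := (@lebesgue_measure R).
Implicit Types (h : R -> R).

Definition hint (a b : R) h : R := \int[leb]_(u in `]a, b]) h u.

Lemma mono_integrable (a b : R) h : nondecreasing_fun h -> leb.-integrable `]a, b] (EFin \o h).
Proof.
move=> hm; apply: measurable_bounded_integrable => //.
- suff : (leb `]a, b]%classic < +oo)%E by [].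
  by rewrite lebesgue_measure_itv /=; case: ifP => _; rewrite ?ltry.
- by apply: nondecreasing_measurable.
- exists (Num.max `|h a| `|h b|); split; first by rewrite num_real.
  move=> M hM u; rewrite /= in_itv /= => /andP[au ub].
  apply: le_trans (ltW hM); rewrite ler_norml le_max.
  have h1 := hm _ _ (ltW au); have h2 := hm _ _ ub.
  apply/andP; split; last first.
    by rewrite (le_trans h2 (ler_norm _)) orbT.
  apply: le_trans h1; rewrite lerNl; apply: le_trans (ler_norm _) _.
  by rewrite normrN le_max lexx.
Qed.

Lemma hint_cst (a b c : R) h : a <= b -> (forall u, a < u <= b -> h u = c) -> hint a b h = c * (b - a).
Proof.
move=> ab hc; transitivity (\int[leb]_(u in `]a, b]) c).
  by apply: eq_Rintegral => u /set_mem; rewrite /= in_itv /=; exact: hc.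
rewrite Rintegral_cst //=; congr (_ * _); rewrite (@lebesgue_measure_itv R `]a, b]) /= lte_fin.
case: ltP => // ba; have -> : a = b by apply/le_anti; rewrite ab ba.
by rewrite subrr.
Qed.

Lemma hint_le (a b c d : R) h : nondecreasing_fun h -> a <= b ->
  (forall u, a < u <= b -> c <= h u <= d) -> c * (b - a) <= hint a b h <= d * (b - a).
Proof.
move=> hm ab hcd.
rewrite -(@hint_cst a b c (fun=> c)) // -(@hint_cst a b d (fun=> d)) //.
have ic (x : R) : leb.-integrable `]a, b] (EFin \o (fun=> x)) by apply: mono_integrable.
have ih := @mono_integrable a b h hm.
by apply/andP; split; apply: le_Rintegral => // u; rewrite /= in_itv /= => /hcd/andP[].
Qed.

Lemma hint_split (x : nat -> R) n h : nondecreasing_fun h -> (forall k, x k <= x k.+1) ->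
  hint (x 0%N) (x n) h = \sum_(k < n) hint (x k) (x k.+1) h.
Proof.
move=> hm xm; elim: n => [|n IH].
  by rewrite big_ord0 (@hint_cst _ _ 0) ?mul0r // => u /andP[h1 /(lt_le_trans h1)]; rewrite ltxx.
have x0n : x 0%N <= x n by elim: n {IH} => // n; move/le_trans; apply.
rewrite big_ord_recr /= -IH /hint.
have -> : (`]x 0%N, x n.+1] = `]x 0%N, x n] `|` `]x n, x n.+1])%classic.
  by rewrite -itv_bndbnd_setU // bnd_simp.
rewrite Rintegral_setU //.
- rewrite -itv_bndbnd_setU ?bnd_simp //; exact: mono_integrable.
- apply/disj_setPS => u [] /=; rewrite !in_itv /= => /andP[_ h1] /andP[h2 _].
  by have := lt_le_trans h2 h1; rewrite ltxx.
Qed.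

(** For monotone [h] the error of the Riemann sum telescopes; the bound sees only the values at 0
    and 1, hence is uniform over a bounded family. *)
Lemma hint_riemann n h : nondecreasing_fun h -> (0 < n)%N ->
  `|hint 0 1 h - n%:R^-1 * \sum_(k < n) h (k.+1%:R / n%:R)| <= n%:R^-1 * (h 1 - h 0).
Proof.
move=> hm n0; have nR : (0 < n%:R :> R) by rewrite ltr0n.
pose x k : R := k%:R / n%:R.
have xm k : x k <= x k.+1 by rewrite ler_pM2r ?invr_gt0 // ler_nat.
have xd k : x k.+1 - x k = n%:R^-1 by rewrite /x -mulrBl -natr1 addrC addKr mul1r.
have xn : x n = 1 by rewrite /x divff // gt_eqF.
have x0 : x 0%N = 0 by rewrite /x mul0r.
have b k : h (x k) * n%:R^-1 <= hint (x k) (x k.+1) h <= h (x k.+1) * n%:R^-1.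
  by rewrite -{1 2}(xd k); apply: hint_le => // u /andP[u1 u2]; rewrite !hm // ltW.
rewrite -{1}x0 -{1}xn hint_split // mulr_sumr -sumrB.
have tel : \sum_(k < n) (h (x k.+1) - h (x k)) = h 1 - h 0.
  by rewrite -(big_mkord xpredT (fun k => h (x k.+1) - h (x k))) telescope_sumr // xn x0.
rewrite -tel mulr_sumr; apply: le_trans (ler_norm_sum _ _ _) _; apply: ler_sum => k _.
have /andP[b1 b2] := b k; rewrite -/(x k.+1) mulrBr ler_norml; apply/andP; split; rewrite mulrC in b1 *; rewrite mulrC in b2; lra.
Qed.

(** Dominated convergence fails along ultrafilters in general. Monotonicity replaces it: the
    integrals are uniformly close to Riemann sums with finitely many points, which do converge. *)
Lemma hint_ulim (U : set_system nat) (UU : ProperFilter U) (f : nat -> R -> R) h (B : R) :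
  (forall i, nondecreasing_fun (f i)) -> nondecreasing_fun h ->
  (forall i, `|f i 0| <= B /\ `|f i 1| <= B) ->
  (forall u, (f i u : R^o) @[i --> U] --> (h u : R^o)) ->
  (hint 0 1 (f i) : R^o) @[i --> U] --> (hint 0 1 h : R^o).
Proof.
move=> fm hm fB fh; apply/cvgrPdist_le => e e0 /=.
have B0 : 0 <= B by have [h0 _] := fB 0%N; apply: le_trans h0.
have hB u : (forall i, `|f i u| <= B) -> `|h u| <= B.
  move=> hb; rewrite ler_norml; apply/andP; split.
    apply: (cvgr_to_ge (fh u)); apply: nearW => i.
    by have := hb i; rewrite ler_norml => /andP[].
  by apply: (cvgr_to_le (fh u)); apply: nearW => i; apply: le_trans (ler_norm _) (hb i).
have h0B : `|h 0| <= B by apply: hB => i; case: (fB i).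
have h1B : `|h 1| <= B by apply: hB => i; case: (fB i).
pose n := (Num.truncn (8 * (B + 1) / e)).+1.
have n0 : (0 < n)%N by [].
have nR : (0 < n%:R :> R) by rewrite ltr0n.
have ne : n%:R^-1 * (2 * B) <= e / 4.
  have : 8 * (B + 1) / e < n%:R by rewrite /n truncnS_gt.
  rewrite ltr_pdivrMr // => hn; rewrite mulrC ler_pdivrMr //; nra.
have cS : (n%:R^-1 * \sum_(k < n) f i (k.+1%:R / n%:R) : R^o) @[i --> U]
    --> (n%:R^-1 * \sum_(k < n) h (k.+1%:R / n%:R) : R^o).
  by apply: (@cvgM R); [exact: cvg_cst|apply: cvg_rsum => k; exact: fh].
have e4 : 0 < e / 4 by rewrite divr_gt0.
have /cvgrPdist_le/(_ _ e4) := cS; apply: filterS => i hi.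
have r1 := @hint_riemann n (f i) (fm i) n0.
have r2 := @hint_riemann n h hm n0.
have d1 : n%:R^-1 * (f i 1 - f i 0) <= e / 4.
  apply: le_trans ne; rewrite ler_pM2l ?invr_gt0 //.
  by have [] := fB i; rewrite !ler_norml => /andP[? ?] /andP[? ?]; lra.
have d2 : n%:R^-1 * (h 1 - h 0) <= e / 4.
  apply: le_trans ne; rewrite ler_pM2l ?invr_gt0 //.
  by move: h0B h1B; rewrite !ler_norml => /andP[? ?] /andP[? ?]; lra.
move: hi (le_trans r1 d1) (le_trans r2 d2).
move: (n%:R^-1 * \sum_(k < n) h (k.+1%:R / n%:R)) (n%:R^-1 * \sum_(k < n) f i (k.+1%:R / n%:R)) => s t.
by rewrite !ler_norml => /andP[? ?] /andP[? ?] /andP[? ?]; lra.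
Qed.

End MonotoneIntegrals.

Lemma ultra_cvg (R : realType) (U : set_system nat) (UU : UltraFilter U) (a : nat -> R) (A B : R) :
  (forall i, A <= a i <= B) -> exists l, (a i : R^o) @[i --> U] --> (l : R^o).
Proof.
move=> ab; have [|l [_ cl]] := @segment_compact R A B (a @ U) _.
  apply: (@filterE nat U _ (fun i => `[A, B]%classic (a i))) => i.
  by rewrite /= in_itv /=; exact: ab.
exists l => S nS; have [//|US] := in_ultra_setVsetC (a @^-1` S) UU.
by have [x []] := cl (~` S) S US nS.
Qed.

Section CircleMeasures.
Variable R : realType.
Local Notation TR := (measurableTypeR R).
Local Notation leb := (@lebesgue_measure R).

Lemma cos_add_mono : nondecreasing_fun (fun t : R => cos t + t).
Proof.
move=> x y xy.
have d (t : R) : is_derive (t : R^o) (1 : R^o) (fun t : R^o => cos t + t : R^o) (- sin t + 1).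
  exact: is_deriveD.
apply: (@ger0_derive1_ndecr R (fun t => cos t + t) x y)  => // [t _|].
- by rewrite derive1E (@derive_val _ _ _ _ _ _ _ (d t)) addrC subr_ge0 sin_le1.
- apply: continuous_subspaceT => t; apply: (@cvgD R); [exact: continuous_cos|exact: cvg_id].
Qed.

Lemma sin_add_mono : nondecreasing_fun (fun t : R => sin t + t).
Proof.
move=> x y xy.
have d (t : R) : is_derive (t : R^o) (1 : R^o) (fun t : R^o => sin t + t : R^o) (cos t + 1).
  exact: is_deriveD.
apply: (@ger0_derive1_ndecr R (fun t => sin t + t) x y)  => // [t _|].
- by rewrite derive1E (@derive_val _ _ _ _ _ _ _ (d t)) addrC -[X in _ + X]opprK subr_ge0 lerNl cos_geN1.
- apply: continuous_subspaceT => t; apply: (@cvgD R); [exact: continuous_sin|exact: cvg_id].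
Qed.

Section ScaledProbability.
Variables (P : probability TR R) (k : {nonneg R}).

Lemma mscale_fin_num : fin_num_fun (mscale k P).
Proof.
move=> A mA; have PA : P A \is a fin_num by exact: fin_num_measure.
by have := @fin_numM R k%:num%:E _ isT PA.
Qed.

Definition scaled_probability : {finite_measure set TR -> \bar R} :=
  HB.pack_for (FiniteMeasure.type TR R) (mscale k P)
    (Measure_isFinite.Build _ _ _ (mscale k P) mscale_fin_num).

End ScaledProbability.

Section PushCircle.
Variables (phi : TR -> TR) (k : R).
Hypotheses (mphi : measurable_fun setT phi) (phiI : forall u, (@I2pi R) (phi u)) (k0 : 0 <= k).

(** The measure is [k] times the image under [phi] of Lebesgue measure on the unit interval, so it
    is constructed from a quantile function instead of a distribution function. *)
Lemma push_circle_measure : exists mu : circle_measure R, forall f : TR -> R,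
  measurable_fun setT f -> (forall t, `|f t| <= 1) ->
  \int[mu]_(t in @I2pi R) f t = k * hint 0 1 (fun u => f (phi u)).
Proof.
have mI := @measurable_I2pi R.
pose X : {mfun TR >-> TR} := HB.pack phi (isMeasurableFun.Build _ _ _ _ phi mphi).
pose P : probability TR R := distribution (uniform_prob (@ltr01 R)) X.
pose nu := scaled_probability P (NngNum k0).
have pre : phi @^-1` (@I2pi R) = setT by apply/seteqP; split=> // u _; exact: phiI.
have supp : nu (~` `[0, 2 * pi[%classic) = 0%E.
  rewrite /nu /= /mscale /= /P /distribution /pushforward.
  rewrite (_ : X @^-1` _ = set0) ?measure0 ?mule0 //.
  by apply/seteqP; split=> // u /= h; apply: h; exact: phiI.
exists (CircleMeasure supp) => f mf f1.
have nng (g : TR -> R) : measurable_fun setT g -> (forall t, 0 <= g t) ->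
    (\int[nu]_(t in @I2pi R) (g t)%:E = k%:E * \int[leb]_(u in `]0%R, 1%R]) (g (phi u))%:E)%E.
  move=> mg g0.
  have -> : (\int[nu]_(t in @I2pi R) (g t)%:E = k%:E * \int[P]_(t in @I2pi R) (g t)%:E)%E.
    apply: (@ge0_integral_mscale _ TR R P (@I2pi R) mI (NngNum k0) (fun t => (g t)%:E)) => //.
      by apply/measurable_EFinP; apply: measurable_funTS.
    by move=> t _; rewrite lee_fin.
  congr (_ * _)%E.
  rewrite /P /distribution ge0_integral_pushforward //; last 2 first.
  - by apply/measurable_EFinP; apply: measurable_funTS.
  - by move=> t _; rewrite lee_fin.
  rewrite (_ : X @^-1` (@I2pi R) = setT); last exact: pre.
  rewrite integral_uniform //; last 2 first.
  - by apply/measurable_EFinP; apply: measurableT_comp.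
  - by move=> u; rewrite lee_fin.
  rewrite subr0 invr1 mul1e.
  apply/esym; apply: (@integral_itv_obnd_cbnd R 0 (BRight 1) (fun u => (g (phi u))%:E)).
  by apply/measurable_EFinP; apply: measurable_funTS; apply: measurableT_comp.
have lebI : (leb `]0%R, 1%R]%classic = 1)%E by rewrite lebesgue_measure_itv /= lte_fin ltr01 sube0.
have m1 : measurable_fun setT (fun t : TR => 1 + f t) by apply: measurable_funD => //.
have i1 (g : TR -> R) : measurable_fun setT g -> (forall t, `|g t| <= 2) ->
    leb.-integrable `]0, 1] (EFin \o (fun u => g (phi u))).
  move=> mg g2; apply: measurable_bounded_integrable => //.
  - suff : (leb `]0%R, 1%R]%classic < +oo)%E by [].
    by rewrite lebI ltry.
  - by apply: measurable_funTS; apply: measurableT_comp.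
  - by exists 2; split => // M hM u _; apply: le_trans (g2 _) (ltW hM).
have i2 (g : TR -> R) : measurable_fun setT g -> (forall t, `|g t| <= 2) ->
    nu.-integrable (@I2pi R) (EFin \o g).
  move=> mg g2; apply: measurable_bounded_integrable => //.
  - by rewrite ltey_eq fin_num_measure.
  - exact: measurable_funTS.
  - by exists 2; split => // M hM u _; apply: le_trans (g2 _) (ltW hM).
have c1 : (forall t : TR, `|(fun=> 1 : R) t| <= 2) by move=> t; rewrite normr1 ler1n.
have f2 t : `|f t| <= 2 by apply: le_trans (f1 t) _; rewrite ler1n.
have s2 t : `|1 + f t| <= 2.
  by apply: le_trans (ler_normD _ _) _; rewrite normr1 -[leRHS]/(1 + 1 : R) lerD2l.
have E (g : TR -> R) : measurable_fun setT g -> (forall t, 0 <= g t) -> (forall t, `|g t| <= 2) ->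
    \int[nu]_(t in @I2pi R) g t = k * hint 0 1 (fun u => g (phi u)).
  move=> mg g0 g2; rewrite /Rintegral nng // fineM //.
  by apply: integrable_fin_num => //; exact: i1.
have E1 := E (fun=> 1) (measurable_cst _) (fun=> ler01) c1.
(* The formula is established for nonnegative functions only. Since [f >= -1], it applies to [1 + f]
   and to 1, and the difference gives [f]. *)
have E2 : \int[nu]_(t in @I2pi R) (1 + f t) = k * hint 0 1 (fun u => 1 + f (phi u)).
  by apply: E => // t; have := f1 t; rewrite ler_norml addrC -lerBlDr sub0r => /andP[].
have e1 : \int[nu]_(t in @I2pi R) (1 + f t) = \int[nu]_(t in @I2pi R) 1 + \int[nu]_(t in @I2pi R) f t.
  by apply: RintegralD => //; [apply: (i2 (fun=> 1))|exact: i2].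
have e2 : hint 0 1 (fun u => 1 + f (phi u)) = hint 0 1 (fun=> 1) + hint 0 1 (fun u => f (phi u)).
  by apply: RintegralD => //; [apply: (i1 (fun=> 1))|exact: i1].
by move: E2; rewrite e1 e2 E1 mulrDr => /addrI.
Qed.

End PushCircle.
End CircleMeasures.

(** * Fejer sampling and the limit measure *)

Section Herglotz.
Variable R : realType.
Local Notation C := R[i].
Local Notation TR := (measurableTypeR R).
Variable g : nat -> nat -> C.
Hypothesis toep : forall m p, g m.+1 p.+1 = g m p.
Hypothesis psd : forall N (x : nat -> C), 0 <= \sum_(m < N) \sum_(p < N) x m * (x p)^*%C * g m p.
Hypothesis g00 : g 0%N 0%N = 1.

Lemma toeplitz_shift d m p : g (d + m) (d + p) = g m p.
Proof. by elim: d => // d IH; rewrite !addSn toep. Qed.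

(* [fejer M t / M] is the Fejer mean of the Fourier series with coefficients [g]; sampling it at
   the [2M]-th roots of unity gives finitely supported measures with the moments
   [(1 - d/M) g d 0] for [d < M]. *)
Definition fejer M (t : R) : C :=
  \sum_(m < M) \sum_(p < M) (expi (m%:R * t))^*%C * (expi (p%:R * t)) * g m p.

Lemma fejer_ge0 M t : 0 <= fejer M t.
Proof.
have := psd M (fun m => (expi (m%:R * t))^*%C); rewrite /fejer.
by under eq_bigr do under eq_bigr do rewrite conjcK.
Qed.

Definition pw M j : R := Re (fejer M (root_angle R (2 * M) j)) / (M%:R * (2 * M)%:R).

Lemma pw_ge0 M j : 0 <= pw M j.
Proof.
rewrite divr_ge0 ?mulr_ge0 ?ler0n //.
by have := fejer_ge0 M (root_angle R (2 * M) j); rewrite lecE => /andP[].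
Qed.

(** Orthogonality of the roots of unity keeps the pairs with [m = d + p], of which there are
    [M - d]. The exponents [d + p] and [m] differ by less than [2 M], so the sampling produces no
    aliasing. *)
Lemma pw_moment M d : (d < M)%N ->
  \sum_(j < 2 * M) (pw M j)%:C%C * expi (d%:R * root_angle R (2 * M) j) = (1 - d%:R / M%:R)%:C%C * g d 0%N.
Proof.
move=> dM; have M0 : (0 < M)%N by case: (M) dM.
have MC : (M%:R : C) != 0 by rewrite pnatr_eq0 -lt0n.
pose K : C := (M%:R * (2 * M)%:R)^-1.
have pwE j : (pw M j)%:C%C = fejer M (root_angle R (2 * M) j) * K.
  have := fejer_ge0 M (root_angle R (2 * M) j); rewrite lecE => /andP[/eqP im _].
  rewrite /pw real_complexM real_complexV real_complexM !rmorph_nat; congr (_ * _).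
  by apply: complex_eqP; rewrite /= ?im.
transitivity (K * \sum_(p < M) \sum_(m < M) g m p * (if (d + p == m)%N then (2 * M)%:R else 0)).
  under eq_bigr do rewrite pwE mulrAC mulrC.
  rewrite -mulr_sumr; congr (_ * _).
  under eq_bigr do rewrite /fejer exchange_big mulr_suml.
  rewrite exchange_big; apply: eq_bigr => p _.
  under eq_bigr do rewrite mulr_suml.
  rewrite exchange_big; apply: eq_bigr => m _.
  rewrite -(@sum_roots R (2 * M) (d + p) m).
  - rewrite mulr_sumr; apply: eq_bigr => j _.
    rewrite natrD [(_ + _) * root_angle _ _ _]mulrDl expiD; ring.
  - rewrite ltn_addr // mul2n -addnn -addSn leq_add // ltnW //.
  - by rewrite ltn_addr // mul2n -addnn ltn_addr.
have -> : \sum_(p < M) \sum_(m < M) g m p * (if (d + p == m)%N then (2 * M)%:R else 0)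
    = (M - d)%:R * (g d 0%N * (2 * M)%:R).
  rewrite -[(M - d)%N in RHS]card_ord [RHS]mulr_natl -sumr_const.
  rewrite (big_ord_widen _ (fun=> g d 0%N * (2 * M)%:R) (leq_subr d M)) [RHS]big_mkcond.
  apply: eq_bigr => p _; rewrite ltn_subRL; case: ifPn => dp.
    rewrite (bigD1 (Ordinal dp)) //= eqxx big1 ?addr0 => [|m mp].
      by have := toeplitz_shift p d 0; rewrite addn0 (addnC p) => ->.
    by case: eqP => [e|]; rewrite ?mulr0 //; case/eqP: mp; apply/val_inj.
  rewrite big1 // => m _; case: eqP => [e|]; rewrite ?mulr0 //.
  by move: dp; rewrite e ltn_ord.
have -> : (1 - d%:R / M%:R)%:C%C = 1 - d%:R / M%:R :> C.
  by rewrite rmorphB rmorph1 /= real_complexM real_complexV !rmorph_nat.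
rewrite /K natrM natrB ?(ltnW dM) //.
by move: (M%:R : C) (d%:R : C) MC (g d 0%N) => m e m0 x; field.
Qed.

Lemma pw_sum M : (0 < M)%N -> \sum_(j < 2 * M) pw M j = 1.
Proof.
move=> M0; apply: (@complexI R); have := pw_moment M0; rewrite mul0r subr0 g00 mulr1 => <-.
by rewrite rmorph_sum; apply: eq_bigr => j _; rewrite mul0r expi0 mulr1.
Qed.

Let W M n : R := \sum_(i < n) pw M i.

Let W_homo M : {homo W M : m n / (m <= n)%N >-> m <= n}.
Proof.
apply: homo_leq => [x|y x z|n]; [exact: lexx|exact: le_trans|].
by rewrite /W big_ord_recr lerDl pw_ge0.
Qed.

(* The quantile function of the discrete measure with mass [pw M j] at [root_angle (2 * M) j]. *)
Definition quantile M (u : R) : R := \sum_(j < 2 * M) 2 * pi / (2 * M)%:R * (W M j.+1 < u)%R%:R.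

Lemma quantile_mono M : nondecreasing_fun (quantile M).
Proof.
move=> u v uv; apply: ler_sum => j _; rewrite ler_wpM2l //.
  by rewrite divr_ge0 ?ler0n // ltW // twopi_gt0.
rewrite ler_nat; case: ltP => // h; by rewrite (lt_le_trans h uv).
Qed.

Lemma quantile_itv M u : 0 <= quantile M u <= 2 * pi.
Proof.
have c0 : 0 <= 2 * pi / (2 * M)%:R :> R by rewrite divr_ge0 ?ler0n // ltW // twopi_gt0.
apply/andP; split; first by apply: sumr_ge0 => j _; rewrite mulr_ge0.
apply: (@le_trans _ _ (\sum_(j < 2 * M) 2 * pi / (2 * M)%:R)).
  by apply: ler_sum => j _; rewrite ler_piMr // -[leRHS]/(1%:R) ler_nat; case: (_ < _).
rewrite sumr_const card_ord -[_ *+ (2 * M)]mulr_natr; have [->|M0] := posnP M.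
  by rewrite muln0 mulr0 ltW // twopi_gt0.
by rewrite divfK // pnatr_eq0 muln_eq0 /= -lt0n.
Qed.

Lemma quantile_piece M j u : (j < 2 * M)%N -> W M j < u <= W M j.+1 -> quantile M u = root_angle R (2 * M) j.
Proof.
move=> jM /andP[u1 u2]; rewrite /quantile -mulr_sumr /root_angle -mulrA; congr (_ * _).
have -> : \sum_(i < 2 * M) (W M i.+1 < u)%R%:R = j%:R :> R.
  rewrite -[j in RHS]card_ord -sum1_card natr_sum.
  rewrite [RHS](big_ord_widen _ (fun=> 1%:R) (ltnW jM)) [RHS]big_mkcond; apply: eq_bigr => i _.
  case: ifPn => ij; first by rewrite (le_lt_trans (W_homo M ij) u1).
  by rewrite ltNge (le_trans u2) // W_homo // ltnS leqNgt.
by rewrite mulrC.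
Qed.

(** The quantile function is a step function that takes the value [root_angle R (2 * M) j] on an
    interval of length [pw M j]. *)
Lemma hint_quantile M (f : R -> R) : (0 < M)%N -> nondecreasing_fun f ->
  hint 0 1 (fun u => f (quantile M u)) = \sum_(j < 2 * M) pw M j * f (root_angle R (2 * M) j).
Proof.
move=> M0 fm.
have hm : nondecreasing_fun (fun u => f (quantile M u)) by move=> u v uv; apply/fm/quantile_mono.
have W0 : W M 0 = 0 by rewrite /W big_ord0.
have WN : W M (2 * M) = 1 by exact: pw_sum.
rewrite -{1}W0 -{1}WN hint_split // => [|k]; last exact: W_homo.
apply: eq_bigr => j _; rewrite (@hint_cst _ _ _ (f (root_angle R (2 * M) j))).
- by rewrite /W big_ord_recr /= addrC addrK mulrC.
- exact: W_homo.
- by move=> u hu; rewrite (quantile_piece _ hu).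
Qed.

Section Limit.
Variable U : set_system nat.
Hypotheses (UU : UltraFilter U) (Uoo : \oo `<=` U).

(** The pointwise limit along the ultrafilter takes the place of Helly's selection theorem. *)
Definition qlim (u : R) : R := lim ((quantile i.+1 u : R^o) @[i --> U]).

Lemma cvg_qlim u : (quantile i.+1 u : R^o) @[i --> U] --> (qlim u : R^o).
Proof.
have [l cl] := ultra_cvg UU (fun i => quantile_itv i.+1 u).
by rewrite /qlim (cvg_lim _ cl).
Qed.

Lemma qlim_itv u : 0 <= qlim u <= 2 * pi.
Proof.
apply/andP; split; [apply: (cvgr_to_ge (cvg_qlim (u := u)))|apply: (cvgr_to_le (cvg_qlim (u := u)))];
  by apply: nearW => i; case/andP: (quantile_itv i.+1 u).
Qed.

Lemma qlim_mono : nondecreasing_fun qlim.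
Proof.
move=> u v uv; rewrite -subr_ge0.
apply: (cvgr_to_ge (cvgB (cvg_qlim (u := v)) (cvg_qlim (u := u)))); apply: nearW => i.
by rewrite subr_ge0; exact: quantile_mono.
Qed.

Lemma cvg_hint_quantile (f : R -> R) : nondecreasing_fun f -> continuous (f : R^o -> R^o) ->
  (\sum_(j < 2 * i.+1) pw i.+1 j * f (root_angle R (2 * i.+1) j) : R^o) @[i --> U]
  --> (hint 0 1 (fun u => f (qlim u)) : R^o).
Proof.
move=> fm cf.
have -> : (fun i => \sum_(j < 2 * i.+1) pw i.+1 j * f (root_angle R (2 * i.+1) j))
    = (fun i => hint 0 1 (fun u => f (quantile i.+1 u))).
  by apply/funext => i; rewrite hint_quantile.
have fb i u : `|f (quantile i.+1 u)| <= Num.max `|f 0| `|f (2 * pi)|.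
  have /andP[q0 q1] := quantile_itv i.+1 u.
  have h1 := fm _ _ q0; have h2 := fm _ _ q1.
  rewrite ler_norml le_max; apply/andP; split; last by rewrite (le_trans h2 (ler_norm _)) orbT.
  by apply: le_trans h1; rewrite lerNl le_max (le_trans (ler_norm (- f 0))) ?normrN.
apply: (@hint_ulim R U _ _ _ (Num.max `|f 0| `|f (2 * pi)|)) => [i|||u].
- by move=> u v uv; apply/fm/quantile_mono.
- by move=> u v uv; apply/fm/qlim_mono.
- by move=> i; split; exact: fb.
- exact: (@cvg_comp _ _ _ (fun i => quantile i.+1 u : R^o) (f : R^o -> R^o) U (nbhs (qlim u : R^o)) _ (cvg_qlim (u := u)) (cf (qlim u))).
Qed.

(* A trigonometric function plus [id] is monotone, which reduces its integrals to monotone ones. *)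
Lemma hint_trig (T : R -> R) (G : nat -> R) d : nondecreasing_fun (fun t => T t + t) -> continuous (T : R^o -> R^o) ->
  (forall i, (d < i.+1)%N -> \sum_(j < 2 * i.+1) pw i.+1 j * T (d%:R * root_angle R (2 * i.+1) j) = (1 - d%:R / i.+1%:R) * G d) ->
  hint 0 1 (fun u => T (d%:R * qlim u)) = G d.
Proof.
move=> Tm cT hG.
have d0 : 0 <= d%:R :> R by [].
pose f t := T (d%:R * t) + d%:R * t; pose l t : R := d%:R * t.
have fm : nondecreasing_fun f by move=> x y xy; apply: (Tm (d%:R * x) (d%:R * y)); rewrite ler_wpM2l.
have lm : nondecreasing_fun l by move=> x y xy; rewrite /l ler_wpM2l.
have cl : continuous (l : R^o -> R^o) by move=> t; apply: (@cvgM R); [exact: cvg_cst|exact: cvg_id].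
have cf : continuous (f : R^o -> R^o).
  move=> t; apply: (@cvgD R); last exact: cl.
  exact: (@cvg_comp _ _ _ (l : R^o -> R^o) (T : R^o -> R^o) _ (nbhs (l t : R^o)) _ (cl t) (cT (l t))).
have c1 : (\sum_(j < 2 * i.+1) pw i.+1 j * f (root_angle R (2 * i.+1) j)
    - \sum_(j < 2 * i.+1) pw i.+1 j * l (root_angle R (2 * i.+1) j) : R^o) @[i --> U]
    --> (hint 0 1 (fun u => f (qlim u)) - hint 0 1 (fun u => l (qlim u)) : R^o).
  by apply: (@cvgB R); exact: cvg_hint_quantile.
have iq (h : R -> R) : nondecreasing_fun h -> (@lebesgue_measure R).-integrable `]0, 1] (EFin \o (fun u => h (qlim u))).
  by move=> hm; apply: mono_integrable => u v uv; apply/hm/qlim_mono.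
have e1 : hint 0 1 (fun u => f (qlim u)) - hint 0 1 (fun u => l (qlim u)) = hint 0 1 (fun u => T (d%:R * qlim u)).
  rewrite /hint -RintegralB //; [|exact: iq|exact: iq].
  by apply: eq_Rintegral => u _; rewrite /f /l addrK.
rewrite e1 in c1.
have c2 : ((1 - d%:R / i.+1%:R) * G d : R^o) @[i --> U] --> (G d : R^o).
  have : ((1 - d%:R / i.+1%:R) * G d : R^o) @[i --> \oo] --> (G d : R^o).
    rewrite -[X in _ --> X]mul1r -[X in X * _]subr0 -[X in _ - X](mulr0 (d%:R : R)).
    apply: (@cvgM R); last exact: cvg_cst.
    apply: (@cvgB R); first exact: cvg_cst.
    by apply: (@cvgM R); [exact: cvg_cst|exact: cvg_harmonic].
  by move=> c A nA; apply: Uoo; exact: c.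
have c3 : ((1 - d%:R / i.+1%:R) * G d : R^o) @[i --> U] --> (hint 0 1 (fun u => T (d%:R * qlim u)) : R^o).
  apply: (cvg_trans _ c1); apply: near_eq_cvg; apply: Uoo; exists d => // i /= di.
  rewrite /= -hG // -sumrB; apply: eq_bigr => j _.
  by rewrite -mulrBr /f /l addrK.
exact: (cvg_unique _ c3 c2).
Qed.

End Limit.

(* The mass that the limit puts at [2 * pi] is moved to [0]. *)
Lemma herglotz_normalized (k : R) : 0 <= k -> exists mu : circle_measure R, forall d,
  zint mu (fun t => expi (d%:R * t)) = k%:C%C * g d 0%N.
Proof.
move=> k0; have [U [UU Uoo]] := @ultraFilterLemma nat \oo _.
pose phi u : R := if qlim U u < 2 * pi then qlim U u else 0.
have mq : measurable_fun setT (qlim U : TR -> TR).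
  by apply: nondecreasing_measurable => //; exact: qlim_mono.
have mphi : measurable_fun setT (phi : TR -> TR).
  apply: measurable_fun_ifT => //.
  by apply: measurable_fun_ltr => //; exact: measurable_cst.
have phiI u : (@I2pi R) (phi u).
  rewrite /I2pi /= in_itv /= /phi; have /andP[q0 q1] := qlim_itv UU u.
  by case: ltP => h; rewrite ?q0 ?h // lexx twopi_gt0.
have expi_phi d u : expi (d%:R * phi u) = expi (d%:R * qlim U u) :> C.
  rewrite /phi; case: ltP => // h.
  have -> : qlim U u = 2 * pi by apply/le_anti; rewrite h andbT; case/andP: (qlim_itv UU u).
  by rewrite mulr0 expi0 expi_natM2pi.
have [mu hmu] := push_circle_measure mphi phiI k0.
exists mu => d.
have trig (T : R -> R) (G : nat -> R) : nondecreasing_fun (fun t => T t + t) -> continuous (T : R^o -> R^o) ->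
    (forall t, `|T t| <= 1) -> (forall t, T (d%:R * phi t) = T (d%:R * qlim U t)) ->
    (forall i, (d < i.+1)%N -> \sum_(j < 2 * i.+1) pw i.+1 j * T (d%:R * root_angle R (2 * i.+1) j) = (1 - d%:R / i.+1%:R) * G d) ->
    \int[mu]_(t in @I2pi R) T (d%:R * t) = k * G d.
  move=> Tm cT T1 Tp hG; rewrite (hmu (fun t => T (d%:R * t))) //; last first.
    apply: (measurableT_comp (f := T : TR -> TR)); first exact: continuous_measurable_fun.
    by apply: measurable_funM; [exact: measurable_cst|exact: measurable_id].
  rewrite -(hint_trig UU Uoo Tm cT hG); congr (_ * _).
  by apply: eq_Rintegral => u _; rewrite Tp.
have mom i : (d < i.+1)%N -> \sum_(j < 2 * i.+1) (pw i.+1 j)%:C%C * expi (d%:R * root_angle R (2 * i.+1) j) = (1 - d%:R / i.+1%:R)%:C%C * g d 0%N.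
  exact: pw_moment.
apply: complex_eqP; rewrite /zint ?ReZ ?ImZ /=.
  apply: (trig (@cos R) (fun d => Re (g d 0%N))).
  - exact: cos_add_mono.
  - exact: continuous_cos.
  - by move=> t; rewrite ler_norml cos_geN1 cos_le1.
  - by move=> u; have := congr1 (@complex.Re R) (expi_phi d u).
  - move=> i di; have := congr1 (@complex.Re R) (mom i di); rewrite ReZ Re_sum => <-.
    by apply: eq_bigr => j _; rewrite ReZ.
apply: (trig (@sin R) (fun d => Im (g d 0%N))).
- exact: sin_add_mono.
- exact: continuous_sin.
- by move=> t; rewrite ler_norml sin_geN1 sin_le1.
- by move=> u; have := congr1 (@complex.Im R) (expi_phi d u).
- move=> i di; have := congr1 (@complex.Im R) (mom i di); rewrite ImZ Im_sum => <-.
  by apply: eq_bigr => j _; rewrite ImZ.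
Qed.

End Herglotz.

Section CircleMoments.
Variables (R : realType) (mu : circle_measure R).

Lemma cmomSS m p : cmom mu m.+1 p.+1 = cmom mu m p.
Proof.
congr (_ * _); apply: eq_zint => t _; rewrite !conj_expi -!expiD; congr expi; rewrite -!natr1; ring.
Qed.

Lemma cmomC m p : cmom mu p m = (cmom mu m p)^*%C.
Proof.
rewrite /cmom conjcM conjc_real; congr (_ * _).
rewrite /gram -zintJ; last by apply: bmeasM; [|apply: bmeasJ]; exact: bmeas_expi.
by apply: eq_zint => t _; rewrite conjcM conjcK mulrC.
Qed.

Lemma dgramC m p : dgram mu p m = (dgram mu m p)^*%C.
Proof. by rewrite /dgram conjcD conjcM !conjc_nat cmomC eq_sym minnC. Qed.

Lemma dgram0m p : dgram mu 0 p = (0%N == p)%:R.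
Proof. by rewrite /dgram min0n mul0r addr0. Qed.

Lemma dgram_affine m p : dgram mu m.+2 p.+2 = 2 * dgram mu m.+1 p.+1 - dgram mu m p.
Proof.
rewrite /dgram !cmomSS !eqSS !minnSS -(natr1 (minn m p).+1) -(natr1 (minn m p)).
by move: ((m == p)%:R) ((minn m p)%:R) (cmom mu m p) => a b c; ring.
Qed.

End CircleMoments.

Section HerglotzGeneral.
Variable R : realType.
Local Notation C := R[i].
Variable g : nat -> nat -> C.
Hypothesis toep : forall m p, g m.+1 p.+1 = g m p.
Hypothesis herm : forall m p, g p m = (g m p)^*%C.
Hypothesis psd : forall N (x : nat -> C), 0 <= \sum_(m < N) \sum_(p < N) x m * (x p)^*%C * g m p.

Let g00 : exists2 c : R, 0 <= c & g 0%N 0%N = c%:C%C.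
Proof.
have := psd 1 (fun=> 1); rewrite !big_ord1 conjc1 !mul1r lecE => /andP[/eqP im re].
by exists (Re (g 0%N 0%N)) => //; apply: complex_eqP.
Qed.

Let zero_moment d : g 0%N 0%N = 0 -> g d 0%N = 0.
Proof.
move=> z; case: d => [//|d].
have gd j : g j j = 0 by elim: j => // j; rewrite toep.
(* Supported at 0 and [d + 1]; since the diagonal vanishes, the form at [x] equals
   [- 2 |g (d+1) 0|^2], which positivity forces to be 0. *)
pose x j : C := if j == 0%N then - g d.+1 0%N else if j == d.+1 then 1 else 0.
have xF (F : nat -> C) : \sum_(m < d.+2) x m * F m = - g d.+1 0%N * F 0%N + F d.+1.
  rewrite big_ord_recl big_ord_recr /= big1 => [|i _].
    by rewrite add0r /x /= eqxx mul1r.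
  by rewrite /x /= /bump /= add1n eqSS ltn_eqF ?mul0r.
have xJ (F : nat -> C) : \sum_(m < d.+2) (x m)^*%C * F m = (- g d.+1 0%N)^*%C * F 0%N + F d.+1.
  rewrite big_ord_recl big_ord_recr /= big1 => [|i _].
    by rewrite add0r /x /= eqxx conjc1 mul1r.
  by rewrite /x /= /bump /= add1n eqSS ltn_eqF ?conjc0 ?mul0r.
have := psd d.+2 x.
under eq_bigr do under eq_bigr do rewrite -mulrA.
under eq_bigr do rewrite -mulr_sumr xJ.
rewrite (xF (fun i => (- g d.+1 0%N)^*%C * g i 0%N + g i d.+1)).
rewrite !gd (herm d.+1 0) rmorphN /= mulr0 add0r addr0 !mulNr -opprD (mulrC _^*%C) mulcJ.
rewrite oppr_ge0 -mulr2n pmulrn_lle0 // lecR => h.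
have /eqP : modulus (g d.+1 0%N) ^+ 2 = 0 by apply/le_anti; rewrite h exprn_ge0 ?modulus_ge0.
by rewrite sqrf_eq0 => /eqP/(congr1 (real_complex R)); rewrite modulusE => /normr0_eq0.
Qed.

(** Both matrices are Toeplitz and Hermitian, so they are determined by their first columns. *)
Lemma cmom_unique (mu : circle_measure R) :
  (forall d, zint mu (fun t => expi (d%:R * t)) = (2 * pi)%:C%C * g d 0%N) -> forall m p, cmom mu m p = g m p.
Proof.
move=> h.
have cd d : cmom mu d 0 = g d 0%N.
  rewrite /cmom /gram (@eq_zint R mu _ (fun t => expi (d%:R * t))) ?h => [|t _]; last by rewrite mul0r expi0 conjc1 mulr1.
  by rewrite mulrA -real_complexM mulVf ?mul1r // gt_eqF // twopi_gt0.
elim=> [|m IH] [|p]; rewrite ?cmomSS ?toep //.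
by rewrite cmomC cd -herm.
Qed.

Theorem herglotz : exists mu : circle_measure R, forall m p, cmom mu m p = g m p.
Proof.
have [c c0 gc] := g00; have tp : (0 <= 2 * pi * c)%R by rewrite mulr_ge0 // ltW // twopi_gt0.
(* Normalised to have 1 on the diagonal. For [c = 0] the constant matrix 1 is a placeholder: the
   total mass [2 * pi * c] is then 0, and [g] vanishes by [zero_moment]. *)
pose g' m p : C := if c == 0 then 1 else c^-1%:C%C * g m p.
have toep' m p : g' m.+1 p.+1 = g' m p by rewrite /g' toep.
have psd' N (x : nat -> C) : 0 <= \sum_(m < N) \sum_(p < N) x m * (x p)^*%C * g' m p.
  rewrite /g'; case: eqVneq => [_|c1].
    have -> : \sum_(m < N) \sum_(p < N) x m * (x p)^*%C * 1 = (\sum_(m < N) x m) * (\sum_(m < N) x m)^*%C.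
      rewrite conjc_sum mulr_suml; apply: eq_bigr => m _; rewrite mulr_sumr.
      by apply: eq_bigr => p _; rewrite mulr1.
    by rewrite mulcJ ler0c exprn_ge0 ?modulus_ge0.
  have -> : \sum_(m < N) \sum_(p < N) x m * (x p)^*%C * (c^-1%:C%C * g m p)
      = c^-1%:C%C * \sum_(m < N) \sum_(p < N) x m * (x p)^*%C * g m p.
    rewrite mulr_sumr; apply: eq_bigr => m _; rewrite mulr_sumr.
    by apply: eq_bigr => p _; rewrite mulrCA.
  by rewrite mulr_ge0 // ler0c invr_ge0.
have g'00 : g' 0%N 0%N = 1.
  by rewrite /g'; case: eqVneq => // c1; rewrite gc real_complexV mulVf // (inj_eq (@complexI R)).
have [mu hmu] := herglotz_normalized toep' psd' g'00 tp.
exists mu; apply: cmom_unique => d; rewrite hmu /g' real_complexM -mulrA; congr (_ * _).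
case: eqVneq => [c1|c1]; first by rewrite c1 mul0r zero_moment // gc c1.
by rewrite mulrA -real_complexM mulfV // mul1r.
Qed.

End HerglotzGeneral.

(** * Pairs of 2-isometries *)

Section GramMatrices.
Variable R : realType.
Local Notation C := R[i].

(* Both arrays are determined by their entries with [minn m p <= 1]. *)
Lemma affine_gram_ext (f g : nat -> nat -> C) :
  (forall m p, f m.+2 p.+2 = 2 * f m.+1 p.+1 - f m p) ->
  (forall m p, g m.+2 p.+2 = 2 * g m.+1 p.+1 - g m p) ->
  (forall m, f m 0%N = g m 0%N) -> (forall p, f 0%N p = g 0%N p) ->
  (forall m, f m.+1 1%N = g m.+1 1%N) -> (forall p, f 1%N p.+1 = g 1%N p.+1) ->
  forall m p, f m p = g m p.
Proof.
move=> hf hg c0 r0 c1 r1 m p; have [k le] : exists k, (m < k)%N by exists m.+1.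
elim: k m p le => // k IH [|[|m]] [|[|p]] //= mk.
by rewrite hf hg !IH // ltnW.
Qed.

(** [u] abstracts the way an indicator acts (product on either side, scaling, conditional), as the
    lemma serves scalar and vector sums alike. *)
Lemma sum_delta (V : nmodType) N m n (F : nat -> nat -> V) (u : bool -> V -> V) :
  (m < N)%N -> (n < N)%N -> (forall x, u true x = x) -> (forall x, u false x = 0) ->
  \sum_(i < N) \sum_(j < N) u ((i == m :> nat) && (j == n :> nat)) (F i j) = F m n.
Proof.
move=> mN nN u1 u0; rewrite (bigD1 (Ordinal mN)) //= [X in _ + X]big1 => [|i im].
  rewrite addr0 (bigD1 (Ordinal nN)) //= big1 => [|j jn]; first by rewrite !eqxx u1 addr0.
  by rewrite (_ : (j == n :> nat) = false) ?andbF ?u0 //; apply/negbTE.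
apply: big1 => j _; rewrite (_ : (i == m :> nat) = false) ?u0 //; exact/negbTE.
Qed.

Lemma qform_pairs N (A B c : nat -> nat -> C) :
  qform N N A B c = Re (\sum_(m < N) \sum_(n < N) c m n *
    (\sum_(p < N) \sum_(q < N) (c p q)^*%C * (A m p * B n q))).
Proof.
rewrite /qform; congr Re.
transitivity (\sum_(n < N) \sum_(q < N) \sum_(m < N) \sum_(p < N) c m n * ((c p q)^*%C * (A m p * B n q))).
  apply: eq_bigr => n _; apply: eq_bigr => q _; rewrite mulr_suml; apply: eq_bigr => m _.
  by rewrite mulr_suml; apply: eq_bigr => p _; rewrite -!mulrA.
transitivity (\sum_(n < N) \sum_(m < N) \sum_(p < N) \sum_(q < N) c m n * ((c p q)^*%C * (A m p * B n q))).
  by apply: eq_bigr => n _; rewrite exchange_big; apply: eq_bigr => m _; rewrite exchange_big.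
rewrite exchange_big; apply: eq_bigr => m _; apply: eq_bigr => n _; rewrite mulr_sumr.
by apply: eq_bigr => p _; rewrite mulr_sumr.
Qed.

Lemma qform_two_points N (A B : nat -> nat -> C) (w : C) m n p q :
  (m < N)%N -> (n < N)%N -> (p < N)%N -> (q < N)%N ->
  qform N N A B (fun i j => ((i == m) && (j == n))%:R + w * ((i == p) && (j == q))%:R) =
  Re (A m m * B n n + w^*%C * (A m p * B n q) + w * (A p m * B q n) + w * w^*%C * (A p p * B q q)).
Proof.
move=> mN nN pN qN; rewrite qform_pairs; congr Re.
have sd i j (F : nat -> nat -> C) : (i < N)%N -> (j < N)%N ->
    \sum_(k < N) \sum_(l < N) ((k == i :> nat) && (l == j :> nat))%:R * F k l = F i j.
  by move=> iN jN; apply: (@sum_delta _ N i j F (fun b x => b%:R * x)) => // x; rewrite ?mul1r ?mul0r.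
have key (F : nat -> nat -> C) (x : C) :
    \sum_(i < N) \sum_(j < N) (((i == m :> nat) && (j == n :> nat))%:R + x * ((i == p :> nat) && (j == q :> nat))%:R) * F i j
    = F m n + x * F p q.
  rewrite -(sd m n F) // -(sd p q F) // mulr_sumr -big_split; apply: eq_bigr => i _.
  by rewrite mulr_sumr -big_split; apply: eq_bigr => j _; rewrite mulrDl mulrA.
have cj (i j : nat) : (((i == m) && (j == n))%:R + w * ((i == p) && (j == q))%:R)^*%C
    = ((i == m) && (j == n))%:R + w^*%C * ((i == p) && (j == q))%:R :> C.
  by rewrite conjcD conjcM; case: (_ && _); case: (_ && _); rewrite ?conjc1 ?conjc0.
under eq_bigr do under eq_bigr do under [X in _ * X]eq_bigr do under eq_bigr do rewrite cj.
under eq_bigr do under eq_bigr do rewrite (key (fun p' q' => A _ p' * B _ q')).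
rewrite (key (fun m' n' => A m' m * B n' n + w^*%C * (A m' p * B n' q))).
ring.
Qed.

End GramMatrices.

Section PairOfOperators.
Variables (R : realType) (H : completeNormedModType R[i]).
Variables (dot : {dot H for Num.conj}) (Hdot : hilbert_inner dot).
Local Notation C := R[i].

Section Orbit.
Variables T1 T2 : {linear H -> H}.

Definition monom e m n : H := iter m T1 (iter n T2 e).
Definition pol e N (c : nat -> nat -> C) : H := \sum_(m < N) \sum_(n < N) c m n *: monom e m n.

Lemma monomZ e a m n : monom (a *: e) m n = a *: monom e m n.
Proof.
rewrite /monom; have -> : iter n T2 (a *: e) = a *: iter n T2 e.
  by elim: n => // n IH; rewrite !iterS IH linearZ.
by elim: m => // m IH; rewrite !iterS IH linearZ.
Qed.

Lemma pol_widen e N N' c : (N <= N')%N ->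
  (forall m n, (N <= m)%N || (N <= n)%N -> c m n = 0) -> pol e N' c = pol e N c.
Proof.
move=> NN c0; rewrite /pol.
rewrite [RHS](big_ord_widen _ (fun m => \sum_(n < N) c m n *: monom e m n) NN) [RHS]big_mkcond.
apply: eq_bigr => m _; case: ltnP => mN; last by apply: big1 => n _; rewrite c0 ?mN // scale0r.
rewrite (big_ord_widen _ (fun n => c m n *: monom e m n) NN) [RHS]big_mkcond.
by apply: eq_bigr => n _; case: ltnP => // nN; rewrite c0 ?nN ?orbT // scale0r.
Qed.

Lemma span_pol e x :
  linear_span [set iter k.1 T1 (iter k.2 T2 e) | k in [set: nat * nat]] x ->
  exists N c, (forall m n, (N <= m)%N || (N <= n)%N -> c m n = 0) /\ x = pol e N c.
Proof.
move=> [k [c [v [hv ->]]]]; elim: k c v hv => [|k IH] c v hv.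
  by exists 0, (fun _ _ => 0); rewrite /pol !big_ord0.
have [N [d [d0 dE]]] := IH (fun i => c (lift ord0 i)) _ (fun i => hv (lift ord0 i)).
have [[m n] _ vE] := hv ord0; pose M := maxn N (maxn m n).+1.
exists M, (fun i j => c ord0 * ((i == m) && (j == n))%:R + d i j); split.
  move=> i j; rewrite !geq_max => h.
  rewrite d0; last by case/orP: h => /andP[->]; rewrite ?orbT.
  rewrite (_ : (_ && _) = false) ?mulr0 ?addr0 //; apply/negbTE/negP => /andP[/eqP im /eqP jn].
  by move: h; rewrite im jn !gtn_max !ltnn ?andbF.
rewrite big_ord_recl dE -(pol_widen e (leq_maxl N (maxn m n).+1) d0) -vE /pol -/M.
rewrite -[iter _ _ _]/(monom e m n).
have mM : (m < M)%N by rewrite leq_max ltnS leq_maxl orbT.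
have nM : (n < M)%N by rewrite leq_max ltnS leq_maxr orbT.
rewrite -(@sum_delta _ M m n (monom e) (fun b x => if b then x else 0)) //.
rewrite scaler_sumr -big_split; apply: eq_bigr => i _; rewrite scaler_sumr -big_split.
by apply: eq_bigr => j _; rewrite scalerDl; case: (_ && _); rewrite ?mulr1 ?mulr0 ?scale0r ?scaler0.
Qed.

Lemma cyclic_dense e x (r : R) : cyclic_vector T1 T2 e -> 0 < r ->
  exists N c, (forall m n, (N <= m)%N || (N <= n)%N -> c m n = 0) /\ nrm (x - pol e N c) <= r.
Proof.
move=> cyc r0; have : setT x by []; rewrite -cyc => /closure_nrm/(_ r r0)[y /span_pol[N [c [c0 ->]]] le].
by exists N, c.
Qed.

Lemma cyclic_orthogonal e x : cyclic_vector T1 T2 e ->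
  (forall m n, dot x (monom e m n) = 0) -> x = 0.
Proof.
move=> cyc ort; apply/eqP; rewrite -nrm_eq0 eq_le nrm_ge0 andbT; apply/ler_addgt0Pl => r r0.
have [N [c [_ le]]] := cyclic_dense x cyc r0; rewrite addr0.
have px : dot x (pol e N c) = 0.
  rewrite dot_sumr big1 // => m _; rewrite dot_sumr big1 // => n _.
  by rewrite dotZr ort mulr0.
have [->|x0] := eqVneq x 0; first by rewrite nrm0 ltW.
have nx : 0 < nrm x by rewrite lt_def nrm_eq0 x0 nrm_ge0.
rewrite -(ler_pM2l nx); apply: le_trans (ler_wpM2l (ltW nx) le).
apply: le_trans (CauchySchwarz_dot Hdot x (x - pol e N c)).
by rewrite dotBr px subr0 (dotxx Hdot) modulus_real expr2 ger0_norm // mulr_ge0 // ltW.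
Qed.

Lemma nrm_pol e N c : nrm (pol e N c) ^+ 2 = Re (\sum_(m < N) \sum_(n < N) c m n *
  (\sum_(p < N) \sum_(q < N) (c p q)^*%C * dot (monom e m n) (monom e p q))).
Proof.
rewrite (sqr_nrm Hdot); congr Re; rewrite /pol dot_suml; apply: eq_bigr => m _.
rewrite dot_suml; apply: eq_bigr => n _; rewrite dotZl; congr (_ * _).
rewrite dot_sumr; apply: eq_bigr => p _; rewrite dot_sumr; apply: eq_bigr => q _.
by rewrite dotZr.
Qed.

End Orbit.

Section TwoIsometry.
Variable T : {linear H -> H}.
Hypothesis iso : two_isometry T.

Lemma two_isometry_nrm h : nrm (T (T h)) ^+ 2 = 2 * nrm (T h) ^+ 2 - nrm h ^+ 2.
Proof.
have := iso h; rewrite -!nrmE -!rmorphXn /= => /(congr1 (@complex.Re R)).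
rewrite ReD ReB -[2]/((1 + 1) : C) mulrDl mul1r ReD /=.
by move: (nrm _ ^+ 2) (nrm _ ^+ 2) (nrm _ ^+ 2) => a b c e; lra.
Qed.

(** The squared norm of [T^k h] is affine in [k] and nonnegative, so its slope cannot be
    negative. *)
Lemma two_isometry_expansive h : nrm h <= nrm (T h).
Proof.
rewrite -(@ler_pXn2r _ 2) ?nnegrE ?nrm_ge0 // leNgt; apply/negP => lt.
pose d := nrm h ^+ 2 - nrm (T h) ^+ 2; have d0 : 0 < d by rewrite subr_gt0.
have aff k : nrm (iter k T h) ^+ 2 = nrm h ^+ 2 - k%:R * d /\ nrm (iter k.+1 T h) ^+ 2 = nrm h ^+ 2 - k.+1%:R * d.
  elim: k => [|k [e1 e2]].
    by rewrite mul0r subr0 mul1r /d opprB addrC subrK.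
  split=> //; rewrite 2!iterS two_isometry_nrm -iterS e1 e2 -(natr1 k.+1) -(natr1 k).
  by move: (k%:R : R) (nrm h ^+ 2) => a b; ring.
have := sqr_ge0 (nrm (iter (Num.bound (nrm h ^+ 2 / d)) T h)).
rewrite (proj1 (aff _)) subr_ge0 leNgt -ltr_pdivrMr // archi_boundP //.
by rewrite divr_ge0 ?sqr_ge0 // ltW.
Qed.

(** Polarisation of the defining identity: sums give the real parts, and the multiple [- i x] gives
    the imaginary parts. *)
Lemma two_isometry_dot x y : dot (T (T x)) (T (T y)) = 2 * dot (T x) (T y) - dot x y.
Proof.
have re u v : Re (dot (T (T u)) (T (T v))) = 2 * Re (dot (T u) (T v)) - Re (dot u v).
  have := two_isometry_nrm (u + v); rewrite !linearD !(sqr_nrmD Hdot) !two_isometry_nrm.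
  move: (nrm _ ^+ 2) (nrm _ ^+ 2) (nrm _ ^+ 2) (nrm _ ^+ 2) (Re _) (Re _) (Re _) => a b c d e f g; lra.
have re2 (z : C) : Re (2 * z) = 2 * Re z by rewrite -ReZ; congr (Re (_ * _)); rewrite rmorph_nat.
apply: complex_eqP; first by rewrite ReB re2 re.
have := re (- 'i%C *: x) y; rewrite !linearZ !dotZl.
have im (z : C) : Re (- 'i%C * z) = Im z by rewrite mulNr ReN ReMc /= mul0r mul1r sub0r opprK.
have im2 (z : C) : Im (2 * z) = 2 * Im z by rewrite -ImZ; congr (Im (_ * _)); rewrite rmorph_nat.
by rewrite !im ImB im2.
Qed.

End TwoIsometry.
End PairOfOperators.

(** * The Dirichlet-type space described by coefficients *)

Section DirichletSpaceCoefficients.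
Variable R : realType.
Local Notation C := R[i].
Lemma pcoef2_fin (a : nat -> nat -> C) N : (forall m n, (N <= m)%N || (N <= n)%N -> a m n = 0) -> pcoef2 a.
Proof.
move=> a0; apply: (@pcoef2_bounded R a (\sum_(i < N) \sum_(j < N) modulus (a i j))) => m n.
have s0 (i : 'I_N) : 0 <= \sum_(j < N) modulus (a i j) by apply: sumr_ge0 => j _; exact: modulus_ge0.
case: (ltnP m N) => mN; last by rewrite a0 ?mN // modulus0 sumr_ge0.
case: (ltnP n N) => nN; last by rewrite a0 ?nN ?orbT // modulus0 sumr_ge0.
rewrite (bigD1 (Ordinal mN)) //= (bigD1 (Ordinal nN)) //= -addrA lerDl.
by rewrite addr_ge0 ?sumr_ge0 // => j _; exact: modulus_ge0.
Qed.

Variables mu1 mu2 : circle_measure R.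

Lemma qsum_ge0 b1 b2 (a : nat -> nat -> C) : (0 <= qsum mu1 mu2 b1 b2 a)%E.
Proof. by apply: nneseries_ge0 => k _ _; apply: nneseries_ge0 => l _ _; rewrite lee_fin qterm_ge0. Qed.

Lemma dirichlet_space_psum2 (f : C * C -> C) a : pcoef2 a -> (forall z, bidisc z -> f z = psum2 a z) ->
  (dnorm mu1 mu2 a < +oo)%E -> dirichlet_space mu1 mu2 f.
Proof.
move=> pa fE fin; have hol := differentiable_psum2 pa fE.
have hE : hardy_normsq f = qsum mu1 mu2 true true a by exact: hardy_normsqE pa fE mu1 mu2.
have dE : dirichlet mu1 mu2 f = _ := dirichletE pa fE mu1 mu2.
have h0 : (0 <= hardy_normsq f)%E by rewrite hE qsum_ge0.
have d0 : (0 <= dirichlet mu1 mu2 f)%E by rewrite dE !adde_ge0 // qsum_ge0.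
have nE : (hardy_normsq f + dirichlet mu1 mu2 f = dnorm mu1 mu2 a)%E := dirichlet_normsqE pa fE mu1 mu2.
split=> // [|_]; last split=> //.
  by apply: le_lt_trans fin; rewrite -nE leeDr.
by apply: le_lt_trans fin; rewrite -nE leeDl.
Qed.

(** Finiteness of the Hardy part has two sources: if both masses are positive it follows from the
    Dirichlet integrals, and if the product measure vanishes it is part of the definition of the
    space. *)
Lemma dirichlet_space_coef (f : C * C -> C) : dirichlet_space mu1 mu2 f ->
  exists a, [/\ pcoef2 a, forall z, bidisc z -> f z = psum2 a z & (dnorm mu1 mu2 a < +oo)%E].
Proof.
move=> [hol dfin hardy]; have [a pa fE] := holomorphic_bidisc_series hol; exists a; split=> //.
rewrite -(dirichlet_normsqE pa fE mu1 mu2); apply: lte_add_pinfty => //.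
rewrite (hardy_normsqE pa fE mu1 mu2).
have [m0|m0] := eqVneq (mu1 setT * mu2 setT)%E 0%E.
  have [|_] := hardy; last by rewrite (hardy_normsqE pa fE mu1 mu2).
  by rewrite -setXTT product_measure1E.
move: dfin; rewrite (dirichletE pa fE mu1 mu2) => dfin.
apply: hardy_of_dirichlet m0 _ _.
  by apply: le_lt_trans dfin; rewrite -addeA leeDl // adde_ge0 // qsum_ge0.
by apply: le_lt_trans dfin; rewrite addeAC leeDr // adde_ge0 // qsum_ge0.
Qed.

Lemma dnorm_fin_support a N : (forall m n, (N <= m)%N || (N <= n)%N -> a m n = 0) ->
  dnorm mu1 mu2 a = (qform N.+2 N.+2 (dgram mu1) (dgram mu2) a)%:E.
Proof.
move=> a0; apply: dnorm_gram => m n h; apply: a0.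
by case/orP: h => h; rewrite (ltnW (ltnW h)) ?orbT.
Qed.

End DirichletSpaceCoefficients.

Section Shifts.
Variable R : realType.
Implicit Types a : nat -> nat -> R[i].

Lemma pcoef2_shift1 a : pcoef2 a -> pcoef2 (pshift1 a).
Proof.
move=> pa r r01; have [M hM] := pa r r01; exists (Num.max 0 M) => -[|m] n /=.
  by rewrite modulus0 !mul0r le_max lexx.
have /andP[r0 r1] := r01; rewrite le_max; apply/orP; right; apply: le_trans (hM m n).
rewrite !ler_wpM2r ?exprn_ge0 ?(ltW r0) // exprS mulrA ler_wpM2r ?exprn_ge0 ?(ltW r0) //.
by rewrite ler_piMr ?modulus_ge0 // ltW.
Qed.

Lemma pcoef2_shift2 a : pcoef2 a -> pcoef2 (pshift2 a).
Proof.
move=> pa; have -> : pshift2 a = ptr (pshift1 (ptr a)) by apply/funext => m; apply/funext => -[|n].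
by apply/pcoef2_tr/pcoef2_shift1/pcoef2_tr.
Qed.

End Shifts.

(** * Necessity of the conditions *)

Section ForwardDirection.
Variables (R : realType) (H : completeNormedModType R[i]).
Variables (dot : {dot H for Num.conj}) (Hdot : hilbert_inner dot).
Local Notation C := R[i].

Section UnitaryModel.
Variables T1 T2 : {linear H -> H}.
Variables mu1 mu2 : circle_measure R.
Variable U : H -> C * C -> C.
Hypothesis Uin : forall h, dirichlet_space mu1 mu2 (U h).
Hypothesis Usur : forall f, dirichlet_space mu1 mu2 f -> exists h, forall z, bidisc z -> U h z = f z.
Hypothesis Ulin : forall (a : C) h k z, bidisc z -> U (a *: h + k) z = a * U h z + U k z.
Hypothesis Unrm : forall h, dirichlet_normsq mu1 mu2 (U h) = (Re (`|h| ^+ 2))%:E.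
Hypothesis Umul : forall h z, bidisc z -> U (T1 h) z = z.1 * U h z /\ U (T2 h) z = z.2 * U h z.

Lemma model_nrm h a : pcoef2 a -> (forall z, bidisc z -> U h z = psum2 a z) -> dnorm mu1 mu2 a = (nrm h ^+ 2)%:E.
Proof.
move=> pa hE; rewrite -(dirichlet_normsqE pa hE mu1 mu2) Unrm; congr (_%:E).
by rewrite -nrmE -rmorphXn.
Qed.

Lemma model0 z : bidisc z -> U 0 z = 0.
Proof. by move=> zb; have := Ulin (-1) 0 0 zb; rewrite scaleN1r oppr0 addr0 mulN1r addNr. Qed.

Lemma model_sum N (c : nat -> C) (v : nat -> H) z : bidisc z ->
  U (\sum_(i < N) c i *: v i) z = \sum_(i < N) c i * U (v i) z.
Proof.
move=> zb; elim: N => [|N IH]; first by rewrite !big_ord0 model0.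
by rewrite !big_ord_recr /= addrC Ulin // IH addrC.
Qed.

Lemma model_monom e m n z : bidisc z -> U (monom T1 T2 e m n) z = z.2 ^+ n * z.1 ^+ m * U e z.
Proof.
move=> zb; rewrite /monom; elim: m => [|m IH].
  rewrite mulr1; elim: n => [|n IH]; first by rewrite mul1r.
  by rewrite iterS (proj2 (Umul _ zb)) IH exprS !mulrA.
rewrite iterS (proj1 (Umul _ zb)) IH exprS; ring.
Qed.

Lemma model_one : exists e, forall z, bidisc z -> U e z = 1.
Proof.
pose d m n : C := if (m == 0%N) && (n == 0%N) then 1 else 0.
have d0 m n : (1 <= m)%N || (1 <= n)%N -> d m n = 0 by rewrite /d; case: m; case: n.
have pd := pcoef2_fin d0.
have dE z : bidisc z -> 1 = psum2 d z :> C.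
  by move=> zb; rewrite (psum2_fin z d0) !big_ord1 /d !expr0 !mulr1.
apply: (Usur (f := fun=> 1)); apply: (dirichlet_space_psum2 pd dE).
by rewrite (dnorm_fin_support mu1 mu2 d0) ltry.
Qed.

Section Constant.
Variable e : H.
Hypothesis e1 : forall z, bidisc z -> U e z = 1.

Lemma model_pol_nrm N c : (forall m n, (N <= m)%N || (N <= n)%N -> c m n = 0) ->
  nrm (pol T1 T2 e N.+2 c) ^+ 2 = qform N.+2 N.+2 (dgram mu1) (dgram mu2) c.
Proof.
move=> c0; apply: EFin_inj; rewrite -(dnorm_fin_support mu1 mu2 c0).
apply/esym/(model_nrm (pcoef2_fin c0)) => z zb.
rewrite (@psum2_fin R c z N.+2) => [|m n h]; last first.
  by apply: c0; case/orP: h => h; rewrite (ltnW (ltnW h)) ?orbT.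
rewrite /pol (eq_bigr (fun m : 'I_ _ => 1 *: \sum_(n < N.+2) c m n *: monom T1 T2 e m n)); last by move=> *; rewrite scale1r.
rewrite (model_sum _ (fun=> 1) (fun m => \sum_(n < N.+2) c m n *: monom T1 T2 e m n)) //.
apply: eq_bigr => m _; rewrite mul1r model_sum //; apply: eq_bigr => n _.
by rewrite model_monom // e1 // mulr1 mulrA.
Qed.

(** The model map is only assumed to preserve norms. Norms of two-term combinations are enough to
    recover all inner products of orbit vectors by polarisation. *)
Lemma model_two_points m n p q (w : C) :
  nrm (monom T1 T2 e m n + w *: monom T1 T2 e p q) ^+ 2 =
  Re (dgram mu1 m m * dgram mu2 n n + w^*%C * (dgram mu1 m p * dgram mu2 n q)
    + w * (dgram mu1 p m * dgram mu2 q n) + w * w^*%C * (dgram mu1 p p * dgram mu2 q q)).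
Proof.
have polE N : (m < N)%N -> (n < N)%N -> (p < N)%N -> (q < N)%N ->
    pol T1 T2 e N (fun i j => ((i == m) && (j == n))%:R + w * ((i == p) && (j == q))%:R)
    = monom T1 T2 e m n + w *: monom T1 T2 e p q.
  move=> mN nN pN qN.
  have sd k l : (k < N)%N -> (l < N)%N -> monom T1 T2 e k l =
      \sum_(i < N) \sum_(j < N) ((i == k :> nat) && (j == l :> nat))%:R *: monom T1 T2 e i j.
    move=> kN lN; apply/esym.
    by apply: (@sum_delta _ N k l (monom T1 T2 e) (fun b x => b%:R *: x)) => // x; rewrite ?scale1r ?scale0r.
  rewrite (sd m n) // (sd p q) // scaler_sumr -big_split; apply: eq_bigr => k _.
  rewrite scaler_sumr -big_split; apply: eq_bigr => l _.
  by rewrite scalerDl scalerA.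
pose N := (maxn (maxn m n) (maxn p q)).+1.
have [mN nN pN qN] : [/\ m < N, n < N, p < N & q < N]%N.
  by rewrite /N !ltnS !leq_max !leqnn ?orbT.
rewrite -(qform_two_points (dgram mu1) (dgram mu2) w (N := N.+2)) ?(leqW (leqW _)) //.
rewrite -model_pol_nrm ?polE ?(leqW (leqW _)) // => i j h.
have z k l : (k < N)%N -> (l < N)%N -> (i == k) && (j == l) = false.
  move=> kN lN; apply/negbTE/negP => /andP[/eqP ik /eqP jl].
  by move: h; rewrite ik jl !(leqNgt N) kN lN.
by rewrite (z m n) // (z p q) // mulr0 addr0.
Qed.

Lemma model_gram m n p q :
  dot (monom T1 T2 e m n) (monom T1 T2 e p q) = dgram mu1 m p * dgram mu2 n q.
Proof.
have n0 (i j : nat) : nrm (monom T1 T2 e i j) ^+ 2 = Re (dgram mu1 i i * dgram mu2 j j).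
  by have := model_two_points i j i j 0; rewrite scale0r addr0 conjc0 !mul0r !addr0.
(* The diagonal terms cancel, and the two mixed terms are conjugate to each other because [dgram] is
   Hermitian. The values 1 and [i] of [w] then give both parts. *)
have main (w : C) : Re (w^*%C * dot (monom T1 T2 e m n) (monom T1 T2 e p q))
    = Re (w^*%C * (dgram mu1 m p * dgram mu2 n q)).
  have := model_two_points m n p q w; rewrite (sqr_nrmD Hdot) nrmZ exprMn dotZr !n0 !ReD.
  have -> : Re (w * (dgram mu1 p m * dgram mu2 q n)) = Re (w^*%C * (dgram mu1 m p * dgram mu2 n q)).
    by rewrite -[RHS]ReJ !conjcM conjcK (dgramC mu1 m p) (dgramC mu2 n q).
  have aux (a b c d : R) : a + b + 2 * d = a + c + c + b -> d = c by lra.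
  by rewrite mulcJ ReZ; exact: aux.
apply: complex_eqP; first by have := main 1; rewrite conjc1 !mul1r.
have := main 'i%C; have im (z : C) : Re (('i%C)^*%C * z) = Im z.
  by rewrite ReMc /= mul0r sub0r mulN1r opprK.
by rewrite !im.
Qed.

(** By [dnorm_const] the squared norm of [h + c e] is [|c|^2 + |h|^2] for every scalar [c], so the
    mixed term vanishes. *)
Lemma model_const_orthogonal h b : pcoef2 b -> b 0%N 0%N = 0 ->
  (forall z, bidisc z -> U h z = psum2 b z) -> dot h e = 0.
Proof.
move=> pb b0 hb.
have re (c : C) : Re (c^*%C * dot h e) = 0.
  have : nrm (h + c *: e) ^+ 2 = modulus c ^+ 2 + nrm h ^+ 2.
    pose d m n : C := if (m == 0%N) && (n == 0%N) then 1 else 0.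
    have d0 m n : (1 <= m)%N || (1 <= n)%N -> d m n = 0 by rewrite /d; case: m; case: n.
    have dE z : bidisc z -> 1 = psum2 d z :> C.
      by move=> zb; rewrite (psum2_fin z d0) !big_ord1 /d !expr0 !mulr1.
    have pd := pcoef2_fin d0; apply: EFin_inj.
    rewrite -(@model_nrm _ (fun m n => c * d m n + b m n)).
    - rewrite EFinD -(model_nrm pb hb) -(dnorm_const mu1 mu2 c b0); apply: eq_dnorm => m n.
      rewrite /d; case: ifP => [/andP[/eqP-> /eqP->]|]; first by rewrite b0 mulr1 addr0.
      by rewrite mulr0 add0r.
    - by apply: pcoef2D => //; apply: pcoef2Z.
    - move=> z zb; rewrite addrC Ulin // psum2D ?psum2Z ?e1 -?dE -?hb //; exact: pcoef2Z.
  rewrite (sqr_nrmD Hdot) nrmZ exprMn dotZr.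
  have -> : nrm e ^+ 2 = 1 by rewrite (sqr_nrm Hdot) (model_gram 0 0 0 0) !dgram0m !mulr1.
  rewrite mulr1; move: (modulus c ^+ 2) (nrm h ^+ 2) (Re _) => x y w; lra.
apply: complex_eqP; first by have := re 1; rewrite conjc1 mul1r.
have := re 'i%C; have im (z : C) : Re (('i%C)^*%C * z) = Im z.
  by rewrite ReMc /= mul0r sub0r mulN1r opprK.
by rewrite im.
Qed.

Lemma model_range_orthogonal h : dot (T1 h) e = 0 /\ dot (T2 h) e = 0.
Proof.
have [a [pa hE _]] := dirichlet_space_coef (Uin h); split.
  apply: (@model_const_orthogonal _ (pshift1 a) (pcoef2_shift1 pa)) => // z zb.
  by rewrite psum2_shift1 // -hE // (proj1 (Umul _ zb)).
apply: (@model_const_orthogonal _ (pshift2 a) (pcoef2_shift2 pa)) => // z zb.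
by rewrite psum2_shift2 // -hE // (proj2 (Umul _ zb)).
Qed.

Lemma model_cyclic_gram x0 : cyclic_vector T1 T2 x0 -> nrm x0 = 1 ->
  (forall h, dot (T1 h) x0 = 0) -> (forall h, dot (T2 h) x0 = 0) ->
  forall m n p q, dot (monom T1 T2 x0 m n) (monom T1 T2 x0 p q) = dgram mu1 m p * dgram mu2 n q.
Proof.
move=> cyc x1 o1 o2 m n p q; pose c := dot e x0.
have dx : dot x0 x0 = 1 by rewrite (dotxx Hdot) x1 expr1n.
(* Both sides have the same inner product with every orbit vector: those of positive degree lie in a
   range, which is orthogonal to [e] and to [x0]. *)
have eE : e = c *: x0.
  apply/eqP; rewrite -subr_eq0; apply/eqP; apply: (cyclic_orthogonal Hdot cyc) => i j.
  rewrite /monom; case: i => [|i].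
    case: j => [|j]; first by rewrite dotBl dotZl dx mulr1 subrr.
    rewrite iterS (dotC dot) dotBr dotZr o2 (proj2 (model_range_orthogonal _)).
    by rewrite mulr0 subrr conjc0.
  rewrite iterS (dotC dot) dotBr dotZr o1 (proj1 (model_range_orthogonal _)).
  by rewrite mulr0 subrr conjc0.
have cc : c * c^*%C = 1.
  by have := model_gram 0 0 0 0; rewrite !dgram0m !mulr1 [monom _ _ _ _ _]eE dotZl dotZr dx mulr1.
by rewrite -model_gram eE !monomZ dotZl dotZr mulrA cc mul1r.
Qed.

End Constant.
End UnitaryModel.

(* If [y] is orthogonal to the range of [T], approximations of [y] can be taken in the
   span of the [S^n x0], which [S] maps into the orthogonal complement of that range. *)
Lemma left_inv_commute (T S : {linear H -> H}) x0 : bounded_op T -> bounded_op S ->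
  (forall h, nrm h <= nrm (T h)) -> (forall h, T (S h) = S (T h)) -> cyclic_vector T S x0 ->
  (forall h n, dot (T h) (iter n S x0) = 0) -> forall h, left_inv dot T (S h) = S (left_inv dot T h).
Proof.
move=> Tb Sb Tge comm cyc ort h; apply: (left_inv_unique Hdot Tb Tge) => k.
rewrite comm -linearB; set y := _ - _.
have y0 u : dot (T u) y = 0 by exact: left_invP.
have [M M0 hM] := bounded_opP Sb.
apply/eqP; rewrite -modulus_eq0 eq_le modulus_ge0 andbT; apply/ler_addgt0Pl => r r0; rewrite addr0.
pose K := nrm (T k) * M + 1; have K0 : 0 < K by rewrite ltr_wpDl // mulr_ge0 // nrm_ge0.
have [N [c [_ le]]] := cyclic_dense y cyc (divr_gt0 r0 K0).
pose s0 : H := if N is N'.+1 then \sum_(n < N) c 0%N n *: iter n S x0 else 0.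
have [s1 pE] : exists s1, pol T S x0 N c = s0 + T s1.
  rewrite /s0 /pol; case: (N) => [|N']; first by exists 0; rewrite big_ord0 linear0 addr0.
  rewrite big_ord_recl; exists (\sum_(i < N') \sum_(n < N'.+1) c i.+1 n *: monom T S x0 i n).
  congr (_ + _); rewrite linear_sum; apply: eq_bigr => i _; rewrite linear_sum; apply: eq_bigr => n _.
  by rewrite linearZ.
have o0 u : dot (T u) s0 = 0.
  rewrite /s0; case: (N) => [|N']; first by rewrite dot0r.
  by rewrite dot_sumr big1 // => n _; rewrite dotZr ort mulr0.
have oS u : dot (T u) (S s0) = 0.
  rewrite /s0; case: (N) => [|N']; first by rewrite linear0 dot0r.
  rewrite linear_sum dot_sumr big1 // => n _.
  by rewrite linearZ dotZr -iterS ort mulr0.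
(* [y - s0] is orthogonal to the range of [T], so dropping the component [T s1] of the approximation
   only brings it closer to [y]. *)
have ys : nrm (y - s0) <= r / K.
  apply: le_trans le; rewrite pE -(@ler_pXn2r _ 2) ?nnegrE ?nrm_ge0 //.
  rewrite opprD addrA [leRHS](sqr_nrmD Hdot) nrmN dotNr (dotC dot) dotBr y0 o0 subrr conjc0 oppr0 /= mulr0 addr0.
  by rewrite lerDl sqr_ge0.
have Sys : S (y - s0) = S y - S s0 by exact: linearB.
have -> : dot (T k) (S y) = dot (T k) (S (y - s0)) by rewrite Sys dotBr oS subr0.
apply: le_trans (CauchySchwarz_dot Hdot _ _) _.
apply: le_trans (ler_wpM2l (nrm_ge0 _) (le_trans (hM _) (ler_wpM2l M0 ys))) _.
rewrite mulrA; apply: (@le_trans _ _ (K * (r / K))); last by rewrite mulrC divfK // gt_eqF.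
by rewrite ler_wpM2r ?divr_ge0 ?(ltW r0) ?(ltW K0) // /K lerDl.
Qed.

Lemma iter_commute (T S : H -> H) m n h : (forall h, T (S h) = S (T h)) ->
  iter m T (iter n S h) = iter n S (iter m T h).
Proof.
move=> comm; have c1 k u : T (iter k S u) = iter k S (T u).
  by elim: k => // k IH; rewrite !iterS comm IH.
by elim: m => // m IH; rewrite !iterS IH c1.
Qed.

Lemma cyclic_swap (T S : {linear H -> H}) x0 : (forall h, T (S h) = S (T h)) ->
  cyclic_vector T S x0 -> cyclic_vector S T x0.
Proof.
move=> comm; rewrite /cyclic_vector => <-; congr (closure (linear_span _)).
by apply/seteqP; split=> _ [[m n] _ <-]; exists (n, m) => //=; rewrite iter_commute.
Qed.

Section Necessity.
Variables T1 T2 : {linear H -> H}.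
Hypotheses (T1b : bounded_op T1) (T2b : bounded_op T2).
Hypothesis comm : forall h, T1 (T2 h) = T2 (T1 h).
Hypotheses (iso1 : two_isometry T1) (iso2 : two_isometry T2).
Variable x0 : H.
Hypotheses (x1 : nrm x0 = 1) (cyc : cyclic_vector T1 T2 x0).
Hypotheses (o1 : forall h, dot (T1 h) x0 = 0) (o2 : forall h, dot (T2 h) x0 = 0).

Lemma gram_left_inv_commute (A B : nat -> nat -> C) : (forall m, A m.+1 0%N = 0) ->
  (forall m n p q, dot (monom T1 T2 x0 m n) (monom T1 T2 x0 p q) = A m p * B n q) ->
  forall h, left_inv dot T1 (T2 h) = T2 (left_inv dot T1 h).
Proof.
move=> A0 gram; apply: (left_inv_commute T1b T2b (two_isometry_expansive iso1) comm cyc) => h n.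
rewrite (adjointP Hdot T1b).
suff -> : adjoint dot T1 (iter n T2 x0) = 0 by rewrite dot0r.
apply: (cyclic_orthogonal Hdot cyc) => p q.
rewrite (dotC dot) -(adjointP Hdot T1b).
by have := gram p.+1 q 0 n; rewrite A0 mul0r /monom /= => ->; rewrite conjc0.
Qed.

End Necessity.

Theorem model_identities (T1 T2 : {linear H -> H}) mu1 mu2 x0 :
  bounded_op T1 -> bounded_op T2 -> (forall h, T1 (T2 h) = T2 (T1 h)) ->
  two_isometry T1 -> two_isometry T2 -> nrm x0 = 1 -> cyclic_vector T1 T2 x0 ->
  (forall h, dot (T1 h) x0 = 0) -> (forall h, dot (T2 h) x0 = 0) ->
  unitarily_equivalent_to_Mz T1 T2 mu1 mu2 ->
  [/\ forall h, left_inv dot T1 (T2 h) = T2 (left_inv dot T1 h),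
      forall h, left_inv dot T2 (T1 h) = T1 (left_inv dot T2 h)
    & forall m n p q, dot (iter m T1 (iter n T2 x0)) (iter p T1 (iter q T2 x0))
        = dot (iter m T1 x0) (iter p T1 x0) * dot (iter n T2 x0) (iter q T2 x0)].
Proof.
move=> T1b T2b comm iso1 iso2 x1 cyc o1 o2 [U [Uin Usur Ulin Unrm Umul]].
have [e e1] := model_one Usur.
have gram := model_cyclic_gram Uin Ulin Unrm Umul e1 cyc x1 o1 o2.
have gram' m n p q : dot (monom T2 T1 x0 m n) (monom T2 T1 x0 p q) = dgram mu2 m p * dgram mu1 n q.
  rewrite mulrC -gram /monom; congr (dot _ _); by rewrite iter_commute.
have d0 (mu : circle_measure R) m : dgram mu m.+1 0 = 0 by rewrite dgramC dgram0m conjc0.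
split.
- exact: (gram_left_inv_commute T1b T2b comm iso1 cyc (d0 mu1) gram).
- exact: (gram_left_inv_commute T2b T1b (fun h => esym (comm h)) iso2 (cyclic_swap comm cyc) (d0 mu2) gram').
- move=> m n p q; have -> := gram m n p q.
  (* Putting the other pair of exponents equal to 0 identifies each factor, because
     [dgram mu 0 0 = 1]. *)
  have g1 := gram m 0 p 0; have g2 := gram 0 n 0 q.
  by rewrite /monom /= !dgram0m !mulr1 !mul1r in g1 g2; rewrite g1 g2.
Qed.

End ForwardDirection.

(** * The left inverse of a 2-isometry and the measure of its orbit *)

Section LeftInverse.
Variables (R : realType) (H : completeNormedModType R[i]).
Variables (dot : {dot H for Num.conj}) (Hdot : hilbert_inner dot).
Local Notation C := R[i].
Variable T : {linear H -> H}.
Hypotheses (Tb : bounded_op T) (iso : two_isometry T).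
Local Notation L := (left_inv dot T).
Let Tge := two_isometry_expansive iso.

Lemma left_inv_linear a h k : L (a *: h + k) = a *: L h + L k.
Proof.
apply: (left_inv_unique Hdot Tb Tge) => u; have -> : T (a *: L h + L k) = a *: T (L h) + T (L k) by exact: linearP.
have -> : a *: h + k - (a *: T (L h) + T (L k)) = a *: (h - T (L h)) + (k - T (L k)).
  by rewrite scalerBr opprD addrACA.
by rewrite dotDr dotZr !(left_invP Hdot Tb Tge) mulr0 addr0.
Qed.

Lemma left_invK h : L (T h) = h.
Proof. by apply: (left_inv_unique Hdot Tb Tge) => k; rewrite subrr dot0r. Qed.

Lemma left_inv_orthogonal h : (forall k, dot (T k) h = 0) -> L h = 0.
Proof. by move=> o; apply: (left_inv_unique Hdot Tb Tge) => k; rewrite linear0 subr0. Qed.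

(** [T] is expansive and [T (L h)] is an orthogonal projection of [h]. *)
Lemma left_inv_nrm h : nrm (L h) <= nrm h.
Proof.
apply: le_trans (Tge _) _; rewrite -(@ler_pXn2r _ 2) ?nnegrE ?nrm_ge0 //.
have -> : nrm h ^+ 2 = nrm (T (L h) + (h - T (L h))) ^+ 2 by rewrite addrC subrK.
by rewrite [leRHS](sqr_nrmD Hdot) (left_invP Hdot Tb Tge) /= mulr0 addr0 lerDl sqr_ge0.
Qed.

Lemma iter_left_inv_linear n a h k : iter n L (a *: h + k) = a *: iter n L h + iter n L k.
Proof. by elim: n => // n IH; rewrite !iterS IH left_inv_linear. Qed.

Lemma iter_left_inv_nrm n h : nrm (iter n L h) <= nrm h.
Proof. by elim: n => // n IH; rewrite iterS; exact: le_trans (left_inv_nrm _) IH. Qed.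

(** Positivity of the difference matrix is expansiveness: its form at [x] is the squared norm of
    [T y] minus that of [y], for the orbit combination [y]. The condition on [x0] settles the
    entries of the Gram matrix with an index 0. *)
Lemma gram_measure x0 : nrm x0 = 1 -> (forall h, dot (T h) x0 = 0) ->
  exists mu : circle_measure R, forall m p, dgram mu m p = dot (iter m T x0) (iter p T x0).
Proof.
move=> x1 o; pose G m p := dot (iter m T x0) (iter p T x0).
have GA m p : G m.+2 p.+2 = 2 * G m.+1 p.+1 - G m p by rewrite /G !iterS (two_isometry_dot Hdot iso).
have G0 : G 0%N 0%N = 1 by rewrite /G (dotxx Hdot) x1 expr1n.
have Gc m : G m.+1 0%N = 0 by rewrite /G iterS o.
have Gr m : G 0%N m.+1 = 0 by rewrite /G dotC -/(G m.+1 0%N) Gc conjc0.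
have [|||mu hmu] := @herglotz R (fun m p => G m.+1 p.+1 - G m p).
- by move=> m p; rewrite GA; ring.
- by move=> m p; rewrite rmorphB /= /G -!(dotC dot).
- move=> N x; pose y := \sum_(m < N) x m *: iter m T x0.
  have yE : \sum_(m < N) \sum_(p < N) x m * (x p)^*%C * G m p = (nrm y ^+ 2)%:C%C.
    rewrite -(dotxx Hdot) /y dot_suml; apply: eq_bigr => m _; rewrite dotZl dot_sumr mulr_sumr.
    by apply: eq_bigr => p _; rewrite dotZr mulrA.
  have TyE : \sum_(m < N) \sum_(p < N) x m * (x p)^*%C * G m.+1 p.+1 = (nrm (T y) ^+ 2)%:C%C.
    rewrite -(dotxx Hdot) /y linear_sum dot_suml; apply: eq_bigr => m _.
    rewrite linearZ dotZl dot_sumr mulr_sumr.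
    by apply: eq_bigr => p _; rewrite linearZ dotZr mulrA.
  under eq_bigr do under eq_bigr do rewrite mulrBr.
  under eq_bigr do rewrite sumrB.
  by rewrite sumrB yE TyE -rmorphB ler0c subr_ge0 lerXn2r ?nnegrE ?nrm_ge0.
exists mu; apply: affine_gram_ext => [m p|m p|m|p|m|p].
- exact: dgram_affine.
- exact: GA.
- rewrite dgramC dgram0m -/(G m 0%N); case: m => [|m]; first by rewrite G0 conjc1.
  by rewrite Gc conjc0.
- rewrite dgram0m -/(G 0%N p); case: p => [|p]; first by rewrite G0.
  by rewrite Gr.
- rewrite /dgram cmomSS hmu -/(G m.+1 1%N) minnSS minn0 mul1r.
  by case: m => [|m]; rewrite ?G0 ?Gc ?subr0 ?add0r // addrC subrK.
- rewrite /dgram cmomSS hmu -/(G 1%N p.+1) minnSS min0n mul1r.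
  by case: p => [|p]; rewrite ?G0 ?Gr ?subr0 ?add0r // addrC subrK.
Qed.

End LeftInverse.

(** * Sufficiency: the coefficient model *)

Section Sufficiency.
Variables (R : realType) (H : completeNormedModType R[i]).
Variables (dot : {dot H for Num.conj}) (Hdot : hilbert_inner dot).
Local Notation C := R[i].
Variables T1 T2 : {linear H -> H}.
Hypotheses (T1b : bounded_op T1) (T2b : bounded_op T2).
Hypothesis comm : forall h, T1 (T2 h) = T2 (T1 h).
Hypotheses (iso1 : two_isometry T1) (iso2 : two_isometry T2).
Variable x0 : H.
Hypotheses (x1 : nrm x0 = 1) (cyc : cyclic_vector T1 T2 x0).
Hypotheses (o1 : forall h, dot (T1 h) x0 = 0) (o2 : forall h, dot (T2 h) x0 = 0).
Local Notation L1 := (left_inv dot T1).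
Local Notation L2 := (left_inv dot T2).
Hypothesis L1T2 : forall h, L1 (T2 h) = T2 (L1 h).
Hypothesis L2T1 : forall h, L2 (T1 h) = T1 (L2 h).
Local Notation v := (monom T1 T2 x0).
Local Notation G1 m p := (dot (iter m T1 x0) (iter p T1 x0)).
Local Notation G2 n q := (dot (iter n T2 x0) (iter q T2 x0)).

(** [x0] is orthogonal to the range of [T], so the left inverse kills it, and by commutation it
    kills every [S^n x0]. A vector killed by the left inverse equals its own residual, which is
    orthogonal to the range. *)
Lemma wandering (T S : {linear H -> H}) : bounded_op T -> two_isometry T -> (forall h, dot (T h) x0 = 0) ->
  (forall h, left_inv dot T (S h) = S (left_inv dot T h)) -> forall h n, dot (T h) (iter n S x0) = 0.
Proof.
move=> Tb iso o LS h n.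
have Lx : left_inv dot T x0 = 0 by exact: (left_inv_orthogonal Hdot Tb iso o).
have LSn : left_inv dot T (iter n S x0) = 0.
  by elim: n => // n IH; rewrite iterS LS IH linear0.
by have := left_invP Hdot Tb (two_isometry_expansive iso) (iter n S x0) h; rewrite LSn linear0 subr0.
Qed.

Section Gram.
Hypothesis id1 : forall m n, dot (iter m.+1 T1 (iter n.+1 T2 x0)) (T1 (T2 x0)) = G1 m.+1 1 * G2 n.+1 1.
Hypothesis id2 : forall m n, dot (iter m.+1 T1 (T2 x0)) (T1 (iter n.+1 T2 x0)) = G1 m.+1 1 * G2 1 n.+1.

Lemma gram_product m n p q : dot (v m n) (v p q) = G1 m p * G2 n q.
Proof.
have A1 (T : {linear H -> H}) : two_isometry T -> forall u w m p,
    dot (iter m.+2 T u) (iter p.+2 T w) = 2 * dot (iter m.+1 T u) (iter p.+1 T w) - dot (iter m T u) (iter p T w).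
  by move=> iso u w k l; rewrite !iterS (two_isometry_dot Hdot iso).
have vE k l : v k l = iter l T2 (iter k T1 x0) by rewrite /monom iter_commute.
have w1 := wandering T1b iso1 o1 L1T2; have w2 := wandering T2b iso2 o2 L2T1.
have w1' h k : dot (iter k T2 x0) (T1 h) = 0 by rewrite dotC w1 conjc0.
have w2' h k : dot (iter k T1 x0) (T2 h) = 0 by rewrite dotC w2 conjc0.
have d1 : dot x0 x0 = 1 by rewrite (dotxx Hdot) x1 expr1n.
have c1 k l j : dot (v k l) (v 0%N j) = G1 k 0 * G2 l j.
  rewrite /monom; case: k => [|k]; first by rewrite d1 mul1r.
  by rewrite !iterS w1 o1 mul0r.
(* The exponents in [T1] are frozen at [(k + 1, 1)] and the extension runs over those in [T2]:
   entries with an index 0 are settled by orthogonality, and those with minimum 1 are [id1] and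
   [id2]. The same extension is then made in [T1]. *)
have key k l j : dot (v k.+1 l) (v 1%N j) = G1 k.+1 1 * G2 l j.
  move: l j; apply: affine_gram_ext => [l j|l j|l|j|l|j].
  - by rewrite !vE A1.
  - by rewrite A1 //; ring.
  - rewrite !vE; case: l => [|l]; first by rewrite d1 mulr1.
    rewrite -[iter 0 T2 (iter 1 _ _)]/(iter 1 T1 x0) [iter l.+1 T2 (iter _ _ _)]iterS w2.
    by rewrite [iter l.+1 T2 x0]iterS o2 mulr0.
  - rewrite !vE; case: j => [|j]; first by rewrite d1 mulr1.
    rewrite -[iter 0 T2 (iter k.+1 _ _)]/(iter k.+1 T1 x0) [iter j.+1 T2 (iter _ _ _)]iterS w2'.
    by rewrite [iter j.+1 T2 x0]iterS -[iter 0 T2 x0]/(iter 0 T1 x0) w2' mulr0.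
  - exact: id1.
  - exact: id2.
have vC k l i j : dot (v k l) (v i j) = (dot (v i j) (v k l))^*%C by rewrite dotC.
have GC k l : G1 k l = (G1 l k)^*%C by rewrite dotC.
have G2C k l : G2 k l = (G2 l k)^*%C by rewrite dotC.
move: m p; apply: affine_gram_ext => [m p|m p|m|p|m|p].
- by rewrite /monom A1.
- by rewrite A1 //; ring.
- exact: c1.
- by rewrite vC c1 conjcM -GC -G2C.
- exact: key.
- by rewrite vC key conjcM -GC -G2C.
Qed.

End Gram.

Definition cf h : nat -> nat -> C := fun m n => dot (iter m L1 (iter n L2 h)) x0.

Lemma cf_linear a h k m n : cf (a *: h + k) m n = a * cf h m n + cf k m n.
Proof.
by rewrite /cf (iter_left_inv_linear Hdot T2b iso2) (iter_left_inv_linear Hdot T1b iso1) dotDl dotZl.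
Qed.

Lemma cfD h k m n : cf (h + k) m n = cf h m n + cf k m n.
Proof. by rewrite -[h]scale1r cf_linear mul1r scale1r. Qed.

Lemma cf0 m n : cf 0 m n = 0.
Proof. by have := cfD 0 0 m n; rewrite addr0 -[LHS]addr0 => /addrI. Qed.

Lemma cfZ a h m n : cf (a *: h) m n = a * cf h m n.
Proof. by rewrite -[a *: h]addr0 cf_linear cf0 addr0. Qed.

Lemma cfB h k m n : cf (h - k) m n = cf h m n - cf k m n.
Proof. by rewrite cfD -scaleN1r cfZ mulN1r. Qed.

Lemma cf_le h m n : modulus (cf h m n) <= nrm h.
Proof.
apply: le_trans (CauchySchwarz_dot Hdot _ _) _; rewrite x1 mulr1.
apply: le_trans (iter_left_inv_nrm Hdot T1b iso1 m _) _.
exact: iter_left_inv_nrm.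
Qed.

Lemma pcoef2_cf h : pcoef2 (cf h).
Proof. exact: pcoef2_bounded (cf_le h). Qed.

Lemma cf_shift1 h : cf (T1 h) = pshift1 (cf h).
Proof.
apply/funext => m; apply/funext => n; rewrite /cf.
have -> : iter n L2 (T1 h) = T1 (iter n L2 h) by elim: n => // n IH; rewrite !iterS IH L2T1.
case: m => [|m]; first by rewrite o1.
by rewrite iterSr (left_invK Hdot T1b iso1).
Qed.

Lemma cf_shift2 h : cf (T2 h) = pshift2 (cf h).
Proof.
apply/funext => m; apply/funext => -[|n]; rewrite /cf /pshift2 /=.
  have -> : iter m L1 (T2 h) = T2 (iter m L1 h) by elim: m => // m IH; rewrite !iterS IH L1T2.
  by rewrite o2.
by rewrite -iterS iterSr (left_invK Hdot T2b iso2).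
Qed.

Lemma cf_x0 m n : cf x0 m n = ((m == 0%N) && (n == 0%N))%:R.
Proof.
have z (T : {linear H -> H}) k : bounded_op T -> two_isometry T -> iter k (left_inv dot T) 0 = 0.
  move=> Tb iso; elim: k => // k IH; rewrite iterS IH.
  by apply: (left_inv_orthogonal Hdot Tb iso) => u; rewrite dot0r.
rewrite /cf; case: n => [|n].
  case: m => [|m]; first by rewrite (dotxx Hdot) x1 expr1n.
  by rewrite iterSr (left_inv_orthogonal Hdot T1b iso1 o1) z // dot0l.
by rewrite iterSr (left_inv_orthogonal Hdot T2b iso2 o2) !z // dot0l andbF.
Qed.

Lemma cf_monom p q m n : cf (v p q) m n = ((m == p) && (n == q))%:R.
Proof.
rewrite /monom; elim: p m n => [|p IH] m n; last first.
  by rewrite iterS cf_shift1; case: m => //= m; rewrite IH.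
elim: q m n => [|q IH] m n; first exact: cf_x0.
rewrite iterS cf_shift2 /pshift2; case: n => [|n]; rewrite ?andbF //=; exact: IH.
Qed.

Lemma cf_pol N c : (forall m n, (N <= m)%N || (N <= n)%N -> c m n = 0) ->
  forall m n, cf (pol T1 T2 x0 N c) m n = c m n.
Proof.
move=> c0 m n; have cfs K (F : nat -> H) : cf (\sum_(i < K) F i) m n = \sum_(i < K) cf (F i) m n.
  by elim: K => [|K IH]; rewrite ?big_ord0 ?cf0 // !big_ord_recr cfD IH.
rewrite /pol (cfs _ (fun i => \sum_(j < N) c i j *: v i j)).
under eq_bigr do rewrite (cfs _ (fun j => c _ j *: v _ j)).
under eq_bigr do under eq_bigr do rewrite cfZ cf_monom.
case: (ltnP m N) => mN; last first.
  rewrite c0 ?mN // big1 // => i _; rewrite big1 // => j _.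
  by rewrite (gtn_eqF (leq_trans (ltn_ord i) mN)) mulr0.
case: (ltnP n N) => nN; last first.
  rewrite c0 ?nN ?orbT // big1 // => i _; rewrite big1 // => j _.
  by rewrite (gtn_eqF (leq_trans (ltn_ord j) nN)) andbF mulr0.
under eq_bigr do under eq_bigr do rewrite eq_sym (eq_sym n).
apply: (@sum_delta _ N m n c (fun b x => x * b%:R)) => // x; by rewrite ?mulr1 ?mulr0.
Qed.

Section Measures.
Variables mu1 mu2 : circle_measure R.
Hypothesis gram : forall m n p q, dot (v m n) (v p q) = dgram mu1 m p * dgram mu2 n q.

Lemma dnorm_cf_pol N c : (forall m n, (N <= m)%N || (N <= n)%N -> c m n = 0) ->
  dnorm mu1 mu2 c = (nrm (pol T1 T2 x0 N c) ^+ 2)%:E.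
Proof.
move=> c0; rewrite (dnorm_fin_support mu1 mu2 c0); congr (_%:E).
have NN : (N <= N.+2)%N by rewrite ltnW // ltnW.
rewrite -(pol_widen T1 T2 x0 NN c0) (nrm_pol Hdot) qform_pairs; congr Re.
apply: eq_bigr => m _; apply: eq_bigr => n _; congr (_ * _).
by apply: eq_bigr => p _; apply: eq_bigr => q _; rewrite gram.
Qed.

(* Lower semicontinuity of the norm along orbit polynomials converging to [h]. *)
Lemma dnorm_cf_near h (r : R) : 0 < r -> (dnorm mu1 mu2 (cf h) <= ((nrm h + r) ^+ 2)%:E)%E.
Proof.
move=> r0.
have /choice[u hu] : forall i : nat, exists u, [/\ nrm (h - u) <= r, nrm (h - u) <= i.+1%:R^-1
    & dnorm mu1 mu2 (cf u) = (nrm u ^+ 2)%:E].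
  move=> i; have m0 : 0 < Num.min r i.+1%:R^-1 by rewrite lt_min r0 invr_gt0 ltr0Sn.
  have [N [c [c0]]] := cyclic_dense h cyc m0; rewrite le_min => /andP[le1 le2].
  exists (pol T1 T2 x0 N c); split=> //.
  by rewrite -(dnorm_cf_pol c0); apply: eq_dnorm => m n; exact: cf_pol.
apply: (@dnorm_lsc _ _ _ (fun i => cf (u i))) => [m n|i].
  apply/cvgrPdist_le => e /gt0_complex[e' e0 ->].
  exists (Num.bound e'^-1) => // i /= Ni; rewrite lec_modulus -cfB; apply: le_trans (cf_le _ _ _) _.
  have [_ le _] := hu i; apply: le_trans le _.
  rewrite -[e']invrK lef_pV2 ?posrE ?invr_gt0 //.
  apply: le_trans (ltW (archi_boundP _)) _; first by rewrite invr_ge0 ltW.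
  by rewrite ler_nat; apply: leq_trans Ni _.
have [le _ ->] := hu i; rewrite lee_fin lerXn2r ?nnegrE ?addr_ge0 ?nrm_ge0 ?(ltW r0) //.
have -> : u i = h - (h - u i) by rewrite opprB addrC subrK.
by apply: le_trans (nrmD _ _) _; rewrite nrmN lerD2l.
Qed.

Lemma dnorm_cf_fin h : exists2 d : R, dnorm mu1 mu2 (cf h) = d%:E & d <= nrm h ^+ 2.
Proof.
have := dnorm_cf_near h (@ltr01 R); have := dnorm_ge0 mu1 mu2 (cf h).
case E : (dnorm mu1 mu2 (cf h)) => [d||] // _ _; exists d => //.
apply/ler_addgt0Pl => e e0; pose s := nrm h.
have s0 : 0 <= s := nrm_ge0 h; have K0 : 0 < 2 * s + 1 by rewrite ltr_wpDl // mulr_ge0.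
(* As [r <= 1], [(s + r)^2 <= s^2 + r (2 s + 1) <= s^2 + e]. *)
pose r := Num.min 1 (e / (2 * s + 1)).
have r0 : 0 < r by rewrite lt_min ltr01 divr_gt0.
have := dnorm_cf_near h r0; rewrite E lee_fin -/s => le; apply: le_trans le _.
have r1 : r <= 1 by rewrite ge_min lexx.
have : r * (2 * s + 1) <= e by rewrite -ler_pdivlMr // ge_min lexx orbT.
move: (r) (s) (e) r0 r1 => p q z p0 p1 h1; nra.
Qed.

(* By the parallelogram law, the defect [|h|^2 - dnorm (cf h)] is at most twice the
   defect of [h - p] if it vanishes at [p]. *)
Lemma dnorm_cf h : dnorm mu1 mu2 (cf h) = (nrm h ^+ 2)%:E.
Proof.
have [d dE dle] := dnorm_cf_fin h; rewrite dE; congr (_%:E); apply/le_anti; rewrite dle /=.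
have low (r : R) : 0 < r -> nrm h ^+ 2 <= 2 * r ^+ 2 + d.
  move=> r0; have [N [c [c0 le]]] := cyclic_dense h cyc r0; set p := pol _ _ _ _ _ in le.
  have pE : dnorm mu1 mu2 (cf p) = (nrm p ^+ 2)%:E.
    by rewrite -(dnorm_cf_pol c0); apply: eq_dnorm => m n; exact: cf_pol.
  have [d1 d1E d1le] := dnorm_cf_fin (p - (h - p)).
  have [d2 d2E _] := dnorm_cf_fin (h - p).
  have d20 : 0 <= d2 by rewrite -lee_fin -d2E dnorm_ge0.
  have := dnorm_parallelogram mu1 mu2 (cf p) (cf (h - p)).
  have -> : (fun m n => cf p m n + cf (h - p) m n) = cf h.
    by apply/funext => m; apply/funext => n; rewrite -cfD addrC subrK.
  have -> : (fun m n => cf p m n - cf (h - p) m n) = cf (p - (h - p)).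
    by apply/funext => m; apply/funext => n; rewrite -cfB.
  rewrite dE d1E pE d2E -!EFinD -EFinM => /(congr1 fine) /= par.
  have e1 : nrm h ^+ 2 = nrm p ^+ 2 + nrm (h - p) ^+ 2 + 2 * Re (dot p (h - p)).
    by rewrite -(sqr_nrmD Hdot) addrC subrK.
  have e2 : nrm (p - (h - p)) ^+ 2 = nrm p ^+ 2 + nrm (h - p) ^+ 2 - 2 * Re (dot p (h - p)).
    by rewrite (sqr_nrmD Hdot) nrmN dotNr ReN mulrN.
  have le2 : nrm (h - p) ^+ 2 <= r ^+ 2 by rewrite lerXn2r ?nnegrE ?nrm_ge0 ?(ltW r0).
  move: par e1 e2 le2 d1le d20; clear d2E d1E dE dle.
  move: (nrm h ^+ 2) (nrm p ^+ 2) (nrm (h - p) ^+ 2) (nrm (p - (h - p)) ^+ 2) (Re _) (r ^+ 2) d d1 d2 => a1 a2 a3 a4 a5 a6 a7 a8 a9.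
  by lra.
apply/ler_addgt0Pl => e e0.
have s0 : 0 < Num.sqrt (e / 2) by rewrite sqrtr_gt0 divr_gt0.
by have := low _ s0; rewrite sqr_sqrtr ?divr_ge0 ?(ltW e0) // mulrC divfK.
Qed.

(** Along an ultrafilter the bounded inner products converge for all [k] at once, so neither
    separability nor a diagonal subsequence enters; Riesz turns the limit functional into a
    vector. *)
Lemma weak_limit (u : nat -> H) (B : R) : (forall i, nrm (u i) <= B) ->
  exists2 U : set_system nat, UltraFilter U /\ \oo `<=` U &
    exists h, forall k, (dot k (u i) : C^o) @[i --> U] --> (dot k h : C^o).
Proof.
move=> uB; have [U [UU Uoo]] := @ultraFilterLemma nat \oo _; exists U => //.
have bd k i : modulus (dot k (u i)) <= nrm k * B.
  by apply: le_trans (CauchySchwarz_dot Hdot _ _) _; rewrite ler_wpM2l ?nrm_ge0.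
have /choice[phi hphi] : forall k, exists l, (dot k (u i) : C^o) @[i --> U] --> (l : C^o).
  move=> k.
  have [a ca] := @ultra_cvg R U UU (fun i => Re (dot k (u i))) (- (nrm k * B)) (nrm k * B) (fun i =>
    etrans (esym (ler_norml _ _)) (le_trans (ler_Re_modulus _) (bd k i))).
  have [b cb] := @ultra_cvg R U UU (fun i => Im (dot k (u i))) (- (nrm k * B)) (nrm k * B) (fun i =>
    etrans (esym (ler_norml _ _)) (le_trans (ler_Im_modulus _) (bd k i))).
  exists (Complex a b); apply/cvgrPdist_le => e /gt0_complex[e' e0 ->].
  have e2 : 0 < e' / 2 by rewrite divr_gt0.
  have /cvgrPdist_le/(_ _ e2) n1 := ca; have /cvgrPdist_le/(_ _ e2) n2 := cb.
  apply: filterS2 n1 n2 => i le1 le2; rewrite lec_modulus; apply: le_trans (ler_modulus_ReIm _) _.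
  rewrite ReB ImB [leRHS]splitr; exact: lerD.
have uniq (f : nat -> C) l l' : (f i : C^o) @[i --> U] --> (l : C^o) -> (f i : C^o) @[i --> U] --> (l' : C^o) -> l = l'.
  by move=> c c'; exact: (cvg_unique _ c c').
have [w hw] : exists w, forall k, phi k = dot k w.
  apply: (riesz Hdot (M := B)) => [x y|a x|x].
  - apply: (uniq _ _ _ (hphi (x + y))).
    have -> : (fun i => dot (x + y) (u i)) = (fun i => dot x (u i) + dot y (u i)).
      by apply/funext => i; rewrite dotDl.
    by apply: (@cvgD _ C^o); exact: hphi.
  - apply: (uniq _ _ _ (hphi (a *: x))).
    have -> : (fun i => dot (a *: x) (u i)) = (fun i => a * dot x (u i)).
      by apply/funext => i; rewrite dotZl.
    by apply: (@cvgM C); [exact: cvg_cst|exact: hphi].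
  - apply/ler_addgt0Pl => e e0; have e0' : (0 : C) < e%:C%C by rewrite ltcR.
    have /cvgrPdist_le/(_ _ e0') n1 := hphi x; have [i hi] := filter_ex n1.
    rewrite lec_modulus in hi; rewrite -[phi x](subrK (dot x (u i))).
    by apply: le_trans (ler_modulusD _ _) _; apply: lerD => //; rewrite mulrC.
by exists w => k; rewrite -hw.
Qed.

Lemma cf_onto a : (dnorm mu1 mu2 a < +oo)%E -> exists h, cf h = a.
Proof.
have := dnorm_ge0 mu1 mu2 a; case E : (dnorm mu1 mu2 a) => [D||] // D0 _.
rewrite lee_fin in D0.
(* The constant 4 is the square root of the factor 16 in [trunc_exists]. *)
have /choice[u hu] : forall N : nat, exists u, nrm u <= 4 * Num.sqrt D /\
    forall m n, (m <= N)%N -> (n <= N)%N -> cf u m n = a m n.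
  move=> N; have [|K [a' [a0 aE le]]] := @trunc_exists R mu1 mu2 a D N; first by rewrite E.
  have a0' m n : (K.+2 <= m)%N || (K.+2 <= n)%N -> a' m n = 0 by exact: a0.
  exists (pol T1 T2 x0 K.+2 a'); split; last by move=> m n mN nN; rewrite (cf_pol a0') aE.
  rewrite -(@ler_pXn2r _ 2) ?nnegrE ?nrm_ge0 ?mulr_ge0 ?sqrtr_ge0 // exprMn sqr_sqrtr //.
  rewrite -lee_fin -(dnorm_cf_pol a0'); apply: le_trans le _; rewrite lee_fin.
  by rewrite -natrX.
have [U [UU Uoo] [h hh]] := weak_limit (fun i => proj1 (hu i)); exists h.
apply/funext => m; apply/funext => n.
(* Each coefficient is a bounded functional of the vector, hence passes to the weak limit; along the
   sequence it is eventually equal to [a m n]. *)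
have [w hw] : exists w, forall k, cf k m n = dot k w.
  apply: (riesz Hdot (M := 1)) => [x y|c x|x].
  - exact: cfD.
  - exact: cfZ.
  - by rewrite mul1r cf_le.
rewrite hw dotC; suff -> : dot w h = (a m n)^*%C by rewrite conjcK.
have c1 : (dot w (u i) : C^o) @[i --> U] --> ((a m n)^*%C : C^o).
  apply: (@cvg_trans _ (((a m n)^*%C : C^o) @[_ --> U])); last exact: cvg_cst.
  apply: near_eq_cvg; apply: Uoo; exists (maxn m n) => // i /= mi.
  have [_ hi] := hu i; rewrite dotC -hw hi //.
    exact: leq_trans (leq_maxl _ _) mi.
  exact: leq_trans (leq_maxr _ _) mi.
exact: (cvg_unique _ (hh w) c1).
Qed.

Theorem coefficient_model : unitarily_equivalent_to_Mz T1 T2 mu1 mu2.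
Proof.
have fin h : (dnorm mu1 mu2 (cf h) < +oo)%E by rewrite dnorm_cf ltry.
exists (fun h => psum2 (cf h)); split.
- by move=> h; apply: (dirichlet_space_psum2 (pcoef2_cf h) (fun _ _ => erefl)).
- move=> f /dirichlet_space_coef[a [pa fE /cf_onto[h hE]]]; exists h => z zb.
  by rewrite hE fE.
- move=> c h k z zb; have -> : cf (c *: h + k) = (fun m n => c * cf h m n + cf k m n).
    by apply/funext => m; apply/funext => n; exact: cf_linear.
  rewrite psum2D ?psum2Z //; [exact: pcoef2_cf|apply: pcoef2Z; exact: pcoef2_cf|exact: pcoef2_cf].
- move=> h; rewrite (dirichlet_normsqE (pcoef2_cf h) (fun _ _ => erefl) mu1 mu2) dnorm_cf.
  by rewrite -nrmE -rmorphXn.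
- move=> h z zb; rewrite cf_shift1 cf_shift2.
  by rewrite psum2_shift1 ?psum2_shift2 //; exact: pcoef2_cf.
Qed.

End Measures.
End Sufficiency.

Theorem theorem5p1 (R : realType) (H : completeNormedModType R[i])
    (dot : {dot H for Num.conj}) (Hdot : hilbert_inner dot)
    (T1 T2 : {linear H -> H})
    (T1_bounded : bounded_op T1) (T2_bounded : bounded_op T2)
    (T12_comm : forall h, T1 (T2 h) = T2 (T1 h))
    (T1_isom : two_isometry T1) (T2_isom : two_isometry T2)
    (T1_analytic : analytic T1) (T2_analytic : analytic T2)
    (x0 : H) (x0_unit : `|x0| = 1) (x0_cyclic : cyclic_vector T1 T2 x0)
    (x0_ker : (ker (adjoint dot T1) `&` ker (adjoint dot T2)) x0) :
  (exists mu1 mu2 : circle_measure R, unitarily_equivalent_to_Mz T1 T2 mu1 mu2)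
  <->
  [/\ left_inv dot T1 \o T2 = T2 \o left_inv dot T1,
      left_inv dot T2 \o T1 = T1 \o left_inv dot T2
    & forall m n : nat, (1 <= m)%N -> (1 <= n)%N ->
        dot (iter m T1 (iter n T2 x0)) (T1 (T2 x0))
          = dot (iter m T1 x0) (T1 x0) * dot (iter n T2 x0) (T2 x0)
        /\
        dot (iter m T1 (T2 x0)) (T1 (iter n T2 x0))
          = dot (iter m T1 x0) (T1 x0) * dot (T2 x0) (iter n T2 x0)].
Proof.
have x1 : nrm x0 = 1 by rewrite /nrm x0_unit.
have o1 h : dot (T1 h) x0 = 0 by rewrite (adjointP Hdot T1_bounded) (proj1 x0_ker) dot0r.
have o2 h : dot (T2 h) x0 = 0 by rewrite (adjointP Hdot T2_bounded) (proj2 x0_ker) dot0r.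
split=> [[mu1 [mu2 model]]|[L1T2 L2T1 identities]].
  have [L1T2 L2T1 gram] :=
    model_identities Hdot T1_bounded T2_bounded T12_comm T1_isom T2_isom x1 x0_cyclic o1 o2 model.
  split=> [||m n _ _]; [exact/funext|exact/funext|].
  split; first exact: (gram m n 1 1).
  exact: (gram m 1 1 n).
have L1T2' h : left_inv dot T1 (T2 h) = T2 (left_inv dot T1 h) := congr1 (@^~ h) L1T2.
have L2T1' h : left_inv dot T2 (T1 h) = T1 (left_inv dot T2 h) := congr1 (@^~ h) L2T1.
(* Each measure comes from the orbit of [x0] under one operator alone; [gram_product] then shows
   that these two orbits determine the joint Gram matrix. *)
have [mu1 hmu1] := gram_measure Hdot T1_isom x1 o1.
have [mu2 hmu2] := gram_measure Hdot T2_isom x1 o2.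
exists mu1, mu2.
apply: (coefficient_model Hdot T1_bounded T2_bounded T1_isom T2_isom x1 x0_cyclic o1 o2 L1T2' L2T1').
move=> m n p q; rewrite hmu1 hmu2.
apply: (gram_product Hdot T1_bounded T2_bounded T12_comm T1_isom T2_isom x1 o1 o2 L1T2' L2T1') => k l.
  exact: (proj1 (identities k.+1 l.+1 isT isT)).
exact: (proj2 (identities k.+1 l.+1 isT isT)).
Qed.
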